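(* Let $k\geq 2$ and $s$ be integers, and let $\lambda_1,\ldots,\lambda_s\in\mathbb{Z}$ satisfy $\lambda_1+\cdots+\lambda_s=0$. Consider the system \[ L_j(x_1,\ldots,x_s)=\lambda_1x_1^j+\cdots+\lambda_sx_s^j=0\qquad(1\leq j\leq k). \] Suppose that $s>s_0(k)$, where $s_0(k)=2k\left[k(\log k+2\log\log k)\right]+10k^2+6$, and suppose that the system possesses both a non-singular real solution and a non-singular $p$-adic solution for every rational prime $p$. Then there exists a constant $K>0$, depending at most on the $\lambda_i$, with the following property. Suppose $\mathcal{A}_N\subset[1,N]$ has cardinality $\delta_N N$ and is $\mathfrak{a}$-uniform of degree $k$, where \[ \mathfrak{a}\leq K\delta_N^{2^{k+1}(s_0(k)+2)}. \] Then for $N$ sufficiently large in terms of the $\lambda_i$, the set $\mathcal{A}_N^s$ necessarily contains non-trivial solutions to the system $L_k=\cdots=L_1=0$, and the number $\mathcal{N}$ of solutions in $\mathcal{A}_N^s$ satisfies \[ \mathcal{N}\gg\delta_N^sN^{s-k(k+1)/2}, \] where the implied constant depends at most on the $\lambda_i$ and $k$.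
   Context: $[x]$ denotes the integer part of $x$. A trivial solution is obtained by partitioning $\{1,\ldots,s\}$ into disjoint classes on each of which the $\lambda_i$ sum to $0$ and setting all $x_i$ in the same class equal; other solutions are non-trivial. A solution $\mathbf{a}$ is non-singular if for some indices $i_1,\ldots,i_k$ the Jacobian $\det(\partial L_j/\partial x_{i_l})_{1\le j,l\le k}$ at $\mathbf{a}$ is non-zero. Uniformity: let $A(x)$ be the indicator function of $\mathcal{A}_N$ and define the balanced function $\mathcal{E}_N(x)=\delta_N-A(x)$ for $1\leq x\leq N$ and $\mathcal{E}_N(x)=0$ otherwise. Define $\Delta_1(f(x);w)=f(x)\overline{f(x-w)}$ and recursively $\Delta_k(f(x);w_1,\ldots,w_k)=\Delta_1(\Delta_{k-1}(f(x);w_1,\ldots,w_{k-1});w_k)$. For $\mathbf{w}=(w_1,\ldots,w_{k+1})$ let $I_{\mathbf{w}}=[1,N]\cap([1,N]+w_1)\cap\cdots\cap([1,N]+w_1+\cdots+w_{k+1})$, where $[1,N]+w$ is the translate by $w$. The set $\mathcal{A}_N$ is $\mathfrak{a}$-uniform of degree $k$ if \[ \sum_{|w_1|,\ldots,|w_{k+1}|\leq N-1}\ \sum_{x\in I_{\mathbf{w}}}\Delta_{k+1}(\mathcal{E}_N(x);\mathbf{w})\leq\mathfrak{a}N^{k+2}. \]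
   Formalization: The formal statement adds that every λ_i is non-zero and that A_N is non-empty; without these the claim fails (e.g. k=2, λ=(1,1,−1,−1,0,…,0) has only trivial solutions, and the empty set is 0-uniform). *)

(* Defs.v *)
From HB Require Import structures.
From mathcomp Require Import all_boot all_order all_algebra finmap.
From mathcomp Require Import all_classical all_reals all_analysis.

Set Implicit Arguments.
Unset Strict Implicit.
Unset Printing Implicit Defensive.

Import Order.TTheory GRing.Theory Num.Theory.

Local Open Scope ring_scope.

(* The field Qp p of p-adic numbers is built as the completion of the
   rationals: p-adic Cauchy sequences modulo null sequences. *)

(* logn p is identically 0 when p is not prime, so for such p this is the
   trivial absolute value and Qp p below is just a copy of the rationals. *)
Definition padic_abs (p : nat) (x : rat) : rat :=
  if x == 0 then 0
  else p%:R ^ ((logn p `|denq x|%N)%:Z - (logn p `|numq x|%N)%:Z).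

Section PadicAbs.
Variable p : nat.
Local Notation v := (padic_abs p).
Let lz (m : int) := (logn p `|m|%N)%:Z.
Let q : rat := p%:R.

Lemma padic_abs0 : v 0 = 0.
Proof. by rewrite /padic_abs eqxx. Qed.

Lemma padic_abs_gt0 x : x != 0 -> 0 < v x.
Proof.
move=> x0; rewrite /padic_abs (negbTE x0).
have [p0|] := posnP p; last by move=> p0; rewrite exprz_gt0 // ltr0n.
by rewrite p0 /= expr0z.
Qed.

Lemma padic_abs_ge0 x : 0 <= v x.
Proof.
by have [->|/padic_abs_gt0/ltW//] := eqVneq x 0; rewrite padic_abs0.
Qed.

Lemma padic_abs1 : v 1 = 1.
Proof. by rewrite /padic_abs oner_eq0 /= logn1. Qed.

Let lzM m n : m != 0 -> n != 0 -> lz (m * n) = lz m + lz n.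
Proof. by move=> m0 n0; rewrite /lz abszM lognM ?absz_gt0. Qed.

Let absfrac (a b : int) : a != 0 -> b != 0 ->
  v (a%:~R / b%:~R) = q ^ (lz b - lz a).
Proof.
move=> a0 b0; set x : rat := _ / _.
have x0 : x != 0 by rewrite mulf_neq0 ?invr_eq0 ?intr_eq0.
have n0 : numq x != 0 by rewrite numq_eq0.
have d0 : denq x != 0 by rewrite denq_eq0.
have E : numq x * b = a * denq x.
  apply: (@intr_inj rat); rewrite !rmorphM /= numqE.
  by rewrite -mulrA [X in _ * X]mulrC mulrA /x divfK ?intr_eq0.
rewrite /padic_abs (negbTE x0); congr (_ ^ _).
move: (congr1 lz E); rewrite !lzM // /lz => e.
apply/eqP; rewrite subr_eq addrAC eq_sym subr_eq [X in X == _]addrC.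
by rewrite e addrC.
Qed.

Lemma padic_absM x y : v (x * y) = v x * v y.
Proof.
have [->|x0] := eqVneq x 0; first by rewrite !(mul0r, padic_abs0).
have [->|y0] := eqVneq y 0; first by rewrite !(mulr0, padic_abs0).
have nx : numq x != 0 by rewrite numq_eq0.
have ny : numq y != 0 by rewrite numq_eq0.
have dx := denq_neq0 x. have dy := denq_neq0 y.
have -> : x * y = (numq x * numq y)%:~R / (denq x * denq y)%:~R.
  by rewrite !rmorphM /= invfM mulrACA !divq_num_den.
rewrite absfrac ?mulf_neq0 // !lzM //.
rewrite /padic_abs (negbTE x0) (negbTE y0).
have [P0|p_gt0] := posnP p.
  by rewrite /q /lz P0 /= !subr0 expr0z mulr1.
rewrite -expfzDr ?pnatr_eq0 -?lt0n //; congr (_ ^ _).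
by rewrite opprD addrACA.
Qed.

Lemma padic_absN x : v (- x) = v x.
Proof.
rewrite /padic_abs oppr_eq0 numqN denqN abszN.
by [].
Qed.

Lemma padic_abs_ultra x y : v (x + y) <= Num.max (v x) (v y).
Proof.
have [->|x0] := eqVneq x 0.
  by rewrite add0r le_max lexx orbT.
have [->|y0] := eqVneq y 0.
  by rewrite addr0 le_max lexx.
have [->|s0] := eqVneq (x + y) 0.
  by rewrite padic_abs0 le_max padic_abs_ge0.
have [pp|np] := boolP (prime p); last first.
  have z n : logn p n = 0%N by rewrite lognE (negbTE np).
  by rewrite /padic_abs (negbTE x0) (negbTE y0) (negbTE s0) !z le_max lexx.
have nx : numq x != 0 by rewrite numq_eq0.
have ny : numq y != 0 by rewrite numq_eq0.
have dx := denq_neq0 x. have dy := denq_neq0 y.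
pose d := denq x * denq y; pose a := numq x * denq y; pose b := numq y * denq x.
have d0 : d != 0 by rewrite mulf_neq0.
have a0 : a != 0 by rewrite mulf_neq0.
have b0 : b != 0 by rewrite mulf_neq0.
have dr : d%:~R != 0 :> rat by rewrite intr_eq0.
have xE : x = a%:~R / d%:~R.
  by rewrite /a /d !rmorphM /= invfM mulrACA divq_num_den divff ?intr_eq0 // mulr1.
have yE : y = b%:~R / d%:~R.
  rewrite /b /d !rmorphM /= [X in _ / X]mulrC invfM mulrACA divq_num_den.
  by rewrite divff ?intr_eq0 // mulr1.
have sE : x + y = (a + b)%:~R / d%:~R by rewrite xE yE -mulrDl -rmorphD.
have ab0 : a + b != 0.
  by apply: contraNneq s0 => ab; rewrite sE ab mul0r.
have q1 : 1 < q by rewrite /q ltr1n prime_gt1.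
rewrite sE {1}xE {1}yE !absfrac //.
rewrite le_max !ler_eXz2l // !lerD2l !lerN2 /lz !lez_nat.
wlog ab : a b a0 b0 ab0 {xE yE sE} / (logn p `|a| <= logn p `|b|)%N.
  move=> H; have [/H->//|/ltnW/H H1] := leqP (logn p `|a|) (logn p `|b|).
  by rewrite orbC addrC H1 // addrC.
apply/orP; left.
have da : ((p ^ logn p `|a|)%N%:Z %| a)%Z by rewrite dvdzE /= pfactor_dvdnn.
have db : ((p ^ logn p `|a|)%N%:Z %| b)%Z.
  by rewrite dvdzE /= pfactor_dvdn ?absz_gt0.
by have := rpredD da db; rewrite dvdzE /= pfactor_dvdn ?absz_gt0.
Qed.

End PadicAbs.

Definition padic_cauchy (p : nat) : {pred nat -> rat} := fun u =>
  `[< forall eps : rat, 0 < eps -> exists M : nat, forall m n : nat,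
        (M <= m)%N -> (M <= n)%N -> padic_abs p (u m - u n) < eps >].

Section CauchySequences.
Variable p : nat.
Local Notation v := (padic_abs p).

Let ultra_lt x y eps : v x < eps -> v y < eps -> v (x + y) < eps.
Proof.
by move=> hx hy; apply: (le_lt_trans (padic_abs_ultra p x y)); rewrite gt_max hx.
Qed.

Lemma padic_cauchy_bounded u : u \in padic_cauchy p ->
  exists2 B : rat, 0 < B & forall n, v (u n) <= B.
Proof.
move=> /asboolP /(_ 1 ltr01) [M HM].
pose B := \sum_(i < M.+1) v (u i) + 1.
have Bi i : (i <= M)%N -> v (u i) <= B.
  move=> iM; rewrite /B (bigD1 (Ordinal (iM : (i < M.+1)%N))) //= -addrA lerDl.
  by rewrite addr_ge0 // sumr_ge0 // => j _; apply: padic_abs_ge0.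
have B1 : 1 <= B.
  by rewrite /B lerDr sumr_ge0 // => j _; apply: padic_abs_ge0.
exists B => [|n]; first exact: lt_le_trans B1.
have [/Bi//|/ltnW Mn] := leqP n M.
rewrite -[u n](subrK (u M)) (le_trans (padic_abs_ultra p _ _)) // ge_max.
by rewrite Bi // andbT (le_trans (ltW (HM n M Mn (leqnn M)))).
Qed.

Fact padic_cauchy_subring : subring_closed (padic_cauchy p).
Proof.
split.
- apply/asboolP => eps e0; exists 0%N => m n _ _.
  by rewrite subrr padic_abs0.
- move=> f g /asboolP Hf /asboolP Hg; apply/asboolP => eps e0.
  have [M HM] := Hf _ e0; have [N HN] := Hg _ e0.
  exists (maxn M N) => m n; rewrite !geq_max => /andP[? ?] /andP[? ?].
  rewrite !fctE opprD opprK addrACA; apply: ultra_lt; first exact: HM.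
  by rewrite addrC HN.
- move=> f g cf cg; have [Bf Bf0 HBf] := padic_cauchy_bounded cf.
  have [Bg Bg0 HBg] := padic_cauchy_bounded cg.
  move: cf cg => /asboolP Hf /asboolP Hg; apply/asboolP => eps e0.
  have [M HM] := Hf _ (divr_gt0 e0 Bg0).
  have [N HN] := Hg _ (divr_gt0 e0 Bf0).
  exists (maxn M N) => m n; rewrite !geq_max => /andP[? ?] /andP[? ?].
  rewrite !fctE.
  have -> : f m * g m - f n * g n = (f m - f n) * g m + f n * (g m - g n).
    by rewrite mulrBl mulrBr addrA subrK.
  apply: ultra_lt; rewrite padic_absM.
    apply: (@le_lt_trans _ _ (v (f m - f n) * Bg)).
      by rewrite ler_wpM2l ?padic_abs_ge0.
    by rewrite -ltr_pdivlMr // HM.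
  apply: (@le_lt_trans _ _ (Bf * v (g m - g n))).
    by rewrite ler_wpM2r ?padic_abs_ge0.
  by rewrite mulrC -ltr_pdivlMr // HN.
Qed.

HB.instance Definition _ := GRing.isSubringClosed.Build (nat -> rat)
  (padic_cauchy p) padic_cauchy_subring.

End CauchySequences.

Record cauchy_seq (p : nat) := CauchySeq {
  cauchy_val :> nat -> rat;
  _ : cauchy_val \in padic_cauchy p
}.

HB.instance Definition _ p := [isSub for @cauchy_val p].
HB.instance Definition _ p := [Choice of cauchy_seq p by <:].
HB.instance Definition _ p :=
  [SubChoice_isSubComNzRing of cauchy_seq p by <:].

Definition padic_null (p : nat) : {pred cauchy_seq p} := fun u =>
  `[< forall eps : rat, 0 < eps -> exists M : nat, forall n : nat,
        (M <= n)%N -> padic_abs p (u n) < eps >].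

Section NullIdeal.
Variable p : nat.
Local Notation v := (padic_abs p).

Fact padic_null_ideal : idealr_closed (@padic_null p).
Proof.
split.
- by apply/asboolP => eps e0; exists 0%N => n _; rewrite padic_abs0.
- apply/negP => /asboolP /(_ 1 ltr01) [M /(_ M (leqnn M))].
  by rewrite padic_abs1 ltxx.
- move=> a x y /asboolP Hx /asboolP Hy; apply/asboolP => eps e0.
  have [B B0 HB] := padic_cauchy_bounded (valP a).
  have [M HM] := Hx _ (divr_gt0 e0 B0); have [N HN] := Hy _ e0.
  exists (maxn M N) => n; rewrite geq_max => /andP[Mn Nn].
  rewrite -[cauchy_val _ n]/(a n * x n + y n).
  apply: (le_lt_trans (padic_abs_ultra p _ _)); rewrite gt_max HN // andbT.
  rewrite padic_absM; apply: (@le_lt_trans _ _ (B * v (x n))).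
    by apply: ler_wpM2r; [exact: padic_abs_ge0 | exact: HB].
  by rewrite mulrC -ltr_pdivlMr // HM.
Qed.

HB.instance Definition _ := isIdealr.Build (cauchy_seq p)
  (@padic_null p) padic_null_ideal.

End NullIdeal.

Definition Qp (p : nat) : Type := {ideal_quot (@padic_null p)}.
HB.instance Definition _ (p : nat) := GRing.ComNzRing.on (Qp p).

Section QpField.
Variable p : nat.
Local Notation v := (padic_abs p).

Local Notation pi := (\pi_({ideal_quot (@padic_null p)}))%qT.

Lemma Qp_mulVx (x : {ideal_quot (@padic_null p)}) :
  x != 0 -> exists y : {ideal_quot (@padic_null p)}, y * x = 1.
Proof.
rewrite -[x]reprK; set u := repr x => unz.
have {unz} unn : u \notin @padic_null p.
  apply: contra unz => un; rewrite -(rmorph0 pi).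
  by rewrite -Quotient.idealrBE subr0.
have [eps e0 He] : exists2 eps : rat, 0 < eps &
    forall M, exists2 n, (M <= n)%N & eps <= v (u n).
  apply: contrapT => H; case/negP: unn; apply/asboolP => eps e0.
  apply: contrapT => H1; apply: H; exists eps => // M.
  apply: contrapT => H2; apply: H1; exists M => n Mn.
  by rewrite ltNge; apply/negP => ?; apply: H2; exists n.
have /asboolP cu := valP u.
have [M HM] := cu _ e0; have [n0 Mn0 un0] := He M.
have lb m : (M <= m)%N -> eps <= v (u m).
  move=> Mm; rewrite leNgt; apply/negP => um.
  have := padic_abs_ultra p (u n0 - u m) (u m).
  rewrite subrK => /(le_trans un0); rewrite le_max leNgt HM //=.
  by rewrite leNgt um.
have nz m : (M <= m)%N -> u m != 0.
  by move=> /lb; apply: contraTneq => ->; rewrite padic_abs0 -ltNge.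
have vV z : z != 0 -> v z^-1 = (v z)^-1.
  move=> z0; apply: (@mulfI _ (v z)); first by rewrite gt_eqF ?padic_abs_gt0.
  by rewrite -padic_absM !divff ?padic_abs1 // gt_eqF ?padic_abs_gt0.
have cw : (fun m => (u m)^-1) \in padic_cauchy p.
  apply/asboolP => d d0.
  have [N HN] := cu _ (mulr_gt0 d0 (mulr_gt0 e0 e0)).
  exists (maxn M N) => m n; rewrite !geq_max => /andP[Mm Nm] /andP[Mn Nn].
  have -> : (u m)^-1 - (u n)^-1 = (u n - u m) * ((u m)^-1 * (u n)^-1).
    by rewrite mulrBl mulrCA divff ?nz // mulr1 mulrA divff ?nz // mul1r.
  rewrite !padic_absM !vV ?nz // -invfM ltr_pdivrMr; last first.
    by rewrite mulr_gt0 // padic_abs_gt0 ?nz.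
  apply: lt_le_trans (HN _ _ Nn Nm) _; rewrite ler_pM2l //.
  by rewrite ler_pM ?(ltW e0) ?lb.
exists (pi (CauchySeq cw)).
rewrite -[RHS](rmorph1 pi).
rewrite -(rmorphM pi).
apply/eqP; rewrite -Quotient.idealrBE; apply/asboolP => d d0.
exists M => n Mn.
rewrite -[cauchy_val _ n]/((u n)^-1 * u n - 1).
by rewrite mulVf ?nz // subrr padic_abs0.
Qed.

Definition Qp_inv (x : Qp p) : Qp p :=
  if pselect (exists y, y * x = 1) is left e then projT1 (cid e) else 0.

Fact Qp_mulVf (x : Qp p) : x != 0 -> Qp_inv x * x = 1.
Proof.
move=> /Qp_mulVx e; rewrite /Qp_inv; case: pselect => // e'.
by case: cid.
Qed.

Fact Qp_inv0 : Qp_inv 0 = 0.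
Proof.
rewrite /Qp_inv; case: pselect => // e; exfalso; case: e => y /eqP.
by rewrite mulr0 eq_sym oner_eq0.
Qed.

HB.instance Definition _ :=
  GRing.ComNzRing_isField.Build (Qp p) Qp_mulVf Qp_inv0.

End QpField.

Definition L (T : comNzRingType) (s : nat) (lam : 'I_s -> int) (j : nat)
    (x : 'I_s -> T) : T :=
  \sum_(i < s) (lam i)%:~R * x i ^+ j.

Definition solution (T : comNzRingType) (s : nat) (lam : 'I_s -> int)
    (k : nat) (x : 'I_s -> T) : bool :=
  [forall j : 'I_k, L lam j.+1 x == 0].

(* Formal partial derivative of L_j in the i-th variable, at x: make the i-th
   coordinate an indeterminate, differentiate, evaluate at x i. *)
Definition dL (T : comNzRingType) (s : nat) (lam : 'I_s -> int) (j : nat)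
    (i : 'I_s) (x : 'I_s -> T) : T :=
  ((L lam j (fun l => if l == i then 'X else (x l)%:P) : {poly T})^`()).[x i].

Lemma dLE (T : comNzRingType) (s : nat) (lam : 'I_s -> int) (j : nat)
    (i : 'I_s) (x : 'I_s -> T) :
  dL lam j i x = (lam i)%:~R * (x i ^+ j.-1 *+ j).
Proof.
rewrite /dL /L (bigD1 i) //= eqxx derivD raddf_sum /= big1 ?addr0.
  by rewrite -(rmorph_int polyC) mul_polyC derivZ derivXn hornerZ hornerMn hornerXn.
move=> l /negbTE ->.
by rewrite -(rmorph_int polyC) -polyC_exp -polyCM derivC.
Qed.

Definition nonsingular (T : comNzRingType) (s : nat) (lam : 'I_s -> int)
    (k : nat) (x : 'I_s -> T) : Prop :=
  exists i : 'I_k -> 'I_s,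
    \det (\matrix_(j < k, l < k) dL lam j.+1 (i l) x) != 0.

Definition has_nonsingular_solution (T : comNzRingType) (s : nat)
    (lam : 'I_s -> int) (k : nat) : Prop :=
  exists x : 'I_s -> T, solution lam k x /\ nonsingular lam k x.

Definition trivial_solution (s : nat) (lam : 'I_s -> int) (x : 'I_s -> int)
    : Prop :=
  exists2 P : {set {set 'I_s}}, finset.partition P [set: 'I_s]%SET &
    forall B, B \in P ->
      \sum_(i in B) lam i = 0 /\ {in B &, forall i j, x i = x j}.

(* Num.floor is the greatest integer not exceeding its argument; for k = 2
   that argument is negative. *)
Definition s0 (R : realType) (k : nat) : int :=
  (2 * k)%N%:Z * Num.floor (k%:R * (ln k%:R + 2 * ln (ln k%:R)) : R)
  + (10 * k ^ 2 + 6)%N%:Z.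

Definition zitv (a b : int) : {fset int} :=
  let len := `|(Num.max 0 (b - a + 1))%R|%N in
  let r := [seq a + i%:Z | i <- iota 0 len] in [fset x in r]%fset.

Lemma in_zitv (a b x : int) : (x \in zitv a b) = (a <= x <= b).
Proof.
rewrite !inE; apply/mapP/andP => [[i]|[ax xb]].
  rewrite mem_iota add0n /= => ilt ->; split; first by rewrite lerDl.
  move: ilt; rewrite -ltz_nat gez0_abs ?le_max ?lexx // lt_max.
  rewrite ltNge lez_nat leq0n /=.
  by rewrite ltzD1 lerBrDl.
exists `|x - a|%N; last by rewrite gez0_abs ?subr_ge0 // [RHS]addrC subrK.
rewrite mem_iota add0n /= -ltz_nat !gez0_abs ?subr_ge0 ?le_max ?lexx // lt_max.
by rewrite ltzD1 lerD2r xb orbT.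
Qed.

Definition density (R : realType) (N : nat) (A : {fset int}) : R :=
  #|` A|%:R / N%:R.

Definition balanced (R : realType) (N : nat) (A : {fset int}) (x : int) : R :=
  if x \in zitv 1 N%:Z then density R N A - (x \in A)%:R else 0.

(* Only real-valued f are needed (f = balanced N A), so the complex
   conjugation of the second factor is omitted. *)
Definition Delta1 (R : realType) (f : int -> R) (w : int) : int -> R :=
  fun x => f x * f (x - w).

Definition Delta (R : realType) (f : int -> R) (w : seq int) : int -> R :=
  foldl (@Delta1 R) f w.

Lemma Delta_rcons (R : realType) (f : int -> R) (w : seq int) (u : int) :
  Delta f (rcons w u) = Delta1 (Delta f w) u.
Proof. exact: foldl_rcons. Qed.

(* x lies in the translate of [1, N] by t iff x - t lies in [1, N]; the index
   i = 0 gives [1, N] itself. *)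
Definition Iw (N : nat) (w : seq int) : {fset int} :=
  [fset x in zitv 1 N%:Z |
    all (fun i => (x - \sum_(u <- take i w) u)%R \in zitv 1 N%:Z)
        (iota 0 (size w).+1)]%fset.

Definition uniform_of_degree (R : realType) (N : nat) (A : {fset int}) (a : R)
    (k : nat) : Prop :=
  \sum_(w : k.+1.-tuple (zitv (1 - N%:Z) (N%:Z - 1)))
    \sum_(x <- Iw N (map val w)) Delta (balanced R N A) (map val w) x
  <= a * N%:R ^+ k.+2.

Definition num_solutions (s : nat) (lam : 'I_s -> int) (k : nat)
    (A : {fset int}) : nat :=
  #|[set x : {ffun 'I_s -> A} | solution lam k (fun i => val (x i))]%SET|.

(* Main.v *)
From HB Require Import structures.
Require Import Defs.
From mathcomp Require Import all_boot all_order all_algebra perm finmap.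
From mathcomp Require Import all_classical all_reals all_analysis.
From mathcomp Require Import complex ring lra zify.

Set Implicit Arguments.
Unset Strict Implicit.
Unset Printing Implicit Defensive.

Import Order.TTheory GRing.Theory Num.Theory.

Local Open Scope ring_scope.

(* Idea.  The circle method over finite grids: integrals over the torus are
   averages over the points a / M with M large, so orthogonality counts exactly.

   1. Nested efficient congruencing (after Wooley) for a large auxiliary prime p
      gives Vinogradov's mean value theorem with an eps-loss, by induction on
      the degree; it is phrased for functions that are equivariant under the
      characters of the curve, so that lower degrees apply to conditioned sums.
   2. The mean value bound implies an inverse theorem for Weyl sums: a Weyl sum
      of size N / Y forces rational approximations with denominators Y^O(1).
   3. Near such rational points a sum of length N p compares with one of length
      N by dilation, which removes the eps-loss: J_t(N) << N^(2t - k(k+1)/2) as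
      soon as t > k(k+1)/2.
   4. Hence the number of solutions in [1, N]^s differs little from the average
      number of representations of nearby divisible values; real and p-adic Newton
      iteration from the non-singular solutions bounds this average from below.
   5. The Gowers norm of degree k controls sums twisted by polynomial phases of
      degree k.  Replacing the balanced function factor by factor compares
      A^s with delta^s [1, N]^s, the remaining 2t factors being handled by step 3.
   6. Trivial solutions have at most s/2 distinct coordinates, and Parseval shows
      that uniformity forces delta^4 N >= 1, so they are outnumbered. *)

(** * Complex exponentials and grid averages *)

(** The conclusion asks for the exact order [N^(s - k(k+1)/2)], so no [N^eps] may survive. Nested
    congruencing gives the critical moment only up to [N^eps]; this is paid with the spare factor
    [|S|^2] that a moment of order [2t > k(k+1)] has on the minor arcs. The number [s0 k] is an even
    integer [2t] with [t] well above [k(k+1)/2], and this [t] serves in the final counts. After a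
    [2^(k+1)]-th root the exponent [2^(k+1) (s0 + 2)] becomes [2t + 2]; replacing one factor leaves
    [s - 1 - 2t] factors of size at most [delta N], hence an error of order [delta^(s+1)]. Singular
    series and integral do not occur as limits: the number of zeros is compared with the average
    multiplicity of the values taken on a set of points where all values are small and divisible by
    a large factorial, so that their phases are near 1 on the major arcs. Newton iteration produces
    approximate zeros, in the reals or in the rationals with the [p]-adic absolute value, which
    rounding turns into integer points. Finally [K] and [N0] precede [k]: as [s0 k < s] forces
    [k < s], finitely many degrees occur. *)

Section Exponential.
Variable R : realType.
Local Notation C := R[i].

Definition nm (z : C) : R := Normc.normc z.

Lemma nm_ge0 z : 0 <= nm z.
Proof. by case: z => a b; exact: sqrtr_ge0. Qed.

Lemma nmM x y : nm (x * y) = nm x * nm y.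
Proof. exact: Normc.normcM. Qed.

Lemma nm0 : nm 0 = 0. Proof. exact: Normc.normc0. Qed.

Lemma nm1 : nm 1 = 1. Proof. exact: Normc.normc1. Qed.

Lemma nmD x y : nm (x + y) <= nm x + nm y.
Proof. exact: (@le_normcD R x y). Qed.

Lemma nmN x : nm (- x) = nm x.
Proof. exact: (@normcN R x). Qed.

Lemma nmB x y : nm (x - y) = nm (y - x).
Proof. by rewrite -nmN opprB. Qed.

Lemma nm_sum (I : Type) (r : seq I) (P : pred I) (F : I -> C) :
  nm (\sum_(i <- r | P i) F i) <= \sum_(i <- r | P i) nm (F i).
Proof.
elim/big_rec2: _ => [|i y x _ h]; first by rewrite nm0.
by apply: le_trans (nmD _ _) _; rewrite lerD2l.
Qed.

Lemma nm_prod (I : Type) (r : seq I) (P : pred I) (F : I -> C) :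
  nm (\prod_(i <- r | P i) F i) = \prod_(i <- r | P i) nm (F i).
Proof. by elim/big_rec2: _ => [|i y x _ <-]; rewrite ?nm1 ?nmM. Qed.

Lemma nmX z n : nm (z ^+ n) = nm z ^+ n.
Proof. by elim: n => [|n ih]; rewrite ?expr0 ?nm1 // !exprS nmM ih. Qed.

Lemma nmV z : nm z^-1 = (nm z)^-1.
Proof. exact: Normc.normcV. Qed.

Lemma nmC (x : R) : nm x%:C%C = `|x|.
Proof. by rewrite /nm /= expr0n /= addr0 sqrtr_sqr. Qed.

Lemma nm_natr n : nm n%:R = n%:R.
Proof. by rewrite -(rmorph_nat (real_complex R)) nmC ger0_norm. Qed.

Lemma nm_conj z : nm z^*%C = nm z.
Proof. by case: z => a b; rewrite /nm /= sqrrN. Qed.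

Lemma nm_sqr z : (nm z ^+ 2)%:C%C = z * z^*%C.
Proof.
case: z => a b; rewrite /nm /= sqr_sqrtr ?addr_ge0 ?sqr_ge0 //.
by apply/eqP; rewrite eq_complex /= !mulrN opprK -!expr2 eqxx addrC mulrC subrr eqxx.
Qed.

Lemma conjc_sum (I : Type) (r : seq I) (P : pred I) (F : I -> C) :
  (\sum_(i <- r | P i) F i)^*%C = \sum_(i <- r | P i) (F i)^*%C.
Proof. exact: rmorph_sum. Qed.

Lemma nm_pow2 z t : (nm z ^+ (2 * t))%:C%C = z ^+ t * (z ^+ t)^*%C.
Proof. by rewrite exprM rmorphXn /= nm_sqr exprMn; congr (_ * _); rewrite rmorphXn. Qed.

Lemma nm_le_sub x y : nm x - nm y <= nm (x - y).
Proof. by rewrite lerBlDr -{1}(subrK y x) nmD. Qed.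

Lemma nm_dist_le x y : `|nm x - nm y| <= nm (x - y).
Proof.
by rewrite ler_norml lerNl opprB nm_le_sub andbT nmB nm_le_sub.
Qed.

Definition e (x : R) : C := (cos (2 * pi * x) +i* sin (2 * pi * x))%C.

Arguments e : simpl never.

Lemma eD x y : e (x + y) = e x * e y.
Proof.
rewrite /e mulrDr cosD sinD.
by apply/eqP; rewrite eq_complex /= [in X in _ && X]addrC !eqxx.
Qed.

Lemma e0 : e 0 = 1.
Proof. by rewrite /e mulr0 cos0 sin0. Qed.

Lemma nm_e x : nm (e x) = 1.
Proof. by rewrite /nm /e /= cos2Dsin2 sqrtr1. Qed.

Lemma eN x : e (- x) = (e x)^*%C.
Proof. by rewrite /e mulrN cosN sinN. Qed.

Lemma eX x n : e (x *+ n) = e x ^+ n.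
Proof. by elim: n => [|n ih]; rewrite ?mulr0n ?e0 // mulrS exprS eD ih. Qed.

Lemma e_nat n : e n%:R = 1.
Proof.
rewrite eX /e mulr1 mulrC mulr_natr cos2pi sin2pi.
by rewrite -[(1 +i* 0)%C]/(1 : C) expr1n.
Qed.

Lemma e_int (z : int) : e z%:~R = 1.
Proof.
case: z => n; first exact: e_nat.
by rewrite NegzE mulrNz eN e_nat conjc1.
Qed.

Lemma eDint x (z : int) : e (x + z%:~R) = e x.
Proof. by rewrite eD e_int mulr1. Qed.

Lemma e_sum (I : Type) (r : seq I) (P : pred I) (F : I -> R) :
  e (\sum_(i <- r | P i) F i) = \prod_(i <- r | P i) e (F i).
Proof. by elim/big_rec2: _ => [|i y x _ <-]; rewrite ?e0 ?eD. Qed.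

Lemma sin_abs_le (x : R) : `|sin x| <= `|x|.
Proof.
wlog x0 : x / 0 <= x.
  move=> H; have [/H//|/ltW] := leP 0 x.
  by rewrite -oppr_ge0 => /H; rewrite sinN !normrN.
have [|c _] := @MVT_segment R sin cos 0 x x0 (fun y _ => is_derive_sin y).
  by apply: derivable_within_continuous => y _; exact: derivable_sin.
rewrite sin0 !subr0 => ->; rewrite normrM ler_piMl //.
exact: cos_max.
Qed.

Lemma nm_e_sub1 x : nm (e x - 1) ^+ 2 = 2 - 2 * cos (2 * pi * x).
Proof.
rewrite /nm /e /= sqr_sqrtr ?addr_ge0 ?sqr_ge0 // subr0.
have := cos2Dsin2 (2 * pi * x); set c := cos _; set s := sin _ => h.
have -> : s ^+ 2 = 1 - c ^+ 2 by lra.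
by ring.
Qed.

(** The modulus is [2 |sin (pi x)|], at most [2 pi |x|]; the constant 8 comes from [pi < 4]. *)
Lemma e_lip1 x : nm (e x - 1) <= 8 * `|x|.
Proof.
rewrite -ler_sqr ?nnegrE ?nm_ge0 ?mulr_ge0 // nm_e_sub1.
have -> : 2 * pi * x = (pi * x) *+ 2 by rewrite mulr2n; ring.
have h := cos_mulr2n (pi * x); rewrite {}h.
have := sin2cos2 (pi * x); set c := cos _ => h.
have h2 : sin (pi * x) ^+ 2 <= (4 * `|x|) ^+ 2.
  rewrite -(real_normK (num_real (sin _))) ler_sqr ?nnegrE ?mulr_ge0 //.
  apply: le_trans (sin_abs_le _) _; rewrite normrM ler_wpM2r //.
  rewrite ger0_norm ?pi_ge0 //; have := @pihalf_lt2 R; lra.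
rewrite exprMn in h2; rewrite exprMn.
by move: h2; rewrite h mulr2n; set y := `|x| ^+ 2; move: (c ^+ 2) => d; lra.
Qed.

Lemma e_lip x y : nm (e x - e y) <= 8 * `|x - y|.
Proof.
have -> : e x - e y = e y * (e (x - y) - 1).
  by rewrite mulrBr mulr1 -eD addrCA subrr addr0.
by rewrite nmM nm_e mul1r e_lip1.
Qed.

(** Take the representative in [[-1/2, 1/2)]. Were it 1/4 or more in modulus, the cosine would be at
    most 0 and the distance to 1 at least the square root of 2. *)
Lemma e_near x : nm (e x - 1) < 1 -> exists z : int, `|x - z%:~R| < 4^-1.
Proof.
move=> h; pose z := Num.floor (x + 2^-1); exists z.
pose y := x - z%:~R.
have hy : - 2^-1 <= y < 2^-1.
  have := floor_le_tmp (x + 2^-1); have := floorD1_gt (x + 2^-1).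
  by rewrite -/z intrD /y; lra.
have ey : e y = e x by rewrite -(eDint y z) /y subrK.
rewrite -/y ltNge; apply/negP => hy4.
have ey2 : nm (e `|y| - 1) < 1.
  have [y0|y0] := leP 0 y; first by rewrite ger0_norm // ey.
  rewrite ltr0_norm // eN ey -[1]conjc1 -rmorphB nm_conj; exact: h.
have : nm (e `|y| - 1) ^+ 2 < 1 by rewrite expr_lt1 ?nm_ge0.
rewrite nm_e_sub1; apply/negP; rewrite -leNgt.
have -> : 2 * pi * `|y| = (2 * pi * (`|y| - 4^-1)) + pi / 2 by field.
rewrite cosDpihalf; suff : 0 <= sin (2 * pi * (`|y| - 4^-1)) by lra.
have pi0 := @pi_ge0 R.
apply: sin_ge0_pi; apply/andP; split; first by rewrite !mulr_ge0 // subr_ge0.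
have : `|y| <= 2^-1 by rewrite ler_norml; lra.
move=> h2; rewrite mulrAC -[leRHS]mul1r ler_wpM2r //; lra.
Qed.

Lemma e_eq1 x : e x = 1 -> exists z : int, x = z%:~R.
Proof.
move=> ex; have [|z hz] := @e_near x; first by rewrite ex subrr nm0.
exists z; apply/eqP; rewrite -subr_eq0; set y := x - _ in hz *.
have : e y = 1 by rewrite -(eDint y z) /y subrK.
move=> [_ sy]; apply/negPn/negP => y0.
have pi0 := @pi_gt0 R.
have sy2 : sin (2 * pi * `|y|) = 0.
  have [h|h] := leP 0 y; first by rewrite ger0_norm.
  by rewrite ltr0_norm // mulrN sinN sy oppr0.
have : 0 < sin (2 * pi * `|y|).
  apply: sin_gt0_pihalf; apply/andP; split; first by rewrite !mulr_gt0 // normr_gt0.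
  have -> : pi / 2 = 2 * pi * 4^-1 :> R by field.
  by rewrite ltr_pM2l // mulr_gt0.
by rewrite sy2 ltxx.
Qed.

Lemma e_orth (m : nat) (h : int) : (0 < m)%N ->
  \sum_(a < m) e (a%:R / m%:R * h%:~R) = m%:R *+ (m%:Z %| h)%Z.
Proof.
move=> m0; have mR : m%:R != 0 :> R by rewrite pnatr_eq0 -lt0n.
have eE (a : 'I_m) : e (a%:R / m%:R * h%:~R) = e (h%:~R / m%:R) ^+ a.
  by rewrite -eX -[X in _ = e X]mulr_natl mulrA mulrAC.
rewrite (eq_bigr _ (fun a _ => eE a)).
have [/dvdzP[w ->]|nd] := boolP (m%:Z %| h)%Z.
  rewrite intrM mulfK // e_int (eq_bigr (fun=> 1)) => [|i _]; last by rewrite expr1n.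
  by rewrite sumr_const card_ord mulr1n.
have ne1 : e (h%:~R / m%:R) - 1 != 0.
  apply: contra nd; rewrite subr_eq0 => /eqP /e_eq1[w hw].
  apply/dvdzP; exists w; apply: (@intr_inj R).
  by rewrite intrM -hw divfK.
apply: (mulfI ne1); rewrite -subrX1 mulr0n mulr0 -eX -[X in e X]mulr_natr divfK //.
by rewrite e_int subrr.
Qed.

End Exponential.

Section Grid.
Variables (R : realType) (k : nat).
Local Notation C := R[i].
Local Notation e := (@e R).
Implicit Types (al : 'I_k -> R).

Definition gpt (M : nat) (a : {ffun 'I_k -> 'I_M}) : 'I_k -> R :=
  fun j => (a j)%:R / M%:R.

(** Stands for the integral over the [k]-dimensional torus. It detects divisibility by [M] instead
    of vanishing, so exact counts take [M] beyond the size of the integers concerned. The type [T]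
    is generic because real and complex averages are compared. *)
Definition Eav (T : unitRingType) (M : nat) (F : ('I_k -> R) -> T) : T :=
  (\sum_(a : {ffun 'I_k -> 'I_M}) F (gpt a)) / (M ^ k)%:R.

Lemma Eav_e M (h : 'I_k -> int) : (0 < M)%N ->
  Eav M (fun al => e (\sum_j al j * (h j)%:~R)) = [forall j, (M%:Z %| h j)%Z]%:R.
Proof.
move=> M0; rewrite /Eav.
under eq_bigr => a _ do rewrite e_sum.
rewrite -(bigA_distr_bigA (fun j (a : 'I_M) => e (a%:R / M%:R * (h j)%:~R))) /=.
under eq_bigr => j _ do rewrite e_orth //.
have [/forallP H|/forallPn[j hj]] := boolP [forall j, (M%:Z %| h j)%Z].
  under eq_bigr => j _ do rewrite H mulr1n.
  by rewrite prodr_const card_ord -natrX divff // pnatr_eq0 -lt0n expn_gt0 M0.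
by rewrite (bigD1 j) //= (negbTE hj) mulr0n !mul0r.
Qed.

Lemma Eav_sum (T : unitRingType) M (I : Type) (r : seq I) (P : pred I)
    (F : I -> ('I_k -> R) -> T) :
  Eav M (fun al => \sum_(i <- r | P i) F i al) = \sum_(i <- r | P i) Eav M (F i).
Proof. by rewrite /Eav exchange_big /= mulr_suml. Qed.

Lemma EavZ (T : unitRingType) M c (F : ('I_k -> R) -> T) :
  Eav M (fun al => c * F al) = c * Eav M F.
Proof. by rewrite /Eav -mulr_sumr mulrA. Qed.

Lemma eq_Eav (T : unitRingType) M (F G : ('I_k -> R) -> T) :
  F =1 G -> Eav M F = Eav M G.
Proof. by move=> h; rewrite /Eav; congr (_ / _); apply: eq_bigr => a _. Qed.

Lemma EavB (T : unitRingType) M (F G : ('I_k -> R) -> T) :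
  Eav M (fun al => F al - G al) = Eav M F - Eav M G.
Proof. by rewrite /Eav -mulrBl sumrB. Qed.

Lemma ler_Eav M (F G : ('I_k -> R) -> R) :
  (forall al, F al <= G al) -> Eav M F <= Eav M G.
Proof.
by move=> h; rewrite /Eav ler_wpM2r ?invr_ge0 // ler_sum.
Qed.

Lemma nm_Eav M (F : ('I_k -> R) -> C) : nm (Eav M F) <= Eav M (fun al => nm (F al)).
Proof.
rewrite /Eav nmM nmV nm_natr ler_wpM2r ?invr_ge0 //; exact: nm_sum.
Qed.

Lemma EavC M (F : ('I_k -> R) -> R) :
  Eav M (fun al => (F al)%:C%C : C) = (Eav M F)%:C%C.
Proof.
by rewrite /Eav rmorphM fmorphV /= rmorph_nat rmorph_sum.
Qed.

Lemma Eav_count (T : finType) M (w : T -> C) (h : T -> 'I_k -> int) : (0 < M)%N ->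
  Eav M (fun al => \sum_t w t * e (\sum_j al j * (h t j)%:~R)) =
  \sum_(t | [forall j, (M%:Z %| h t j)%Z]) w t.
Proof.
move=> M0; rewrite Eav_sum [RHS]big_mkcond; apply: eq_bigr => t _.
by rewrite EavZ Eav_e //; case: ifP; rewrite ?mulr1 ?mulr0.
Qed.

Definition phi al (x : int) : R := \sum_j al j * x%:~R ^+ j.+1.

Definition esum (I : finType) (pos : I -> int) al : C := \sum_i e (phi al (pos i)).

Lemma nm_esum (I : finType) (pos : I -> int) al : nm (esum pos al) <= #|I|%:R.
Proof.
apply: le_trans (nm_sum _ _ _) _; rewrite (eq_bigr (fun=> 1)) => [|i _]; last exact: nm_e.
by rewrite sumr_const.
Qed.

End Grid.

(** * Curves close to the moment curve modulo p *)

Section CurveAlgebra.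
Variable p : nat.
Hypothesis p_pr : prime p.
Local Notation F := 'F_p.
Local Notation rd := (map_poly (intr : int -> F)).

Lemma dvdz_Fp (x : int) : (p%:Z %| x)%Z = (x%:~R == 0 :> F).
Proof. exact: (dvdz_pcharf (pchar_Fp p_pr)). Qed.

(* This class of systems is stable under translation and p-adic rescaling. *)
Definition cclass k (P : 'I_k -> {poly int}) :=
  exists2 D : int, ~~ (p%:Z %| D)%Z &
  exists Q : 'I_k -> {poly int}, forall j, P j = D *: 'X^(j.+1) + p%:Z *: Q j.

Section NormalForm.
Variables (l : nat) (G : 'I_l -> {poly int}) (xi : int).

Definition taymx : 'M[int]_l := \matrix_(i, m) (G i \Po ('X + xi%:P))`_m.+1.

(** Taylor expansions at [xi], diagonalised in degrees 1 to [l]. The adjugate instead of the inverse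
    keeps the coefficients integral, at the price of the factor [\det taymx], which will be prime to
    [p]. *)
Definition nfpoly (r : 'I_l) : {poly int} :=
  \sum_i (\adj taymx) r i *: (G i \Po ('X + xi%:P)).

Lemma nfpoly_coef r (m : 'I_l) : (nfpoly r)`_m.+1 = \det taymx *+ (r == m).
Proof.
have /matrixP/(_ r m) := mul_adj_mx taymx; rewrite !mxE => <-.
by rewrite /nfpoly coef_sum; apply: eq_bigr => i _; rewrite coefZ !mxE.
Qed.

Lemma nfpoly_eval r w :
  (nfpoly r).[w] = \sum_i (\adj taymx) r i * (G i).[xi + w].
Proof.
rewrite /nfpoly horner_sum; apply: eq_bigr => i _.
by rewrite hornerZ horner_comp !hornerE addrC.
Qed.

(** At [x = xi + p^b z] degree [m] acquires [p^(b m)]. Degrees 1 to [l] reduce to the single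
    monomial of degree [r + 1]; higher ones exceed it by at least [p^b], and the second hypothesis
    turns this excess into a factor [p], so the result is again in [cclass]. *)
Lemma normal_form (b : nat) :
  ~~ (p%:Z %| \det taymx)%Z ->
  (forall r m, (l < m)%N -> (p%:Z %| (nfpoly r)`_m * p%:Z ^+ b)%Z) ->
  exists2 P' : 'I_l -> {poly int}, cclass P' &
    forall r z, \sum_i (\adj taymx) r i * (G i).[xi + p%:Z ^+ b * z] =
      (nfpoly r)`_0 + p%:Z ^+ (b * r.+1) * (P' r).[z].
Proof.
move=> dT hH; pose N := \max_r size (nfpoly r).
(* Coefficient of degree [l + 1 + m] once [p^(b (r + 1))] is taken out; [l + m - r] is positive
   because [r < l]. *)
pose cf r m := (nfpoly r)`_(l.+1 + m) * p%:Z ^+ (b * (l + m - r)).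
have cfp r m : (p%:Z %| cf r m)%Z.
  rewrite /cf; have -> : (b * (l + m - r) = b + b * (l + m - r).-1)%N.
    by rewrite -mulnS prednK // subn_gt0 ltn_addr.
  by rewrite exprD mulrA dvdz_mulr // hH // leq_addr.
pose Q r := \sum_(m < N) (cf r m %/ p%:Z)%Z *: 'X^(l.+1 + m) : {poly int}.
exists (fun r : 'I_l => \det taymx *: 'X^(r.+1) + p%:Z *: Q r).
  by exists (\det taymx) => //; exists Q.
move=> r z; rewrite -nfpoly_eval.
rewrite (@horner_coef_wide _ (1 + (l + N))); last first.
  by apply: leq_trans (leq_bigmax (F := fun r => size (nfpoly r)) r) _; rewrite addnA leq_addl.
rewrite big_split_ord big_ord1 /= expr0 mulr1 big_split_ord /=; congr (_ + _).
rewrite hornerD mulrDr; congr (_ + _).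
  under eq_bigr => m _ do rewrite nfpoly_coef.
  rewrite (bigD1 r) //= eqxx big1 ?addr0 => [|m /negbTE]; last first.
    by rewrite eq_sym => ->; rewrite mul0r.
  by rewrite mulr1n exprMn -exprM hornerZ hornerXn add1n mulrCA.
rewrite hornerZ /Q horner_sum !mulr_sumr; apply: eq_bigr => m _.
rewrite hornerZ hornerXn -/(nfpoly r).
rewrite [p%:Z * (_ * _)]mulrA; have <- : cf r m = p%:Z * (cf r m %/ p%:Z)%Z by rewrite mulrC divzK.
rewrite /bump /= /cf !add1n addSn exprMn -exprM.
have -> : (b * (l + m).+1 = b * r.+1 + b * (l + m - r))%N.
  by rewrite -mulnDr addSn subnKC // (leq_trans (ltnW (ltn_ord r))) ?leq_addr.
by rewrite exprD; ring.
Qed.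

End NormalForm.

Lemma rd_shift (G : {poly int}) xi :
  rd (G \Po ('X + xi%:P)) = rd G \Po ('X + (xi%:~R)%:P).
Proof. by rewrite map_comp_poly rmorphD /= map_polyX map_polyC. Qed.

Lemma rd_cclass k (P : 'I_k -> {poly int}) D Q :
  (forall j, P j = D *: 'X^(j.+1) + p%:Z *: Q j) ->
  forall j, rd (P j) = (D%:~R : F) *: 'X^(j.+1).
Proof.
move=> PE j; rewrite PE rmorphD /= !map_polyZ /= map_polyXn.
have -> : (p%:Z)%:~R = 0 :> F by apply/eqP; rewrite -dvdz_Fp dvdzz.
by rewrite scale0r addr0.
Qed.

Lemma size_shiftXn (c : F) n : size (('X + c%:P) ^+ n) = n.+1.
Proof. by rewrite -[c]opprK polyCN size_exp_XsubC. Qed.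

Lemma coef_shiftXn (c : F) n m : (n < m)%N -> (('X + c%:P) ^+ n)`_m = 0.
Proof.
by move=> nm; rewrite nth_default // size_shiftXn.
Qed.

Lemma lead_shiftXn (c : F) n : (('X + c%:P) ^+ n)`_n = 1.
Proof.
have := lead_coef_exp ('X + c%:P) n; rewrite lead_coefXaddC expr1n => <-.
by rewrite lead_coefE size_shiftXn.
Qed.

(** Modulo [p] the curve is [D] times the moment curve, so its Taylor matrix is lower triangular
    with [D] on the diagonal, and no degree above [k] survives. *)
Lemma cclass_taymx k (P : 'I_k -> {poly int}) xi : cclass P ->
  ~~ (p%:Z %| \det (taymx P xi))%Z /\
  (forall r m, (k < m)%N -> (p%:Z %| (nfpoly P xi r)`_m)%Z).
Proof.
move=> [D pD [Q PE]].
have cE i m : ((P i \Po ('X + xi%:P))`_m)%:~R =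
    (D%:~R : F) * (('X + (xi%:~R)%:P) ^+ i.+1)`_m.
  rewrite -coef_map /= rd_shift (rd_cclass PE) comp_polyZ coefZ.
  by rewrite comp_Xn_poly.
split.
  rewrite dvdz_Fp -det_map_mx det_trig.
    apply/prodf_neq0 => i _; rewrite !mxE /= cE lead_shiftXn mulr1.
    by rewrite -dvdz_Fp.
  apply/is_trig_mxP => i j ij; rewrite !mxE /= cE coef_shiftXn ?mulr0 //.
move=> r m km; rewrite /nfpoly coef_sum; apply: rpred_sum => i _.
rewrite coefZ dvdz_mull // dvdz_Fp cE coef_shiftXn ?mulr0 //.
exact: leq_ltn_trans (ltn_ord i) km.
Qed.

Lemma cclass_rescale k (P : 'I_k -> {poly int}) xi b : cclass P ->
  exists2 P' : 'I_k -> {poly int}, cclass P' &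
  exists (U : 'I_k -> 'I_k -> int) (c : 'I_k -> int), forall i z,
    \sum_j U i j * (P j).[xi + p%:Z ^+ b * z] =
    c i + p%:Z ^+ (b * i.+1) * (P' i).[z].
Proof.
move=> iP; have [dT hH] := cclass_taymx xi iP.
have [|P' iP' h] := @normal_form k P xi b dT.
  by move=> r m km; rewrite dvdz_mulr // hH.
by exists P' => //; exists (fun i j => (\adj (taymx P xi)) i j), (fun i => (nfpoly P xi i)`_0).
Qed.

Lemma comp_shiftXn (c : F) n : ('X + c%:P) ^+ n \Po ('X - c%:P) = 'X^n.
Proof.
elim: n => [|n ih]; first by rewrite !expr0 comp_polyC.
by rewrite !exprS comp_polyM ih comp_polyD comp_polyX comp_polyC subrK.
Qed.

(* The top l coordinates, recentred at eta, restrict near xi to a curve that is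
   again nondegenerate: the kernel argument divides f' = (X + c)^(n-1) g by X^l. *)
Lemma shifted_powers_free l n (c d : F) (v : 'rV[F]_l) :
  (0 < n)%N -> (n + l <= p)%N -> c != 0 -> d != 0 ->
  (forall m : 'I_l, \sum_r v 0 r * (d * (('X + c%:P) ^+ (n + r))`_m.+1) = 0) ->
  v = 0.
Proof.
move=> n0 nlp c0 d0 H.
(* These factors come from differentiation; [n + l <= p] keeps them invertible. *)
have nz (r : 'I_l) : (n + r)%:R != 0 :> F.
  rewrite -(dvdn_pcharf (pchar_Fp p_pr)) gtnNdvd ?addn_gt0 ?n0 //.
  by rewrite (leq_trans _ nlp) // ltn_add2l.
pose f := \sum_r (v 0 r * d) *: ('X + c%:P) ^+ (n + r).
pose g := \sum_r (v 0 r * d * (n + r)%:R) *: ('X + c%:P) ^+ r.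
(* Differentiating removes the constant term, about which [H] says nothing. *)
have fg : f^`() = ('X + c%:P) ^+ n.-1 * g.
  rewrite /f /g raddf_sum /= mulr_sumr; apply: eq_bigr => r _.
  rewrite derivZ deriv_exp derivD derivX derivC addr0 mul1r.
  rewrite -scalerAr -exprD -scaler_nat scalerA mulrC.
  by congr (_ *: _ ^+ _); rewrite -{1}(prednK n0) addSn.
have tf : take_poly l f^`() = 0.
  apply/polyP => m; rewrite coef_take_poly coef0; case: ifP => // ml.
  rewrite coef_deriv /f coef_sum (_ : \sum_r _ = 0) ?mul0rn //.
  rewrite -[RHS](H (Ordinal ml)); apply: eq_bigr => r _.
  by rewrite coefZ mulrA.
have dX : 'X^l %| ('X + c%:P) ^+ n.-1 * g.
  by rewrite -fg -(poly_take_drop l f^`()) tf add0r dvdp_mull.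
have cop : coprimep 'X^l (('X + c%:P) ^+ n.-1).
  rewrite coprimep_expl // coprimep_expr // coprimep_sym coprimepX.
  by rewrite rootE !hornerE.
rewrite (Gauss_dvdpr _ cop) in dX.
have sg : (size g <= l)%N.
  apply: leq_trans (size_sum _ _ _) _; apply/bigmax_leqP => r _.
  by rewrite (leq_trans (size_scale_leq _ _)) // size_shiftXn.
have g0 : g = 0.
  apply/eqP; apply: contraTT dX => gn0; apply/negP => /(dvdp_leq gn0).
  by rewrite size_polyXn leqNgt ltnS sg.
have : g \Po ('X - c%:P) = 0 by rewrite g0 comp_poly0.
rewrite /g raddf_sum /= => hg; apply/rowP => r; rewrite mxE.
have /(congr1 (fun q : {poly F} => q`_r)) := hg.
rewrite coef0 coef_sum (bigD1 r) //= big1 ?addr0.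
  rewrite comp_polyZ comp_shiftXn coefZ coefXn eqxx.
  move/eqP; rewrite mulr1 mulf_eq0 (negbTE (nz r)) orbF mulf_eq0 (negbTE d0) orbF.
  by move/eqP.
move=> i ir; rewrite comp_polyZ comp_shiftXn.
by rewrite coefZ coefXn eq_sym (inj_eq val_inj) (negbTE ir) mulr0.
Qed.

(** One family of combinations [U] sees the two classes differently. It starts from the top [l]
    coordinates of the normal form at [eta], so around [eta] its members are constant up to order
    [k - l + 1]. Around [xi] they are, modulo [p], powers of [X + cc] with [cc] nonzero, and
    [shifted_powers_free] makes their first [l] Taylor coefficients independent: a curve of degree
    [l]. *)
Lemma cclass_lower k l (P : 'I_k -> {poly int}) xi eta a : cclass P ->
  (0 < l <= k)%N -> (k < p)%N -> (0 < a)%N -> ~~ (p%:Z %| xi - eta)%Z ->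
  exists2 P' : 'I_l -> {poly int}, cclass P' &
  exists (U : 'I_l -> 'I_k -> int) (c d : 'I_l -> int),
  (forall r z, \sum_j U r j * (P j).[xi + p%:Z ^+ a * z] =
    c r + p%:Z ^+ (a * r.+1) * (P' r).[z]) /\
  (forall b r y, (p%:Z ^+ (b * (k - l).+1) %|
     \sum_j U r j * (P j).[eta + p%:Z ^+ b * y] - d r)%Z).
Proof.
move=> iP /andP[l0 lk] kp a0 xe; have [dT hH] := cclass_taymx eta iP.
pose U1 := \adj (taymx P eta); pose c1 i := (nfpoly P eta i)`_0.
have ltk (r : 'I_l) : (k - l + r < k)%N.
  by rewrite -ltn_subRL subKn.
pose io (r : 'I_l) : 'I_k := Ordinal (ltk r).
pose G (r : 'I_l) := \sum_j U1 (io r) j *: P j.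
have GE (r : 'I_l) x : (G r).[x] = \sum_j U1 (io r) j * (P j).[x].
  by rewrite /G horner_sum; apply: eq_bigr => j _; rewrite hornerZ.
have Gs (r : 'I_l) : G r \Po ('X + eta%:P) = nfpoly P eta (io r).
  rewrite /G /nfpoly raddf_sum /=; apply: eq_bigr => j _.
  by rewrite comp_polyZ.
pose dd : F := (\det (taymx P eta))%:~R.
have dd0 : dd != 0 by rewrite -dvdz_Fp.
have rdG (r : 'I_l) : rd (G r \Po ('X + eta%:P)) =
    ((c1 (io r))%:~R)%:P + dd *: 'X^((io r).+1).
  apply/polyP => m; rewrite Gs coef_map /= coefD coefC coefZ coefXn.
  have [->|m0] := posnP m; first by rewrite /= mulr0 addr0.
  have [km|mk] := ltnP k m.
    have /eqP -> : ((nfpoly P eta (io r))`_m)%:~R == 0 :> F by rewrite -dvdz_Fp hH.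
    rewrite add0r gtn_eqF ?mulr0 //.
    exact: leq_ltn_trans (ltn_ord (io r)) km.
  have mk' : (m.-1 < k)%N by rewrite prednK.
  have := nfpoly_coef P eta (io r) (Ordinal mk'); rewrite /= prednK // => ->.
  rewrite add0r -(inj_eq val_inj) /= -[in RHS](prednK m0) eqSS [in RHS]eq_sym.
  by rewrite rmorphMn /= mulr_natr.
pose cc : F := (xi - eta)%:~R.
have cc0 : cc != 0 by rewrite -dvdz_Fp.
have rdG2 (r : 'I_l) : rd (G r \Po ('X + xi%:P)) =
    ((c1 (io r))%:~R)%:P + dd *: ('X + cc%:P) ^+ ((k - l).+1 + r).
  have -> : G r \Po ('X + xi%:P) = (G r \Po ('X + eta%:P)) \Po ('X + (xi - eta)%:P).
    rewrite -comp_polyA rmorphD /= comp_polyX comp_polyC; congr (_ \Po _).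
    by rewrite -addrA -rmorphD /= subrK.
  rewrite rd_shift rdG rmorphD /= comp_polyC comp_polyZ comp_Xn_poly.
  by rewrite addSn.
have dT2 : ~~ (p%:Z %| \det (taymx G xi))%Z.
  rewrite dvdz_Fp -det_map_mx; apply/negP => /det0P[v v0 vT].
  case/negP: v0; apply/eqP.
  apply: (@shifted_powers_free l (k - l).+1 cc dd) => //.
    by rewrite addSn subnK.
  move=> m; have /rowP/(_ m) := vT; rewrite !mxE => E.
  rewrite -[RHS]E; apply: eq_bigr => r _; congr (_ * _).
  by rewrite !mxE -coef_map /= rdG2 coefD coefC coefZ add0r.
(* Nothing is known here about the coefficients above degree [l]; [0 < a] supplies the factor
   [p]. *)
have [|P' iP' h] := @normal_form l G xi a dT2.
  move=> r m _; rewrite dvdz_mull // -(prednK a0) exprS dvdz_mulr //.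
exists P' => //.
pose U2 := \adj (taymx G xi).
exists (fun r j => \sum_i U2 r i * U1 (io i) j), (fun r => (nfpoly G xi r)`_0),
  (fun r => \sum_i U2 r i * c1 (io i)).
have sw r x : \sum_j (\sum_i U2 r i * U1 (io i) j) * (P j).[x] =
    \sum_i U2 r i * (G i).[x].
  under eq_bigr => j _ do rewrite mulr_suml.
  rewrite exchange_big /=; apply: eq_bigr => i _; rewrite GE mulr_sumr.
  by apply: eq_bigr => j _; rewrite mulrA.
split => [r z|b r y]; first by rewrite sw h.
rewrite sw -sumrB; apply: rpred_sum => i _.
rewrite -mulrBr dvdz_mull // GE.
have [|P1 _ h1] := @normal_form k P eta b dT.
  by move=> r' m km; rewrite dvdz_mulr // hH.
rewrite h1 addrC addKr; apply: dvdz_mulr; apply: dvdz_exp2l.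
by rewrite leq_mul2l /= ltnS leq_addr orbT.
Qed.

End CurveAlgebra.

(** Sum of the degrees 1 to [k]; [2 * kap k] is the critical exponent of Vinogradov's mean value. *)
Definition kap (k : nat) : nat := (k * k.+1)./2.

Lemma kap2 k : (2 * kap k = k * k.+1)%N.
Proof. by rewrite /kap mul2n halfK oddM /= andbN subn0. Qed.

Arguments kap : simpl never.

(** Makes the later Hölder step exact: read with [l - 1] for [l] and [d = k - l], it interpolates
    [kap l] between [kap (l - 1)] and [kap k - kap (k - l)]. *)
Lemma kap_hoelder l d :
  (d.+1 * kap l.+1 + kap d = d * kap l + kap (l.+1 + d))%N.
Proof.
apply/eqP; rewrite -(eqn_pmul2l (isT : 0 < 2)%N) !mulnDr.
by rewrite (mulnCA 2 d.+1) (mulnCA 2 d) !kap2; apply/eqP; lia.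
Qed.

Lemma kap_le k l : (l <= k)%N -> (kap l <= kap k)%N.
Proof. by move=> lk; rewrite half_leq // leq_mul. Qed.

Section RealSums.
Variable R : realType.

(** Comparison with the largest term. One factor [#|J|] is lost against Hölder, which is harmless
    where a fixed power of [p] per level may be wasted. *)
Lemma sum_pow_le (J : finType) (x : J -> R) m : (0 < #|J|)%N ->
  (forall j, 0 <= x j) ->
  (\sum_j x j) ^+ m <= #|J|%:R ^+ m * \sum_j x j ^+ m.
Proof.
move=> J0 x0; have /card_gt0P[j0 _] := J0.
pose M := [arg max_(i > j0) x i]%O.
have Mx j : x j <= x M by rewrite /M; case: arg_maxP => // i _ /(_ j); apply.
apply: (@le_trans _ _ ((#|J|%:R * x M) ^+ m)).
  rewrite lerXn2r ?nnegrE ?mulr_ge0 ?sumr_ge0 //.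
  by apply: le_trans (ler_sum _ (fun j _ => Mx j)) _; rewrite sumr_const mulr_natl.
rewrite exprMn ler_wpM2l ?exprn_ge0 // (bigD1 M) //= lerDl sumr_ge0 // => j _.
exact: exprn_ge0.
Qed.

Lemma mul_pow_le_add (x y : R) m n : 0 <= x -> 0 <= y ->
  x ^+ m * y ^+ n <= x ^+ (m + n) + y ^+ (m + n).
Proof.
move=> x0 y0; rewrite !exprD; have [xy|/ltW yx] := leP x y.
  apply: ler_wpDl; first by rewrite mulr_ge0 ?exprn_ge0.
  by rewrite ler_wpM2r ?exprn_ge0 // lerXn2r.
apply: ler_wpDr; first by rewrite mulr_ge0 ?exprn_ge0.
by rewrite ler_wpM2l ?exprn_ge0 // lerXn2r.
Qed.

Lemma agm_weighted (u v : R) K : 0 <= u -> 0 <= v ->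
  u ^+ K * v <= ((K%:R * u + v) / K.+1%:R) ^+ K.+1.
Proof.
move=> u0 v0.
have := @leif_AGM R 'I_K.+1 predT (fun i => if i == ord_max then v else u).
rewrite /= cardT size_enum_ord => h.
have {h}[|h _] := h; first by move=> i; case: ifP.
rewrite !big_ord_recr /= eqxx in h.
have ne (i : 'I_K) : (widen_ord (leqnSn K) i == ord_max) = false.
  by rewrite -(inj_eq val_inj) /= ltn_eqF.
move: h; under eq_bigr => i _ do rewrite ne.
under [in X in _ <= X -> _]eq_bigr => i _ do rewrite ne.
by rewrite prodr_const sumr_const !card_ord mulr_natl.
Qed.

(** Hölder's inequality with exponents [K / (K + 1)] and [1 / (K + 1)], stated without roots. After
    division by the total sums each term is bounded by a weighted arithmetic mean, and these means
    add up to 1. *)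
Lemma hoelder_pow (J : finType) (x y z : J -> R) K :
  (forall j, 0 <= x j) -> (forall j, 0 <= y j) -> (forall j, 0 <= z j) ->
  (forall j, z j ^+ K.+1 <= x j ^+ K * y j) ->
  (\sum_j z j) ^+ K.+1 <= (\sum_j x j) ^+ K * \sum_j y j.
Proof.
move=> x0 y0 z0 h; set X := \sum_j x j; set Y := \sum_j y j.
have X0 : 0 <= X by exact: sumr_ge0.
have Y0 : 0 <= Y by exact: sumr_ge0.
have zz : (forall j, z j = 0) -> (\sum_j z j) ^+ K.+1 <= X ^+ K * Y.
  by move=> H; rewrite big1 // expr0n /= mulr_ge0 ?exprn_ge0.
have [Y00|Yn0] := eqVneq Y 0.
  apply: zz => j; apply/eqP; rewrite -[_ == 0]/((0 < K.+1)%N && (z j == 0)) -expf_eq0 eq_le exprn_ge0 // andbT.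
  apply: le_trans (h j) _; have /eqP := Y00; rewrite psumr_eq0 // => /allP /(_ j).
  by rewrite mem_index_enum => /(_ isT) /eqP ->; rewrite mulr0.
have [X00|Xn0] := eqVneq X 0.
  case: K h zz => [|K] h zz.
    rewrite expr0 mul1r expr1; apply: ler_sum => j _.
    by have := h j; rewrite expr0 expr1 mul1r.
  apply: zz => j; apply/eqP; rewrite -[_ == 0]/((0 < K.+2)%N && (z j == 0)) -expf_eq0 eq_le exprn_ge0 // andbT.
  apply: le_trans (h j) _; have /eqP := X00; rewrite psumr_eq0 // => /allP /(_ j).
  by rewrite mem_index_enum => /(_ isT) /eqP ->; rewrite expr0n mul0r.
have Xp : 0 < X by rewrite lt_def Xn0.
have Yp : 0 < Y by rewrite lt_def Yn0.
pose g := (X ^+ K * Y) `^ (K.+1%:R^-1).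
have gp : 0 < g by rewrite powR_gt0 // mulr_gt0 // exprn_gt0.
have gK : g ^+ K.+1 = X ^+ K * Y.
  rewrite -powR_mulrn ?powR_ge0 // -powRrM mulVf ?pnatr_eq0 // powRr1 //.
  by rewrite mulr_ge0 ?exprn_ge0.
rewrite -gK lerXn2r ?nnegrE ?sumr_ge0 ?(ltW gp) //.
have key j : z j <= g * ((K%:R * (x j / X) + y j / Y) / K.+1%:R).
  have s0 : 0 <= (K%:R * (x j / X) + y j / Y) / K.+1%:R.
    by rewrite divr_ge0 // addr_ge0 ?mulr_ge0 ?invr_ge0.
  set sj := _ / K.+1%:R in s0 *.
  suff : z j ^+ K.+1 <= (g * sj) ^+ K.+1.
    by rewrite ler_pXn2r // nnegrE ?z0 // mulr_ge0 // ltW.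
  rewrite exprMn gK; apply: le_trans (h j) _.
  have := @agm_weighted (x j / X) (y j / Y) K.
  move=> /(_ (divr_ge0 (x0 j) X0) (divr_ge0 (y0 j) Y0)) h2.
  rewrite -ler_pdivrMl ?mulr_gt0 ?exprn_gt0 //; apply: le_trans h2.
  rewrite exprMn exprVn invfM le_eqVlt; apply/orP; left; apply/eqP.
  by rewrite mulrACA [X ^- K * _]mulrC [Y^-1 * _]mulrC.
apply: le_trans (ler_sum _ (fun j _ => key j)) _.
rewrite -mulr_sumr -mulr_suml big_split /= -mulr_sumr -!mulr_suml.
by rewrite -/X -/Y !divff // mulr1 -natr1 divff ?mulr1 // natr1 pnatr_eq0.
Qed.

End RealSums.

Lemma conjcM (R : realType) (x y : R[i]) : (x * y)^*%C = x^*%C * y^*%C.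
Proof. exact: rmorphM. Qed.

Lemma dvdz_horner_sub (Q : {poly int}) (x y : int) :
  (x - y %| Q.[x] - Q.[y])%Z.
Proof.
elim/poly_ind: Q => [|Q c IH]; first by rewrite !horner0 subrr dvdz0.
rewrite !hornerMXaddC.
have -> : Q.[x] * x + c - (Q.[y] * y + c) = (Q.[x] - Q.[y]) * x + Q.[y] * (x - y) by ring.
by apply: rpredD; [rewrite dvdz_mulr|rewrite dvdz_mull].
Qed.

Lemma residue_ord (q : nat) (x : int) : (0 < q)%N ->
  exists t0 : 'I_q, forall t : 'I_q, (q%:Z %| x - t%:Z)%Z = (t == t0).
Proof.
move=> q0; have qz : q%:Z != 0 by rewrite eqz_nat -lt0n.
have lt0 : (`|(x %% q%:Z)%Z|%N < q)%N.
  by rewrite -ltz_nat gez0_abs ?modz_ge0 // ltz_pmod // ltz_nat.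
exists (Ordinal lt0) => t; rewrite -(inj_eq val_inj) /=.
rewrite -eqz_mod_dvd -eqz_nat gez0_abs ?modz_ge0 //.
by rewrite [X in _ == X]modz_small ?ltz_nat ?ltn_ord // eq_sym.
Qed.

(** * Nested efficient congruencing *)

Section Decoupling.
Variables (R : realType) (p : nat).
Hypothesis p_pr : prime p.
Local Notation C := R[i].
Local Notation e := (@e R).
Local Notation pz := (p%:Z).
Local Notation pr := (p%:R : R).

Let p0 : (0 < p)%N. Proof. exact: prime_gt0. Qed.
Let prp : 0 < pr. Proof. by rewrite ltr0n. Qed.

Definition fcl (I : finType) (Om : Type) (pos : I -> int) (F : I -> Om -> C)
    (n : nat) (z : int) (w : Om) : C :=
  \sum_(i | (pz ^+ n %| pos i - z)%Z) F i w.

(* The family F i behaves like e(sum_j al_j P_j(pos i)), with w in the role of al: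
   al may be shifted by be / p^m at the cost of a unimodular factor u. *)
Definition equivar k (P : 'I_k -> {poly int}) (m : nat) (I Om : finType)
    (pos : I -> int) (F : I -> Om -> C) (Phi : Om -> R) :=
  (forall w, 0 <= Phi w) /\
  forall be : 'I_k -> int, exists2 tau : Om -> Om, injective tau &
    exists2 u : Om -> C, (forall w, nm (u w) = 1 /\ Phi (tau w) = Phi w) &
    forall i w, F i (tau w) =
      u w * e ((\sum_j be j * (P j).[pos i])%:~R / pr ^+ m) * F i w.

Definition mean (Om : finType) (f : Om -> C) (m : nat) (Phi : Om -> R) : R :=
  \sum_w nm (f w) ^+ m * Phi w.

(** [La] bounds the critical mean over one class of level [n], the finest resolution. The shifts
    have denominator [p^(k n)], the precision of the coordinate of degree [k] at resolution
    [p^-n]. *)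
Definition dsys k n (P : 'I_k -> {poly int}) (I Om : finType)
    (pos : I -> int) (F : I -> Om -> C) (Phi : Om -> R) (La : R) :=
  [/\ cclass p P, equivar P (k * n) pos F Phi &
   forall z, mean (fcl pos F n z) (2 * kap k) Phi <= La].

(* Decoupling of degree k at scale p^-n with constant D: square-root cancellation
   among the p^n residue classes at the critical exponent k(k+1), up to D. *)
Definition Dec k n (D : R) :=
  forall (P : 'I_k -> {poly int}) (I Om : finType) (pos : I -> int)
    (F : I -> Om -> C) (Phi : Om -> R) La,
  dsys n P pos F Phi La ->
  mean (fun w => \sum_i F i w) (2 * kap k) Phi <= D * pr ^+ (n * kap k) * La.

Lemma mean_ge0 (Om : finType) (f : Om -> C) m Phi :
  (forall w, 0 <= Phi w) -> 0 <= mean f m Phi.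
Proof. by move=> P0; rewrite sumr_ge0 // => w _; rewrite mulr_ge0 ?exprn_ge0 ?nm_ge0. Qed.

Lemma dsys_La k n (P : 'I_k -> {poly int}) (I Om : finType) (pos : I -> int)
    (F : I -> Om -> C) (Phi : Om -> R) La :
  dsys n P pos F Phi La -> 0 <= La.
Proof. by case=> _ [P0 _] /(_ 0); apply: le_trans; exact: mean_ge0. Qed.

Lemma Dec_mono k n D D' : D <= D' -> Dec k n D -> Dec k n D'.
Proof.
move=> DD h P I Om pos F Phi La ds; apply: le_trans (h _ _ _ _ _ _ _ ds) _.
by rewrite !ler_wpM2r ?exprn_ge0 ?(ltW prp) // (dsys_La ds).
Qed.

Lemma fcl_split (I Om : finType) (pos : I -> int) (F : I -> Om -> C) a a' z w :
  (a <= a')%N ->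
  fcl pos F a z w = \sum_(t < p ^ (a' - a)) fcl pos F a' (z + pz ^+ a * t%:Z) w.
Proof.
move=> aa; rewrite /fcl.
under [RHS]eq_bigr => t _ do rewrite big_mkcond.
rewrite exchange_big /= big_mkcond; apply: eq_bigr => i _.
have pa0 m : pz ^+ m != 0 by rewrite expf_neq0 // eqz_nat -lt0n.
have pE : pz ^+ a' = pz ^+ a * pz ^+ (a' - a) by rewrite -exprD subnKC.
case: ifP => [/dvdzP[y hy]|nd].
  have [|t0 ht0] := @residue_ord (p ^ (a' - a)) y; first by rewrite expn_gt0 p0.
  have cond (t : 'I_(p ^ (a' - a))) :
      (pz ^+ a' %| pos i - (z + pz ^+ a * t%:Z))%Z = (t == t0).
    rewrite opprD addrA hy mulrC -mulrBr pE dvdz_mul2l ?pa0 // -ht0.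
    by rewrite -[pz]natz -rmorphXn /= natz.
  rewrite (bigD1 t0) //= cond eqxx big1 ?addr0 // => t ht.
  by rewrite cond (negbTE ht).
rewrite big1 // => t _; case: ifP => // h; case/negP: nd.
have : (pz ^+ a %| pos i - (z + pz ^+ a * t%:Z))%Z.
  by apply: dvdz_trans h; rewrite pE dvdz_mulr.
by rewrite opprD addrA rpredBr // dvdz_mulr.
Qed.

Lemma fcl0 (I Om : finType) (pos : I -> int) (F : I -> Om -> C) z w :
  fcl pos F 0 z w = \sum_i F i w.
Proof. by rewrite /fcl; apply: eq_bigl => i; rewrite expr0 dvd1z. Qed.

Lemma mean_split (I Om : finType) (pos : I -> int) (F : I -> Om -> C) a a' z m Phi B :
  (a <= a')%N -> (forall w, 0 <= Phi w) ->
  (forall t, mean (fcl pos F a' (z + pz ^+ a * t)) m Phi <= B) ->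
  mean (fcl pos F a z) m Phi <= (pr ^+ (a' - a)) ^+ m.+1 * B.
Proof.
move=> aa P0 h; set q := (p ^ (a' - a))%N.
have q0 : (0 < #|'I_q|)%N by rewrite card_ord expn_gt0 p0.
apply: (@le_trans _ _ (\sum_w q%:R ^+ m *
    (\sum_(t < q) nm (fcl pos F a' (z + pz ^+ a * t%:Z) w) ^+ m) * Phi w)).
  apply: ler_sum => w _; rewrite ler_wpM2r // (fcl_split _ _ _ _ aa).
  apply: (@le_trans _ _ ((\sum_(t < q) nm (fcl pos F a' (z + pz ^+ a * t%:Z) w)) ^+ m)).
    by rewrite lerXn2r ?nnegrE ?nm_ge0 ?sumr_ge0 // => [i _|]; [exact: nm_ge0|exact: nm_sum].
  have := @sum_pow_le R _ (fun t : 'I_q => nm (fcl pos F a' (z + pz ^+ a * t%:Z) w)) m q0.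
  by rewrite card_ord; apply => j; exact: nm_ge0.
rewrite (_ : \sum_w _ = q%:R ^+ m *
    \sum_(t < q) mean (fcl pos F a' (z + pz ^+ a * t%:Z)) m Phi); last first.
  rewrite /mean exchange_big mulr_sumr /=; apply: eq_bigr => w _.
  by rewrite -mulr_suml mulrA.
have -> : pr ^+ (a' - a) = q%:R by rewrite natrX.
rewrite exprSr -mulrA ler_wpM2l ?exprn_ge0 //.
rewrite -[q in q%:R](card_ord q) mulr_natl -sumr_const; apply: ler_sum => t _.
exact: h.
Qed.

Lemma Dec_trivial k n : Dec k n (pr ^+ (n * (kap k).+1)).
Proof.
move=> P I Om pos F Phi La [_ [P0 _] h].
have := @mean_split _ _ pos F 0 n 0 (2 * kap k) Phi La (leq0n n) P0 (fun t => h _).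
rewrite subn0 -exprM /mean; under eq_bigr => w _ do rewrite fcl0.
move/le_trans; apply; rewrite -exprD le_eqVlt; apply/orP; left; apply/eqP.
by congr (_ ^+ _ * _); lia.
Qed.

Lemma reindex_inj_sum (Om : finType) (tau : Om -> Om) (G : Om -> R) :
  injective tau -> \sum_w G (tau w) = \sum_w G w.
Proof. by move=> ti; rewrite [RHS](reindex_inj ti). Qed.

(* Averaging over the shifts is Parseval on Z/p^n. *)
Lemma Dec1 n : Dec 1 n 1.
Proof.
move=> P I Om pos F Phi La [[D pD [Q PE]] [P0 eqv] h].
have -> : (2 * kap 1 = 2)%N by [].
have k1 : kap 1 = 1%N by [].
rewrite k1 muln1 mul1r.
(* Dividing out [pos i - pos i'] leaves [D + p c], prime to [p]; so the curve separates the classes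
   modulo [p^n] exactly as the positions do. *)
have PP i i' : (pz ^+ n %| (P ord0).[pos i] - (P ord0).[pos i'])%Z =
    (pz ^+ n %| pos i - pos i')%Z.
  have /dvdzP[c hc] := dvdz_horner_sub (Q ord0) (pos i) (pos i').
  have -> : (P ord0).[pos i] - (P ord0).[pos i'] = (pos i - pos i') * (D + pz * c).
    rewrite !PE !hornerD !hornerZ !hornerXn !expr1.
    have -> : D * pos i + pz * (Q ord0).[pos i] - (D * pos i' + pz * (Q ord0).[pos i']) =
      (pos i - pos i') * D + pz * ((Q ord0).[pos i] - (Q ord0).[pos i']) by ring.
    by rewrite hc; ring.
  rewrite mulrC Gauss_dvdzr // coprimezXl //.
  rewrite coprimezE /= prime_coprime // -(@dvdzE pz).
  by rewrite rpredDr // dvdz_mulr.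
pose q := (p ^ n)%N; have q0 : (0 < q)%N by rewrite expn_gt0 p0.
have shift (b : 'I_q) : mean (fun w => \sum_i F i w) 2 Phi =
   \sum_w nm (\sum_i e (b%:R / q%:R * (P ord0).[pos i]%:~R) * F i w) ^+ 2 * Phi w.
  have [tau ti [u hu hF]] := eqv (fun=> b%:Z).
  rewrite /mean -(@reindex_inj_sum _ tau) //; apply: eq_bigr => w _.
  have [u1 ->] := hu w; congr (_ ^+ 2 * _).
  under eq_bigr => i _ do rewrite hF -mulrA.
  rewrite -mulr_sumr nmM u1 mul1r; congr nm; apply: eq_bigr => i _.
  by rewrite big_ord1 intrM mul1n natrX mulrAC.
(* Averaging the shifted squares over [b] modulo [p^n] kills the pairs of indices in different
   classes. *)
have sumshift : q%:R * mean (fun w => \sum_i F i w) 2 Phi =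
    \sum_w q%:R * (\sum_(t < q) nm (fcl pos F n t%:Z w) ^+ 2) * Phi w.
  rewrite -[X in X%:R * _](card_ord q) mulr_natl -sumr_const.
  under eq_bigr => b _ do rewrite (shift b).
  rewrite exchange_big /=; apply: eq_bigr => w _.
  rewrite -mulr_suml; congr (_ * _); apply: (@complexI R).
  rewrite rmorph_sum rmorphM rmorph_nat rmorph_sum /=.
  under eq_bigr => b _ do rewrite nm_sqr rmorph_sum /= mulr_suml.
  under [in RHS]eq_bigr => t _ do rewrite nm_sqr rmorph_sum /= mulr_suml.
  have -> : q%:R * \sum_(t < q) \sum_(i | (pz ^+ n %| pos i - t%:Z)%Z)
      F i w * \sum_(i' | (pz ^+ n %| pos i' - t%:Z)%Z) (F i' w)^*%C =
      \sum_i \sum_i' (q%:R *+ (pz ^+ n %| pos i - pos i')%Z) * (F i w * (F i' w)^*%C).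
    rewrite mulr_sumr; under eq_bigr => t _ do rewrite big_mkcond mulr_sumr.
    rewrite exchange_big /=; apply: eq_bigr => i _.
    have [t0] := @residue_ord q (pos i) q0.
    have -> : q%:Z = pz ^+ n by rewrite -[pz]natz -rmorphXn /= natz.
    move=> ht0.
    rewrite (bigD1 t0) //= ht0 eqxx [X in _ + X]big1 ?addr0 => [|t tt]; last first.
      by rewrite ht0 (negbTE tt) mulr0.
    rewrite !mulr_sumr big_mkcond /=; apply: eq_bigr => i' _.
    have -> : (pz ^+ n %| pos i' - (t0 : 'I_q)%:Z)%Z = (pz ^+ n %| pos i - pos i')%Z.
      have := ht0 t0; rewrite eqxx => h0.
      apply/idP/idP => hh.
        have -> : pos i - pos i' = (pos i - (t0 : 'I_q)%:Z) - (pos i' - (t0 : 'I_q)%:Z) by ring.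
        exact: rpredB.
      have -> : pos i' - (t0 : 'I_q)%:Z = (pos i - (t0 : 'I_q)%:Z) - (pos i - pos i') by ring.
      exact: rpredB.
    by case: ifP; rewrite ?mulr1n ?mulr0n ?mul0r.
  rewrite exchange_big /=; apply: eq_bigr => i _.
  under eq_bigr => b _ do rewrite mulr_sumr.
  rewrite exchange_big /=; apply: eq_bigr => i' _.
  under eq_bigr => b _ do rewrite conjcM -eN mulrACA -eD -mulrBr -intrB.
  rewrite -mulr_suml e_orth // -PP; congr (_ *+ _ * _).
  by rewrite -[pz]natz -rmorphXn /= natz.
have : q%:R * mean (fun w => \sum_i F i w) 2 Phi <= q%:R * (q%:R * La).
  rewrite sumshift; under eq_bigr => w _ do rewrite -mulrA mulr_suml.
  rewrite -mulr_sumr ler_wpM2l // exchange_big /=.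
  rewrite -[q in leRHS](card_ord q) mulr_natl -sumr_const; apply: ler_sum => t _.
  exact: (h t%:Z).
by rewrite ler_pM2l ?ltr0n // natrX.
Qed.

End Decoupling.

Lemma hoelder_compl (d A B c E : nat) :
  (d.+1 * A = d * B + (c - E) -> B <= c -> E <= c ->
  d.+1 * (c - A) = d * (c - B) + E)%N.
Proof.
move=> h Bc Ec; rewrite !mulnBr h mulSn; have := leq_mul (leqnn d) Bc.
by move: (d * c)%N (d * B)%N => X Y; lia.
Qed.

(** * Mixed means over two separated residue classes *)

Section Bilinear.
Variables (R : realType) (p : nat).
Hypothesis p_pr : prime p.
Local Notation C := R[i].
Local Notation e := (@e R).
Local Notation pz := (p%:Z).
Local Notation pr := (p%:R : R).
Local Notation Dec := (@Dec R p).
Local Notation fcl := (@fcl R p _ _).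

Let p0 : (0 < p)%N. Proof. exact: prime_gt0. Qed.
Let prp : 0 < pr. Proof. by rewrite ltr0n. Qed.
Let pr1 : 1 <= pr. Proof. by rewrite ler1n. Qed.
Let prn0 : pr != 0. Proof. by rewrite gt_eqF. Qed.

Lemma intrXp m : (pz ^+ m)%:~R = pr ^+ m.
Proof. by rewrite rmorphXn. Qed.

Lemma pz_neq0 m : pz ^+ m != 0.
Proof. by rewrite expf_neq0 // eqz_nat -lt0n. Qed.

Definition repos (I : Type) (pos : I -> int) (a : nat) (xi : int) : I -> int :=
  fun i => ((pos i - xi) %/ pz ^+ a)%Z.

(** With [repos], zooms into the class of [xi] modulo [p^a]. Off that class the quotient in [repos]
    has no meaning, so the terms are set to 0. *)
Definition refun (I Om : Type) (pos : I -> int) (F : I -> Om -> C) (a : nat)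
    (xi : int) : I -> Om -> C :=
  fun i w => if (pz ^+ a %| pos i - xi)%Z then F i w else 0.

Lemma fcl_repos (I Om : finType) (pos : I -> int) (F : I -> Om -> C) a b xi z w :
  fcl (repos pos a xi) (refun pos F a xi) b z w =
  fcl pos F (a + b) (xi + pz ^+ a * z) w.
Proof.
rewrite /fcl big_mkcond [RHS]big_mkcond; apply: eq_bigr => i _; rewrite /refun /repos.
have [/dvdzP[y hy]|nd] := boolP (pz ^+ a %| pos i - xi)%Z.
  rewrite hy mulzK ?pz_neq0 // opprD addrA hy [y * _]mulrC -mulrBr exprD.
  by rewrite dvdz_mul2l ?pz_neq0.
have -> : (pz ^+ (a + b) %| pos i - (xi + pz ^+ a * z))%Z = false.
  apply/negP => h; case/negP: nd.
  have : (pz ^+ a %| pos i - (xi + pz ^+ a * z))%Z.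
    by apply: dvdz_trans h; rewrite exprD dvdz_mulr.
  by rewrite opprD addrA rpredBr // dvdz_mulr.
by case: ifP.
Qed.

Lemma sum_refun (I Om : finType) (pos : I -> int) (F : I -> Om -> C) a xi w :
  \sum_i refun pos F a xi i w = fcl pos F a xi w.
Proof. by rewrite /fcl [RHS]big_mkcond. Qed.

Lemma eq_mean (Om : finType) (f g : Om -> C) m (Phi : Om -> R) :
  f =1 g -> mean f m Phi = mean g m Phi.
Proof. by move=> h; apply: eq_bigr => w _; rewrite h. Qed.

(** Zooming into a class of level [b] gives again a curve of degree [k], now with [n - b] levels
    left; the shifts it must admit have the coarser denominator [p^(k (n - b))]. *)
Lemma Dec_rescale k n b D (P : 'I_k -> {poly int}) (I Om : finType)
    (pos : I -> int) (F : I -> Om -> C) (Phi : Om -> R) La eta :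
  (b <= n)%N -> Dec k (n - b) D -> dsys p n P pos F Phi La ->
  mean (fcl pos F b eta) (2 * kap k) Phi <= D * pr ^+ ((n - b) * kap k) * La.
Proof.
move=> bn hD [cP [P0 eqv] h].
have [P' cP' [U [c hU]]] := cclass_rescale p_pr eta b cP.
have := hD P' I Om (repos pos b eta) (refun pos F b eta) Phi La.
rewrite (eq_mean _ _ (sum_refun pos F b eta)); apply; split => //; last first.
  move=> z; rewrite (eq_mean _ _ (fcl_repos pos F b (n - b) eta z)) subnKC //.
split => // be.
(* The new coordinate [i] carries [p^(b (i + 1))]; the weight completes this to [p^(b k)], which
   brings the denominator [p^(k n)] down to [p^(k (n - b))]. *)
have [tau ti [u hu hF]] := eqv (fun j => \sum_i be i * U i j * pz ^+ (b * (k - i.+1))).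
exists tau => //.
exists (fun w => u w * e ((\sum_i be i * c i * pz ^+ (b * (k - i.+1)))%:~R / pr ^+ (k * n))).
  by move=> w; have [u1 ->] := hu w; rewrite nmM u1 nm_e mul1r.
move=> i w; rewrite /refun /repos; case: ifP => [/dvdzP[y hy]|]; last by rewrite mulr0.
rewrite hF -!mulrA; congr (_ * _); rewrite mulrA -eD; congr (e _ * _).
rewrite hy mulzK ?pz_neq0 //.
have posE : pos i = eta + pz ^+ b * y by rewrite [_ * y]mulrC -hy addrC subrK.
have -> : \sum_j (\sum_i0 be i0 * U i0 j * pz ^+ (b * (k - i0.+1))) * (P j).[pos i] =
    \sum_i0 be i0 * c i0 * pz ^+ (b * (k - i0.+1)) +
    pz ^+ (b * k) * \sum_i0 be i0 * (P' i0).[y].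
  under eq_bigr => j _ do rewrite mulr_suml.
  rewrite exchange_big /= mulr_sumr -big_split /=; apply: eq_bigr => i0 _.
  have -> : pz ^+ (b * k) = pz ^+ (b * (k - i0.+1)) * pz ^+ (b * i0.+1).
    by rewrite -exprD -mulnDr subnK.
  have -> : be i0 * c i0 * pz ^+ (b * (k - i0.+1)) + pz ^+ (b * (k - i0.+1)) *
      pz ^+ (b * i0.+1) * (be i0 * (P' i0).[y]) =
      be i0 * pz ^+ (b * (k - i0.+1)) * (c i0 + pz ^+ (b * i0.+1) * (P' i0).[y]) by ring.
  rewrite -hU -posE mulr_sumr; apply: eq_bigr => j _; ring.
rewrite intrD mulrDl; congr (_ + _); rewrite intrM intrXp.
have -> : (k * n = b * k + k * (n - b))%N by rewrite [(b * k)%N]mulnC -mulnDr subnKC.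
by rewrite exprD invfM mulrACA divff ?mul1r // expf_neq0.
Qed.

(* The weight |f_b(eta)|^m is invariant under the shifts in the top l coordinates,
   so f_a(xi) can be decoupled by the degree l theorem against it. *)
Lemma Dec_lower k l n a a' b m D (P : 'I_k -> {poly int}) (I Om : finType)
    (pos : I -> int) (F : I -> Om -> C) (Phi : Om -> R) La La' xi eta :
  (0 < l <= k)%N -> (k < p)%N -> (0 < a <= a')%N -> (l * a' = b * (k - l).+1)%N ->
  (l * a' <= k * n)%N ->
  Dec l (a' - a) D -> dsys p n P pos F Phi La -> ~~ (pz %| xi - eta)%Z ->
  (forall z, mean (fcl pos F a' (xi + pz ^+ a * z)) (2 * kap l)
      (fun w => nm (fcl pos F b eta w) ^+ m * Phi w) <= La') ->
  mean (fcl pos F a xi) (2 * kap l) (fun w => nm (fcl pos F b eta w) ^+ m * Phi w) <=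
  D * pr ^+ ((a' - a) * kap l) * La'.
Proof.
move=> lk kp /andP[a0 aa] lab lan hD [cP [P0 eqv] h] xe h'.
have [P' cP' [U [c [d [hU hd]]]]] := cclass_lower p_pr cP lk kp a0 xe.
set W := fun w => _.
have := hD P' I Om (repos pos a xi) (refun pos F a xi) W La'.
rewrite (eq_mean _ _ (sum_refun pos F a xi)); apply; split => //; last first.
  move=> z; rewrite (eq_mean _ _ (fcl_repos pos F a (a' - a) xi z)) subnKC //.
split => [w|be]; first by rewrite /W mulr_ge0 ?exprn_ge0 ?nm_ge0.
(* Same weights as for rescaling, with [l] for [k]; the power of [p] in [sh] then lowers the
   denominator from [p^(k n)] to [p^(l a')]. *)
pose ga (r : 'I_l) := be r * pz ^+ (a * (l - r.+1)).
pose sh j := pz ^+ (k * n - l * a') * \sum_r ga r * U r j.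
have shE x : \sum_j sh j * (P j).[x] =
    pz ^+ (k * n - l * a') * \sum_r ga r * \sum_j U r j * (P j).[x].
  rewrite /sh; under eq_bigr => j _ do rewrite -mulrA mulr_suml.
  rewrite -mulr_sumr exchange_big /=; congr (_ * _); apply: eq_bigr => r _.
  by rewrite mulr_sumr; apply: eq_bigr => j _; rewrite mulrA.
have knE : (k * n = (k * n - l * a') + l * a')%N by rewrite subnK.
have phE x : (\sum_j sh j * (P j).[x])%:~R / pr ^+ (k * n) =
    (\sum_r ga r * \sum_j U r j * (P j).[x])%:~R / pr ^+ (l * a').
  rewrite shE intrM intrXp {2}knE exprD invfM mulrACA divff ?mul1r //.
  by rewrite expf_neq0.
have [tau ti [u hu hF]] := eqv sh.
exists tau => //.
exists (fun w => u w * e ((\sum_r ga r * c r)%:~R / pr ^+ (l * a'))).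
  move=> w; have [u1 Ph] := hu w; rewrite nmM u1 nm_e mul1r; split => //.
  rewrite /W Ph; congr (_ ^+ m * _).
  have -> : fcl pos F b eta (tau w) =
      u w * e ((\sum_r ga r * d r)%:~R / pr ^+ (l * a')) * fcl pos F b eta w.
    rewrite /fcl mulr_sumr; apply: eq_bigr => i /dvdzP[y hy].
    rewrite hF; congr (_ * _ * _); rewrite phE.
    have posE : pos i = eta + pz ^+ b * y by rewrite [_ * y]mulrC -hy addrC subrK.
    (* On the class of [eta] the combinations are constant modulo [p^(b (k - l + 1)) = p^(l a')],
       exactly the denominator of the shift; so the whole sum over that class is multiplied by one
       unimodular number. *)
    have [z hz] : exists z, \sum_r ga r * \sum_j U r j * (P j).[pos i] =
        \sum_r ga r * d r + pz ^+ (l * a') * z.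
      have /dvdzP[z hz] : (pz ^+ (l * a') %| \sum_r ga r * \sum_j U r j * (P j).[pos i] -
          \sum_r ga r * d r)%Z.
        rewrite -sumrB; apply: rpred_sum => r _; rewrite -mulrBr dvdz_mull // lab posE.
        exact: hd.
      by exists z; rewrite [_ * z]mulrC -hz addrC subrK.
    rewrite hz intrD intrM intrXp mulrDl mulrAC divff ?mul1r ?eDint //.
    by rewrite expf_neq0.
  by rewrite !nmM u1 nm_e !mul1r.
move=> i w; rewrite /refun /repos; case: ifP => [/dvdzP[y hy]|]; last by rewrite mulr0.
rewrite hF -!mulrA; congr (_ * _); rewrite mulrA -eD; congr (e _ * _).
rewrite hy mulzK ?pz_neq0 // phE.
have posE : pos i = xi + pz ^+ a * y by rewrite [_ * y]mulrC -hy addrC subrK.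
have -> : \sum_r ga r * \sum_j U r j * (P j).[pos i] =
    \sum_r ga r * c r + pz ^+ (a * l) * \sum_r be r * (P' r).[y].
  rewrite mulr_sumr -big_split /=; apply: eq_bigr => r _; rewrite posE hU /ga.
  have -> : pz ^+ (a * l) = pz ^+ (a * (l - r.+1)) * pz ^+ (a * r.+1).
    by rewrite -exprD -mulnDr subnK.
  ring.
rewrite intrD mulrDl; congr (_ + _); rewrite intrM intrXp.
have -> : (l * a' = a * l + l * (a' - a))%N by rewrite [(a * l)%N]mulnC -mulnDr subnKC.
by rewrite exprD invfM mulrACA divff ?mul1r // expf_neq0.
Qed.

Section FixedLevel.
Variables k n : nat.
Hypothesis kp : (k < p)%N.

(** The two exponents add up to the critical one, [2 * kap k]; [l] tells how much of it sits on the
    class of [xi]. *)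
Definition bil (I Om : finType) (pos : I -> int) (F : I -> Om -> C) (Phi : Om -> R)
    (l a b : nat) (xi eta : int) : R :=
  mean (fcl pos F a xi) (2 * kap l)
    (fun w => nm (fcl pos F b eta w) ^+ (2 * (kap k - kap l)) * Phi w).

(* Bounds mixed means of two classes, of levels a and b, that are distinct modulo p. *)
Definition Bd l a b (B : R) :=
  forall (P : 'I_k -> {poly int}) (I Om : finType) (pos : I -> int)
    (F : I -> Om -> C) (Phi : Om -> R) La xi eta,
  dsys p n P pos F Phi La -> ~~ (pz %| xi - eta)%Z ->
  bil pos F Phi l a b xi eta <=
  B * (pr ^+ ((n - a) * kap l) * pr ^+ ((n - b) * (kap k - kap l))) * La.

Lemma Bd0 a b D : (b <= n)%N -> Dec k (n - b) D -> Bd 0 a b D.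
Proof.
move=> bn hD P I Om pos F Phi La xi eta ds _; rewrite /bil.
have -> : kap 0 = 0%N by []. rewrite !muln0 expr0 mul1r subn0.
apply: le_trans (Dec_rescale eta bn hD ds).
by apply: ler_sum => w _; rewrite expr0 mul1r.
Qed.

(** Decoupling of degree [l] refines the first class from level [a] to [a'] at the sole cost [D].
    The equation [l a' = b (k - l + 1)] marks the finest level at which the weight on the class of
    [eta] is still invariant; [0 < a] keeps the subclasses distinct from [eta] modulo [p]. *)
Lemma Bd_lower l a a' b D B : (0 < l <= k)%N -> (0 < a <= a')%N -> (a' <= n)%N ->
  (l * a' = b * (k - l).+1)%N -> Dec l (a' - a) D -> Bd l a' b B -> Bd l a b (D * B).
Proof.
move=> lk /andP[a0 aa] an lab hD hB P I Om pos F Phi La xi eta ds xe.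
have lan : (l * a' <= k * n)%N by rewrite leq_mul //; case/andP: lk.
apply: le_trans (@Dec_lower k l n a a' b _ D P I Om pos F Phi La
  (B * (pr ^+ ((n - a') * kap l) * pr ^+ ((n - b) * (kap k - kap l))) * La) xi eta
  lk kp _ lab lan hD ds xe _) _; rewrite ?a0 //.
  move=> z; apply: hB ds _; rewrite addrAC rpredDr // dvdz_mulr //.
  by rewrite -(prednK a0) exprS dvdz_mulr.
have -> : ((n - a) * kap l = (a' - a) * kap l + (n - a') * kap l)%N.
  by rewrite -mulnDl; congr (_ * _)%N; lia.
rewrite exprD le_eqVlt; apply/orP; left; apply/eqP; ring.
Qed.

Lemma Bd_start l a b D D' : (l <= k)%N -> (a <= n)%N -> (b <= n)%N ->
  Dec k (n - a) D -> Dec k (n - b) D' -> Bd l a b (D + D').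
Proof.
move=> lk an bn hD hD' P I Om pos F Phi La xi eta ds xe.
have ka := @Dec_rescale k n a D P I Om pos F Phi La xi an hD ds.
have kb := @Dec_rescale k n b D' P I Om pos F Phi La eta bn hD' ds.
have [_ [P0 _] _] := ds.
set x := pr ^+ (n - a); set y := pr ^+ (n - b).
have x0 : 0 < x by rewrite exprn_gt0. have y0 : 0 < y by rewrite exprn_gt0.
rewrite !exprM -/x -/y in ka kb *; clearbody x y.
set A := kap l; set B := (kap k - A)%N.
have AB : kap k = (A + B)%N by rewrite /B subnKC // kap_le.
rewrite /bil -/A -/B.
apply: (@le_trans _ _ (x ^+ A * y ^+ B *
   (mean (fcl pos F a xi) (2 * kap k) Phi / x ^+ kap k +
    mean (fcl pos F b eta) (2 * kap k) Phi / y ^+ kap k))).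
  rewrite /mean !mulr_suml -big_split mulr_sumr /=; apply: ler_sum => w _.
  set f := nm _; set g := nm (fcl pos F b eta w).
  (* Dividing by the expected sizes of the two classes puts both on the same scale before the
     product is bounded by a sum. *)
  have := @mul_pow_le_add R (f ^+ 2 / x) (g ^+ 2 / y) A B.
  rewrite !divr_ge0 ?exprn_ge0 ?nm_ge0 ?(ltW x0) ?(ltW y0) // => /(_ isT isT).
  rewrite -AB !expr_div_n -!exprM => H.
  rewrite mulrA.
  have -> : f ^+ (2 * A) * g ^+ (2 * B) * Phi w =
     x ^+ A * y ^+ B * (f ^+ (2 * A) / x ^+ A * (g ^+ (2 * B) / y ^+ B)) * Phi w.
    by congr (_ * _); field; rewrite !expf_neq0 ?gt_eqF.
  have -> : x ^+ A * y ^+ B * (f ^+ (2 * kap k) * Phi w / x ^+ kap k +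
      g ^+ (2 * kap k) * Phi w / y ^+ kap k) =
     x ^+ A * y ^+ B * (f ^+ (2 * kap k) / x ^+ kap k + g ^+ (2 * kap k) / y ^+ kap k) * Phi w.
    by ring.
  by rewrite ler_wpM2r // ler_wpM2l // mulr_ge0 ?exprn_ge0 ?(ltW x0) ?(ltW y0).
have -> : (D + D') * (x ^+ A * y ^+ B) * La = x ^+ A * y ^+ B * (D * La + D' * La) by ring.
rewrite ler_wpM2l ?mulr_ge0 ?exprn_ge0 ?(ltW x0) ?(ltW y0) //.
apply: lerD; rewrite ler_pdivrMr ?exprn_gt0 //; [move: ka|move: kb];
  by move/le_trans; apply; rewrite mulrAC.
Qed.

(** Part of the weight on [xi] is traded for a mean in which the two classes have exchanged roles;
    [kap_hoelder] matches the exponents. The exchange is what lets the next round refine the other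
    class. *)
Lemma Bd_hoelder l a b B1 B2 B : (0 < l < k)%N ->
  0 <= B -> B1 ^+ (k - l) * B2 <= B ^+ (k - l).+1 ->
  0 <= B1 -> 0 <= B2 ->
  Bd l.-1 a b B1 -> Bd (k - l) b a B2 -> Bd l a b B.
Proof.
move=> /andP[l0 lk] B0 BB B10 B20 h1 h2 P I Om pos F Phi La xi eta ds xe.
have La0 := dsys_La ds.
have {}h1 := h1 _ _ _ _ _ _ _ _ _ ds xe.
have ex : ~~ (pz %| eta - xi)%Z by rewrite -opprB rpredN.
have {}h2 := h2 _ _ _ _ _ _ _ _ _ ds ex.
have [_ [P0 _] _] := ds.
have E1 : ((k - l).+1 * kap l = (k - l) * kap l.-1 + (kap k - kap (k - l)))%N.
  have h := kap_le (leq_subr l k); have := kap_hoelder l.-1 (k - l).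
  by rewrite prednK // subnKC 1?ltnW // addnBA // => <-; rewrite addnK.
have E2 : ((k - l).+1 * (kap k - kap l) = (k - l) * (kap k - kap l.-1) + kap (k - l))%N.
  have h1' : (kap l <= kap k)%N by rewrite kap_le // ltnW.
  have h2' : (kap l.-1 <= kap k)%N by rewrite kap_le // (leq_trans (leq_pred _)) // ltnW.
  have h3' : (kap (k - l) <= kap k)%N by rewrite kap_le // leq_subr.
  exact: hoelder_compl.
set K := (k - l)%N in BB h2 E1 E2 *.
have H : bil pos F Phi l a b xi eta ^+ K.+1 <=
    bil pos F Phi l.-1 a b xi eta ^+ K * bil pos F Phi K b a eta xi.
  apply: hoelder_pow => w; rewrite ?mulr_ge0 ?exprn_ge0 ?nm_ge0 //.
  set f := nm _; set g := nm _; rewrite le_eqVlt; apply/orP; left; apply/eqP.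
  rewrite !exprMn -!exprM.
  rewrite -!mulnA ![(_ * K.+1)%N]mulnC ![(_ * K)%N]mulnC E1 E2 !mulnDr.
  by rewrite !exprD exprS; ring.
set N1 := pr ^+ _ * _ in h1; set N2 := pr ^+ _ * _ in h2; set N3 := pr ^+ _ * _.
have N10 : 0 <= N1 by rewrite mulr_ge0 ?exprn_ge0.
have N20 : 0 <= N2 by rewrite mulr_ge0 ?exprn_ge0.
have N30 : 0 <= N3 by rewrite mulr_ge0 ?exprn_ge0.
have NN : N3 ^+ K.+1 = N1 ^+ K * N2.
  rewrite /N1 /N2 /N3 !exprMn -!exprM [X in _ = _ * X]mulrC mulrACA -!exprD.
  congr (_ ^+ _); congr (_ + _)%N.
    by rewrite -!mulnA ![(_ * K.+1)%N]mulnC ![(_ * K)%N]mulnC E1 mulnDr.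
  by rewrite -!mulnA ![(_ * K.+1)%N]mulnC ![(_ * K)%N]mulnC E2 mulnDr.
clearbody N1 N2 N3.
have bil0 l' a' b' x y : 0 <= bil pos F Phi l' a' b' x y.
  by apply: mean_ge0 => w; rewrite mulr_ge0 ?exprn_ge0 ?nm_ge0.
suff : bil pos F Phi l a b xi eta ^+ K.+1 <= (B * N3 * La) ^+ K.+1.
  by rewrite ler_pXn2r // nnegrE ?bil0 // !mulr_ge0.
apply: le_trans H _; apply: (@le_trans _ _ ((B1 * N1 * La) ^+ K * (B2 * N2 * La))).
  apply: ler_pM => //; rewrite ?exprn_ge0 ?bil0 //.
  by rewrite lerXn2r // nnegrE ?bil0 // !mulr_ge0.
rewrite !exprMn NN.
have -> : B1 ^+ K * N1 ^+ K * La ^+ K * (B2 * N2 * La) =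
  (B1 ^+ K * B2) * (N1 ^+ K * N2) * La ^+ K.+1 by rewrite exprS; ring.
rewrite ler_wpM2r ?exprn_ge0 // ler_wpM2r // mulr_ge0 ?exprn_ge0 //.
Qed.

(** Either the largest term carries half of the total, or the others do, and then one of them
    reaches [S / (2 #|J|)], as does the largest. *)
Lemma bilinear_pointwise (J : finType) (x : J -> R) (S : R) m1 m2 :
  (0 < #|J|)%N -> (forall j, 0 <= x j) -> 0 <= S -> S <= \sum_j x j ->
  S ^+ (m1 + m2) <= 2 ^+ (m1 + m2) * \sum_j x j ^+ (m1 + m2) +
    (2 * #|J|%:R) ^+ (m1 + m2) * \sum_j \sum_(j' | j' != j) x j ^+ m1 * x j' ^+ m2.
Proof.
move=> J0 x0 S0 Sx; have /card_gt0P[j0 _] := J0.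
pose M := [arg max_(i > j0) x i]%O.
have Mx j : x j <= x M by rewrite /M; case: arg_maxP => // i _ /(_ j); apply.
have Jr : 0 < #|J|%:R :> R by rewrite ltr0n.
have t2 : 0 <= (2 * #|J|%:R) ^+ (m1 + m2) *
    \sum_j \sum_(j' | j' != j) x j ^+ m1 * x j' ^+ m2.
  rewrite mulr_ge0 ?exprn_ge0 ?mulr_ge0 // sumr_ge0 // => j _; rewrite sumr_ge0 // => j' _.
  by rewrite mulr_ge0 ?exprn_ge0.
have [SM|SM] := leP S (2 * x M).
  apply: ler_wpDr => //; apply: (@le_trans _ _ ((2 * x M) ^+ (m1 + m2))).
    by rewrite lerXn2r ?nnegrE ?mulr_ge0.
  rewrite exprMn ler_wpM2l ?exprn_ge0 // (bigD1 M) //= lerDl sumr_ge0 // => j _.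
  exact: exprn_ge0.
have [j' jM Sj] : exists2 j', j' != M & S <= 2 * #|J|%:R * x j'.
  apply: contrapT => H.
  have lt j : j != M -> x j <= S / (2 * #|J|%:R).
    move=> jM; rewrite ler_pdivlMr ?mulr_gt0 // mulrC leNgt; apply/negP => h.
    by apply: H; exists j => //; exact: ltW.
  have : \sum_j x j <= x M + S / 2.
    rewrite (bigD1 M) //= lerD2l; apply: le_trans (ler_sum _ lt) _.
    apply: (@le_trans _ _ (\sum_(j : J) S / (2 * #|J|%:R))).
      rewrite [leRHS](bigD1 M) //= lerDr divr_ge0 // mulr_ge0 //.
    rewrite sumr_const -[_ *+ _]mulr_natr invfM mulrA -mulrA mulVf ?mulr1 //.
    by rewrite gt_eqF.
  by move=> h; have := le_trans Sx h; move: SM; lra.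
apply: ler_wpDl.
  by rewrite mulr_ge0 ?exprn_ge0 // sumr_ge0 // => j _; exact: exprn_ge0.
apply: (@le_trans _ _ ((2 * #|J|%:R) ^+ (m1 + m2) * (x M ^+ m1 * x j' ^+ m2))).
  apply: (@le_trans _ _ ((2 * #|J|%:R * x j') ^+ (m1 + m2))).
    by rewrite lerXn2r ?nnegrE ?mulr_ge0.
  rewrite exprMn ler_wpM2l ?exprn_ge0 ?mulr_ge0 // exprD ler_wpM2r ?exprn_ge0 //.
  by rewrite lerXn2r ?nnegrE.
rewrite ler_wpM2l ?exprn_ge0 ?mulr_ge0 // (bigD1 M) //= (bigD1 j') //= -addrA lerDl.
rewrite addr_ge0 ?sumr_ge0 // => [j _|j _]; first by rewrite mulr_ge0 ?exprn_ge0.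
by rewrite sumr_ge0 // => ? _; rewrite mulr_ge0 ?exprn_ge0.
Qed.

Lemma mean_swap (Om : finType) (f g : Om -> C) m1 m2 (Phi : Om -> R) :
  mean f m1 (fun w => nm (g w) ^+ m2 * Phi w) =
  mean g m2 (fun w => nm (f w) ^+ m1 * Phi w).
Proof. by apply: eq_bigr => w _; rewrite mulrCA. Qed.

(** When one class modulo [p] dominates, zooming into it gives the bound at [n - 1]; otherwise two
    distinct classes are large, and crude splitting down to levels [a] and [b] brings in the mixed
    bound. *)
Lemma Bd_linear l a b D B : (l <= k)%N -> (0 < a <= n)%N -> (0 < b <= n)%N ->
  0 <= B -> Dec k n.-1 D -> Bd l a b B ->
  Dec k n (4 ^+ kap k * pr * D / pr ^+ kap k +
    (2 * pr) ^+ (2 * kap k) * pr ^+ 2 * pr ^+ ((a + b) * (2 * kap k).+1) * B).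
Proof.
move=> lk /andP[a0 an] /andP[b0 bn] B0 hD hB P I Om pos F Phi La ds.
have La0 := dsys_La ds; have [_ [P0 _] _] := ds.
have n0 : (0 < n)%N by exact: leq_trans an.
have kkl := kap_le lk.
set A := (2 * kap l)%N; set E := (2 * (kap k - kap l))%N.
have AE : (2 * kap k = A + E)%N by rewrite /A /E -mulnDr subnKC.
pose f1 t w := fcl pos F 1 t%:Z w.
have pJ : (0 < #|'I_p|)%N by rewrite card_ord.
have fs w : \sum_i F i w = \sum_(t < p) f1 t w.
  rewrite -(fcl0 p pos F 0) (fcl_split p_pr pos F 0 w (leq0n 1)) subn0 expn1.
  by apply: eq_bigr => t _; rewrite expr0 mul1r add0r.
have H1 (t : 'I_p) : mean (f1 t) (2 * kap k) Phi <= D * pr ^+ (n.-1 * kap k) * La.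
  by have := @Dec_rescale k n 1 D P I Om pos F Phi La t%:Z n0; rewrite subn1; apply.
set NB := B * (pr ^+ ((n - a) * kap l) * pr ^+ ((n - b) * (kap k - kap l))) * La.
have NB0 : 0 <= NB by rewrite !mulr_ge0 ?exprn_ge0.
have H2 (t t' : 'I_p) : t' != t ->
    mean (f1 t) A (fun w => nm (f1 t' w) ^+ E * Phi w) <=
    pr ^+ ((a + b) * (2 * kap k).+1) * NB.
  move=> tt.
  have cop z z' : ~~ (pz %| (t%:Z + pz ^+ 1 * z) - (t'%:Z + pz ^+ 1 * z'))%Z.
    have -> : t%:Z + pz ^+ 1 * z - (t'%:Z + pz ^+ 1 * z') = (t%:Z - t'%:Z) + pz * (z - z').
      by rewrite expr1; ring.
    rewrite rpredDr ?dvdz_mulr // -eqz_mod_dvd !modz_small ?ltz_nat ?ltn_ord //.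
    by rewrite eqz_nat eq_sym (inj_eq val_inj).
  apply: (@le_trans _ _ ((pr ^+ (a - 1)) ^+ A.+1 * ((pr ^+ (b - 1)) ^+ E.+1 * NB))).
    apply: mean_split => // [w|z]; first by rewrite mulr_ge0 ?exprn_ge0 ?nm_ge0.
    rewrite mean_swap; apply: mean_split => // [w|z'].
      by rewrite mulr_ge0 ?exprn_ge0 ?nm_ge0.
    rewrite mean_swap; exact: hB ds (cop z z').
  rewrite mulrA ler_wpM2r // -!exprM -exprD ler_weXn2l // mulnDl AE.
  by apply: leq_add; apply: leq_mul; rewrite ?leq_subr // ltnS ?leq_addr ?leq_addl.
apply: (@le_trans _ _ (2 ^+ (2 * kap k) * \sum_(t < p) mean (f1 t) (2 * kap k) Phi +
   (2 * pr) ^+ (2 * kap k) * \sum_(t < p) \sum_(t' < p | t' != t)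
      mean (f1 t) A (fun w => nm (f1 t' w) ^+ E * Phi w))).
  rewrite /mean exchange_big /=.
  under [X in _ <= _ + _ * X]eq_bigr => t _ do rewrite exchange_big /=.
  rewrite [X in _ <= _ + _ * X]exchange_big /= !mulr_sumr -big_split /=.
  apply: ler_sum => w _; rewrite fs.
  have := @bilinear_pointwise _ (fun t : 'I_p => nm (f1 t w)) (nm (\sum_(t < p) f1 t w)) A E pJ.
  move=> /(_ (fun t => nm_ge0 _) (nm_ge0 _) (nm_sum _ _ _)).
  rewrite -AE card_ord => h; apply: le_trans (ler_wpM2r (P0 w) h) _.
  rewrite mulrDl -!mulrA !mulr_suml le_eqVlt; apply/orP; left; apply/eqP.
  congr (_ + _ * _); apply: eq_bigr => t _; rewrite mulr_suml.
  by apply: eq_bigr => t' _; rewrite mulrA.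
rewrite -[leRHS]mulrA [leRHS]mulrDl; apply: lerD.
  apply: (@le_trans _ _ (2 ^+ (2 * kap k) * (pr * (D * pr ^+ (n.-1 * kap k) * La)))).
    rewrite ler_wpM2l ?exprn_ge0 // -[X in X%:R * _](card_ord p) mulr_natl -sumr_const.
    by apply: ler_sum => t _.
  rewrite exprM (_ : 2 ^+ 2 = 4); last by rewrite expr2 -natrM.
  have -> : (n * kap k = kap k + n.-1 * kap k)%N by rewrite -mulSn prednK.
  rewrite exprD le_eqVlt; apply/orP; left; apply/eqP; field.
  by rewrite expf_neq0.
rewrite -!mulrA ler_wpM2l ?exprn_ge0 ?mulr_ge0 //.
apply: (@le_trans _ _ (pr ^+ 2 * (pr ^+ ((a + b) * (2 * kap k).+1) * NB))).
  have cc : pr ^+ 2 = \sum_(t < p) \sum_(t' < p) 1.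
    by rewrite !sumr_const card_ord expr2 mulr_natr.
  rewrite cc mulr_suml; apply: ler_sum => t _; rewrite mulr_suml.
  rewrite [leRHS](bigID (fun t' => t' != t)) /=; apply: ler_wpDr.
    by rewrite sumr_ge0 // => ? _; rewrite mul1r mulr_ge0 ?exprn_ge0.
  by apply: ler_sum => t' tt; rewrite mul1r H2.
rewrite expr2 -mulrA; do 2![rewrite ler_wpM2l //].
rewrite ler_wpM2l ?exprn_ge0 // /NB -mulrA ler_wpM2l //.
have -> : (n * kap k = n * kap l + n * (kap k - kap l))%N by rewrite -mulnDr subnKC.
rewrite ler_wpM2r // -exprD ler_weXn2l //.
by apply: leq_add; rewrite leq_mul2r leq_subr orbT.
Qed.

End FixedLevel.
End Bilinear.

(** * Driving the exponent to zero *)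

Section Iteration.
Variables (R : realType) (p : nat).
Hypothesis p_pr : prime p.
Local Notation pr := (p%:R : R).
Local Notation Dec := (@Dec R p).
Local Notation Bd := (@Bd R p).

Let p0 : (0 < p)%N. Proof. exact: prime_gt0. Qed.
Let prp : 0 < pr. Proof. by rewrite ltr0n. Qed.
Let pr1 : 1 <= pr. Proof. by rewrite ler1n. Qed.

Definition pw (x : R) : R := pr `^ x.

Lemma pw_ge0 x : 0 <= pw x. Proof. exact: powR_ge0. Qed.
Lemma pwD x y : pw (x + y) = pw x * pw y.
Proof. by rewrite /pw powRD //; apply/implyP => _; rewrite gt_eqF. Qed.
Lemma pw0 : pw 0 = 1. Proof. exact: powRr0. Qed.
Lemma pwX x n : pw x ^+ n = pw (x * n%:R).
Proof. by rewrite /pw powRrM powR_mulrn // powR_ge0. Qed.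
Lemma pw_nat n : pw n%:R = pr ^+ n.
Proof. by rewrite /pw powR_mulrn // ltW. Qed.
Lemma pw_le x y : x <= y -> pw x <= pw y.
Proof. by move=> xy; exact: ler_powR. Qed.
Lemma pw_ge1 x : 0 <= x -> 1 <= pw x.
Proof. by move=> h; rewrite -pw0 pw_le. Qed.

Definition expo k (eta : R) := exists2 C, 0 <= C & forall n, Dec k n (C * pw (eta * n%:R)).

Lemma expo_le k x y : x <= y -> expo k x -> expo k y.
Proof.
move=> xy [C C0 h]; exists C => // n; apply: Dec_mono (h n) => //.
by rewrite ler_wpM2l // pw_le // ler_wpM2r.
Qed.

Section Step.
Variables (k : nat) (eta : R).
Hypotheses (k2 : (1 < k)%N) (kp : (k < p)%N) (eta0 : 0 <= eta).
Hypothesis lower : forall l, (0 < l < k)%N -> forall eps, 0 < eps -> expo l eps.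
Hypothesis here : expo k eta.

(** [cseq m l] is the exponent gained per level [b] after [m] rounds. The recursion is that of
    [Bd_hoelder]: its second term is the gain at level [lev l b = b (k - l + 1) / l], taken with
    Hölder weight [1 / (k - l + 1)]. The value at [l = 0] is the saving [eta b] of rescaling by [b]
    levels. *)
Fixpoint cseq (m l : nat) : R :=
  if l == 0%N then eta else
  if m is m'.+1 then
    (k - l)%:R / (k - l).+1%:R * cseq m' l.-1 + cseq m' (k - l) / l%:R
  else 0.

Lemma cseq0 m : cseq m 0 = eta. Proof. by case: m. Qed.

(** Each round preserves the total, since [cseq m l] receives the coefficients
    [(k - l - 1) / (k - l)] and [1 / (k - l)], and it injects [(k - 1) / k] times [eta] from
    [l = 0]. So a positive [eta] makes some [cseq m l] as large as desired. *)
Lemma cseq_sum m : \sum_(1 <= l < k) cseq m l = m%:R * ((k.-1)%:R / k%:R * eta).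
Proof.
have kE : k = k.-1.+1 by rewrite prednK // ltnW.
elim: m => [|m IH].
  rewrite mul0r big_nat big1 // => -[|l] //.
have -> : \sum_(1 <= l < k) cseq m.+1 l =
    \sum_(1 <= l < k) (k - l)%:R / (k - l).+1%:R * cseq m l.-1 +
    \sum_(1 <= l < k) cseq m (k - l) / l%:R.
  by rewrite -big_split; apply: eq_big_nat => -[|l].
have -> : \sum_(1 <= l < k) cseq m (k - l) / l%:R = \sum_(1 <= l < k) cseq m l / (k - l)%:R.
  rewrite big_nat_rev; apply: eq_big_nat => l /andP[l0 lk].
  by rewrite add1n subSS subKn // ltnW.
have -> : \sum_(1 <= l < k) (k - l)%:R / (k - l).+1%:R * cseq m l.-1 =
   (k.-1)%:R / k%:R * eta + \sum_(1 <= l < k) (k - l.+1)%:R / (k - l)%:R * cseq m l.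
  rewrite big_add1 /=.
  (* The added term, [i = k - 1], has factor 0. *)
  have -> : \sum_(0 <= i < k.-1) (k - i.+1)%:R / (k - i.+1).+1%:R * cseq m i =
    \sum_(0 <= i < k) (k - i.+1)%:R / (k - i)%:R * cseq m i.
    rewrite [in RHS]kE big_nat_recr //= -kE subnn !mul0r addr0.
    apply: eq_big_nat => l /= lk.
    by rewrite subnSK //; move: lk; rewrite kE /= => /leq_trans; apply.
  rewrite [LHS]big_ltn ?(ltnW k2) //.
  by rewrite cseq0 subn0 subn1.
rewrite -addrA -big_split /= -natr1 mulrDl mul1r [RHS]addrC; congr (_ + _).
rewrite -IH; apply: eq_big_nat => l /andP[l0 lk].
have kl0 : (k - l)%:R != 0 :> R by rewrite pnatr_eq0 -lt0n subn_gt0.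
have kE2 : (k - l)%:R = (k - l.+1)%:R + 1 :> R by rewrite natr1 subnSK.
rewrite kE2 in kl0 *; move: kl0; set x := (k - l.+1)%:R => kl0.
by field.
Qed.

(** The balanced level of [Bd_lower]. The division is exact when [l] divides [b], whence the powers
    of [k!] that are required to divide [b] below. *)
Definition lev (l b : nat) : nat := (b * (k - l).+1) %/ l.

Lemma levE l b : (0 < l)%N -> (l %| b)%N -> (l * lev l b = b * (k - l).+1)%N.
Proof. by move=> l0 lb; rewrite mulnC /lev divnK // dvdn_mulr. Qed.

Lemma lev_le l b : (0 < l <= k)%N -> (l %| b)%N -> (lev l b <= k * b)%N.
Proof.
move=> /andP[l0 lk] lb; rewrite -(leq_pmul2l l0) levE // [leqRHS]mulnA [leqRHS]mulnC.
rewrite leq_mul2l; apply/orP; right; apply: (@leq_trans k); last by rewrite leq_pmull.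
by rewrite ltn_subrL l0 (leq_trans l0 lk).
Qed.

Lemma step_start : exists2 C, 0 <= C & forall n b l,
  (0 < l < k)%N -> (k`! %| b)%N -> (k * b <= n)%N ->
  Bd k n l (lev l b) b (C * pw (eta * n%:R)).
Proof.
have [C C0 h] := here; exists (2 * C); rewrite ?mulr_ge0 // => n b l /andP[l0 lk] kb bn.
have lb : (l %| b)%N by rewrite (dvdn_trans _ kb) // dvdn_fact // l0 ltnW.
have an : (lev l b <= n)%N by rewrite (leq_trans (lev_le _ lb)) // l0 ltnW.
have bn' : (b <= n)%N by rewrite (leq_trans _ bn) // leq_pmull // ltnW.
have -> : 2 * C * pw (eta * n%:R) = C * pw (eta * n%:R) + C * pw (eta * n%:R) by ring.
have mono m : Dec k (n - m) (C * pw (eta * n%:R)).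
  apply: Dec_mono (h (n - m)%N) => //; rewrite ler_wpM2l // pw_le // ler_wpM2l //.
  by rewrite ler_nat leq_subr.
by apply: Bd_start => //; exact: ltnW.
Qed.

Lemma lower_unif eps : 0 < eps -> exists2 C, 0 <= C &
  forall l, (0 < l < k)%N -> forall n, Dec l n (C * pw (eps * n%:R)).
Proof.
move=> e0.
have H : forall j, (j <= k)%N -> exists2 C, 0 <= C &
    forall l, (0 < l < j)%N -> forall n, Dec l n (C * pw (eps * n%:R)).
  elim=> [|j IH] jk; first by exists 0 => // l; rewrite ltn0 andbF.
  have [C C0 h] := IH (ltnW jk).
  have [j0|j0] := posnP j.
    by exists C => // l; rewrite j0 ltnS leqn0; case: l.
  have [C' C'0 h'] := @lower j (introT andP (conj j0 jk)) eps e0.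
  exists (C + C'); first exact: addr_ge0.
  move=> l /andP[l0]; rewrite ltnS leq_eqVlt => /orP[/eqP->|lj] n.
    by apply: Dec_mono (h' n) => //; rewrite ler_wpM2r ?pw_ge0 // lerDr.
  by apply: Dec_mono (h l _ n); rewrite ?l0 // ler_wpM2r ?pw_ge0 // lerDl.
exact: H (leqnn k).
Qed.

Lemma Bd_mono n l a b B B' : B <= B' -> Bd k n l a b B -> Bd k n l a b B'.
Proof.
move=> BB h P I Om pos F Phi La xi et ds xe; apply: le_trans (h _ _ _ _ _ _ _ _ _ ds xe) _.
rewrite ler_wpM2r ?(dsys_La ds) // ler_wpM2r // mulr_ge0 // exprn_ge0 // ltW //.
Qed.

Lemma step_iter m de : 0 < de -> exists2 C, 0 <= C & forall n b l,
  (0 < l < k)%N -> (k`! ^ m.+1 %| b)%N -> (0 < b)%N -> (k ^ m.+1 * b <= n)%N ->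
  Bd k n l (lev l b) b (C * pw (eta * n%:R - cseq m l * b%:R + de * n%:R)).
Proof.
elim: m de => [|m IH] de de0.
  have [C C0 h] := step_start; exists C => // n b l lk kb b0 bn.
  rewrite !expn1 in kb bn; apply: Bd_mono (h _ _ _ lk kb bn).
  rewrite ler_wpM2l // pw_le //; case/andP: lk => l0 _.
  by rewrite /= gtn_eqF // mul0r subr0 lerDl mulr_ge0 // ltW.
have de2 : 0 < de / 2 by rewrite divr_gt0.
have [C1 C10 hS] := IH _ de2; have [C2 C20 hL] := lower_unif de2.
have [C3 C30 hD] := here.
pose C := C1 * C2 + C3; have C0 : 0 <= C by rewrite addr_ge0 ?mulr_ge0.
exists C => // n b l /andP[l0 lk] kb b0 bn.
set a := lev l b.
have kf : (0 < k`!)%N by exact: fact_gt0.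
have lkf j : (0 < j <= k)%N -> (j %| k`!)%N by move=> jk; exact: dvdn_fact.
have kfb : (k`! %| b)%N by apply: dvdn_trans kb; rewrite expnS dvdn_mulr.
have lb : (l %| b)%N by rewrite (dvdn_trans _ kfb) // lkf // l0 ltnW.
have laE : (l * a = b * (k - l).+1)%N by exact: levE.
have a0 : (0 < a)%N by rewrite -(ltn_pmul2l l0) muln0 laE muln_gt0 b0.
have ab : (a <= k * b)%N by apply: lev_le => //; rewrite l0 ltnW.
have kn : (k ^ m.+1 * (k * b) <= n)%N by rewrite mulnA -expnSr.
have kbn : (k * b <= n)%N.
  by apply: leq_trans kn; rewrite leq_pmull // expn_gt0 (ltnW k2).
have bn' : (b <= n)%N by rewrite (leq_trans _ kbn) // leq_pmull // ltnW.
have an : (k ^ m.+1 * a <= n)%N by apply: leq_trans kn; rewrite leq_mul2l ab orbT.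
have kan : (k * a <= n)%N.
  by apply: leq_trans an; rewrite expnS mulnAC leq_pmulr // expn_gt0 (ltnW k2).
have ka : (k`! ^ m.+1 %| a)%N.
  have /dvdnP[b' bE] := kb; have /dvdnP[g gE] : (l %| k`!)%N by rewrite lkf // l0 ltnW.
  apply/dvdnP; exists (b' * g * (k - l).+1)%N; apply/eqP.
  by rewrite -(eqn_pmul2l l0) laE bE expnS {1}gE; apply/eqP; ring.
(* The induction hypothesis concerns the balanced level [lev j b1]; decoupling of degree [j] carries
   it back to any coarser level [a1], at the cost of the second half of [de]. *)
have gen j b1 a1 : (0 < j < k)%N -> (k`! ^ m.+1 %| b1)%N -> (0 < b1)%N ->
    (k ^ m.+1 * b1 <= n)%N -> (k * b1 <= n)%N -> (0 < a1)%N ->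
    (j * a1 <= b1 * (k - j).+1)%N ->
    Bd k n j a1 b1 (C * pw (eta * n%:R - cseq m j * b1%:R + de * n%:R)).
  move=> /andP[j0 jk] kb1 b10 bn1 kbn1 a10 ja.
  have jb1 : (j %| b1)%N.
    rewrite (dvdn_trans _ kb1) // (dvdn_trans (lkf j _)) ?j0 1?ltnW //.
    by rewrite expnS dvdn_mulr.
  have jE := levE j0 jb1.
  have aa : (a1 <= lev j b1)%N by rewrite -(leq_pmul2l j0) jE.
  have ln : (lev j b1 <= n)%N by rewrite (leq_trans (lev_le _ jb1)) // j0 ltnW.
  have jk' : (0 < j < k)%N by rewrite j0.
  have jk2 : (0 < j <= k)%N by rewrite j0 ltnW.
  have aa2 : (0 < a1 <= lev j b1)%N by rewrite a10.
  have := Bd_lower p_pr kp jk2 aa2 ln jE (hL j jk' _) (hS n b1 j jk' kb1 b10 bn1).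
  apply: Bd_mono.
  have -> : eta * n%:R - cseq m j * b1%:R + de * n%:R =
    de / 2 * n%:R + (eta * n%:R - cseq m j * b1%:R + de / 2 * n%:R) by lra.
  rewrite [pw (de / 2 * n%:R + _)]pwD [leRHS]mulrA mulrA ler_wpM2r ?pw_ge0 //.
  rewrite mulrAC [C2 * C1]mulrC.
  apply: ler_pM; rewrite ?mulr_ge0 ?pw_ge0 //; first by rewrite lerDl.
  rewrite pw_le // ler_wpM2l ?(ltW de2) // ler_nat.
  exact: leq_trans (leq_subr _ _) ln.
(* Roles exchanged: the reference level is [a], and [b] is coarse enough because
   [(k - l) b <= a (l + 1)]. *)
have B2 : Bd k n (k - l) b a (C * pw (eta * n%:R - cseq m (k - l) * a%:R + de * n%:R)).
  have kl : (0 < k - l < k)%N by rewrite subn_gt0 lk ltn_subrL l0 (ltn_trans l0).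
  have gB : ((k - l) * b <= a * (k - (k - l)).+1)%N.
    rewrite subKn ?(ltnW lk) // -(leq_pmul2l l0) [leqRHS]mulnA laE.
    by rewrite mulnC -mulnA mulnCA -mulnA leq_mul2l leq_mul ?orbT.
  exact: gen kl ka a0 an kan b0 gB.
have B1 : Bd k n l.-1 a b (C * pw (eta * n%:R - cseq m l.-1 * b%:R + de * n%:R)).
  (* For [l = 1] the lower index is 0, where the saving comes from the exponent [eta] at [n - b]. *)
  have [l1|l1] := leqP l 1.
    have -> : l.-1 = 0%N by case: (l) l1 => [|[]].
    apply: Bd_mono (Bd0 p_pr a bn' (hD (n - b)%N)).
    apply: ler_pM; rewrite ?pw_ge0 //; first by rewrite lerDr mulr_ge0.
    rewrite cseq0 pw_le // natrB // mulrBr lerDl mulr_ge0 // ltW //.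
  have lp : (0 < l.-1 < k)%N.
    by apply/andP; split; [rewrite -ltnS prednK|exact: leq_ltn_trans (leq_pred l) lk].
  have kb' : (k`! ^ m.+1 %| b)%N by apply: dvdn_trans kb; rewrite dvdn_exp2l.
  have bn2 : (k ^ m.+1 * b <= n)%N.
    by apply: leq_trans kn; rewrite leq_mul2l leq_pmull ?orbT // ltnW.
  have gA : (l.-1 * a <= b * (k - l.-1).+1)%N.
    apply: (@leq_trans (l * a)); first by rewrite leq_mul2r leq_pred orbT.
    by rewrite laE leq_mul2l ltnS leq_sub2l ?orbT // leq_pred.
  exact: gen lp kb' b0 bn2 kbn a0 gA.
have lk' : (0 < l < k)%N by rewrite l0.
apply: (Bd_hoelder lk' _ _ _ _ B1 B2); rewrite ?mulr_ge0 ?pw_ge0 //.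
rewrite !exprMn !pwX mulrACA -exprSr -pwD ler_wpM2l ?exprn_ge0 // pw_le //.
have aE : a%:R = b%:R * (k - l).+1%:R / l%:R :> R.
  by apply: (canRL (mulfK _)); rewrite ?pnatr_eq0 -?lt0n // -!natrM mulnC laE.
rewrite [in leRHS]/= gtn_eqF // aE -natr1 le_eqVlt; apply/orP; left; apply/eqP.
set x := (k - l)%:R; field.
by rewrite pnatr_eq0 -lt0n l0 natr1 pnatr_eq0.
Qed.

End Step.

(** The decrement [ta] is uniform in [eta >= eps0], so that iterating terminates. By [cseq_sum] some
    [cseq m l] outgrows the price of [Bd_linear], and an induction on [n] then runs with the smaller
    exponent. *)
Lemma expo_improve k eps0 : (1 < k)%N -> (k < p)%N ->
  2 * (4 ^+ kap k * pr) <= pr ^+ kap k ->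
  (forall l, (0 < l < k)%N -> forall eps, 0 < eps -> expo l eps) -> 0 < eps0 ->
  exists2 ta, 0 < ta & forall eta, eps0 <= eta -> expo k eta ->
    expo k (Num.max (eta - ta) 0).
Proof.
move=> k2 kp hp lower e0.
(* As [lev l b <= k b], splitting down to levels [lev l b] and [b] costs at most [p^((T - 1) b)]; a
   gain of [p^(T b)] leaves [p^b] over. *)
pose T := (k.+1 * (2 * kap k).+1).+1.
have [m hm] : exists m : nat, k%:R * T%:R / eps0 <= m%:R.
  by exists (Num.bound (k%:R * T%:R / eps0)); exact/ltW/archi_boundP/divr_ge0/ltW.
have kr0 : 0 < (k ^ m.+1)%:R :> R by rewrite ltr0n expn_gt0 (ltnW k2).
(* [b] is about [n / k^(m+1)], that is [2 ta n]; half of it pays for the loss [ta n] of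
   [step_iter]. *)
pose ta := 2^-1 / (k ^ m.+1)%:R : R.
have ta0 : 0 < ta by rewrite divr_gt0.
exists ta => // eta e0e here.
have eta0 : 0 <= eta by rewrite (le_trans _ e0e) // ltW.
have [l lk Tl] : exists2 l, (0 < l < k)%N & T%:R <= cseq k eta m l.
  apply: contrapT => H.
  have lt l : (1 <= l < k)%N -> cseq k eta m l < T%:R.
    by move=> lk; rewrite ltNge; apply/negP => h; apply: H; exists l.
  have : \sum_(1 <= l < k) cseq k eta m l < \sum_(1 <= l < k) T%:R.
    by apply: ltr_sum_nat.
  rewrite cseq_sum // sumr_const_nat subn1; apply/negP; rewrite -leNgt -[leLHS]mulr_natr.
  have k1 : 0 < (k.-1)%:R :> R by rewrite ltr0n -subn1 subn_gt0.
  have k0 : 0 < k%:R :> R by rewrite ltr0n ltnW.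
  have -> : m%:R * ((k.-1)%:R / k%:R * eta) = (m%:R * eta / k%:R) * (k.-1)%:R by ring.
  rewrite ler_pM2r // ler_pdivlMr // mulrC.
  apply: (@le_trans _ _ (m%:R * eps0)); first by rewrite -ler_pdivrMr.
  by rewrite ler_wpM2l.
have [C C0 hC] := step_iter k2 kp eta0 lower here m ta0.
pose f := (k`! ^ m.+1)%N; pose Q := (k ^ m.+1 * f)%N.
have f0 : (0 < f)%N by rewrite expn_gt0 fact_gt0.
have Q0 : (0 < Q)%N by rewrite muln_gt0 f0 expn_gt0 (ltnW k2).
pose C4 := (2 * pr) ^+ (2 * kap k) * pr ^+ 2 * C * pw f%:R.
have C40 : 0 <= C4 by rewrite !mulr_ge0 ?exprn_ge0 ?pw_ge0 ?mulr_ge0 // ltW.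
pose C5 := 2 * C4 + pr ^+ (Q * (kap k).+1).
have C50 : 0 <= C5 by apply: addr_ge0; [exact: mulr_ge0|exact/exprn_ge0/ltW].
set et := Num.max (eta - ta) 0.
have et0 : 0 <= et by rewrite le_max lexx orbT.
exists C5 => //; elim=> [|n IH].
  apply: Dec_mono (@Dec_trivial R p p_pr k 0) => //.
  rewrite mul0n expr0 mulr0 pw0 mulr1 /C5; apply: ler_wpDl; first by rewrite mulr_ge0.
  exact: exprn_ege1.
have [nQ|Qn] := ltnP n.+1 Q.
  apply: Dec_mono (@Dec_trivial R p p_pr k n.+1) => //.
  apply: (@le_trans _ _ (C5 * 1)); last by rewrite ler_wpM2l // pw_ge1 // mulr_ge0.
  rewrite mulr1 /C5; apply: ler_wpDl; first by rewrite mulr_ge0.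
  by rewrite ler_weXn2l // leq_mul2r ltnW ?orbT.
pose b := (f * (n.+1 %/ Q))%N.
have b0 : (0 < b)%N by rewrite muln_gt0 f0 divn_gt0.
have bn : (k ^ m.+1 * b <= n.+1)%N by rewrite /b mulnA mulnC leq_trunc_div.
have fb : (f %| b)%N by rewrite dvdn_mulr.
have {}hC := hC n.+1 b l lk fb b0 bn.
have [l0 lk1] := andP lk.
have lb : (l %| b)%N.
  apply: dvdn_trans fb; rewrite /f expnS dvdn_mulr // dvdn_fact //.
  by rewrite l0 ltnW.
have lk2 : (0 < l <= k)%N by rewrite l0 ltnW.
have ab := lev_le lk2 lb.
have kb : (k * b <= n.+1)%N.
  by apply: leq_trans bn; rewrite leq_mul2r -{1}(expn1 k) leq_pexp2l ?orbT // ltnW.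
have a0 : (0 < lev k l b)%N by rewrite -(ltn_pmul2l l0) muln0 levE // muln_gt0 b0.
have an : (0 < lev k l b <= n.+1)%N by rewrite a0 (leq_trans ab).
have bn2 : (0 < b <= n.+1)%N by rewrite b0 (leq_trans _ kb) // leq_pmull // ltnW.
set B := C * _ in hC; have B0 : 0 <= B by rewrite mulr_ge0 ?pw_ge0.
apply: Dec_mono (Bd_linear p_pr (ltnW lk1) an bn2 B0 (IH : Dec k n.+1.-1 _) hC) => //.
set X := pw (et * n.+1%:R).
have X0 : 0 <= X by exact: pw_ge0.
have -> : C5 * X = (C5 * X) / 2 + (C5 * X) / 2 by lra.
(* Half of the constant goes to the term of the dominant class, by the lower bound on [p], and half
   to the separated term. *)
apply: lerD.
  have px0 : 0 < pr ^+ kap k by rewrite exprn_gt0.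
  rewrite ler_pdivrMr // [leRHS]mulrAC -[leRHS]mulrA mulrC.
  apply: ler_pM; rewrite ?mulr_ge0 ?pw_ge0 ?exprn_ge0 ?(ltW prp) //.
    by rewrite ler_wpM2l // pw_le // ler_wpM2l // ler_nat.
  by rewrite ler_pdivlMr // mulrC.
apply: (@le_trans _ _ (C4 * X)); last first.
  rewrite /C5 mulrDl mulrDl; apply: ler_wpDr; last by lra.
  by rewrite !mulr_ge0 ?exprn_ge0 // ltW.
rewrite /C4 /B.
have -> : (2 * pr) ^+ (2 * kap k) * pr ^+ 2 * C * pw f%:R * X =
   (2 * pr) ^+ (2 * kap k) * pr ^+ 2 * C * (pw f%:R * X) by rewrite mulrA.
set G := (2 * pr) ^+ (2 * kap k) * pr ^+ 2; set y := pw _.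
have -> : G * pr ^+ ((lev k l b + b) * (2 * kap k).+1) * (C * y) =
   G * C * (pr ^+ ((lev k l b + b) * (2 * kap k).+1) * y) by ring.
apply: ler_wpM2l; first by rewrite !mulr_ge0 ?exprn_ge0 ?mulr_ge0 // ltW.
rewrite -pw_nat /y /X -!pwD pw_le //.
have h1 : ((lev k l b + b) * (2 * kap k).+1)%:R <= (T%:R - 1) * b%:R :> R.
  have -> : T%:R - 1 = (k.+1 * (2 * kap k).+1)%:R :> R by rewrite /T -natr1 addrK.
  rewrite -natrM ler_nat mulnAC leq_mul2r; apply/orP; right.
  by rewrite mulSn addnC leq_add2l.
have h2 : T%:R * b%:R <= cseq k eta m l * b%:R by rewrite ler_wpM2r.
have h3 : 2 * ta * n.+1%:R <= b%:R + f%:R.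
  rewrite /ta mulrA divff ?pnatr_eq0 // mul1r mulrC ler_pdivrMr // -natrD -natrM ler_nat.
  rewrite /b -mulnSr [(f * _)%N]mulnC -mulnA [(f * _)%N]mulnC -/Q.
  by rewrite ltnW // ltn_ceil.
have h4 : (eta - ta) * n.+1%:R <= et * n.+1%:R by rewrite ler_wpM2r // le_max lexx.
by lra.
Qed.

(** Strong induction, as [expo_improve] needs every lower degree with every positive exponent. The
    bound on [p] yields [k < p] and absorbs the factor [4^(kap k) p] of the dominant class. *)
Theorem nested_congruencing k : (0 < k)%N -> (2 * 4 ^ kap k <= p)%N ->
  forall eps, 0 < eps -> expo k eps.
Proof.
elim/ltn_ind: k => k IH k0 kp4 eps e0.
have kk : (k <= kap k)%N.
  rewrite -(leq_pmul2l (isT : 0 < 2)%N) kap2 mulnC leq_mul2l ltnS k0 orbT //.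
have kp : (k < p)%N.
  apply: leq_trans kp4; apply: (@leq_trans (4 ^ k)); first exact: ltn_expl.
  by apply: leq_trans (leq_pmull _ _) => //; rewrite leq_exp2l.
have [k1|k2] := leqP k 1.
  have -> : k = 1%N by apply/eqP; rewrite eqn_leq k1 k0.
  exists 1 => // n; apply: Dec_mono (@Dec1 R p p_pr n) => //.
  by rewrite mul1r pw_ge1 // mulr_ge0 // ltW.
have hp : 2 * (4 ^+ kap k * pr) <= pr ^+ kap k.
  apply: (@le_trans _ _ (pr ^+ 2)); last by rewrite ler_weXn2l // (leq_trans k2).
  by rewrite expr2 mulrA ler_wpM2r ?(ltW prp) // -natrX -natrM ler_nat.
have lower l : (0 < l < k)%N -> forall eps, 0 < eps -> expo l eps.
  move=> /andP[l0 lk]; apply: IH => //; apply: leq_trans kp4.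
  by rewrite leq_mul2l /= leq_exp2l // kap_le // ltnW.
have [ta ta0 H] := expo_improve k2 kp hp lower e0.
have start : expo k (kap k).+1%:R.
  exists 1 => // n; apply: Dec_mono (@Dec_trivial R p p_pr k n) => //.
  by rewrite mul1r -pw_nat pw_le // mulnC natrM.
have it i : expo k (Num.max ((kap k).+1%:R - i%:R * ta) eps).
  elim: i => [|i ih].
    by apply: expo_le start; rewrite mul0r subr0 le_max lexx.
  apply: expo_le (H _ _ ih); last by rewrite le_max lexx orbT.
  rewrite ge_max; apply/andP; split; last by rewrite le_max (ltW e0) orbT.
  have -> : i.+1%:R = i%:R + 1 :> R by rewrite natr1.
  rewrite lerBlDr ge_max; apply/andP; split.
    have : (kap k).+1%:R - (i%:R + 1) * ta <=
       Num.max ((kap k).+1%:R - (i%:R + 1) * ta) eps by rewrite le_max lexx.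
    by set x := Num.max _ _; lra.
  have : eps <= Num.max ((kap k).+1%:R - (i%:R + 1) * ta) eps by rewrite le_max lexx orbT.
  by set x := Num.max _ _; lra.
pose i := Num.bound ((kap k).+1%:R / ta).
apply: expo_le (it i); rewrite ge_max lexx andbT.
have : (kap k).+1%:R < i%:R * ta.
  by rewrite -ltr_pdivrMr // archi_boundP // divr_ge0 // ltW.
by move=> h; rewrite lerBlDr (le_trans (ltW h)) // lerDr ltW.
Qed.

End Iteration.

(** Vinogradov's counting function with [t] variables on each side, taken in [0, ..., N - 1]. *)
Definition Jn (k t N : nat) : nat :=
  #|[set xy : {ffun 'I_t -> 'I_N} * {ffun 'I_t -> 'I_N} |
     [forall j : 'I_k, (\sum_i (xy.1 i) ^ j.+1 == \sum_i (xy.2 i) ^ j.+1)%N]]|.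

Lemma e_sum_sqr (R : realType) (T : finType) (A : T -> R) :
  (\sum_x e (A x)) * (\sum_x e (A x))^*%C = \sum_(xy : T * T) e (A xy.1 - A xy.2).
Proof.
rewrite conjc_sum mulr_suml; under eq_bigr => x _ do rewrite mulr_sumr.
by rewrite pair_bigA; apply: eq_bigr => -[x y] _; rewrite eD eN.
Qed.

(** * Vinogradov's mean values *)

Section Moments.
Variables (R : realType) (k : nat).
Local Notation C := R[i].
Local Notation e := (@e R).
Implicit Types (al be : 'I_k -> R).

Definition zscale (lam : int) al : 'I_k -> R := fun j => lam%:~R * al j.

Definition powdiff (I : finType) (pos : I -> int) t
    (xy : {ffun 'I_t -> I} * {ffun 'I_t -> I}) (j : 'I_k) : int :=
  \sum_i pos (xy.1 i) ^+ j.+1 - \sum_i pos (xy.2 i) ^+ j.+1.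

Lemma phi_scale lam al x : phi (zscale lam al) x = \sum_j al j * (lam * x ^+ j.+1)%:~R.
Proof.
apply: eq_bigr => j _; rewrite /zscale rmorphM rmorphXn /=.
by rewrite [_ * al j]mulrC -mulrA.
Qed.

Lemma esum_pow_expand (I : finType) (pos : I -> int) al t :
  esum pos al ^+ t = \sum_(x : {ffun 'I_t -> I}) e (\sum_i phi al (pos (x i))).
Proof.
rewrite -[in LHS](card_ord t) -prodr_const.
rewrite (bigA_distr_bigA (fun (i : 'I_t) x => e (phi al (pos x)))) /=.
by apply: eq_bigr => x _; rewrite e_sum.
Qed.

Lemma esum_moment (I : finType) (pos : I -> int) t M lam : (0 < M)%N ->
  Eav M (fun al : 'I_k -> R => nm (esum pos (zscale lam al)) ^+ (2 * t)) =
  #|[set xy : {ffun 'I_t -> I} * {ffun 'I_t -> I} |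
     [forall j, (M%:Z %| lam * powdiff pos xy j)%Z]]|%:R.
Proof.
move=> M0; apply: (@complexI R); rewrite -EavC.
have -> : (#|[set xy : {ffun 'I_t -> I} * {ffun 'I_t -> I} |
     [forall j, (M%:Z %| lam * powdiff pos xy j)%Z]]|%:R)%:C%C =
   \sum_(xy : {ffun 'I_t -> I} * {ffun 'I_t -> I} |
      [forall j, (M%:Z %| lam * powdiff pos xy j)%Z]) (1 : C).
  by rewrite sumr_const rmorph_nat cardsE.
rewrite -(@Eav_count R k _ M (fun=> 1)) //; apply: eq_Eav => al.
rewrite nm_pow2 esum_pow_expand e_sum_sqr; apply: eq_bigr => -[x y] _; rewrite mul1r /=.
congr e.
have pE (z : {ffun 'I_t -> I}) : \sum_i phi (zscale lam al) (pos (z i)) =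
    \sum_j al j * (\sum_i lam * pos (z i) ^+ j.+1)%:~R.
  rewrite (eq_bigr _ (fun i _ => phi_scale lam al (pos (z i)))) exchange_big /=.
  by apply: eq_bigr => j _; rewrite rmorph_sum mulr_sumr.
rewrite !pE -sumrB; apply: eq_bigr => j _; rewrite -mulrBr -rmorphB.
by rewrite /powdiff /= mulrBr !mulr_sumr.
Qed.

Definition npos (N : nat) : 'I_N -> int := fun i => (i : nat)%:Z.
Definition S (N : nat) al : C := esum (@npos N) al.

Lemma powdiff_npos N t (xy : {ffun 'I_t -> 'I_N} * {ffun 'I_t -> 'I_N}) j :
  powdiff (@npos N) xy j =
  (\sum_i (xy.1 i) ^ j.+1)%N%:Z - (\sum_i (xy.2 i) ^ j.+1)%N%:Z.
Proof.
have h (z : {ffun 'I_t -> 'I_N}) :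
    \sum_i npos (z i) ^+ j.+1 = (\sum_i (z i) ^ j.+1)%N%:Z.
  by rewrite -[RHS]natz natr_sum; apply: eq_bigr => i _; rewrite natrX natz.
by rewrite /powdiff !h.
Qed.

Lemma Jn_le_moment N t M : (0 < M)%N ->
  (Jn k t N)%:R <= Eav M (fun al : 'I_k -> R => nm (S N al) ^+ (2 * t)).
Proof.
move=> M0; have := @esum_moment _ (@npos N) t M 1 M0.
rewrite (@eq_Eav R k _ _ _ (fun al => nm (S N al) ^+ (2 * t))); last first.
  move=> al; rewrite /S; congr (nm (esum _ _) ^+ _).
  by apply: boolp.funext => j; rewrite /zscale mul1r.
move=> ->; rewrite ler_nat; apply: subset_leq_card; apply/fintype.subsetP => xy.
rewrite !inE => /forallP h; apply/forallP => j; rewrite powdiff_npos.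
by rewrite (eqP (h j)) subrr mulr0 dvdz0.
Qed.

(** As [io] injects the indices into [[0, N)], the bound holds for every subset of the interval.
    With [M] beyond [|lam| t N^k] a congruence modulo [M] is an equality, and [lam] cancels. *)
Lemma moment_le_Jn (I : finType) (io : I -> nat) (pos : I -> int) N t M lam :
  injective io -> (forall i, (io i < N)%N) -> (forall i, pos i = (io i)%:Z) ->
  lam != 0 -> (`|lam| * (t * N ^ k) < M)%N ->
  Eav M (fun al : 'I_k -> R => nm (esum pos (zscale lam al)) ^+ (2 * t)) <= (Jn k t N)%:R.
Proof.
move=> ioi ioN posE lam0 hM; have M0 : (0 < M)%N by exact: leq_ltn_trans hM.
rewrite esum_moment // ler_nat.
pose g (x : {ffun 'I_t -> I}) : {ffun 'I_t -> 'I_N} := [ffun i => Ordinal (ioN (x i))].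
have gi : injective g.
  move=> x y /ffunP h; apply/ffunP => i; apply: ioi.
  by have := h i; rewrite !ffunE => -[].
rewrite -(card_imset (f := fun xy => (g xy.1, g xy.2))); last first.
  by move=> [x y] [x' y'] [/gi -> /gi ->].
apply: subset_leq_card; apply/fintype.subsetP => _ /imsetP[[x y] + ->].
rewrite !inE => /forallP h; apply/forallP => j /=.
have pE (z : {ffun 'I_t -> I}) : \sum_i pos (z i) ^+ j.+1 = (\sum_i (g z i) ^ j.+1)%N%:Z.
  rewrite -[RHS]natz natr_sum; apply: eq_bigr => i _; rewrite natrX natz ffunE /=.
  by rewrite posE.
have bd (z : {ffun 'I_t -> I}) : (\sum_i (g z i) ^ j.+1 <= t * N ^ k)%N.
  apply: (@leq_trans (\sum_(i < t) N ^ k)); last by rewrite sum_nat_const card_ord.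
  apply: leq_sum => i _.
  have N0 : (0 < N)%N by exact: leq_ltn_trans (ltn_ord (g z i)).
  apply: (@leq_trans (N ^ j.+1)); first by rewrite leq_exp2r // ltnW.
  by rewrite leq_pexp2l.
have := h j; rewrite /powdiff /= !pE.
set u := (\sum_i (g x i) ^ _)%N; set v := (\sum_i (g y i) ^ _)%N => hd.
have : lam * (u%:Z - v%:Z) == 0.
  apply/eqP; apply/eqP; rewrite -absz_eq0; move: hd; rewrite dvdzE /= => hd.
  have lt : (`|(lam * (u%:Z - v%:Z))%R|%N < M)%N.
    rewrite abszM; apply: leq_ltn_trans hM; rewrite leq_mul2l; apply/orP; right.
    have := bd x; have := bd y; rewrite -/u -/v.
    have [uv|vu] := leqP u v.
      by rewrite -opprB abszN subzn // absz_nat => h1 _; exact: leq_trans (leq_subr _ _) h1.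
    by rewrite subzn ?(ltnW vu) // absz_nat => _ h1; exact: leq_trans (leq_subr _ _) h1.
  by apply: contraLR hd => nz; rewrite gtnNdvd // lt0n.
by rewrite mulf_eq0 (negbTE lam0) /= subr_eq0 eqz_nat.
Qed.

Lemma moment_S_le N t M : (t * N ^ k < M)%N ->
  Eav M (fun al : 'I_k -> R => nm (S N al) ^+ (2 * t)) <= (Jn k t N)%:R.
Proof.
move=> hM; have := @moment_le_Jn _ (fun i : 'I_N => i : nat) (@npos N) N t M 1.
rewrite /= mul1n => h; apply: le_trans (h _ _ _ _ hM) => //; last exact: ord_inj.
rewrite (@eq_Eav R k _ _ _ (fun al => nm (esum (@npos N) (zscale 1 al)) ^+ (2 * t))) //.
move=> al; rewrite /S; congr (nm (esum _ _) ^+ _).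
by apply: boolp.funext => j; rewrite /zscale mul1r.
Qed.

(** Closeness modulo 1 in the box natural for length [N]: changing [al j] by [eps / N^(j+1)] moves
    the phase by at most [eps] on [[0, N]]. *)
Definition near1 N (eps : R) al be :=
  forall j, exists z : int, `|al j - be j - z%:~R| <= eps / N%:R ^+ j.+1.

Lemma near_phi N eps al be x : (0 < N)%N -> (x <= N)%N -> near1 N eps al be ->
  nm (e (phi al x%:Z) - e (phi be x%:Z)) <= 8 * (k%:R * eps).
Proof.
move=> N0 xN nab; have [z hz] := boolp.choice nab.
have Nr : 0 < N%:R :> R by rewrite ltr0n.
pose w : int := \sum_j z j * (x%:Z ^+ j.+1).
rewrite -(eDint (phi be _) w); apply: le_trans (e_lip _ _) _; rewrite ler_pM2l //.
rewrite opprD addrA /phi -sumrB /w rmorph_sum /= -sumrB.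
apply: le_trans (ler_norm_sum _ _ _) _.
rewrite mulr_natl -[X in _ *+ X](card_ord k) -sumr_const; apply: ler_sum => j _.
rewrite rmorphM rmorphXn /= -!mulrBl normrM normrX.
have -> : `|(x%:Z)%:~R : R| = x%:R by rewrite ger0_norm.
apply: le_trans (ler_wpM2r _ (hz j)) _; first exact: exprn_ge0.
have eps0 : 0 <= eps.
  have := le_trans (normr_ge0 _) (hz j); rewrite pmulr_lge0 // invr_gt0 exprn_gt0 //.
rewrite mulrAC ler_pdivrMr ?exprn_gt0 // ler_wpM2l // lerXn2r ?nnegrE // ler_nat //.
Qed.

Lemma near_S N eps al be : (0 < N)%N -> near1 N eps al be ->
  nm (S N al - S N be) <= N%:R * (8 * (k%:R * eps)).
Proof.
move=> N0 nab; rewrite /S /esum -sumrB; apply: le_trans (nm_sum _ _ _) _.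
rewrite mulr_natl -[X in _ *+ X](card_ord N) -sumr_const; apply: ler_sum => i _.
exact: (near_phi N0 (ltnW (ltn_ord i)) nab).
Qed.

End Moments.

Section LargeValues.
Variables (R : realType) (k : nat).
Local Notation e := (@e R).

Lemma prod_box N : ((\prod_(j < k) N ^ (k - j.+1)) * N ^ kap k = N ^ (k * k))%N.
Proof.
have -> : (N ^ kap k = \prod_(j < k) N ^ j.+1)%N.
  elim: k => [|m IH]; first by rewrite big_ord0.
  rewrite big_ord_recr /= -IH -expnD; congr (_ ^ _)%N; apply/eqP.
  by rewrite -(eqn_pmul2l (isT : 0 < 2)%N) mulnDr !kap2; apply/eqP; lia.
rewrite -big_split /= (eq_bigr (fun=> N ^ k)%N) => [|j _]; last by rewrite -expnD subnK.
by rewrite prod_nat_const card_ord -expnM.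
Qed.

(** Around each [al i] a box of sides comparable to [1 / (D N^(j+1))] keeps the sum above half its
    size. Disjoint boxes are limited in number by the mean value; with more points two boxes meet,
    and their centres are close. *)
Lemma large_values N u D Y B (W : R) (al : 'I_B.+1 -> 'I_k -> R) :
  (0 < N)%N -> (0 < Y)%N -> (u < D)%N -> (32 * k * Y <= D)%N ->
  (Jn k u N)%:R <= W * (N ^ (2 * u))%:R / (N ^ kap k)%:R ->
  (forall i, N%:R / Y%:R <= nm (S N (al i))) ->
  W * (2 * Y%:R) ^+ (2 * u) * D%:R ^+ k < B.+1%:R ->
  exists i i' : 'I_B.+1, (i < i')%N /\ near1 N (2 / D%:R) (al i') (al i).
Proof.
move=> N0 Y0 uD YD hJ hal hB.
have Nr : 0 < N%:R :> R by rewrite ltr0n.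
have Yr : 0 < Y%:R :> R by rewrite ltr0n.
have D0 : (0 < D)%N by exact: leq_ltn_trans uD.
have Dr : 0 < D%:R :> R by rewrite ltr0n.
(* With this [M] a box has exactly [N^(k - j - 1)] grid points in direction [j]. *)
pose M := (D * N ^ k)%N.
have M0 : (0 < M)%N by rewrite muln_gt0 D0 expn_gt0 N0.
have Mr : 0 < M%:R :> R by rewrite ltr0n.
have Mz : (0 : int) < M%:Z by rewrite ltz_nat.
have Mz0 : M%:Z != 0 by rewrite gt_eqF.
pose fl i j := Num.floor (al i j * M%:R).
have mlt (x : int) : (`|(x %% M%:Z)%Z|%N < M)%N.
  by rewrite -ltz_nat gez0_abs ?modz_ge0 // ltz_pmod.
pose red (x : int) : 'I_M := Ordinal (mlt x).
have redE x : exists z : int, (red x : nat)%:Z = x + z * M%:Z.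
  exists (- (x %/ M%:Z)%Z); rewrite /red /= gez0_abs ?modz_ge0 //.
  by rewrite {2}(divz_eq x M%:Z) mulNr addrAC subrr add0r.
have redI x y : red x = red y -> exists z : int, x = y + z * M%:Z.
  move=> /(congr1 (fun a : 'I_M => (a : nat)%:Z)).
  have [z1 ->] := redE x; have [z2 ->] := redE y => h.
  by exists (z2 - z1); rewrite mulrBl addrA -h addrK.
pose box := family (fun j : 'I_k => [pred b : 'I_M | (b < N ^ (k - j.+1))%N]).
pose th (ib : 'I_B.+1 * {ffun 'I_k -> 'I_M}) : {ffun 'I_k -> 'I_M} :=
  [ffun j => red (fl ib.1 j + (ib.2 j : nat)%:Z)].
pose dom := [set ib : 'I_B.+1 * {ffun 'I_k -> 'I_M} | ib.2 \in box].
have NkM j : (N ^ (k - j.+1) <= M)%N.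
  apply: (@leq_trans (N ^ k)); first by rewrite leq_pexp2l // leq_subr.
  by rewrite leq_pmull.
have flE i j : 0 <= al i j * M%:R - (fl i j)%:~R < 1.
  by have := floor_le_tmp (al i j * M%:R); have := floorD1_gt (al i j * M%:R);
     rewrite -/(fl i j) intrD; lra.
have boxr (j : 'I_k) : (N ^ (k - j.+1))%:R = M%:R / (D%:R * N%:R ^+ j.+1) :> R.
  have -> : M%:R = D%:R * (N ^ (k - j.+1))%:R * N%:R ^+ j.+1 :> R.
    by rewrite -natrX -!natrM -mulnA -expnD subnK.
  by field; rewrite expf_neq0 gt_eqF //= gt_eqF.
have box1 (j : 'I_k) : 1 <= (N ^ (k - j.+1))%:R :> R by rewrite ler1n expn_gt0 N0.
have thnear ib : ib \in dom -> near1 N (2 / D%:R) (al ib.1) (gpt R (th ib)).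
  case: ib => i b; rewrite inE /= => /familyP hb j.
  have [z hz] := redE (fl i j + (b j : nat)%:Z).
  exists (- z); rewrite /gpt ffunE /=.
  have -> : (red (fl i j + (b j : nat)%:Z))%:R = (fl i j)%:~R + (b j)%:R + z%:~R * M%:R :> R.
    by rewrite -[LHS]/(((red _ : nat)%:Z)%:~R) hz !rmorphD rmorphM.
  rewrite rmorphN opprK mulrDl mulfK ?gt_eqF // opprD addrA subrK.
  have -> : al i j - ((fl i j)%:~R + (b j)%:R) / M%:R =
     (al i j * M%:R - (fl i j)%:~R - (b j)%:R) / M%:R by field; rewrite gt_eqF.
  rewrite normrM normfV (gtr0_norm Mr) ler_pdivrMr //.
  have -> : 2 / D%:R / N%:R ^+ j.+1 * M%:R = 2 * (N ^ (k - j.+1))%:R :> R.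
    by rewrite boxr; field; rewrite expf_neq0 gt_eqF //= gt_eqF.
  have := hb j; rewrite inE -(ltr_nat R) => hbj.
  have := flE i j; have := box1 j; have : 0 <= (b j)%:R :> R by [].
  rewrite ler_norml; move: (b j)%:R hbj => x; lra.
have [inj|] := pselect {in dom &, injective th}; last first.
  move=> ninj.
  have [ib [ib' [d1 d2 ee nn]]] : exists ib ib', [/\ ib \in dom, ib' \in dom, th ib = th ib' & ib <> ib'].
    apply: contrapT => H; apply: ninj => ib ib' d1 d2 ee; apply: contrapT => nn.
    by apply: H; exists ib, ib'.
  case: ib ib' d1 d2 ee nn => [i b] [i' b'] /= d1 d2 ee nn.
  have tz j : exists z : int, fl i j + (b j : nat)%:Z = fl i' j + (b' j : nat)%:Z + z * M%:Z.
    by have /ffunP/(_ j) := ee; rewrite !ffunE /= => /redI.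
  have ii : i != i'.
    apply/eqP => ii; apply: nn; rewrite ii; congr (_, _); apply/ffunP => j.
    have [z] := tz j; rewrite ii => hz; apply: ord_inj.
    have h1 : (b j : nat)%:Z = (b' j : nat)%:Z + z * M%:Z.
      by apply: (addrI (fl i' j)); rewrite hz addrA.
    have : ((b j : nat)%:Z %% M%:Z)%Z = ((b' j : nat)%:Z %% M%:Z)%Z.
      by rewrite h1 addrC modzMDl.
    by rewrite !modz_small ?ltz_nat ?ltn_ord // => -[].
  have nearI (i1 i2 : 'I_B.+1) (b1 b2 : {ffun 'I_k -> 'I_M}) : b1 \in box -> b2 \in box ->
     (forall j, exists z : int, fl i1 j + (b1 j : nat)%:Z = fl i2 j + (b2 j : nat)%:Z + z * M%:Z) ->
     near1 N (2 / D%:R) (al i1) (al i2).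
    move=> /familyP h1 /familyP h2 hz j; have [z hzj] := hz j; exists z.
    have E : al i1 j - al i2 j - z%:~R =
      ((al i1 j * M%:R - (fl i1 j)%:~R) - (al i2 j * M%:R - (fl i2 j)%:~R) +
       ((b2 j)%:R - (b1 j)%:R)) / M%:R.
      have /(congr1 (fun x : int => x%:~R : R)) := hzj.
      rewrite !rmorphD rmorphM /= => hr.
      have -> : (fl i1 j)%:~R = (fl i2 j)%:~R + (b2 j)%:R + z%:~R * M%:R - (b1 j)%:R :> R.
        by apply: (canRL (addrK _)); exact: hr.
      by field; rewrite gt_eqF.
    rewrite E normrM normfV (gtr0_norm Mr) ler_pdivrMr //.
    have -> : 2 / D%:R / N%:R ^+ j.+1 * M%:R = 2 * (N ^ (k - j.+1))%:R :> R.
      by rewrite boxr; field; rewrite expf_neq0 gt_eqF //= gt_eqF.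
    have := h1 j; have := h2 j; rewrite !inE -!(ltr_nat R) => hb2 hb1.
    have := flE i1 j; have := flE i2 j; have := box1 j.
    have : 0 <= (b1 j)%:R :> R by []. have : 0 <= (b2 j)%:R :> R by [].
    rewrite ler_norml; move: (b1 j)%:R (b2 j)%:R hb1 hb2 => x y; lra.
  have b1 : b \in box by move: d1; rewrite inE.
  have b2 : b' \in box by move: d2; rewrite inE.
  have [lt|gt|eq] := ltngtP i i'; last by case/negP: ii; apply/eqP/ord_inj.
    exists i, i'; split => //; apply: nearI b2 b1 _ => j; have [z hz] := tz j.
    by exists (- z); rewrite mulNr hz addrK.
  by exists i', i; split => //; exact: nearI b1 b2 tz.
exfalso; move: hB; apply/negP; rewrite -leNgt.
pose X := [set a : {ffun 'I_k -> 'I_M} | N%:R / (2 * Y%:R) <= nm (S N (gpt R a))].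
have sub : th @: dom \subset X.
  apply/fintype.subsetP => _ /imsetP[ib di ->]; rewrite inE.
  have h := near_S N0 (thnear ib di).
  have h2 := hal ib.1.
  have h3 := nm_le_sub (S N (al ib.1)) (S N (gpt R (th ib))).
  (* [32 k Y <= D] makes the variation inside a box at most half of [N / Y]. *)
  have h4 : N%:R * (8 * (k%:R * (2 / D%:R))) <= N%:R / (2 * Y%:R) :> R.
    rewrite ler_pM2l // -[leRHS]mul1r ler_pdivlMr ?mulr_gt0 //.
    have -> : 8 * (k%:R * (2 / D%:R)) * (2 * Y%:R) = (32 * k * Y)%:R / D%:R :> R.
      by rewrite !natrM; field; rewrite gt_eqF.
    by rewrite ler_pdivrMr // mul1r ler_nat.
  have h5 : N%:R / Y%:R = N%:R / (2 * Y%:R) + N%:R / (2 * Y%:R) :> R.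
    by field; rewrite gt_eqF.
  by move: h h2 h3 h4 h5; set x := N%:R / Y%:R; set y := N%:R / (2 * Y%:R); lra.
have cdom : #|dom| = (B.+1 * \prod_(j < k) N ^ (k - j.+1))%N.
  have -> : dom = finset.setX [set: 'I_B.+1]%SET [set b | b \in box].
    by apply/finset.setP => -[i b]; rewrite !inE.
  rewrite cardsX cardsT card_ord cardsE; congr (_ * _)%N.
  rewrite card_family foldrE big_map big_enum /=; apply: eq_bigr => j _.
  rewrite -sum1_card; have := NkM j; move: (N ^ _)%N => q qM.
  rewrite (eq_bigl (fun i : 'I_M => (i < q)%N)) //.
  by rewrite (big_ord_narrow qM) sum1_card card_ord.
have cX : (B.+1 * \prod_(j < k) N ^ (k - j.+1) <= #|X|)%N.
  by rewrite -cdom -(card_in_imset inj) subset_leq_card.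
have mk : #|X|%:R * (N%:R / (2 * Y%:R)) ^+ (2 * u) <= (M ^ k)%:R * (Jn k u N)%:R :> R.
  have hm : (u * N ^ k < M)%N by rewrite /M ltn_mul2r expn_gt0 N0.
  have := @moment_S_le R k N u M hm.
  rewrite /Eav ler_pdivrMr ?ltr0n ?expn_gt0 ?M0 // mulrC => /(le_trans _); apply.
  rewrite mulr_natl -sumr_const [leRHS](bigID (mem X)) /=.
  rewrite ler_wpDr ?sumr_ge0 // => [a _|]; first by rewrite exprn_ge0 ?nm_ge0.
  apply: ler_sum => a; rewrite inE => ha; rewrite lerXn2r ?nnegrE ?nm_ge0 //.
have W0 : 0 <= W.
  have : 0 <= W * (N ^ (2 * u))%:R / (N ^ kap k)%:R by exact: le_trans hJ.
  by rewrite -mulrA pmulr_lge0 // divr_gt0 // ltr0n expn_gt0 N0.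
have {hJ}mk := le_trans mk (ler_wpM2l (ler0n _ _) hJ).
have cX' : B.+1%:R * (\prod_(j < k) N ^ (k - j.+1))%:R <= #|X|%:R :> R.
  by rewrite -natrM ler_nat.
set Pb := (\prod_(j < k) N ^ (k - j.+1))%N in cX'.
have Pb0 : 0 < Pb%:R :> R by rewrite ltr0n prodn_gt0 // => j; rewrite expn_gt0 N0.
have q0 : 0 <= (N%:R / (2 * Y%:R)) ^+ (2 * u) :> R by rewrite exprn_ge0 // divr_ge0 // mulr_ge0.
have {}mk := le_trans (ler_wpM2r q0 cX') mk.
have hN := prod_box N; rewrite -/Pb in hN.
have ME : (M ^ k)%:R = D%:R ^+ k * (Pb%:R * (N ^ kap k)%:R) :> R.
  by rewrite -natrM hN /M expnMn -expnM natrM natrX.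
have nk0 : 0 < (N ^ kap k)%:R :> R by rewrite ltr0n expn_gt0 N0.
have y2 : 0 < (2 * Y%:R) ^+ (2 * u) :> R by rewrite exprn_gt0 // mulr_gt0.
have n2 : 0 < N%:R ^+ (2 * u) :> R by rewrite exprn_gt0.
rewrite ME expr_div_n (natrX _ N (2 * u)) in mk.
have E1 : D%:R ^+ k * (Pb%:R * (N ^ kap k)%:R) * (W * N%:R ^+ (2 * u) / (N ^ kap k)%:R) =
   (W * (2 * Y%:R) ^+ (2 * u) * D%:R ^+ k) *
   (Pb%:R * (N%:R ^+ (2 * u) / (2 * Y%:R) ^+ (2 * u))) :> R.
  by field; rewrite !gt_eqF.
rewrite E1 -[X in X <= _]mulrA ler_pM2r // in mk.
by rewrite mulr_gt0 // divr_gt0.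
Qed.

End LargeValues.

(** * The inverse theorem for Weyl sums *)

Section Weyl.
Variables (R : realType) (k u : nat).
Local Notation C := R[i].
Local Notation e := (@e R).
Local Notation S := (@S R k).
Implicit Types (al be : 'I_k -> R).

(** Coefficients in [x], the constant one excepted, of [phi al (x + h)]. *)
Definition shift (h : nat) al : 'I_k -> R := fun j =>
  \sum_(i < k | (j <= i)%N) 'C(i.+1, j.+1)%:R * h%:R ^+ (i - j) * al i.

Lemma phi_shift h al (x : nat) :
  phi al (x + h)%N%:Z = phi (shift h al) x%:Z + phi al h%:Z.
Proof.
rewrite /phi /shift; under [X in _ = X + _]eq_bigr => j _ do rewrite mulr_suml.
rewrite (exchange_big_dep predT) //= -big_split /=; apply: eq_bigr => i _.
rewrite -[((x + h)%N%:Z)%:~R]/((x + h)%:R) -[(x%:Z)%:~R]/(x%:R) -[(h%:Z)%:~R]/(h%:R).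
rewrite natrD [x%:R + _]addrC exprDn big_ord_recl /= bin0 expr0 mulr1 mulr1n subn0 mulrDr.
rewrite [LHS]addrC.
congr (_ + _); rewrite mulr_sumr.
rewrite (big_ord_widen k (fun j => al i * (h%:R ^+ (i.+1 - bump 0 j) *
   x%:R ^+ bump 0 j *+ 'C(i.+1, bump 0 j)))) //.
apply: eq_big => [j|j _]; first by rewrite ltnS.
by rewrite /bump /= add1n subSS -mulr_natr; ring.
Qed.

Lemma sum_shift (F : nat -> C) N h :
  \sum_(x < N) F (x + h)%N - \sum_(x < N) F x =
  \sum_(N <= x < N + h) F x - \sum_(x < h) F x.
Proof.
rewrite -(big_mkord xpredT (fun x => F (x + h)%N)) -!(big_mkord xpredT F).
have -> : \sum_(0 <= x < N) F (x + h)%N = \sum_(h <= x < N + h) F x.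
  by have := big_addn 0 (N + h) h xpredT F; rewrite add0n addnK => ->.
have E1 : \sum_(0 <= x < N + h) F x = \sum_(0 <= x < h) F x + \sum_(h <= x < N + h) F x.
  by apply: big_cat_nat => //; rewrite leq_addl.
have E2 : \sum_(0 <= x < N + h) F x = \sum_(0 <= x < N) F x + \sum_(N <= x < N + h) F x.
  by apply: big_cat_nat => //; rewrite leq_addr.
apply/eqP; rewrite subr_eq addrAC eq_sym subr_eq; apply/eqP.
by rewrite [LHS]addrC -E2 E1 addrC.
Qed.

Lemma S_shift_sum h al N :
  \sum_(x < N) e (phi al (x + h)%N%:Z) = e (phi al h%:Z) * S N (shift h al).
Proof.
rewrite /S /esum mulr_sumr; apply: eq_bigr => x _.
by rewrite phi_shift eD mulrC.
Qed.

Lemma S_shift_near h al N :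
  nm (e (phi al h%:Z) * S N (shift h al) - S N al) <= 2 * h%:R.
Proof.
rewrite -S_shift_sum /S /esum /npos (sum_shift (fun x => e (phi al x%:Z))).
have hb (r : seq nat) : nm (\sum_(x <- r) e (phi al x%:Z)) <= (size r)%:R.
  apply: le_trans (nm_sum _ _ _) _; rewrite (eq_bigr (fun=> 1)) => [|i _]; last exact: nm_e.
  by rewrite big_const_seq count_predT iter_addr_0.
apply: le_trans (nmD _ _) _; rewrite nmN mulr2n mulrDl mul1r; apply: lerD.
  by apply: le_trans (hb _) _; rewrite size_iota addKn.
rewrite -(big_mkord xpredT (fun x => e (phi al x%:Z))).
by apply: le_trans (hb _) _; rewrite size_iota subn0.
Qed.

Lemma nm_S_shift h al N : nm (S N al) - 2 * h%:R <= nm (S N (shift h al)).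
Proof.
have := S_shift_near h al N; set z := e _ * _ => h1.
have -> : nm (S N (shift h al)) = nm z by rewrite /z nmM nm_e mul1r.
have := nm_le_sub (S N al) z; rewrite nmB; move: h1; lra.
Qed.

Lemma shift_top h al (j : 'I_k) (j1 : 'I_k) : (j1.+1 = j)%N ->
  shift h al j1 = al j1 + j.+1%:R * h%:R * al j +
  \sum_(i < k | (j < i)%N) 'C(i.+1, j)%:R * h%:R ^+ (i - j1) * al i.
Proof.
move=> jE; rewrite /shift (bigD1 j1) //= binn subnn expr0 !mul1r -addrA; congr (_ + _).
rewrite (bigD1 j) /=; last by rewrite -jE leqnSn -(inj_eq val_inj) /= -jE gtn_eqF.
rewrite jE binSn; have -> : (j - j1 = 1)%N by rewrite -jE subSnn.
rewrite expr1; congr (_ + _); apply: eq_bigl => i; rewrite -!(inj_eq val_inj) /= -jE.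
by apply/idP/idP => [/andP[/andP[h1 h2] h3]|h1];
  rewrite ?ltn_neqAle ?[_ == i]eq_sym ?h1 ?h2 ?h3 //; move: h1 h2 h3 || move: h1; lia.
Qed.

Lemma int_lt1_eq0 (z : int) : `|z%:~R| < 1 :> R -> z = 0.
Proof. by rewrite -intr_norm -[1]/(1%:~R) ltr_int; clear; lia. Qed.

(** Successive multiples differ by less than 1/4 modulo 1, so they cannot jump to the neighbourhood
    of another integer: by induction every [h g0] stays below 1/4 itself. *)
Lemma small_multiples (ga : R) H : (0 < H)%N ->
  (forall h, (0 < h <= H)%N -> exists z : int, `|h%:R * ga - z%:~R| < 4^-1) ->
  exists z : int, `|ga - z%:~R| <= (4 * H%:R)^-1.
Proof.
move=> H0 hyp; have [|z0] := hyp 1%N; first by rewrite H0.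
rewrite mul1r => h1; exists z0; set g0 := ga - _ in h1 *.
have cl h : (0 < h <= H)%N -> `|h%:R * g0| < 4^-1.
  elim: h => // h IH /andP[_ hH].
  have [h0|h0] := posnP h; first by rewrite h0 mul1r.
  have ih : `|h%:R * g0| < 4^-1 by apply: IH; rewrite h0 ltnW.
  have [|z hz] := hyp h.+1; first by rewrite hH.
  pose z' := z - h.+1%:Z * z0.
  have hz' : `|h.+1%:R * g0 - z'%:~R| < 4^-1.
    rewrite /z' rmorphB rmorphM /= /g0.
    suff -> : h.+1%:R * (ga - z0%:~R) - (z%:~R - h.+1%:R * z0%:~R) = h.+1%:R * ga - z%:~R :> R by [].
    by ring.
  have s : `|h.+1%:R * g0| < 2^-1.
    rewrite -natr1 mulrDl mul1r; apply: le_lt_trans (ler_normD _ _) _; move: ih h1; lra.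
  have : `|z'%:~R| < 1 :> R.
    have -> : z'%:~R = h.+1%:R * g0 - (h.+1%:R * g0 - z'%:~R) :> R by ring.
    apply: le_lt_trans (ler_normB _ _) _; move: s hz'; lra.
  rewrite -intr_norm -[1]/(1%:~R) ltr_int => z1.
  have z0' : z' = 0 by move: z1; lia.
  by move: hz'; rewrite z0' subr0.
have := cl H; rewrite H0 leqnn => /(_ isT).
have Hr : 0 < H%:R :> R by rewrite ltr0n.
rewrite normrM ger0_norm // => h2; rewrite -(ler_pM2l Hr).
have -> : H%:R * (4 * H%:R)^-1 = 4^-1 :> R by field; rewrite gt_eqF.
exact: ltW.
Qed.

(* Inverse theorem for the coefficients of index at least j: u is an exponent whose
   mean value is sharp up to Y, and E does not depend on N, Y, al. *)
Definition wp (j E : nat) := forall N Y al, (1 < Y)%N -> (Y ^ E <= N)%N ->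
  (Jn k u N)%:R <= Y%:R * (N ^ (2 * u))%:R / (N ^ kap k)%:R :> R ->
  N%:R / Y%:R <= nm (S N al) ->
  exists2 q : nat, (0 < q <= Y ^ E)%N & forall i : 'I_k, (j <= i)%N ->
    exists z : int, `|q%:R * al i - z%:~R| <= (Y ^ E)%:R / N%:R ^+ i.+1.

Lemma wp_top : wp k 0.
Proof.
by move=> N Y al Y1 _ _ _; exists 1%N => // i; rewrite leqNgt ltn_ord.
Qed.

(** An exponent beyond the numerical constants met below, each of which is then at most [Y^c0]
    because [Y >= 2]. *)
Let c0 := (k * 2 ^ k + u + 64 * k + 64)%N.
Let d := c0.+1.

Section Level.
Variables (N Y : nat).
Hypothesis Y1 : (1 < Y)%N.
Let Yr0 : 0 < Y%:R :> R. Proof. by rewrite ltr0n ltnW. Qed.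

Lemma Ypow_c0 m : (m <= c0)%N -> (m <= Y ^ c0)%N.
Proof.
move=> mc; apply: leq_trans mc _; apply: leq_trans (ltnW (ltn_expl c0 (isT : 1 < 2)%N)) _.
by rewrite leq_exp2r // /c0 addn_gt0 orbT.
Qed.

Lemma Yle a b : (a <= b)%N -> (Y ^ a <= Y ^ b)%N.
Proof. by move=> ab; rewrite leq_exp2l. Qed.

Lemma bin_le_pow2 n m : ('C(n, m) <= 2 ^ n)%N.
Proof.
elim: n m => [|n IH] [|m] //; first by rewrite bin0 expn_gt0.
by rewrite binS expnS mul2n -addnn leq_add.
Qed.

(* Error made by replacing the higher coefficients by their rational approximations. *)
Lemma tail_integral (E g q w h : nat) (al' : 'I_k -> R) (P : pred 'I_k)
    (cf : 'I_k -> nat) (m : 'I_k -> nat) (j : nat) :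
  (0 < N)%N -> (E + d + c0 <= g)%N -> (0 < q)%N -> h = (q * w)%N -> (h * Y ^ g <= N)%N ->
  (forall i, P i -> exists z : int, `|q%:R * al' i - z%:~R| <= (Y ^ E)%:R / N%:R ^+ i.+1) ->
  (forall i, P i -> (cf i <= 2 ^ k)%N) -> (forall i, P i -> (m i + j = i.+1)%N /\ (0 < m i)%N) ->
  exists z : int, `|\sum_(i < k | P i) (cf i)%:R * h%:R ^+ m i * al' i - z%:~R| <=
     (Y ^ d)%:R^-1 / N%:R ^+ j.
Proof.
move=> N0 gE q0 hE hN H hcf hm.
have Nr : 0 < N%:R :> R by rewrite ltr0n.
have [zz hz] : exists zz : 'I_k -> int, forall i, P i ->
   `|q%:R * al' i - (zz i)%:~R| <= (Y ^ E)%:R / N%:R ^+ i.+1.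
  have : forall i, exists z : int, P i -> `|q%:R * al' i - z%:~R| <= (Y ^ E)%:R / N%:R ^+ i.+1.
    by move=> i; have [/H[z hz]|] := boolP (P i); [exists z|exists 0].
  by move=> H'; have [zz hz] := boolp.choice H'; exists zz.
exists (\sum_(i < k | P i) (cf i)%:Z * h%:Z ^+ (m i).-1 * w%:Z * zz i).
rewrite rmorph_sum /= -sumrB; apply: le_trans (ler_norm_sum _ _ _) _.
have bound i : P i -> `|(cf i)%:R * h%:R ^+ m i * al' i -
    ((cf i)%:Z * h%:Z ^+ (m i).-1 * w%:Z * zz i)%:~R| <=
    (2 ^ k)%:R * ((Y ^ E)%:R / (Y ^ g)%:R / N%:R ^+ j) :> R.
  move=> Pi; have [mj m0] := hm i Pi.
  have -> : (cf i)%:R * h%:R ^+ m i * al' i -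
     ((cf i)%:Z * h%:Z ^+ (m i).-1 * w%:Z * zz i)%:~R =
     ((cf i)%:R * h%:R ^+ (m i).-1 * w%:R) * (q%:R * al' i - (zz i)%:~R) :> R.
    by rewrite !rmorphM rmorphXn /= -{1}(prednK m0) exprS {1}hE natrM; ring.
  rewrite normrM ger0_norm ?mulr_ge0 ?exprn_ge0 // -!mulrA.
  apply: ler_pM => //; first by rewrite ler_nat hcf.
  apply: (@le_trans _ _ (h%:R ^+ m i * ((Y ^ E)%:R / N%:R ^+ i.+1))).
    rewrite -{2}(prednK m0) exprSr -mulrA ler_wpM2l ?exprn_ge0 //.
    apply: ler_pM => //; last exact: hz.
    by rewrite ler_nat hE leq_pmull.
  have hYg : h%:R <= N%:R / (Y ^ g)%:R :> R.
    by rewrite ler_pdivlMr ?ltr0n ?expn_gt0 ?(ltnW Y1) // -natrM ler_nat.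
  have hm' : h%:R ^+ m i <= N%:R ^+ m i / (Y ^ g)%:R :> R.
    apply: (@le_trans _ _ ((N%:R / (Y ^ g)%:R) ^+ m i)); first by rewrite lerXn2r ?nnegrE ?divr_ge0.
    rewrite expr_div_n ler_wpM2l ?exprn_ge0 // lef_pV2 ?posrE ?exprn_gt0 ?ltr0n ?expn_gt0 ?(ltnW Y1) //.
    by rewrite -{1}[(Y ^ g)%:R]expr1 ler_weXn2l // ler1n expn_gt0 (ltnW Y1).
  apply: le_trans (ler_wpM2r _ hm') _; first by rewrite divr_ge0 ?exprn_ge0.
  rewrite -mj exprD le_eqVlt; apply/orP; left; apply/eqP; field.
  by rewrite !expf_neq0 ?(gt_eqF Nr) //= pnatr_eq0 -lt0n expn_gt0 (ltnW Y1).
apply: le_trans (ler_sum _ bound) _.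
apply: (@le_trans _ _ (\sum_(i < k) (2 ^ k)%:R * ((Y ^ E)%:R / (Y ^ g)%:R / N%:R ^+ j))).
  by rewrite [leRHS](bigID P) /= lerDl sumr_ge0.
rewrite sumr_const card_ord -[_ *+ k]mulr_natl mulrA -natrM [in leLHS]mulrA.
rewrite ler_wpM2r ?invr_ge0 ?exprn_ge0 // mulrA -natrM.
rewrite ler_pdivrMr ?ltr0n ?expn_gt0 ?(ltnW Y1) // mulrC.
rewrite ler_pdivlMr ?ltr0n ?expn_gt0 ?(ltnW Y1) // -natrM ler_nat.
apply: (@leq_trans (Y ^ c0 * Y ^ E * Y ^ d)).
  rewrite leq_mul2r leq_mul2r; apply/orP; right; apply/orP; right; apply: Ypow_c0.
  by rewrite /c0 -!addnA leq_addr.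
by rewrite -!expnD Yle //; move: gE; lia.
Qed.

End Level.

(** Shifting by [h] moves the coefficient of index [j - 1] with slope [(j + 1) al_j], up to
    near-integers when [h] is a multiple of the denominator [q] of the higher coefficients. All
    shifted sums stay large, so [large_values] makes two of them nearly agree, which approximates
    [al_j] by a rational. *)
Lemma wp_step (j : 'I_k) E : (0 < j)%N -> wp j.+1 E -> exists E', wp j E'.
Proof.
move=> j0 hw.
(* [Y^b] shifts beat the threshold of [large_values], as [4 Y <= Y^3]; [Y^g] is the margin that
   keeps boundary and tail errors small; [Y^G] limits the length of the second orbit. *)
pose b := (1 + 6 * u + d * k)%N; pose g := (E + d + c0 + 3)%N; pose G := (E + 2 * b + g)%N.
pose E' := (G + b + c0 + E)%N.
exists E' => N Y al Y1 YN hJ hS.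
have Yr0 : 0 < Y%:R :> R by rewrite ltr0n ltnW.
have Yn0 : (0 < Y)%N by exact: ltnW.
have N0 : (0 < N)%N by apply: leq_trans YN; rewrite expn_gt0 Yn0.
have Nr : 0 < N%:R :> R by rewrite ltr0n.
have YE a : (a <= E')%N -> (Y ^ a <= N)%N.
  by move=> h; apply: leq_trans YN; rewrite leq_exp2l.
have [|q /andP[q0 qE] hq] := hw N Y al Y1 _ hJ hS; first by apply: YE; rewrite /E'; clear; lia.
pose D := (Y ^ d)%N; pose B := (Y ^ b)%N.
have D0 : 0 < D%:R :> R by rewrite ltr0n expn_gt0 Yn0.
have c0D m : (m <= c0)%N -> (m * Y <= D)%N.
  by move=> h; rewrite /D /d expnSr leq_mul2r Ypow_c0 ?orbT.
have D64 : (64 <= D)%N by apply: leq_trans (c0D 64 _); rewrite ?leq_pmulr // /c0 leq_addl.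
have ltj1 : (j.-1 < k)%N by apply: leq_ltn_trans (leq_pred j) (ltn_ord j).
pose j1 : 'I_k := Ordinal ltj1.
have jE : (j1.+1 = j)%N by rewrite /= prednK.
pose be := j.+1%:R * q%:R * al j.
have orbit w : (q * w * B * Y ^ g <= N)%N ->
    exists2 r : nat, (0 < r <= B)%N & exists z : int,
      `|r%:R * w%:R * be - z%:~R| <= 4 / D%:R / N%:R ^+ j.
  move=> hw'.
  pose pt (i : 'I_B.+1) := shift (q * (w * i)) al.
  have hi (i : 'I_B.+1) : (q * (w * i) * Y ^ g <= N)%N.
    apply: leq_trans hw'; rewrite leq_mul2r mulnA leq_mul2l.
    by rewrite -ltnS ltn_ord !orbT.
  have big (i : 'I_B.+1) : N%:R / (2 * Y)%:R <= nm (S N (pt i)).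
    apply: le_trans (nm_S_shift _ _ _).
    have h4 : (4 * Y * (q * (w * i)) <= N)%N.
      apply: leq_trans (hi i); rewrite mulnC leq_mul2l; apply/orP; right.
      apply: (@leq_trans (Y ^ 3)); last by rewrite leq_exp2l // /g; clear; lia.
      by rewrite expnSr leq_mul2r (@leq_exp2r 2 Y 2) // Y1 orbT.
    have : (4 * Y * (q * (w * i)))%:R <= N%:R :> R by rewrite ler_nat.
    move: hS; rewrite !natrM; set hh := q%:R * _; set s := nm _ => hs h4'.
    apply: (@le_trans _ _ (N%:R / Y%:R - 2 * hh)); last by rewrite lerD2r.
    rewrite lerBrDl -lerBrDr.
    have -> : N%:R / Y%:R - N%:R / (2 * Y%:R) = N%:R / (2 * Y%:R) :> R by field; rewrite gt_eqF.
    by rewrite ler_pdivlMr ?mulr_gt0 //; move: h4'; lra.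
  have Y20 : (0 < 2 * Y)%N by rewrite muln_gt0.
  have uD : (u < D)%N.
    apply: (@leq_trans (u.+1 * Y)); first by rewrite leq_pmulr.
    by apply: c0D; rewrite /c0; clear; lia.
  have YD : (32 * k * (2 * Y) <= D)%N.
    have -> : (32 * k * (2 * Y) = 64 * k * Y)%N by lia.
    by apply: c0D; rewrite /c0; clear; lia.
  have hB : Y%:R * (2 * (2 * Y)%:R) ^+ (2 * u) * D%:R ^+ k < B.+1%:R :> R.
    have -> : 2 * (2 * Y)%:R = (4 * Y)%:R :> R by rewrite !natrM; ring.
    rewrite -!natrX -!natrM ltr_nat ltnS /B (_ : b = (6 * u).+1 + d * k)%N //.
    rewrite [(Y ^ (_ + _))%N]expnD [(Y ^ (6 * u).+1)%N]expnS /D -expnM.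
    rewrite leq_mul2r; apply/orP; right; rewrite leq_mul2l; apply/orP; right.
    have -> : (6 * u = 3 * (2 * u))%N by lia.
    rewrite [(Y ^ (3 * _))%N]expnM; case: (posnP (2 * u)) => [->//|u0]; rewrite leq_exp2r //.
    by rewrite expnSr leq_mul2r (@leq_exp2r 2 Y 2) // Y1 orbT.
  have [i [i' [ii nn]]] := large_values N0 Y20 uD YD hJ big hB.
  have [z hz] := nn j1.
  have tl (i0 : 'I_B.+1) : exists z : int,
     `|\sum_(i < k | (j < i)%N) 'C(i.+1, j)%:R * (q * (w * i0))%:R ^+ (i - j1) * al i - z%:~R| <=
     (Y ^ d)%:R^-1 / N%:R ^+ j.
    apply: (@tail_integral N Y Y1 E g q (w * i0)) => //.
    - by rewrite /g leq_addr.
    - by move=> i2 _; apply: leq_trans (bin_le_pow2 _ _) _; rewrite leq_exp2l // ltn_ord.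
    - by move=> i2; rewrite -jE; split; lia.
  have [z1 hz1] := tl i; have [z2 hz2] := tl i'.
  exists (i' - i)%N.
    by rewrite subn_gt0 ii (leq_trans (leq_subr _ _)) // -ltnS ltn_ord.
  exists (z - z2 + z1).
  have E1 := @shift_top (q * (w * i)) al j j1 jE; have E2 := @shift_top (q * (w * i')) al j j1 jE.
  move: hz; rewrite /pt E1 E2 jE.
  set T1 := \sum_(_ < k | _) _ in hz1 *; set T2 := \sum_(_ < k | _) _ in hz2 *.
  have -> : 2 / D%:R / N%:R ^+ j = 2 * (D%:R^-1 / N%:R ^+ j) :> R by rewrite mulrA.
  have -> : 4 / D%:R / N%:R ^+ j = 4 * (D%:R^-1 / N%:R ^+ j) :> R by rewrite mulrA.
  rewrite -/D in hz1 hz2; set ep := D%:R^-1 / _ in hz1 hz2 * => hz.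
  have -> : (i' - i)%:R * w%:R * be - (z - z2 + z1)%:~R =
    ((al j1 + j.+1%:R * (q * (w * i'))%:R * al j + T2) -
     (al j1 + j.+1%:R * (q * (w * i))%:R * al j + T1) - z%:~R) -
     (T2 - z2%:~R) + (T1 - z1%:~R) :> R.
    by rewrite natrB ?(ltnW ii) // rmorphD rmorphB /= /be !natrM; ring.
  apply: le_trans (ler_normD _ _) _; have h3 := ler_normB
    ((al j1 + j.+1%:R * (q * (w * i'))%:R * al j + T2) -
     (al j1 + j.+1%:R * (q * (w * i))%:R * al j + T1) - z%:~R) (T2 - z2%:~R).
  by move: h3 hz hz1 hz2; lra.
(* The first orbit gives an error of order [1 / N^j] only; orbiting again with the long step [r1 L],
   [L] about [N / Y^G], gains the missing factor [N]. *)
have [|r1 /andP[r10 r1B] [z1 hz1]] := orbit 1%N.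
  rewrite muln1; apply: leq_trans (YE (E + b + g)%N _); last by rewrite /E' /G; clear; lia.
  by rewrite [(Y ^ (_ + g))%N]expnD [(Y ^ (E + b))%N]expnD leq_mul // leq_mul.
pose L := (N %/ Y ^ G)%N.
have YG : (Y ^ G <= N)%N by apply: YE; rewrite /E'; clear; lia.
have L0 : (0 < L)%N by rewrite divn_gt0 // expn_gt0 Yn0.
have [|r2 /andP[r20 r2B] [z2 hz2]] := orbit (r1 * L)%N.
  apply: leq_trans (leq_trunc_div N (Y ^ G)); rewrite -/L.
  have -> : (q * (r1 * L) * B * Y ^ g = L * (q * r1 * B * Y ^ g))%N by lia.
  rewrite leq_mul2l; apply/orP; right.
  have -> : (Y ^ G = Y ^ E * Y ^ b * Y ^ b * Y ^ g)%N.
    by rewrite -!expnD; congr (_ ^ _)%N; rewrite /G; clear; lia.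
  by rewrite !leq_mul.
set ga := r1%:R * be - z1%:~R.
rewrite mulr1 in hz1.
have gb : `|ga| <= 4 / D%:R / N%:R ^+ j by [].
have Lr : 0 < L%:R :> R by rewrite ltr0n.
have NL : L%:R <= N%:R / (Y ^ G)%:R :> R.
  by rewrite ler_pdivlMr ?ltr0n ?expn_gt0 ?Yn0 // -natrM ler_nat leq_trunc_div.
have NL2 : N%:R / (Y ^ G)%:R <= 2 * L%:R :> R.
  rewrite ler_pdivrMr ?ltr0n ?expn_gt0 ?Yn0 // -!natrM ler_nat.
  have := ltn_ceil N (_ : 0 < Y ^ G)%N; rewrite expn_gt0 Yn0 -/L => /(_ isT) h.
  apply: leq_trans (ltnW h) _; rewrite leq_mul2r; apply/orP; right.
  by rewrite mul2n -addnn -addn1 leq_add2l.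
have Nj : 1 <= N%:R ^+ j :> R by rewrite exprn_ege1 // ler1n.
have e4 : 4 / D%:R / N%:R ^+ j <= 16^-1 :> R.
  apply: (@le_trans _ _ (4 / D%:R)).
    by rewrite ler_pdivrMr ?exprn_gt0 // ler_peMr // divr_ge0.
  rewrite ler_pdivrMr //; have : 64 <= D%:R :> R by rewrite (ler_nat _ 64).
  by lra.
pose z3 := z2 - (r2 * L)%:Z * z1.
have hz3 : `|(r2 * L)%:R * ga - z3%:~R| <= 4 / D%:R / N%:R ^+ j.
  have -> : (r2 * L)%:R * ga - z3%:~R = r2%:R * (r1 * L)%:R * be - z2%:~R :> R.
    by rewrite /ga /z3 intrB intrM (_ : ((r2 * L)%N%:Z)%:~R = (r2 * L)%:R :> R) // !natrM; ring.
  exact: hz2.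
have small : `|(r2 * L)%:R * ga| <= 16^-1.
  rewrite normrM ger0_norm // natrM.
  apply: (@le_trans _ _ (B%:R * (N%:R / (Y ^ G)%:R) * (4 / D%:R / N%:R ^+ j))).
    apply: ler_pM; rewrite ?mulr_ge0 //; apply: ler_pM => //.
    by rewrite ler_nat.
  have h1 : B%:R / (Y ^ G)%:R <= 1 :> R.
    rewrite ler_pdivrMr ?ltr0n ?expn_gt0 ?Yn0 // mul1r ler_nat /B leq_exp2l // /G; clear; lia.
  have h2 : N%:R / N%:R ^+ j <= 1 :> R.
    rewrite ler_pdivrMr ?exprn_gt0 // mul1r -{1}[N%:R]expr1 ler_weXn2l // ler1n //.
  have h3 : 4 / D%:R <= 16^-1 :> R.
    rewrite ler_pdivrMr //; have : 64 <= D%:R :> R by rewrite (ler_nat _ 64).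
    by lra.
  have -> : B%:R * (N%:R / (Y ^ G)%:R) * (4 / D%:R / N%:R ^+ j) =
     (B%:R / (Y ^ G)%:R) * (N%:R / N%:R ^+ j) * (4 / D%:R) :> R by ring.
  apply: le_trans h3; rewrite ler_piMl ?divr_ge0 // mulr_ile1 ?divr_ge0 ?exprn_ge0 //.
have z30 : z3 = 0.
  have : `|z3%:~R| < 1 :> R.
    have -> : z3%:~R = (r2 * L)%:R * ga - ((r2 * L)%:R * ga - z3%:~R) :> R by ring.
    apply: le_lt_trans (ler_normB _ _) _; move: small (le_trans hz3 e4); lra.
  exact: int_lt1_eq0.
have gaE : `|ga| <= (Y ^ G)%:R / N%:R ^+ j.+1.
  move: hz3; rewrite z30 subr0 normrM ger0_norm // => h.
  have h1 : L%:R * `|ga| <= 4 / D%:R / N%:R ^+ j.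
    apply: le_trans h; rewrite ler_wpM2r // ler_nat leq_pmull //.
  have h2 : N%:R / (Y ^ G)%:R * `|ga| <= 8 / D%:R / N%:R ^+ j.
    have -> : 8 / D%:R / N%:R ^+ j = 2 * (4 / D%:R / N%:R ^+ j) :> R by ring.
    apply: le_trans (ler_wpM2r (normr_ge0 _) NL2) _; rewrite -(mulrA 2) ler_pM2l //.
  have h3 : 8 / D%:R <= 1 :> R.
    rewrite ler_pdivrMr //; have : 64 <= D%:R :> R by rewrite (ler_nat _ 64).
    by lra.
  rewrite exprSr; rewrite -ler_pdivlMl ?divr_gt0 ?ltr0n ?expn_gt0 ?Yn0 // in h2.
  apply: le_trans h2 _; rewrite invf_div.
  have -> : (Y ^ G)%:R / N%:R * (8 / D%:R / N%:R ^+ j) =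
    8 / D%:R * ((Y ^ G)%:R / (N%:R ^+ j * N%:R)) :> R.
    by field; rewrite expf_neq0 gt_eqF //= gt_eqF.
  by rewrite ler_piMl // divr_ge0 // mulr_ge0 ?exprn_ge0.
exists (r1 * j.+1 * q)%N.
  rewrite !muln_gt0 r10 q0 /=.
  apply: (@leq_trans (Y ^ b * Y ^ c0 * Y ^ E)); last first.
    by rewrite -!expnD leq_exp2l // /E'; clear; lia.
  rewrite !leq_mul //; apply: Ypow_c0 => //; apply: leq_trans (ltn_ord j) _.
  by rewrite /c0; clear; lia.
move=> i; rewrite leq_eqVlt => /orP[/eqP/ord_inj <-|ji].
  exists z1; have -> : (r1 * j.+1 * q)%:R * al j - z1%:~R = ga.
    by rewrite /ga /be !natrM; ring.
  apply: le_trans gaE _; rewrite ler_wpM2r ?invr_ge0 ?exprn_ge0 // ler_nat leq_exp2l //.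
  by rewrite /E'; clear; lia.
have [z hz] := hq i ji; exists ((r1 * j.+1)%:Z * z).
have -> : (r1 * j.+1 * q)%:R * al i - ((r1 * j.+1)%:Z * z)%:~R =
   (r1 * j.+1)%:R * (q%:R * al i - z%:~R) :> R.
  by rewrite intrM (_ : ((r1 * j.+1)%N%:Z)%:~R = (r1 * j.+1)%:R :> R) // [in LHS]natrM; ring.
rewrite normrM ger0_norm //.
apply: le_trans (ler_wpM2l (ler0n _ _) hz) _; rewrite mulrA -natrM.
rewrite ler_wpM2r ?invr_ge0 ?exprn_ge0 // ler_nat.
apply: (@leq_trans (Y ^ b * Y ^ c0 * Y ^ E)); last first.
  by rewrite -!expnD leq_exp2l // /E'; clear; lia.
rewrite !leq_mul //; apply: Ypow_c0 => //; apply: leq_trans (ltn_ord j) _.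
by rewrite /c0; clear; lia.
Qed.

(** For [j = 0] no lower coefficient records the shift, but the constant phase does. Shifting by
    multiples [h] of [q] hardly changes the coefficients modulo 1, so [e (phi al h)] must be near 1,
    and [phi al h] is [h al_0] up to near-integers. *)
Lemma wp_last (o : 'I_k) E : o = 0%N :> nat -> wp 1 E -> exists E', wp 0 E'.
Proof.
move=> o0 hw; pose g := (E + d + c0)%N; pose E' := (E + g)%N.
exists E' => N Y al Y1 YN hJ hS.
have Yn0 : (0 < Y)%N by exact: ltnW.
have Yr0 : 0 < Y%:R :> R by rewrite ltr0n.
have N0 : (0 < N)%N by apply: leq_trans YN; rewrite expn_gt0 Yn0.
have Nr : 0 < N%:R :> R by rewrite ltr0n.
have [|q /andP[q0 qE] hq] := hw N Y al Y1 _ hJ hS.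
  by apply: leq_trans YN; rewrite leq_exp2l // leq_addr.
have DY : (8 * (8 * k + 8) * Y <= Y ^ d)%N.
  rewrite /d expnSr leq_mul2r; apply/orP; right; apply: Ypow_c0 => //.
  by rewrite /c0; clear; lia.
have D0 : 0 < (Y ^ d)%:R :> R by rewrite ltr0n expn_gt0 Yn0.
have key w : (0 < w)%N -> (q * w * Y ^ g <= N)%N -> nm (e (w%:R * (q%:R * al o)) - 1) < 1.
  move=> w0 hN; set h := (q * w)%N.
  have nr : near1 N (Y ^ d)%:R^-1 (shift h al) al.
    move=> j.
    have -> : shift h al j - al j =
       \sum_(i < k | (j < i)%N) 'C(i.+1, j.+1)%:R * h%:R ^+ (i - j) * al i.
      rewrite /shift (bigD1 j) //= binn subnn expr0 !mul1r [al j + _]addrC addrK.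
      by apply: eq_bigl => i; rewrite ltn_neqAle andbC eq_sym.
    apply: (@tail_integral N Y Y1 E g q w) => //.
    - by move=> i ji; apply: hq; apply: leq_ltn_trans ji.
    - by move=> i _; apply: leq_trans (bin_le_pow2 _ _) _; rewrite leq_exp2l // ltn_ord.
    - by move=> i; split; lia.
  have [z hz] : exists z : int,
     `|\sum_(i < k | (0 < i)%N) 1%:R * h%:R ^+ i.+1 * al i - z%:~R| <= (Y ^ d)%:R^-1 / N%:R ^+ 0.
    apply: (@tail_integral N Y Y1 E g q w) => //.
    - by move=> i _; rewrite expn_gt0.
    - by move=> i _; rewrite addn0.
  have phiE : phi al h%:Z = h%:R * al o + \sum_(i < k | (0 < i)%N) 1%:R * h%:R ^+ i.+1 * al i.
    rewrite /phi (bigD1 o) //= o0 expr1 mulrC; congr (_ + _).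
    apply: eq_big => [i|i _]; last by rewrite mul1r mulrC.
    by rewrite -(inj_eq val_inj) /= o0 lt0n.
  have s1 : nm (e (w%:R * (q%:R * al o)) - e (phi al h%:Z)) <= 8 * (Y ^ d)%:R^-1.
    rewrite -[X in nm (X - _)](eDint _ z); apply: le_trans (e_lip _ _) _; rewrite ler_pM2l //.
    move: hz; rewrite expr0 divr1 phiE distrC /h natrM => hz; apply: le_trans hz; rewrite le_eqVlt.
    apply/orP; left; apply/eqP; congr (`|_|); ring.
  have s2 := near_S N0 nr; have s3 := S_shift_near h al N.
  (* Multiplying by [N / Y], at most the modulus of the sum, reduces the claim to a bound for
     [(A - 1) T], which splits into controlled differences. *)
  rewrite -subr_gt0 -(pmulr_rgt0 _ (divr_gt0 Nr Yr0)) mulrBr mulr1 subr_gt0.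
  apply: le_lt_trans (ler_wpM2r (nm_ge0 _) hS) _; rewrite mulrC -nmM.
  have hY : h%:R * (Y ^ d)%:R <= N%:R :> R.
    rewrite -natrM ler_nat; apply: leq_trans hN; rewrite leq_mul2l leq_exp2l // /g; clear; lia.
  set A := e _ in s1 *; set B := e (phi _ _) in s1 s3 *; set T := S N al in s2 s3 *.
  set T' := S N _ in s2 s3.
  have -> : (A - 1) * T = (A - B) * T + (B * (T - T') + (B * T' - T)) by ring.
  apply: le_lt_trans (nmD _ _) _; have := nmD (B * (T - T')) (B * T' - T).
  rewrite !nmM nm_e mul1r [nm (T - T')]nmB => s4.
  have s5 : nm (A - B) * nm T <= 8 * (Y ^ d)%:R^-1 * N%:R.
    apply: ler_pM; rewrite ?nm_ge0 //; apply: le_trans (nm_esum _ _) _.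
    by rewrite card_ord.
  apply: (@le_lt_trans _ _ (N%:R * (8 * k + 8 + 2)%:R / (Y ^ d)%:R)).
    have h2 : h%:R <= N%:R / (Y ^ d)%:R :> R by rewrite ler_pdivlMr.
    move: s2 s3 s4 s5 h2; rewrite !natrD natrM; set vv := (Y ^ d)%:R^-1.
    set x1 := nm _; set x2 := nm _; set x3 := nm _; set x4 := _ * nm _; nra.
  rewrite ltr_pdivrMr // -mulrA ltr_pM2l // mulrC ltr_pdivlMr // -natrM ltr_nat.
  apply: leq_trans DY; rewrite ltn_mul2r Yn0 /=; clear; lia.
pose H := (N %/ Y ^ E')%N.
have YG0 : (0 < Y ^ E')%N by rewrite expn_gt0 Yn0.
have H0 : (0 < H)%N by rewrite divn_gt0.
have [|z hz] := @small_multiples (q%:R * al o) H H0.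
  move=> w /andP[w0 wH]; have [|z hz] := @e_near R (w%:R * (q%:R * al o)); last by exists z.
  apply: key => //; apply: leq_trans (leq_trunc_div N (Y ^ E')); rewrite -/H mulnC [(Y ^ E')%N]expnD.
  have -> : (H * (Y ^ E * Y ^ g) = Y ^ g * (Y ^ E * H))%N by lia.
  by rewrite leq_mul2l leq_mul ?orbT.
exists q; first by rewrite q0 (leq_trans qE) // leq_exp2l // leq_addr.
move=> i _; case: (posnP i) => [i0|i1].
  have -> : i = o by apply: val_inj; rewrite /= o0.
  exists z; apply: le_trans hz _; rewrite o0 expr1.
  rewrite ler_pdivlMr // ler_pdivrMl ?mulr_gt0 ?ltr0n // -!natrM ler_nat.
  have := ltn_ceil N YG0; rewrite -/H => h.
  apply: leq_trans (ltnW h) _; rewrite leq_mul2r; apply/orP; right; lia.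
have [z1 hz1] := hq i i1; exists z1; apply: le_trans hz1 _.
by rewrite ler_wpM2r ?invr_ge0 ?exprn_ge0 // ler_nat leq_exp2l // leq_addr.
Qed.

Theorem weyl : exists E, wp 0 E.
Proof.
have st j : (j <= k)%N -> (0 < k - j)%N \/ k = 0%N -> exists E, wp (k - j) E.
  elim: j => [|j IH] jk h; first by rewrite subn0; exists 0%N; exact: wp_top.
  have [E hE] := IH (ltnW jk) (or_introl (ltac:(lia) : (0 < k - j)%N)).
  have lt : (k - j.+1 < k)%N by lia.
  apply: (@wp_step (Ordinal lt) E); first by case: h => //= h; lia.
  by rewrite /= subnSK.
have [k0|k0] := posnP k; first by exists 0%N; rewrite -[X in wp X]k0; exact: wp_top.
have [] := st k.-1; [by lia|by left; lia|move=> E hE].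
apply: (@wp_last (Ordinal k0) E) => //.
by have -> : 1%N = (k - k.-1)%N by lia.
Qed.

End Weyl.

(** * Removal of the eps-loss *)

Section Dilation.
Variables (R : realType) (k : nat).
Local Notation C := R[i].
Local Notation e := (@e R).
Local Notation S := (@S R k).
Implicit Types (al be : 'I_k -> R).

Lemma sum_blocks (F : nat -> C) L m :
  \sum_(x < L * m) F x = \sum_(i < m) \sum_(y < L) F (L * i + y)%N.
Proof.
elim: m => [|m IH]; first by rewrite muln0 !big_ord0.
by rewrite mulnSr big_split_ord big_ord_recr /= IH.
Qed.

(** On a block of [q l] terms [v] is nearly constant, so the block sum is [l] complete sums of [u]
    times one value of [v]; the incomplete last block costs [q l]. *)
Lemma block_approx (u v v0 : nat -> C) q l n eta : (0 < q * l)%N -> 0 <= eta ->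
  (forall x, u (x + q)%N = u x) -> (forall x, nm (u x) <= 1) -> (forall x, nm (v x) <= 1) ->
  (forall i y, (y < q * l)%N -> (q * l * i + y < n)%N ->
     nm (v (q * l * i + y)%N - v0 i) <= eta) ->
  nm (\sum_(x < n) u x * v x - l%:R * (\sum_(x < q) u x) * \sum_(i < n %/ (q * l)) v0 i) <=
  n%:R * eta + (q * l)%:R.
Proof.
move=> L0 e0 per nu nv app; set L := (q * l)%N in L0 app *; set m := (n %/ L)%N.
have peri x i : u (x + q * i)%N = u x.
  by elim: i => [|i IH]; rewrite ?muln0 ?addn0 // mulnSr addnA per.
have -> : l%:R * (\sum_(x < q) u x) = \sum_(x < L) u x.
  rewrite [RHS]sum_blocks [RHS](eq_bigr (fun=> \sum_(x < q) u x)) => [|i _].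
    by rewrite sumr_const card_ord mulr_natl.
  by apply: eq_bigr => y _; rewrite addnC peri.
have nE : n = (L * m + n %% L)%N by rewrite mulnC -divn_eq.
rewrite [in \sum_(x < n) _]nE big_split_ord /= addrAC.
apply: le_trans (nmD _ _) _; apply: lerD; last first.
  apply: le_trans (nm_sum _ _ _) _.
  apply: (@le_trans _ _ (\sum_(i < n %% L) 1)).
    by apply: ler_sum => i _; rewrite nmM mulr_ile1 ?nm_ge0.
  by rewrite sumr_const card_ord ler_nat ltnW // ltn_pmod.
rewrite (sum_blocks (fun x => u x * v x)) mulr_sumr -sumrB.
apply: le_trans (nm_sum _ _ _) _.
apply: (@le_trans _ _ (\sum_(i < m) L%:R * eta)); last first.
  rewrite sumr_const card_ord -[_ *+ m]mulr_natl mulrA ler_wpM2r // -natrM ler_nat.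
  by rewrite [X in (_ <= X)%N]nE mulnC leq_addr.
apply: ler_sum => i _; rewrite mulr_suml -sumrB; apply: le_trans (nm_sum _ _ _) _.
rewrite -[L in L%:R]card_ord mulr_natl -sumr_const; apply: ler_sum => y _.
have -> : u (L * i + y)%N = u y by rewrite addnC /L -mulnA peri.
rewrite -mulrBr nmM; apply: le_trans (ler_wpM2r (nm_ge0 _) (nu _)) _; rewrite mul1r.
apply: app => //; rewrite [X in (_ < X)%N]nE.
apply: (@leq_trans (L * i.+1)); first by rewrite mulnSr ltn_add2l.
by apply: leq_trans (leq_addr _ _); rewrite leq_mul2l ltn_ord orbT.
Qed.

Lemma pow_diff_le (x y b : R) n : 0 <= x <= b -> 0 <= y <= b ->
  `|x ^+ n.+1 - y ^+ n.+1| <= n.+1%:R * b ^+ n * `|x - y|.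
Proof.
move=> /andP[x0 xb] /andP[y0 yb]; rewrite subrXX normrM mulrC ler_wpM2r //.
apply: le_trans (ler_norm_sum _ _ _) _; rewrite mulr_natl -[X in _ *+ X](card_ord n.+1) -sumr_const.
apply: ler_sum => i _; rewrite ger0_norm ?mulr_ge0 ?exprn_ge0 //.
have -> : b ^+ n = b ^+ (n - i) * b ^+ i.
  by rewrite -exprD subnK // -ltnS.
by rewrite ler_pM ?exprn_ge0 // lerXn2r ?nnegrE ?(le_trans x0 xb).
Qed.

Lemma phi_lip be (B : R) N x y : (0 < N)%N -> 0 <= B ->
  (forall j, `|be j| <= B / N%:R ^+ j.+1) -> (x <= N)%N -> (y <= N)%N ->
  `|phi be x%:Z - phi be y%:Z| <= (k * k)%:R * B / N%:R * `|x%:R - y%:R|.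
Proof.
move=> N0 B0 hb xN yN; have Nr : 0 < N%:R :> R by rewrite ltr0n.
rewrite /phi -sumrB; apply: le_trans (ler_norm_sum _ _ _) _.
apply: (@le_trans _ _ (\sum_(j < k) k%:R * B / N%:R * `|x%:R - y%:R|)); last first.
  by rewrite sumr_const card_ord -[leLHS]mulr_natl natrM !mulrA.
apply: ler_sum => j _; rewrite -mulrBr normrM.
have h := @pow_diff_le x%:R y%:R N%:R j.
apply: le_trans (ler_pM _ _ (hb j) (h _ _)) _; rewrite ?ler0n ?ler_nat //.
have -> : B / N%:R ^+ j.+1 * (j.+1%:R * N%:R ^+ j * `|x%:R - y%:R|) =
   j.+1%:R * B / N%:R * `|x%:R - y%:R|.
  by rewrite exprSr; field; rewrite expf_neq0 gt_eqF.
by rewrite ler_wpM2r // ler_wpM2r ?invr_ge0 // ler_wpM2r // ler_nat.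
Qed.

Lemma phi_dil p be (x : nat) :
  phi (fun j => p%:R ^+ j.+1 * be j) x%:Z = phi be (p * x)%N%:Z.
Proof.
apply: eq_bigr => j _; rewrite -[((p * x)%N%:Z)%:~R]/((p * x)%:R) -[(x%:Z)%:~R]/(x%:R).
by rewrite natrM exprMn; ring.
Qed.

Lemma phiD al be x : phi (fun j => al j + be j) x = phi al x + phi be x.
Proof. by rewrite /phi -big_split; apply: eq_bigr => j _; rewrite mulrDl. Qed.

Lemma e_phi_periodic (c : 'I_k -> int) q (x : nat) : (0 < q)%N ->
  e (phi (fun j => (c j)%:~R / q%:R) (x + q)%N%:Z) = e (phi (fun j => (c j)%:~R / q%:R) x%:Z).
Proof.
move=> q0; have qr : q%:R != 0 :> R by rewrite pnatr_eq0 -lt0n.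
pose Z (j : 'I_k) : int := \sum_(i < j.+1) (x + q)%N%:Z ^+ (j.+1.-1 - i) * x%:Z ^+ i.
rewrite -[RHS](eDint _ (\sum_j c j * Z j)); congr e.
rewrite rmorph_sum /= /phi -big_split; apply: eq_bigr => j _ /=.
have E : (x + q)%N%:Z ^+ j.+1 = x%:Z ^+ j.+1 + q%:Z * Z j.
  have := subrXX (x + q)%N%:Z x%:Z j.+1; rewrite -/(Z j) {2}PoszD addrAC subrr add0r.
  by move/eqP; rewrite subr_eq addrC => /eqP.
have -> : (((x + q)%N%:Z)%:~R : R) ^+ j.+1 = (x%:Z)%:~R ^+ j.+1 + q%:R * (Z j)%:~R.
  by rewrite -rmorphXn /= E rmorphD rmorphM rmorphXn.
by rewrite rmorphM /=; field.
Qed.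

(** Both sums are compared with the same main term [W]: a complete sum modulo [q] times a sum of the
    smooth part over the points [p q i]. The long sum uses blocks of length [q p], the short one
    blocks of length [q]. *)
Lemma S_dilate p N q Q (c : 'I_k -> int) al : (0 < p)%N -> (0 < N)%N -> (0 < q <= Q)%N ->
  (forall j, `|q%:R * al j - (c j)%:~R| <= Q%:R / (p * N)%:R ^+ j.+1) ->
  nm (S (p * N) al / (p * N)%:R -
      S N (fun j => (c j)%:~R / q%:R + p%:R ^+ j.+1 * (al j - (c j)%:~R / q%:R)) / N%:R) <=
  ((16 * (k * k) + 2) * Q)%:R / N%:R.
Proof.
move=> p0 N0 /andP[q0 qQ] hc.
have qr : 0 < q%:R :> R by rewrite ltr0n.
have Nr : 0 < N%:R :> R by rewrite ltr0n.
have pr : 0 < p%:R :> R by rewrite ltr0n.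
pose be j := al j - (c j)%:~R / q%:R.
pose u (x : nat) := e (phi (fun j => (c j)%:~R / q%:R) x%:Z).
have hb j : `|be j| <= (Q%:R / q%:R) / (p * N)%:R ^+ j.+1.
  have -> : be j = (q%:R * al j - (c j)%:~R) / q%:R by rewrite /be; field; rewrite gt_eqF.
  by rewrite normrM normfV (ger0_norm (ltW qr)) [leRHS]mulrAC ler_wpM2r ?invr_ge0.
have lip x y : (x <= p * N)%N -> (y <= p * N)%N -> (x <= y + p * q)%N -> (y <= x)%N ->
    nm (e (phi be x%:Z) - e (phi be y%:Z)) <= 8 * ((k * k)%:R * Q%:R / N%:R).
  move=> xN yN xy yx; apply: le_trans (e_lip _ _) _; rewrite ler_pM2l //.
  apply: le_trans (phi_lip _ _ hb xN yN) _; rewrite ?muln_gt0 ?p0 ?divr_ge0 //.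
  have hxy : `|x%:R - y%:R| <= (p * q)%:R :> R.
    by rewrite -natrB // ger0_norm // ler_nat leq_subLR.
  apply: le_trans (ler_wpM2l _ hxy) _; first by rewrite divr_ge0 // mulr_ge0 // divr_ge0.
  rewrite !natrM le_eqVlt; apply/orP; left; apply/eqP; field.
  by rewrite !gt_eqF.
pose W := (\sum_(x < q) u x) * \sum_(i < N %/ q) e (phi be (p * (q * i))%N%:Z).
set eta := 8 * _ in lip.
have eta0 : 0 <= eta by rewrite mulr_ge0 // divr_ge0 // mulr_ge0.
have nu x : nm (u x) <= 1 by rewrite nm_e.
have per x : u (x + q)%N = u x by exact: e_phi_periodic.
have h1 : nm (S (p * N) al - p%:R * W) <= (p * N)%:R * eta + (q * p)%:R.
  have -> : S (p * N) al = \sum_(x < p * N) u x * e (phi be x%:Z).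
    apply: eq_bigr => x _; rewrite /u -eD -phiD; congr (e (phi _ _)).
    by apply: boolp.funext => j; rewrite /be addrC subrK.
  have -> : p%:R * W = p%:R * (\sum_(x < q) u x) *
     \sum_(i < (p * N) %/ (q * p)) e (phi be (q * p * i)%N%:Z).
    have -> : ((p * N) %/ (q * p) = N %/ q)%N by rewrite [(q * p)%N]mulnC divnMl.
    rewrite /W -mulrA; congr (_ * (_ * _)).
    by apply: eq_bigr => i _; rewrite mulnA [(q * p)%N]mulnC.
  apply: (@block_approx u (fun x => e (phi be x%:Z)) (fun i => e (phi be (q * p * i)%N%:Z))) => //.
  - by rewrite muln_gt0 q0.
  - by move=> x; rewrite nm_e.
  - move=> i y yq lt; apply: lip; [exact: ltnW| |by rewrite [(p * q)%N]mulnC leq_add2l ltnW|exact: leq_addr].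
    by apply: leq_trans (ltnW lt); rewrite leq_addr.
have h2 : nm (S N (fun j => (c j)%:~R / q%:R + p%:R ^+ j.+1 * be j) - W) <= N%:R * eta + q%:R.
  have -> : S N (fun j => (c j)%:~R / q%:R + p%:R ^+ j.+1 * be j) =
      \sum_(x < N) u x * e (phi be (p * x)%N%:Z).
    by apply: eq_bigr => x _; rewrite /u -eD -phi_dil -phiD.
  have := @block_approx u (fun x => e (phi be (p * x)%N%:Z))
    (fun i => e (phi be (p * (q * i))%N%:Z)) q 1 N eta.
  rewrite !muln1 mul1r; apply => //.
  - by move=> x; rewrite nm_e.
  - move=> i y yq lt; apply: lip; rewrite ?leq_mul2l ?(ltnW lt) ?orbT //.
    + by apply/orP; right; apply: leq_trans (ltnW lt); rewrite leq_addr.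
    + by rewrite mulnDr leq_add2l leq_mul2l ltnW ?orbT.
    + by rewrite leq_addr orbT.
set S1 := S (p * N) al in h1 *; set S2 := S N _ in h2 *.
have -> : S1 / (p * N)%:R - S2 / N%:R = (S1 - p%:R * W) / (p * N)%:R - (S2 - W) / N%:R.
  have Nc : N%:R != 0 :> C by rewrite pnatr_eq0 -lt0n.
  have pc : p%:R != 0 :> C by rewrite pnatr_eq0 -lt0n.
  by rewrite natrM; field; rewrite Nc pc.
apply: le_trans (nmD _ _) _; rewrite nmN !nmM !nmV !nm_natr.
apply: (@le_trans _ _ (((p * N)%:R * eta + (q * p)%:R) / (p * N)%:R + (N%:R * eta + q%:R) / N%:R)).
  by apply: lerD; rewrite ler_wpM2r ?invr_ge0.
have -> : ((p * N)%:R * eta + (q * p)%:R) / (p * N)%:R + (N%:R * eta + q%:R) / N%:R =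
   (16 * ((k * k)%:R * Q%:R) + 2 * q%:R) / N%:R.
  by rewrite /eta !natrM; field; rewrite !gt_eqF.
rewrite ler_wpM2r ?invr_ge0 //.
have -> : ((16 * (k * k) + 2) * Q)%:R = 16 * ((k * k)%:R * Q%:R) + 2 * Q%:R :> R.
  by rewrite natrM natrD (natrM _ 16); ring.
by rewrite lerD2l ler_pM2l // ler_nat.
Qed.

End Dilation.

(** Fractions [c / q] and [c' / q'] that differ modulo 1 do so by at least [1 / (q q')], more than
    the dilated errors can bridge. Otherwise [P (B - B') + r - r' = 0], and remainders below [P] are
    determined. *)
Lemma dilation_inj (M m m' q q' P a a' r r' : nat) (c c' B B' w : int) :
  (0 < q)%N -> (0 < q')%N -> (M = q * m)%N -> (M = q' * m')%N ->
  a%:Z = c * m%:Z + B -> a'%:Z = c' * m'%:Z + B' ->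
  (a < M)%N -> (a' < M)%N -> (r < P)%N -> (r' < P)%N ->
  (c * m%:Z + P%:Z * B + r%:Z) - (c' * m'%:Z + P%:Z * B' + r'%:Z) = w * M%:Z ->
  (q * q')%:Z * `|P%:Z * (B - B') + (r%:Z - r'%:Z)| < M%:Z ->
  a = a' /\ r = r'.
Proof.
move=> q0 q0' Mq Mq' aE aE' aM aM' rP rP' hw small.
pose V := P%:Z * (B - B') + (r%:Z - r'%:Z).
have DV : c * m%:Z - c' * m'%:Z + V = w * M%:Z by rewrite -hw /V; ring.
have mult : (q * q')%:Z * V = M%:Z * (w * (q * q')%:Z - (c * q'%:Z - c' * q%:Z)).
  have e1 : q%:Z * m%:Z = M%:Z by rewrite Mq.
  have e2 : q'%:Z * m'%:Z = M%:Z by rewrite Mq'.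
  have -> : V = w * M%:Z - (c * m%:Z - c' * m'%:Z) by rewrite -DV; ring.
  have -> : M%:Z * (w * (q * q')%:Z - (c * q'%:Z - c' * q%:Z)) =
     w * (q * q')%:Z * M%:Z - (c * q'%:Z * M%:Z - c' * q%:Z * M%:Z) by ring.
  by rewrite -{3}e1 -{3}e2 PoszM; ring.
have V0 : V = 0.
  have M0 : 0 < M%:Z by rewrite ltz_nat; exact: leq_ltn_trans aM.
  have : `|M%:Z * (w * (q * q')%:Z - (c * q'%:Z - c' * q%:Z))| < M%:Z.
    by rewrite -mult normrM ger0_norm.
  rewrite normrM (ger0_norm (ltW M0)) -{2}[M%:Z]mulr1 ltr_pM2l // => h.
  have h0 : w * (q * q')%:Z - (c * q'%:Z - c' * q%:Z) = 0 by move: h; set z := _ - _; clear; lia.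
  move: mult; rewrite h0 mulr0 => /eqP; rewrite mulf_eq0 => /orP[|/eqP//].
  by move=> /eqP[] /eqP; rewrite muln_eq0 !eqn0Ngt q0 q0'.
have [BB rr] : B = B' /\ r = r'.
  have P0 : (0 < P)%N by exact: leq_ltn_trans rP.
  have h : P%:Z * (B - B') = r'%:Z - r%:Z by move: V0; rewrite /V; clear; lia.
  have BB : B - B' = 0.
    have : `|P%:Z * (B - B')| < P%:Z by rewrite h; move: rP rP'; clear; lia.
    rewrite normrM ger0_norm // -{2}[P%:Z]mulr1 ltr_pM2l ?ltz_nat //.
    by set z := _ - _; clear; lia.
  split; first by move: BB; clear; lia.
  by move: h; rewrite BB mulr0; clear; lia.
split => //; have E1 : a%:Z - a'%:Z = w * M%:Z by rewrite -DV aE aE' V0 BB; ring.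
have M0 : 0 < M%:Z by rewrite ltz_nat; exact: leq_ltn_trans aM.
have : `|w * M%:Z| < M%:Z by rewrite -E1; move: aM aM'; clear; lia.
rewrite normrM (ger0_norm (ltW M0)) -{2}[M%:Z]mul1r ltr_pM2r // => h.
have w0 : w = 0 by move: h; clear; lia.
by move: E1; rewrite w0 mul0r; clear; lia.
Qed.

Lemma pow_lip1 (R : realType) (x y : R) n : 0 <= x <= 1 -> 0 <= y <= 1 ->
  x ^+ n <= y ^+ n + n%:R * `|x - y|.
Proof.
case: n => [|n] hx hy; first by rewrite !expr0 mul0r addr0.
have := pow_diff_le n hx hy; rewrite expr1n mulr1 => h.
by rewrite -lerBlDl; apply: le_trans (ler_norm _) h.
Qed.

Lemma dilation_alg (F : fieldType) (c M q P a r w : F) : q != 0 -> M != 0 ->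
  (c * (M / q) + P * (M * (a / M - c / q)) + r - w * M) / M -
  (c / q + P * (a / M - c / q)) - - w = r / M.
Proof. by move=> q0 M0; field; rewrite q0 M0. Qed.

(** * Comparing the moments of lengths [p N] and [N] *)

Section DilationStep.
Variables (R : realType) (k t p N Y E : nat).
Local Notation C := R[i].
Local Notation S := (@S R k).
Local Notation K := (kap k).
Hypotheses (p0 : (0 < p)%N) (N0 : (0 < N)%N) (Kt : (K < t)%N).
Hypotheses (Y1 : (1 < Y)%N) (hE : (Y ^ E <= p * N)%N).
Hypothesis hJ : (Jn k K (p * N))%:R <= Y%:R * ((p * N) ^ (2 * K))%:R / ((p * N) ^ K)%:R :> R.
Hypothesis hw : wp R k K 0 E.
Let Q := (Y ^ E)%N.
Hypothesis sep : (4 * Q ^ 3 < N)%N.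
Let N' := (p * N)%N.
(** [Q!] makes every [c / q] with [q <= Q] a grid point; the other factors make [M] exceed the
    counts and spacings involved. *)
Let M := (Q`! * (4 * Q ^ 2 * (t + K + 1)) * N' ^ k.+1)%N.

Let Q0 : (0 < Q)%N. Proof. by rewrite expn_gt0 ltnW. Qed.
Let N'0 : (0 < N')%N. Proof. by rewrite muln_gt0 p0. Qed.
Let M1 : (4 * Q ^ 2 * (t + K + 1) * N' ^ k.+1 <= M)%N.
Proof. by rewrite leq_mul2r leq_pmull ?orbT // fact_gt0. Qed.
Let Ml a : (a <= N' ^ k.+1)%N -> (4 * Q ^ 2 * a <= M)%N.
Proof.
move=> h; apply: leq_trans M1; rewrite leq_mul // -[X in (X <= _)%N]muln1 leq_mul //.
by rewrite addn1.
Qed.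
Let Mt a : (a <= t + K)%N -> (a * N' ^ k < M)%N.
Proof.
move=> h; apply: leq_trans M1; apply: (@leq_trans ((t + K + 1) * N' ^ k)).
  by rewrite ltn_mul2r expn_gt0 N'0 /= addn1 ltnS.
apply: leq_mul; last by rewrite leq_pexp2l.
by rewrite leq_pmull // muln_gt0 expn_gt0 Q0.
Qed.
Let M0 : (0 < M)%N. Proof. exact: leq_ltn_trans (Mt (leq0n _)). Qed.
Let qM q : (0 < q <= Q)%N -> (M = q * (M %/ q))%N.
Proof.
by move=> h; rewrite mulnC divnK // /M !dvdn_mulr // dvdn_fact.
Qed.

Local Notation grid := {ffun 'I_k -> 'I_M}.
Let nS n (a : grid) : R := nm (S n (gpt R a)) / n%:R.
Let nS01 n a : (0 < n)%N -> 0 <= nS n a <= 1.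
Proof.
move=> n0; rewrite /nS divr_ge0 ?nm_ge0 //= ler_pdivrMr ?ltr0n // mul1r.
by apply: le_trans (nm_esum _ _) _; rewrite card_ord.
Qed.
Let X : pred grid := fun a => Y%:R^-1 <= nS N' a.

Let approx : exists qc : grid -> nat * ('I_k -> int), forall a, X a ->
  (0 < (qc a).1 <= Q)%N /\
  forall j, `|(qc a).1%:R * gpt R a j - ((qc a).2 j)%:~R| <= Q%:R / N'%:R ^+ j.+1.
Proof.
suff H : forall a, exists qc : nat * ('I_k -> int), X a -> (0 < qc.1 <= Q)%N /\
    forall j, `|qc.1%:R * gpt R a j - (qc.2 j)%:~R| <= Q%:R / N'%:R ^+ j.+1.
  by have [qc hqc] := boolp.choice H; exists qc.
move=> a; have [Xa|] := boolP (X a); last by exists (0%N, fun=> 0).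
have [|q hq hz] := hw (al := gpt R a) Y1 hE hJ.
  move: Xa; rewrite /X /nS ler_pdivlMr ?ltr0n // mulrC; exact.
have [c hc] := boolp.choice (fun i : 'I_k => hz i isT).
by exists (q, c).
Qed.

Let moment_nS n u : (0 < n)%N -> Eav M (fun al : 'I_k -> R => nm (S n al) ^+ (2 * u)) =
  (\sum_a nS n a ^+ (2 * u)) / (M ^ k)%:R * n%:R ^+ (2 * u).
Proof.
move=> n0; rewrite /Eav [RHS]mulrAC [in RHS]mulr_suml; congr (_ / _); apply: eq_bigr => a _.
by rewrite /nS expr_div_n divfK // expf_neq0 // pnatr_eq0 -lt0n.
Qed.

Let momK : (\sum_a nS N' a ^+ (2 * K)) / (M ^ k)%:R <= Y%:R / N'%:R ^+ K.
Proof.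
have := @moment_S_le R k N' K M (Mt (leq_addl _ _)); rewrite moment_nS // => h.
rewrite -(ler_pM2r (exprn_gt0 (2 * K) (_ : 0 < N'%:R))) ?ltr0n //.
apply: le_trans h _; apply: le_trans hJ _; rewrite -!natrX -/N' le_eqVlt.
by apply/orP; left; apply/eqP; rewrite mulrAC.
Qed.

(** Dilation multiplies coordinate [j] by [p^(j+1)] and leaves gaps of that many grid steps; these
    offsets fill them, [p^K] for each major point. *)
Let Fam : pred {ffun 'I_k -> 'I_(p ^ k)} := family (fun j : 'I_k => [pred x : 'I_(p ^ k) | (x < p ^ j.+1)%N]).

Let cardFam : #|Fam| = (p ^ K)%N.
Proof.
rewrite card_family foldrE big_map big_enum /=.
have -> : (p ^ K = \prod_(j < k) p ^ j.+1)%N.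
  clear; elim: k => [|m IH]; first by rewrite big_ord0.
  rewrite big_ord_recr /= -IH -expnD; congr (_ ^ _)%N; apply/eqP.
  by rewrite -(eqn_pmul2l (isT : 0 < 2)%N) mulnDr !kap2; apply/eqP; lia.
apply: eq_bigr => j _; have : (p ^ j.+1 <= p ^ k)%N by rewrite leq_pexp2l.
rewrite -sum1_card; move: (p ^ j.+1)%N => q qk.
rewrite (eq_bigl (fun i : 'I_(p ^ k) => (i < q)%N)) //.
by rewrite (big_ord_narrow qk) sum1_card card_ord.
Qed.

Let err : R := ((16 * (k * k) + 2) * Q + 8 * k)%:R / N%:R.

(** Pairs of a major point and an offset go injectively to grid points where the sum of length [N]
    has almost the same normalised size. The factor [p^K] so gained matches the normalisation by the
    [K]-th power of the length. *)
Let major : (p ^ K)%:R * (\sum_(a | X a) nS N' a ^+ (2 * t)) <=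
  \sum_a nS N a ^+ (2 * t) + (#|X| * p ^ K)%:R * ((2 * t)%:R * err).
Proof.
have [qc hqc] := approx.
pose q a := (qc a).1; pose c a := (qc a).2; pose m a := (M %/ q a)%N.
pose B (a : grid) (j : 'I_k) : int := (a j : nat)%:Z - c a j * (m a)%:Z.
pose b (ar : grid * {ffun 'I_k -> 'I_(p ^ k)}) j : int :=
  c ar.1 j * (m ar.1)%:Z + (p ^ j.+1)%:Z * B ar.1 j + (ar.2 j : nat)%:Z.
have Mz : M%:Z != 0 by rewrite -[0]/(0%N%:Z) eqz_nat -lt0n.
have blt ar j : (`|(b ar j %% M%:Z)%Z|%N < M)%N.
  by rewrite -ltz_nat gez0_abs ?modz_ge0 // ltz_pmod // ltz_nat.
pose g ar : grid := [ffun j => Ordinal (blt ar j)].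
have gE ar j : exists w : int, (g ar j : nat)%:Z = b ar j - w * M%:Z.
  exists (b ar j %/ M%:Z)%Z; rewrite ffunE /= gez0_abs ?modz_ge0 //.
have Mr : 0 < M%:R :> R by rewrite ltr0n.
have Nr : 0 < N%:R :> R by rewrite ltr0n.
have pr : 0 < p%:R :> R by rewrite ltr0n.
have N'r : 0 < N'%:R :> R by rewrite ltr0n.
have Qr : 0 < Q%:R :> R by rewrite ltr0n.
have mE a : X a -> (M = q a * m a)%N by move=> /hqc[h _]; exact: qM.
have q0 a : X a -> (0 < q a <= Q)%N by move=> /hqc[].
have mr a : X a -> (m a)%:R = M%:R / (q a)%:R :> R.
  move=> Xa; have /andP[qa _] := q0 a Xa.
  have /(congr1 (fun n => n%:R : R)) := mE a Xa; rewrite natrM => ->.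
  by rewrite mulrC mulKf // pnatr_eq0 -lt0n.
have BE a j : X a -> (B a j)%:~R = M%:R * (gpt R a j - (c a j)%:~R / (q a)%:R) :> R.
  move=> Xa; have /andP[qa _] := q0 a Xa.
  have qr : (q a)%:R != 0 :> R by rewrite pnatr_eq0 -lt0n.
  rewrite /B rmorphB rmorphM /= /gpt.
  have -> : ((m a)%:Z)%:~R = M%:R / (q a)%:R :> R by exact: mr.
  rewrite -[(((a j : nat)%:Z)%:~R : R)]/((a j)%:R); field.
  by rewrite qr gt_eqF.
have Bb a (j : 'I_k) : X a -> `|(p ^ j.+1)%:R * (B a j)%:~R| <= M%:R * Q%:R / N%:R :> R.
  move=> Xa; have /andP[qa _] := q0 a Xa; have [_ /(_ j) h] := hqc a Xa.
  have qr : 1 <= (q a)%:R :> R by rewrite ler1n.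
  have qr0 : 0 < (q a)%:R :> R by rewrite ltr0n.
  have h1 : `|gpt R a j - (c a j)%:~R / (q a)%:R| <= Q%:R / N'%:R ^+ j.+1.
    apply: le_trans h; rewrite -/(q a) -/(c a).
    have -> : (q a)%:R * gpt R a j - (c a j)%:~R = (q a)%:R * (gpt R a j - (c a j)%:~R / (q a)%:R).
      by field; rewrite gt_eqF.
    by rewrite normrM (ger0_norm (ltW qr0)) ler_peMl.
  rewrite BE // normrM ger0_norm // normrM (ger0_norm (ltW Mr)) mulrCA -mulrA ler_pM2l //.
  apply: le_trans (ler_wpM2l (ler0n _ _) h1) _.
  have -> : (p ^ j.+1)%:R * (Q%:R / N'%:R ^+ j.+1) = Q%:R / N%:R ^+ j.+1 :> R.
    rewrite /N' natrM natrX exprMn; field.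
    by rewrite !expf_neq0 ?gt_eqF.
  rewrite ler_pM2l // lef_pV2 ?posrE ?exprn_gt0 //.
  by rewrite -{1}[N%:R]expr1 ler_weXn2l // ler1n.
have ginj : {in [pred ar | X ar.1 && Fam ar.2] &, injective g}.
  move=> [a r] [a' r'] /andP[/= Xa Fr] /andP[/= Xa' Fr'] gg.
  have both j : a j = a' j :> nat /\ r j = r' j :> nat.
    have [w hw1] := gE (a, r) j; have [w' hw2] := gE (a', r') j.
    have hbb : b (a, r) j - b (a', r') j = (w - w') * M%:Z.
      move: hw1; rewrite gg hw2 => h.
      have -> : b (a, r) j = b (a', r') j - w' * M%:Z + w * M%:Z by rewrite h subrK.
      by ring.
    apply: (@dilation_inj M (m a) (m a') (q a) (q a') (p ^ j.+1) _ _ _ _ (c a j) (c a' j)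
              (B a j) (B a' j) (w - w')) => //.
    - by have /andP[] := q0 a Xa.
    - by have /andP[] := q0 a' Xa'.
    - exact: mE.
    - exact: mE.
    - by rewrite /B addrC subrK.
    - by rewrite /B addrC subrK.
    - by have := forallP Fr j; rewrite inE.
    - by have := forallP Fr' j; rewrite inE.
    have /andP[_ qQ] := q0 a Xa; have /andP[_ qQ'] := q0 a' Xa'.
    have rb : (r j < p ^ j.+1)%N by have := forallP Fr j; rewrite inE.
    have rb' : (r' j < p ^ j.+1)%N by have := forallP Fr' j; rewrite inE.
    have iE (P u v : nat) (x y : int) : (P%:Z * (x - y) + (u%:Z - v%:Z))%:~R =
        P%:R * (x%:~R - y%:~R) + (u%:R - v%:R) :> R by rewrite intrD intrM !intrB.
    rewrite -(ltr_int R) rmorphM /= intr_norm iE.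
    apply: (@le_lt_trans _ _ ((Q ^ 2)%:R * (2 * (M%:R * Q%:R / N%:R) + (p ^ k)%:R))).
      apply: ler_pM => //; first by rewrite -[((_)%:~R : R)]/((q a * q a')%:R) ler_nat leq_mul.
      apply: le_trans (ler_normD _ _) _; apply: lerD.
        rewrite mulrBr mulr2n mulrDl mul1r; apply: le_trans (ler_normB _ _) _.
        by apply: lerD; apply: Bb.
      apply: (@le_trans _ _ (p ^ j.+1)%:R); last by rewrite ler_nat leq_pexp2l.
      move: rb rb'; rewrite -(ltr_nat R) -[in X in _ -> X -> _](ltr_nat R).
      have : 0 <= (r j)%:R :> R by []. have : 0 <= (r' j)%:R :> R by [].
      by set x := (r j)%:R; set x' := (r' j)%:R; rewrite ler_norml; lra.
    rewrite -[((M%:Z)%:~R : R)]/(M%:R) mulrDr.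
    have h1 : (Q ^ 2)%:R * (2 * (M%:R * Q%:R / N%:R)) < M%:R / 2 :> R.
      have -> : (Q ^ 2)%:R * (2 * (M%:R * Q%:R / N%:R)) = (M%:R / 2) * ((4 * Q ^ 3)%:R / N%:R) :> R.
        by rewrite natrM !natrX; field; rewrite gt_eqF.
      by rewrite gtr_pMr ?divr_gt0 // ltr_pdivrMr // mul1r ltr_nat.
    have h2 : (Q ^ 2)%:R * (p ^ k)%:R <= M%:R / 4 :> R.
      rewrite ler_pdivlMr // mulrC mulrA -!natrM ler_nat Ml //.
      apply: (@leq_trans (N' ^ k)); last by rewrite leq_pexp2l.
      by case: (posnP k) => [->//|k1]; rewrite leq_exp2r // /N' leq_pmulr.
    by move: h1 h2 Mr; lra.
  congr (_, _); apply/ffunP => j; apply: val_inj; by case: (both j).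
have step a r : X a -> Fam r -> nS N' a ^+ (2 * t) <= nS N (g (a, r)) ^+ (2 * t) + (2 * t)%:R * err.
  move=> Xa Fr; apply: le_trans (pow_lip1 _ (nS01 a N'0) (nS01 (g (a, r)) N0)) _.
  rewrite lerD2l ler_wpM2l // /nS.
  have [qQ hq] := hqc a Xa.
  have h1 := S_dilate p0 N0 qQ hq; rewrite -/N' in h1.
  set al' := fun j : 'I_k => _ + _ in h1.
  have nr : near1 N N%:R^-1 (gpt R (g (a, r))) al'.
    move=> j; have [w hw1] := gE (a, r) j; exists (- w).
    have -> : gpt R (g (a, r)) j - al' j - (- w)%:~R = (r j)%:R / M%:R.
      have E1 : (g (a, r) j)%:R = (b (a, r) j)%:~R - w%:~R * M%:R :> R.
        by have := congr1 (fun z : int => z%:~R : R) hw1; rewrite rmorphB rmorphM.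
      have /andP[qa _] := q0 a Xa.
      have qr : (q a)%:R != 0 :> R by rewrite pnatr_eq0 -lt0n.
      have iE2 (x y : int) (m1 P r1 : nat) : (x * m1%:Z + P%:Z * y + r1%:Z)%:~R =
          x%:~R * m1%:R + P%:R * y%:~R + r1%:R :> R by rewrite !intrD !intrM.
      have E2 : (b (a, r) j)%:~R = (c a j)%:~R * (M%:R / (q a)%:R) +
          p%:R ^+ j.+1 * (M%:R * ((a j)%:R / M%:R - (c a j)%:~R / (q a)%:R)) + (r j)%:R :> R.
        by rewrite /b /= iE2 mr // BE // natrX.
      have -> : (- w)%:~R = - w%:~R :> R by rewrite intrN.
      rewrite {1}/gpt E1 E2; apply: dilation_alg => //; by rewrite gt_eqF.
    rewrite ger0_norm ?divr_ge0 // ler_pdivrMr //.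
    have rb : (r j < p ^ j.+1)%N by have := forallP Fr j; rewrite inE.
    apply: (@le_trans _ _ (p ^ j.+1)%:R); first by rewrite ler_nat ltnW.
    rewrite -invfM -exprS mulrC ler_pdivlMr ?exprn_gt0 // -natrX -natrM ler_nat.
    apply: (@leq_trans (N' ^ k.+1)).
      by rewrite /N' expnMn; apply: leq_mul; rewrite leq_pexp2l // ltnS // ltnW.
    by apply: leq_trans (Ml (leqnn _)); rewrite leq_pmull // muln_gt0 expn_gt0 Q0.
  have h2 := near_S N0 nr.
  set S1 := S N' _ in h1 *; set S2 := S N al' in h1 h2; set S3 := S N _ in h2 *.
  have nd (z : C) (n : nat) : nm z / n%:R = nm (z / n%:R) by rewrite nmM nmV nm_natr.
  rewrite !nd; apply: le_trans (nm_dist_le _ _) _.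
  have -> : S1 / N'%:R - S3 / N%:R = (S1 / N'%:R - S2 / N%:R) + (S2 - S3) / N%:R.
    by rewrite mulrBl addrA subrK.
  have -> : err = ((16 * (k * k) + 2) * Q)%:R / N%:R + (8 * k)%:R / N%:R by rewrite /err natrD mulrDl.
  apply: le_trans (nmD _ _) _; apply: lerD => //.
  rewrite nmM nmV nm_natr nmB ler_wpM2r ?invr_ge0 //.
  apply: le_trans h2 _; rewrite le_eqVlt; apply/orP; left; apply/eqP.
  by rewrite natrM; field; rewrite gt_eqF.
have -> : (p ^ K)%:R * (\sum_(a | X a) nS N' a ^+ (2 * t)) =
   \sum_(ar : grid * {ffun 'I_k -> 'I_(p ^ k)} | X ar.1 && Fam ar.2) nS N' ar.1 ^+ (2 * t).
  rewrite -(pair_big X Fam (fun a r => nS N' a ^+ (2 * t))) /= mulr_sumr.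
  by apply: eq_bigr => a _; rewrite sumr_const cardFam mulr_natl.
apply: (@le_trans _ _ (\sum_(ar : grid * {ffun 'I_k -> 'I_(p ^ k)} | X ar.1 && Fam ar.2)
   (nS N (g ar) ^+ (2 * t) + (2 * t)%:R * err))).
  by apply: ler_sum => -[a r] /andP[/= Xa Fr]; apply: step.
rewrite big_split /=; apply: lerD; last first.
  rewrite -(pair_big X Fam (fun a r => (2 * t)%:R * err)) /=.
  rewrite (eq_bigr (fun=> (p ^ K)%:R * ((2 * t)%:R * err))) => [|a _]; last first.
    by rewrite sumr_const cardFam -[LHS]mulr_natl.
  by rewrite sumr_const -[leLHS]mulr_natl [(#|X| * _)%:R]natrM -[leRHS]mulrA lexx.
have -> : \sum_(ar : grid * {ffun 'I_k -> 'I_(p ^ k)} | X ar.1 && Fam ar.2) nS N (g ar) ^+ (2 * t)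
   = \sum_(d in [set g ar | ar in [pred ar | X ar.1 && Fam ar.2]]) nS N d ^+ (2 * t).
  by rewrite big_imset //=; apply: eq_bigl => ar; rewrite inE.
rewrite [leRHS](bigID (mem [set g ar | ar in [pred ar | X ar.1 && Fam ar.2]])) /=.
rewrite lerDl sumr_ge0 // => d _; rewrite exprn_ge0 //.
by have /andP[] := nS01 d N0.
Qed.

(** On minor points the spare exponent gives [Y^-2] against the loss [Y] of the critical moment. The
    proportion of major points is at most [Y^(2K+1) / (p N)^K], so the error made at each of them in
    [major] stays affordable. *)
Lemma dilation_step :
  (Jn k t (p * N))%:R * (p * N)%:R ^+ K / (p * N)%:R ^+ (2 * t) <=
  (Jn k t N)%:R * N%:R ^+ K / N%:R ^+ (2 * t) + Y%:R^-1 +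
  (2 * t)%:R * (((16 * (k * k) + 2) * Y ^ E + 8 * k)%:R / N%:R) * Y%:R ^+ (2 * K + 1) :> R.
Proof.
rewrite -/N' -/Q -/err.
have Mr : 0 < (M ^ k)%:R :> R by rewrite ltr0n expn_gt0 M0.
have Nr : 0 < N%:R :> R by rewrite ltr0n.
have pr : 0 < p%:R :> R by rewrite ltr0n.
have N'r : 0 < N'%:R :> R by rewrite ltr0n.
have Yr : 0 < Y%:R :> R by rewrite ltr0n ltnW.
have nS0 n a : (0 < n)%N -> 0 <= nS n a by move=> /(@nS01 n a)/andP[].
have err0 : 0 <= err by rewrite divr_ge0.
have cX : #|X|%:R / (M ^ k)%:R <= Y%:R ^+ (2 * K + 1) / N'%:R ^+ K :> R.
  have : #|X|%:R * Y%:R^-1 ^+ (2 * K) <= \sum_a nS N' a ^+ (2 * K).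
    rewrite mulr_natl -sumr_const [leRHS](bigID X) /= -[leLHS]addr0; apply: lerD.
      by apply: ler_sum => a Xa; rewrite lerXn2r ?nnegrE ?invr_ge0 ?nS0.
    by apply: sumr_ge0 => a _; rewrite exprn_ge0 ?nS0.
  move=> h; rewrite addn1 exprSr -mulrA; apply: le_trans (ler_wpM2l _ momK); last by rewrite exprn_ge0.
  rewrite mulrA ler_wpM2r ?invr_ge0 // -ler_pdivrMl ?exprn_gt0 // mulrC.
  by apply: le_trans h; rewrite exprVn.
have mom : (Jn k t N')%:R / N'%:R ^+ (2 * t) <= (\sum_a nS N' a ^+ (2 * t)) / (M ^ k)%:R.
  rewrite ler_pdivrMr ?exprn_gt0 // -moment_nS //; exact: Jn_le_moment.
have momN : (\sum_a nS N a ^+ (2 * t)) / (M ^ k)%:R <= (Jn k t N)%:R / N%:R ^+ (2 * t).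
  rewrite ler_pdivlMr ?exprn_gt0 // -moment_nS //; apply: moment_S_le.
  apply: leq_ltn_trans (Mt (leq_addr K t)); rewrite leq_mul2l /N'; apply/orP; right.
  by case: (posnP k) => [->//|k1]; rewrite leq_exp2r // leq_pmull.
have minor : (\sum_(a | ~~ X a) nS N' a ^+ (2 * t)) / (M ^ k)%:R <= Y%:R^-1 / N'%:R ^+ K.
  have h : \sum_(a | ~~ X a) nS N' a ^+ (2 * t) <= Y%:R^-1 ^+ 2 * \sum_a nS N' a ^+ (2 * K).
    rewrite mulr_sumr [leRHS](bigID X) /= -[leLHS]add0r; apply: lerD.
      by apply: sumr_ge0 => a _; rewrite mulr_ge0 ?exprn_ge0 ?nS0 ?invr_ge0.
    apply: ler_sum => a Xa.
    have -> : (2 * t = 2 * (t - K.+1) + 2 + 2 * K)%N by move: Kt; clear; lia.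
    rewrite exprD ler_wpM2r ?exprn_ge0 ?nS0 // exprD.
    have /andP[a0 a1] := nS01 a N'0.
    rewrite -[leRHS]mul1r ler_pM ?exprn_ge0 // ?exprn_ile1 //.
    by rewrite lerXn2r ?nnegrE ?invr_ge0 // ltW // ltNge.
  apply: le_trans (ler_wpM2r _ h) _; first by rewrite invr_ge0.
  rewrite -mulrA; apply: le_trans (ler_wpM2l _ momK) _; first by rewrite exprn_ge0 ?invr_ge0.
  rewrite le_eqVlt; apply/orP; left; apply/eqP; field.
  by rewrite expf_neq0 ?gt_eqF.
have pK : 0 < (p ^ K)%:R :> R by rewrite ltr0n expn_gt0 p0.
have maj : (\sum_(a | X a) nS N' a ^+ (2 * t)) / (M ^ k)%:R <=
    ((Jn k t N)%:R / N%:R ^+ (2 * t)) / (p ^ K)%:R + Y%:R ^+ (2 * K + 1) / N'%:R ^+ K * ((2 * t)%:R * err).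
  rewrite -(ler_pM2l pK) mulrA.
  apply: le_trans (ler_wpM2r _ major) _; first by rewrite invr_ge0.
  rewrite mulrDl mulrDr; apply: lerD.
    by apply: le_trans momN _; rewrite mulrCA divff ?mulr1 // gt_eqF.
  have -> : (#|X| * p ^ K)%:R * ((2 * t)%:R * err) / (M ^ k)%:R =
    (p ^ K)%:R * (#|X|%:R / (M ^ k)%:R * ((2 * t)%:R * err)) by rewrite natrM; ring.
  by rewrite ler_pM2l // ler_wpM2r ?mulr_ge0.
have NK : N'%:R ^+ K = (p ^ K)%:R * N%:R ^+ K :> R by rewrite /N' natrM exprMn natrX.
rewrite [leLHS]mulrAC -ler_pdivlMr ?exprn_gt0 //.
apply: le_trans mom _; rewrite (bigID X) /= mulrDl.
apply: le_trans (lerD maj minor) _; rewrite le_eqVlt; apply/orP; left; apply/eqP.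
rewrite NK; field; by rewrite !gt_eqF ?exprn_gt0.
Qed.

End DilationStep.

Lemma Jn_mono (R : realType) k t N N' : (N <= N')%N -> (Jn k t N <= Jn k t N')%N.
Proof.
move=> NN; rewrite -(ler_nat R); pose M := (t * N' ^ k).+1.
apply: le_trans (@Jn_le_moment R k N t M isT) _.
have := @moment_le_Jn R k 'I_N (fun i => i : nat) (@npos N) N' t M 1.
rewrite mul1n => h; apply: le_trans (h _ _ _ _ _) => //; last 2 first.
- exact: ord_inj.
- by move=> i; apply: leq_trans NN.
rewrite (@eq_Eav R k _ _ _ (fun al => nm (esum (@npos N) (zscale 1 al)) ^+ (2 * t))) //.
move=> al; rewrite /S; congr (nm (esum _ _) ^+ _).
by apply: boolp.funext => j; rewrite /zscale mul1r.
Qed.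

(** * Vinogradov's mean value without loss *)

Section SharpMean.
Variables (R : realType) (k : nat).
Hypothesis k0 : (0 < k)%N.
Local Notation K := (kap k).
Local Notation C := R[i].
Local Notation e := (@e R).

Section Prime.
Variable p : nat.
Hypothesis p_pr : prime p.
Hypothesis p4 : (2 * 4 ^ K <= p)%N.
Let p0 : (0 < p)%N. Proof. exact: prime_gt0. Qed.
Local Notation pw := (@pw R p).

(** The grid with [M = p^(k n)] serves as [Om], and translating it realises the required shifts. A
    class of level [n] contains one integer below [p^n], so its mean is at most the size of the
    grid. *)
Lemma Jn_prime_power eps : 0 < eps ->
  exists2 c, 0 <= c & forall n, (Jn k K (p ^ n))%:R <= c * pw (eps * n%:R) * p%:R ^+ (n * K).
Proof.
move=> e0; have [c c0 h] := @nested_congruencing R p p_pr k k0 p4 eps e0.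
exists c => // n; pose M := (p ^ (k * n))%N.
have M0 : (0 < M)%N by rewrite expn_gt0 p0.
have Mr : 0 < M%:R :> R by rewrite ltr0n.
pose Om := {ffun 'I_k -> 'I_M}.
pose F (i : 'I_(p ^ n)) (w : Om) : C := e (phi (gpt R w) (npos i)).
have ds : @dsys R p k n (fun j => 'X^(j.+1)) _ _ (@npos (p ^ n)) F (fun=> 1) #|Om|%:R.
  split.
  - exists 1; last by exists (fun=> 0) => j; rewrite scale1r scaler0 addr0.
    by rewrite dvdz1 absz_nat eqn_leq leqNgt prime_gt1.
  - split => // be.
    have Mz : M%:Z != 0 by rewrite eqz_nat -lt0n.
    have rlt x : (`|(x %% M%:Z)%Z|%N < M)%N.
      by rewrite -ltz_nat gez0_abs ?modz_ge0 // ltz_pmod // ltz_nat.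
    pose tau (w : Om) : Om := [ffun j => Ordinal (rlt ((w j : nat)%:Z + be j))].
    have tauE w j : exists z : int, (tau w j : nat)%:Z = (w j : nat)%:Z + be j - z * M%:Z.
      exists (((w j : nat)%:Z + be j) %/ M%:Z)%Z; rewrite ffunE /= gez0_abs ?modz_ge0 //.
    exists tau.
      move=> w w' ww; apply/ffunP => j; apply: ord_inj.
      have [z hz] := tauE w j; have [z' hz'] := tauE w' j.
      have : ((w j : nat)%:Z = (w' j : nat)%:Z + (z - z') * M%:Z).
        move: hz; rewrite ww hz' => hz; apply: (addIr (be j)).
        by rewrite mulrBl -[LHS](subrK (z * M%:Z)) -hz; ring.
      move=> hm; have : ((w j : nat)%:Z %% M%:Z)%Z = ((w' j : nat)%:Z %% M%:Z)%Z.
        by rewrite hm addrC modzMDl.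
      by rewrite !modz_small ?ltz_nat ?ltn_ord // => -[].
    exists (fun=> 1); first by move=> w; rewrite nm1.
    move=> i w; rewrite mul1r /F -eD.
    have [z hz] := boolp.choice (tauE w).
    rewrite -[LHS](eDint _ (\sum_j z j * npos i ^+ j.+1)); congr e.
    rewrite !rmorph_sum /= /phi mulr_suml -!big_split; apply: eq_bigr => j _ /=.
    rewrite hornerXn /gpt.
    have -> : (tau w j)%:R = (w j)%:R + (be j)%:~R - (z j)%:~R * M%:R :> R.
      by have := congr1 (fun x : int => x%:~R : R) (hz j); rewrite rmorphB rmorphD rmorphM.
    rewrite !rmorphM !rmorphXn /=.
    have -> : p%:R ^+ (k * n) = M%:R :> R by rewrite natrX.
    by field; rewrite gt_eqF.
  - move=> z; rewrite /mean -sumr_const; apply: ler_sum => w _; rewrite mulr1.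
    apply: exprn_ile1; rewrite ?nm_ge0 // /fcl.
    have [t0 ht0] := @residue_ord (p ^ n) z (ltac:(by rewrite expn_gt0 p0)).
    rewrite (eq_bigl (pred1 t0)) ?big_pred1_eq ?nm_e // => i.
    rewrite /= -ht0 -opprB rpredN /npos.
    by rewrite -[p%:Z]natz -rmorphXn /= natz.
have {}h := h n _ _ _ _ _ _ _ ds.
apply: le_trans (@Jn_le_moment R k (p ^ n) K M M0) _; rewrite /Eav.
have Mk : 0 < (M ^ k)%:R :> R by rewrite ltr0n expn_gt0 M0.
rewrite ler_pdivrMr //.
move: h; rewrite card_ffun !card_ord => h; apply: le_trans h; rewrite /mean.
by apply: ler_sum => w _; rewrite mulr1.
Qed.

(** Along the lengths [P^n] the parameter [Y = p^n] grows with the length, so that the errors of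
    [dilation_step] are summed by a geometric series. *)
Lemma sharp_mean_prime t : (K < t)%N ->
  exists2 c : R, 0 < c & forall N, (0 < N)%N ->
  (Jn k t N)%:R <= c * N%:R ^+ (2 * t - K).
Proof.
move=> Kt; have [E hw] := @weyl R k K.
(* So large that [P^n] exceeds [4 Q^3] and that dividing by it beats both [Q] and [Y^(2K+1)]. *)
pose m := (3 * E + 2 * K + 2)%N; pose P := (p ^ m)%N.
have p1 : (1 < p)%N by exact: prime_gt1.
have p4' : (4 < p)%N.
  apply: leq_trans p4; apply: (@leq_trans (2 * 4 ^ 1)) => //; rewrite leq_mul2l /= leq_exp2l //.
  by rewrite -(leq_pmul2l (isT : 0 < 2)%N) kap2 muln1; move: k0; clear; case: k => // n _; nia.
have pr : 1 < p%:R :> R by rewrite ltr1n.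
have pr0 : 0 < p%:R :> R by rewrite ltr0n.
have mr : 0 < m%:R :> R by rewrite ltr0n /m addn_gt0 orbT.
(* With this exponent the loss at [P^(n+1)] is [p^((n+1)/2)], which stays below [Y = p^n], constant
   included, once [n >= n0]. *)
have e0 : 0 < (2 * m%:R)^-1 :> R by rewrite invr_gt0 mulr_gt0.
have [c c0 hc] := Jn_prime_power e0.
pose c1 := Num.bound c.
have cc1 : c <= p%:R ^+ c1.
  apply: le_trans (ltW (archi_boundP c0)) _; rewrite -natrX ler_nat -/c1.
  exact: ltnW (ltn_expl _ p1).
pose n0 := (2 * c1 + 1)%N.
have P0 : (0 < P)%N by rewrite expn_gt0 p0.
pose F n : R := (Jn k t (P ^ n))%:R * (P ^ n)%:R ^+ K / (P ^ n)%:R ^+ (2 * t).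
pose c2 : R := 1 + (2 * t)%:R * ((16 * (k * k) + 2) + 8 * k)%:R.
have c20 : 0 <= c2 by rewrite addr_ge0 // mulr_ge0.
have rec n : (n0 <= n)%N -> F n.+1 <= F n + c2 / p%:R ^+ n.
  move=> n0n; have n1 : (0 < n)%N by apply: leq_trans n0n; rewrite /n0 addn1.
  have Y1 : (1 < p ^ n)%N by rewrite -(exp1n n) ltn_exp2r.
  have := @dilation_step R k t P (P ^ n) (p ^ n) E P0 _ Kt Y1 _ _ hw _.
  rewrite -expnS -/(F n.+1) -/(F n) => /(_ (ltac:(by rewrite expn_gt0 P0)) ) h.
  apply: le_trans (h _ _ _) _.
  - rewrite /P -!expnM leq_exp2l // /m; move: n1; clear; nia.
  - have := hc (m * n.+1)%N; rewrite /P -!expnM => h1; apply: le_trans h1 _.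
    have -> : (p ^ n)%:R * (p ^ (m * n.+1 * (2 * K)))%:R / (p ^ (m * n.+1 * K))%:R =
       p%:R ^+ n * p%:R ^+ (m * n.+1 * K) :> R.
      have -> : (m * n.+1 * (2 * K) = m * n.+1 * K + m * n.+1 * K)%N by clear; lia.
      by rewrite !natrX exprD; field; rewrite expf_neq0 // gt_eqF.
    rewrite ler_wpM2r ?exprn_ge0 //.
    have -> : (2 * m%:R)^-1 * (m * n.+1)%:R = n.+1%:R / 2 :> R.
      by rewrite natrM; field; rewrite gt_eqF.
    apply: (@le_trans _ _ (p%:R ^+ c1 * pw (n - c1)%:R)).
      apply: ler_pM; rewrite ?pw_ge0 //; apply: pw_le => //.
      rewrite ler_pdivrMr // -natrM ler_nat.
      by move: n0n; rewrite /n0; clear; lia.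
    rewrite /pw powR_mulrn // -exprD subnKC //.
    by move: n0n; rewrite /n0; clear; lia.
  - rewrite /P -!expnM.
    apply: (@leq_trans (p ^ (n * E * 3) * p ^ n)).
      rewrite -[(n * E * 3)%N]mulnA [ltnRHS]mulnC ltn_mul2r expn_gt0 p0 /=.
      apply: leq_trans p4' _; rewrite -[X in (X <= _)%N]expn1 leq_exp2l //.
    rewrite -expnD leq_exp2l // /m; clear; nia.
  rewrite -[leLHS]addrA lerD2l /c2 mulrDl mul1r natrX lerD2l.
  rewrite -expnM -[leLHS]mulrA -[leRHS]mulrA ler_wpM2l //.
  have hQ : ((16 * (k * k) + 2) * p ^ (n * E) + 8 * k)%:R <=
     ((16 * (k * k) + 2) + 8 * k)%:R * p%:R ^+ (n * E) :> R.
    rewrite -natrX -natrM ler_nat [leqRHS]mulnDl leq_add2l leq_pmulr // expn_gt0 p0 //.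
  rewrite -mulrA mulrCA [leLHS]mulrC mulrAC.
  apply: le_trans (ler_wpM2r _ (ler_wpM2r _ hQ)) _; rewrite ?exprn_ge0 ?invr_ge0 //.
  rewrite -!mulrA ler_wpM2l // /P -expnM natrX -exprM.
  rewrite mulrCA -exprD ler_pdivrMl ?exprn_gt0 // ler_pdivlMr ?exprn_gt0 // -exprD.
  rewrite ler_weXn2l ?ltW // /m; clear; nia.
have [B B0 hB] : exists2 B : R, 0 <= B & forall n, (n0 <= n)%N -> F n <= B.
  have F0 n : 0 <= F n by rewrite /F divr_ge0 // mulr_ge0.
  exists (F n0 + 2 * c2 / p%:R ^+ n0); first by rewrite addr_ge0 // divr_ge0 // mulr_ge0.
  suff h n : (n0 <= n)%N -> F n + 2 * c2 / p%:R ^+ n <= F n0 + 2 * c2 / p%:R ^+ n0.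
    move=> n /h; apply: le_trans; rewrite lerDl divr_ge0 ?mulr_ge0 ?exprn_ge0 //.
  elim: n => [|n IH]; first by rewrite leqn0 => /eqP <-.
  rewrite leq_eqVlt => /orP[/eqP <-//|]; rewrite ltnS => nn.
  apply: le_trans (IH nn); apply: le_trans (lerD (rec n nn) (lexx _)) _.
  rewrite -addrA lerD2l exprS.
  have pn : 0 < p%:R ^+ n :> R by rewrite exprn_gt0.
  have p2 : 2 <= p%:R :> R by rewrite (ler_nat R 2).
  have h : 2 * c2 / (p%:R * p%:R ^+ n) <= c2 / p%:R ^+ n.
    rewrite invfM mulrA ler_wpM2r ?invr_ge0 ?(ltW pn) // ler_pdivrMr // mulrC.
    by rewrite ler_wpM2l.
  have -> : 2 * c2 / p%:R ^+ n = c2 / p%:R ^+ n + c2 / p%:R ^+ n by rewrite -mulrA mulr2n mulrDl mul1r.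
  by rewrite lerD2l.
pose d := (2 * t - K)%N.
have P1 : (1 < P)%N by rewrite /P -{1}(exp1n m) ltn_exp2r // /m addn_gt0 orbT.
exists ((B + 1) * (P ^ n0.+1)%:R ^+ d).
  by apply: mulr_gt0; [move: B0; lra|rewrite exprn_gt0 // ltr0n expn_gt0 P0].
(* Rounding [N] up to such a power of [P] costs at most the fixed factor [P^(n0+1)]. *)
move=> N N0; pose n := (n0 + up_log P N)%N.
have NP : (N <= P ^ n)%N.
  by apply: leq_trans (up_logP N P1) _; rewrite leq_exp2l // leq_addl.
have PN : (P ^ n <= P ^ n0.+1 * N)%N.
  rewrite /n expnD expnS [(P * _)%N]mulnC -mulnA leq_mul2l; apply/orP; right.
  case: N N0 {NP n} => // -[|N] _; first by rewrite up_log1 expn0 muln1.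
  have /andP[h _] := @up_log_bounds P N.+2 P1 isT.
  have l0 : (0 < up_log P N.+2)%N by rewrite up_log_gt0 P1.
  rewrite -{1}(prednK l0) expnS leq_mul2l; apply/orP; right; exact: ltnW.
apply: (@le_trans _ _ (Jn k t (P ^ n))%:R); first by rewrite ler_nat (Jn_mono R).
have Pn : 0 < (P ^ n)%:R :> R by rewrite ltr0n expn_gt0 P0.
have hF := hB n (leq_addr _ _).
have JE : (Jn k t (P ^ n))%:R = F n * (P ^ n)%:R ^+ d.
  have tE : (2 * t = d + K)%N by rewrite /d subnK //; move: Kt; clear; lia.
  by rewrite /F tE exprD; field; rewrite !expf_neq0 ?gt_eqF.
rewrite JE -mulrA -exprMn -natrM; apply: ler_pM; rewrite ?exprn_ge0 //.
- by rewrite /F divr_ge0 // mulr_ge0.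
- by apply: le_trans hF _; rewrite lerDl.
by rewrite lerXn2r ?nnegrE // ler_nat.
Qed.

End Prime.

Theorem sharp_mean t : (K < t)%N ->
  exists2 c : R, 0 < c & forall N, (0 < N)%N -> (Jn k t N)%:R <= c * N%:R ^+ (2 * t - K).
Proof.
move=> Kt; have [p pp p_pr] := prime_above (2 * 4 ^ K).
exact: (sharp_mean_prime p_pr (ltnW pp) Kt).
Qed.

End SharpMean.

Lemma sum_supp (V : nmodType) (L1 L2 : seq int) (g : int -> V) :
  uniq L1 -> uniq L2 -> {subset L2 <= L1} -> (forall y, y \notin L2 -> g y = 0) ->
  \sum_(y <- L1) g y = \sum_(y <- L2) g y.
Proof.
move=> u1 u2 sub g0; rewrite (bigID (fun y => y \in L2)) /= [X in _ + X]big1 ?addr0; last first.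
  by move=> y /g0.
rewrite -big_filter; apply: perm_big; apply: uniq_perm; rewrite ?filter_uniq // => y.
rewrite mem_filter; apply/andP/idP => [[]//|h]; split => //; exact: sub.
Qed.

Lemma sum_cons_tuple (V : nmodType) (T : finType) n (F : n.+1.-tuple T -> V) :
  \sum_w F w = \sum_(x : T) \sum_(v : n.-tuple T) F (cons_tuple x v).
Proof.
rewrite pair_bigA /=; apply: (reindex (fun xv : T * n.-tuple T => cons_tuple xv.1 xv.2)).
apply: onW_bij; exists (fun w => (thead w, behead_tuple w)) => [[x v]|w] /=.
  by congr (_, _); apply: val_inj.
by apply: val_inj; case: (tupleP w).
Qed.

Lemma sum_pow2_le (R : realType) (J : finType) (x : J -> R) d : (forall j, 0 <= x j) ->
  (\sum_j x j) ^+ (2 ^ d) <= #|J|%:R ^+ (2 ^ d).-1 * \sum_j x j ^+ (2 ^ d).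
Proof.
have sq (y : J -> R) : (\sum_j y j) ^+ 2 <= #|J|%:R * \sum_j y j ^+ 2.
  have h : 0 <= \sum_i \sum_j (y i - y j) ^+ 2.
    by apply: sumr_ge0 => i _; apply: sumr_ge0 => j _; exact: sqr_ge0.
  have E : \sum_i \sum_j (y i - y j) ^+ 2 =
      2 * (#|J|%:R * \sum_j y j ^+ 2) - 2 * (\sum_j y j) ^+ 2.
    have E1 i : \sum_j (y i - y j) ^+ 2 =
        #|J|%:R * y i ^+ 2 + \sum_j y j ^+ 2 - 2 * (y i * \sum_j y j).
      transitivity (\sum_j (y i ^+ 2 + y j ^+ 2 - 2 * (y i * y j))).
        by apply: eq_bigr => j _; ring.
      by rewrite sumrB big_split /= sumr_const -[_ *+ #|_|]mulr_natl -!mulr_sumr.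
    rewrite (eq_bigr _ (fun i _ => E1 i)) sumrB big_split /= -!mulr_sumr -mulr_suml.
    by rewrite sumr_const -[X in _ + X - _]mulr_natl; ring.
  by move: h; rewrite E; lra.
elim: d x => [|d IH] x x0.
  rewrite expn0 expr0 mul1r expr1 le_eqVlt; apply/orP; left; apply/eqP.
  by apply: eq_bigr => j _; rewrite expr1.
rewrite [in leLHS]expnS exprM.
have s0 : 0 <= \sum_j x j ^+ 2 by apply: sumr_ge0 => j _; exact: sqr_ge0.
apply: le_trans (lerXn2r _ _ _ (sq x)) _; rewrite ?nnegrE ?sqr_ge0 ?mulr_ge0 //.
rewrite exprMn; apply: le_trans (ler_wpM2l _ (IH (fun j => x j ^+ 2) (fun j => sqr_ge0 _))) _.
  by rewrite exprn_ge0.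
rewrite mulrA -exprD.
have -> : (2 ^ d + (2 ^ d).-1 = (2 ^ d.+1).-1)%N.
  by rewrite expnS; have := expn_gt0 2 d; case: (2 ^ d)%N => // n _; lia.
rewrite le_eqVlt; apply/orP; left; apply/eqP; congr (_ * _).
by apply: eq_bigr => j _; rewrite -exprM expnS.
Qed.

(** * Uniformity and polynomial phases *)

Section Gowers.
Variables (R : realType) (N : nat).
Local Notation C := R[i].
Local Notation e := (@e R).
Local Notation I := (zitv 1 N%:Z).
Local Notation W := (zitv (1 - N%:Z) (N%:Z - 1)).
Implicit Types (f : int -> C).

Definition Tsum f : C := \sum_(x <- I) f x.
Definition supp (V : nmodType) (f : int -> V) := forall x, x \notin I -> f x = 0.
Definition cD1 f (w : int) : int -> C := fun x => f x * (f (x - w))^*%C.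
Definition cD f (w : seq int) : int -> C := foldl cD1 f w.

Lemma cD1_supp f w : supp f -> supp (cD1 f w).
Proof. by move=> h x /h; rewrite /cD1 => ->; rewrite mul0r. Qed.

Lemma Tsum_sqr f : supp f -> (nm (Tsum f) ^+ 2)%:C%C = \sum_(w <- W) Tsum (cD1 f w).
Proof.
move=> hf; rewrite nm_sqr /Tsum conjc_sum mulr_suml exchange_big /=.
rewrite [LHS]big_seq [RHS]big_seq; apply: eq_bigr => x xI.
rewrite /cD1 mulr_sumr.
rewrite -(big_map (fun w => x - w) xpredT (fun y => f x * (f y)^*%C)); symmetry.
apply: sum_supp; rewrite ?fset_uniq //.
- by rewrite map_inj_uniq ?fset_uniq // => y z /addrI/oppr_inj.
- move=> y yI; apply/mapP; exists (x - y); last by rewrite opprB addrC subrK.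
  by move: xI yI; rewrite !in_zitv; lia.
- by move=> y /hf ->; rewrite conjc0 mulr0.
Qed.

Lemma card_W : (0 < N)%N -> (#|` W| <= 2 * N)%N.
Proof.
move=> N0; have sub : {subset enum_fset W <= [seq i%:Z - (N%:Z - 1) | i <- iota 0 (2 * N)]}.
  move=> x; rewrite in_zitv => /andP[h1 h2]; apply/mapP; exists (absz (x + (N%:Z - 1))).
    by rewrite mem_iota; move: h1 h2; lia.
  by move: h1 h2; lia.
have := uniq_leq_size (fset_uniq W) sub; by rewrite size_map size_iota.
Qed.

(** Weyl differencing: each squaring introduces one [w] through [Tsum_sqr], and [sum_pow2_le] moves
    the remaining power inside the sum over [w], which has at most [2N] terms. *)
Lemma gowers_weyl d f : (0 < N)%N -> supp f ->
  nm (Tsum f) ^+ (2 ^ d.+1) <= (2 * N)%:R ^+ (2 ^ d.+1 - d.+2) *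
   complex.Re (\sum_(w : d.+1.-tuple W) Tsum (cD f (map val w))).
Proof.
move=> N0; elim: d f => [|d IH] f hf.
  rewrite expn1 subnn expr0 mul1r sum_cons_tuple.
  have -> : \sum_(x : W) \sum_(v : 0.-tuple W) Tsum (cD f (map val (cons_tuple x v))) =
     \sum_(w <- W) Tsum (cD1 f w).
    rewrite [RHS]big_seq_fsetE; apply: eq_bigr => x _.
    rewrite (bigD1 [tuple]) //= [X in _ + X]big1 ?addr0 // => v /negP[].
    by apply/eqP; exact: tuple0.
  by rewrite -Tsum_sqr.
rewrite [in X in X <= _]expnS exprM.
have n2 : nm (Tsum f) ^+ 2 <= \sum_(w : W) nm (Tsum (cD1 f (val w))).
  have -> : nm (Tsum f) ^+ 2 = nm (\sum_(w <- W) Tsum (cD1 f w)).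
    by rewrite -Tsum_sqr // nmC ger0_norm // exprn_ge0 ?nm_ge0.
  by rewrite big_seq_fsetE; exact: nm_sum.
apply: le_trans (lerXn2r _ _ _ n2) _; rewrite ?nnegrE ?exprn_ge0 ?nm_ge0 //.
  by apply: sumr_ge0 => w _; exact: nm_ge0.
apply: (@le_trans _ _ (#|{: W}|%:R ^+ (2 ^ d.+1).-1 * \sum_(w : W) nm (Tsum (cD1 f (val w))) ^+ (2 ^ d.+1))).
  by apply: sum_pow2_le => w; exact: nm_ge0.
have cW : #|{: W}|%:R <= (2 * N)%:R :> R by rewrite ler_nat -cardfE card_W.
apply: (@le_trans _ _ ((2 * N)%:R ^+ (2 ^ d.+1).-1 * \sum_(w : W)
   ((2 * N)%:R ^+ (2 ^ d.+1 - d.+2) *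
   complex.Re (\sum_(v : d.+1.-tuple W) Tsum (cD (cD1 f (val w)) (map val v)))))).
  apply: ler_pM; rewrite ?exprn_ge0 //.
  - by apply: sumr_ge0 => w _; rewrite exprn_ge0 ?nm_ge0.
  - by rewrite lerXn2r ?nnegrE.
  by apply: ler_sum => w _; apply: IH; exact: cD1_supp.
rewrite -mulr_sumr mulrA -exprD.
have -> : ((2 ^ d.+1).-1 + (2 ^ d.+1 - d.+2) = 2 ^ d.+2 - d.+3)%N.
  have : (d.+2 <= 2 ^ d.+1)%N by rewrite ltn_expl.
  by rewrite [(2 ^ d.+2)%N]expnS; move: (2 ^ d.+1)%N => a; lia.
rewrite sum_cons_tuple.
have reS (J : finType) (F : J -> C) : complex.Re (\sum_i F i) = \sum_i complex.Re (F i).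
  by apply: (big_morph (@complex.Re R)) => // -[a b] [c d'].
by rewrite reS lexx.
Qed.

Definition cd (psi : int -> R) (w : int) : int -> R := fun x => psi x - psi (x - w).

Lemma cD_phase (E psi : int -> R) w x :
  cD (fun y => (E y)%:C%C * e (psi y)) w x = (Delta E w x)%:C%C * e (foldl cd psi w x).
Proof.
elim: w E psi => [|w ws IH] E psi //=.
have -> : cD1 (fun y => (E y)%:C%C * e (psi y)) w =
    fun y => (Delta1 E w y)%:C%C * e (cd psi w y).
  have cr (r : R) : (r%:C%C : C)^*%C = r%:C%C.
    by apply/eqP; rewrite eq_complex /= oppr0 !eqxx.
  apply: boolp.funext => y; rewrite /cD1 /Delta1 /cd eD eN conjcM cr.
  have -> : (E y * E (y - w))%:C%C = (E y)%:C%C * (E (y - w))%:C%C :> C by rewrite rmorphM.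
  by ring.
exact: IH.
Qed.

Lemma size_diff_poly (P : {poly R}) (c : R) :
  (size (P - (P \Po ('X - c%:P)))%R <= (size P).-1)%N.
Proof.
have [->|P0] := eqVneq P 0; first by rewrite comp_poly0 subr0 size_poly0.
have s2 : size ('X - c%:P) = 2%N by rewrite size_XsubC.
apply/leq_sizeP => j; rewrite leq_eqVlt coefB => /orP[/eqP <-|hj].
  have l1 := lead_coef_comp P (_ : (1 < size ('X - c%:P)%R)%N).
  have : lead_coef (P \Po ('X - c%:P)) = lead_coef P.
    by rewrite l1 ?s2 // lead_coefXsubC expr1n mulr1.
  by rewrite !lead_coefE size_comp_poly2 // => ->; rewrite subrr.
rewrite !nth_default ?subr0 //; last by move: hj; case: (size P).
by rewrite size_comp_poly2 //; move: hj; case: (size P).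
Qed.

(** Each difference lowers the degree, so [k + 1] of them annihilate a phase of degree [k]: this is
    how uniformity of degree [k] reaches such phases. *)
Lemma cd_poly (w : seq int) (P : {poly R}) (psi : int -> R) :
  (forall x, psi x = P.[x%:~R]) -> (size P <= size w)%N -> forall x, foldl cd psi w x = 0.
Proof.
elim: w P psi => [|w ws IH] P psi hP sz x /=.
  by move: sz; rewrite leqn0 size_poly_eq0 => /eqP P0; rewrite hP P0 horner0.
apply: (IH (P - (P \Po ('X - (w%:~R)%:P)))) => [y|].
  by rewrite /cd !hP hornerD hornerN horner_comp !hornerE rmorphB.
apply: leq_trans (size_diff_poly _ _) _; move: sz => /=; case: (size P) => //.
Qed.

(** A nonzero value needs all the partially shifted points inside the interval; hence summing over
    [Iw], as uniformity does, equals summing over the whole interval. *)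
Lemma Delta_supp (E : int -> R) w x : supp E -> Delta E w x != 0 ->
  forall i, (i <= size w)%N -> x - \sum_(u <- take i w) u \in I.
Proof.
move=> hE; elim/last_ind: w x => [|w u IH] x.
  move=> Ex i; rewrite leqn0 => /eqP ->; rewrite big_nil subr0.
  by apply: contraNT Ex => /hE; rewrite /Delta /= => ->.
rewrite Delta_rcons /Delta1 mulf_eq0 negb_or => /andP[h1 h2] i.
rewrite size_rcons leq_eqVlt => /orP[/eqP ->|].
  rewrite take_oversize ?size_rcons // -cats1 big_cat big_seq1 /=.
  have := IH _ h2 (size w) (leqnn _); rewrite take_size => h.
  by have -> : x - (\sum_(v <- w) v + u) = x - u - \sum_(v <- w) v by ring.
rewrite ltnS => iw; rewrite -cats1 takel_cat //; exact: IH.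
Qed.

Lemma mem_Iw w x : (x \in Iw N w) =
  (x \in I) && all (fun i => (x - \sum_(u <- take i w) u)%R \in I) (iota 0 (size w).+1).
Proof. by rewrite !inE. Qed.

Lemma sum_Iw (E : int -> R) w : supp E ->
  \sum_(x <- I) Delta E w x = \sum_(x <- Iw N w) Delta E w x.
Proof.
move=> hE; apply: sum_supp; rewrite ?fset_uniq //.
  by move=> x; rewrite mem_Iw => /andP[].
move=> x; apply: contraNeq => h; rewrite mem_Iw.
have h' := Delta_supp hE h; have := h' 0%N isT; rewrite take0 big_nil subr0 => xI.
rewrite xI andTb; apply/allP => i; rewrite mem_iota add0n ltnS => /andP[_ hi].
exact: h'.
Qed.

End Gowers.

Lemma balanced_supp (R : realType) N A : supp N (balanced R N A).
Proof. by move=> x /negbTE; rewrite /balanced => ->. Qed.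

Theorem uniform_phase (R : realType) k N (A : {fset int}) (a : R) (al : 'I_k -> R) :
  (0 < N)%N -> uniform_of_degree N A a k ->
  nm (Tsum N (fun x => (balanced R N A x)%:C%C * e (phi al x))) ^+ (2 ^ k.+1) <=
  a * (2 * N)%:R ^+ (2 ^ k.+1).
Proof.
move=> N0 hu; set E := balanced R N A.
have hf : supp N (fun x => (E x)%:C%C * e (phi al x)).
  by move=> x /(@balanced_supp R N A) h; rewrite /E h mul0r.
have gw := gowers_weyl k N0 hf.
pose P : {poly R} := \sum_(j < k) al j *: 'X^(j.+1).
have hP x : phi al x = P.[x%:~R].
  rewrite /P horner_sum; apply: eq_bigr => j _; by rewrite hornerZ hornerXn.
have sP : (size P <= k.+1)%N.
  apply: leq_trans (size_sum _ _ _) _; apply/bigmax_leqP => j _.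
  by apply: leq_trans (size_scale_leq _ _) _; rewrite size_polyXn ltnS.
have Tw w : size w = k.+1 -> Tsum N (cD (fun x => (E x)%:C%C * e (phi al x)) w) =
    (\sum_(x <- Iw N w) Delta E w x)%:C%C.
  move=> sw; rewrite -(sum_Iw w (@balanced_supp R N A)) rmorph_sum /Tsum; apply: eq_bigr => x _.
  by rewrite cD_phase (cd_poly hP) ?sw // e0 mulr1.
have GE : \sum_(w : k.+1.-tuple (zitv (1 - N%:Z) (N%:Z - 1)))
     Tsum N (cD (fun x => (E x)%:C%C * e (phi al x)) (map val w)) =
    (\sum_(w : k.+1.-tuple (zitv (1 - N%:Z) (N%:Z - 1)))
    \sum_(x <- Iw N (map val w)) Delta E (map val w) x)%:C%C.
  by rewrite rmorph_sum; apply: eq_bigr => w _; apply: Tw; rewrite size_map size_tuple.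
rewrite GE [complex.Re _]/= in gw.
set D := (2 ^ k.+1 - k.+2)%N in gw; set G := \sum_w _ in gw.
have D0 : 0 < (2 * N)%:R ^+ D :> R by rewrite exprn_gt0 // ltr0n muln_gt0.
(* The Weyl bound makes the cube sum nonnegative, hence [a N^(k+2)] too, which permits enlarging the
   power of 2 at the end. *)
have G0 : 0 <= G by rewrite -(pmulr_rge0 _ D0); apply: le_trans gw; rewrite exprn_ge0 ?nm_ge0.
apply: le_trans gw _; apply: le_trans (ler_wpM2l (ltW D0) hu) _.
have a0 : 0 <= a * N%:R ^+ k.+2 by exact: le_trans G0 hu.
have E1 : (2 ^ k.+1 = D + k.+2)%N by rewrite subnK // ltn_expl.
rewrite E1 exprD [leRHS]mulrCA ler_pM2l // natrM exprMn [leRHS]mulrCA ler_peMl //.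
by rewrite exprn_ege1 // ler1n.
Qed.

(** * Solutions in boxes and local densities *)

Section System.
Variables (R : realType) (k s : nat) (lam : 'I_s -> int).
Local Notation C := R[i].
Local Notation e := (@e R).
Local Notation S := (@S R k).
Local Notation K := (kap k).
Implicit Types (al : 'I_k -> R).

Definition Lz (x : 'I_s -> int) (j : 'I_k) : int := \sum_i lam i * x i ^+ j.+1.
Definition lamsum : nat := (\sum_i `|lam i|%N)%N.

Lemma solutionE (x : 'I_s -> int) : solution lam k x = [forall j, Lz x j == 0].
Proof.
by apply: eq_forallb => j; congr (_ == _); apply: eq_bigr => i _; rewrite intz.
Qed.

Lemma prod_wsum (I : finType) (pos : I -> int) (f : 'I_s -> I -> C) al :
  \prod_i (\sum_x f i x * e (phi (zscale (lam i) al) (pos x))) =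
  \sum_(x : {ffun 'I_s -> I}) (\prod_i f i (x i)) *
    e (\sum_j al j * (Lz (fun i => pos (x i)) j)%:~R).
Proof.
rewrite (bigA_distr_bigA (fun i x => f i x * e (phi (zscale (lam i) al) (pos x)))) /=.
apply: eq_bigr => x _; rewrite big_split /= -e_sum; congr (_ * e _).
transitivity (\sum_i \sum_j al j * (lam i * pos (x i) ^+ j.+1)%:~R).
  by apply: eq_bigr => i _; exact: phi_scale.
rewrite exchange_big /=; apply: eq_bigr => j _.
by rewrite -mulr_sumr /Lz rmorph_sum.
Qed.

Lemma Eav_prod (I : finType) (pos : I -> int) (f : 'I_s -> I -> C) M : (0 < M)%N ->
  Eav M (fun al => \prod_i (\sum_x f i x * e (phi (zscale (lam i) al) (pos x)))) =
  \sum_(x : {ffun 'I_s -> I} | [forall j, (M%:Z %| Lz (fun i => pos (x i)) j)%Z])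
    \prod_i f i (x i).
Proof.
move=> M0; rewrite -(Eav_count _ _ M0); apply: eq_Eav => al; exact: prod_wsum.
Qed.

Lemma Lz_bound (x : 'I_s -> int) N j : (0 < N)%N -> (forall i, (`|x i| <= N)%N) ->
  (`|Lz x j| <= lamsum * N ^ j.+1)%N.
Proof.
move=> N0 hx; rewrite -lez_nat abszE; apply: le_trans (ler_norm_sum _ _ _) _.
rewrite /lamsum big_distrl /= -natz natr_sum; apply: ler_sum => i _.
by rewrite natz -abszE abszM abszX lez_nat leq_mul2l leq_exp2r // hx orbT.
Qed.

Lemma Lz_dvd (x : 'I_s -> int) (c : int) N M j : (0 < N)%N -> (forall i, (`|x i| <= N)%N) ->
  (lamsum * N ^ k + `|c| < M)%N -> (M%:Z %| Lz x j - c)%Z = (Lz x j == c).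
Proof.
move=> N0 hx hM; have hL : (`|Lz x j - c| < M)%N.
  apply: leq_ltn_trans hM; have := Lz_bound j N0 hx => h.
  apply: (@leq_trans (`|Lz x j| + `|c|)%N).
    by rewrite -lez_nat PoszD !abszE; exact: ler_normB.
  rewrite leq_add2r; apply: leq_trans h _; rewrite leq_mul2l; apply/orP; right.
  by rewrite leq_pexp2l.
rewrite -subr_eq0; apply/idP/eqP => [|->]; last exact: dvdz0.
move: hL; set z := _ - c => hL; rewrite dvdzE /= => hd; apply/eqP; rewrite -absz_eq0.
by apply: contraLR hL; rewrite -lt0n -leqNgt => z0; exact: dvdn_leq.
Qed.

(** All factors but the one at [i0] are at most the largest, whose power [s - 1 >= n] is bounded by
    one term of the sum. Keeping [a i0] apart saves [1 / Y] when it is small. *)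
Lemma prod_le_moment (a : 'I_s -> R) n i0 : (forall i, 0 <= a i <= 1) -> (0 < n < s)%N ->
  \prod_i a i <= a i0 * \sum_i a i ^+ n.
Proof.
move=> ha /andP[n0 ns].
have a0 i : 0 <= a i by have /andP[] := ha i.
have a1 i : a i <= 1 by have /andP[] := ha i.
have [i1 _ hmax] := @arg_maxP _ _ _ i0 xpredT a isT.
have {}hmax i : a i <= a i1 by exact: hmax.
rewrite (bigD1 i0) //= ler_wpM2l //.
apply: (@le_trans _ _ (\prod_(i | i != i0) a i1)).
  by apply: ler_prod => i _; rewrite a0 /= hmax.
rewrite prodr_const cardC1 card_ord.
apply: (@le_trans _ _ (a i1 ^+ n)).
  by apply: ler_wiXn2l => //; move: ns; case: s => // m; rewrite ltnS.
by rewrite (bigD1 i1) //= lerDl sumr_ge0 // => i _; rewrite exprn_ge0.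
Qed.

Let nS N al i : R := nm (S N (zscale (lam i) al)) / N%:R.

Let nS01 N al i : (0 < N)%N -> 0 <= nS N al i <= 1.
Proof.
move=> n0; rewrite /nS divr_ge0 ?nm_ge0 //= ler_pdivrMr ?ltr0n // mul1r.
by apply: le_trans (nm_esum _ _) _; rewrite card_ord.
Qed.

Let nm_prod_S N al : (0 < N)%N ->
  nm (\prod_i S N (zscale (lam i) al)) = N%:R ^+ s * \prod_i nS N al i.
Proof.
move=> N0; rewrite nm_prod; rewrite -[in X in N%:R ^+ X](card_ord s) -prodr_const -big_split /=.
by apply: eq_bigr => i _; rewrite /nS mulrC divfK // pnatr_eq0 -lt0n.
Qed.

Lemma S_one N al : S N al = \sum_(x < N) 1 * e (phi al (npos x)).
Proof. by apply: eq_bigr => x _; rewrite mul1r. Qed.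

(* Every value of the system taken on B is divisible by all the denominators that occur on the
   major arcs and is small there, so moving from 0 to that value changes little. *)
Lemma compare_solutions N Y t E (eta : R) (i0 : 'I_s) (B : {set {ffun 'I_s -> 'I_N}})
    (V : finType) (v : {ffun 'I_s -> 'I_N} -> V) (D : {set V}) :
  wp R k t 0 E -> (0 < t)%N -> (2 * t < s)%N -> (1 < Y)%N -> (Y ^ E <= N)%N ->
  (forall i, lam i != 0) -> 0 <= eta ->
  (Jn k t N)%:R <= Y%:R * (N ^ (2 * t))%:R / (N ^ K)%:R :> R ->
  (forall x, x \in B -> forall j,
     (((`|lam i0| * (Y ^ E)`!)%N%:Z %| Lz (fun i => npos (x i)) j)%Z /\
     (Y ^ E)%:R * `|(Lz (fun i => npos (x i)) j)%:~R| <= eta * N%:R ^+ j.+1)) ->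
  (forall x, x \in B -> v x \in D) ->
  (forall x y, x \in B -> y \in B -> v x = v y ->
     forall j, Lz (fun i => npos (x i)) j = Lz (fun i => npos (y i)) j) ->
  #|B|%:R / #|D|%:R <=
  #|[set x : {ffun 'I_s -> 'I_N} | solution lam k (fun i => npos (x i))]|%:R +
  s%:R * (2 / Y%:R + 8 * (k%:R * eta)) * ((Jn k t N)%:R * N%:R ^+ s / N%:R ^+ (2 * t)).
Proof.
move=> hw t0 ts Y1 YN lam0 eta0 hJ hB vD vinj.
set r0 := #|[set x | _]|.
have N0 : (0 < N)%N by apply: leq_trans YN; rewrite expn_gt0 ltnW.
have Nr : 0 < N%:R :> R by rewrite ltr0n.
have Yr : 0 < Y%:R :> R by rewrite ltr0n ltnW.
pose Lx (x : {ffun 'I_s -> 'I_N}) := Lz (fun i => npos (x i)).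
pose M := (2 * lamsum * (t.+1 * N ^ k)).+1.
have xN (x : {ffun 'I_s -> 'I_N}) i : (`|npos (x i)| <= N)%N by rewrite /npos absz_nat ltnW.
have LM (x : {ffun 'I_s -> 'I_N}) j : (lamsum * N ^ k + `|Lx x j| < M)%N.
  have h := Lz_bound j N0 (xN x); rewrite /M ltnS.
  apply: (@leq_trans (lamsum * N ^ k + lamsum * N ^ k)).
    rewrite leq_add2l; apply: leq_trans h _; rewrite leq_mul2l; apply/orP; right.
    by rewrite leq_pexp2l.
  by rewrite mulSn; clear; move: (N ^ k)%N lamsum => a b; nia.
have M0 : (0 < M)%N by [].
pose r x := #|[set y : {ffun 'I_s -> 'I_N} | [forall j, Lx y j == Lx x j]]|.
pose PS al := \prod_i S N (zscale (lam i) al).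
have cnt (c : 'I_k -> int) : (forall j, (lamsum * N ^ k + `|c j| < M)%N) ->
   (#|[set y : {ffun 'I_s -> 'I_N} | [forall j, Lx y j == c j]]|%:R : C) =
   Eav M (fun al => PS al * e (- \sum_j al j * (c j)%:~R)).
  move=> hc; transitivity (Eav M (fun al => \sum_(y : {ffun 'I_s -> 'I_N}) 1 *
      e (\sum_j al j * (Lx y j - c j)%:~R))).
    rewrite Eav_count // -sum1_card natr_sum; apply: eq_big => [y|//].
    rewrite inE; apply: eq_forallb => j; by rewrite (Lz_dvd j N0 (xN y)).
  apply: eq_Eav => al; rewrite /PS.
  under [in RHS]eq_bigr => i _ do rewrite S_one.
  rewrite prod_wsum mulr_suml; apply: eq_bigr => y _.
  rewrite prodr_const expr1n !mul1r -eD -sumrN -big_split; congr e; apply: eq_bigr => j _ /=.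
  by rewrite rmorphB mulrBr.
have r0E : (r0%:R : C) = Eav M PS.
  have -> : r0 = #|[set y : {ffun 'I_s -> 'I_N} | [forall j, Lx y j == 0]]|.
    by apply: eq_card => y; rewrite !inE solutionE.
  rewrite (cnt (fun=> 0)) => [|j]; last by rewrite absz0 addn0 (leq_ltn_trans _ (LM [ffun=> Ordinal N0] j)) // leq_addr.
  apply: eq_Eav => al; rewrite big1 ?oppr0 ?e0 ?mulr1 // => j _; by rewrite mulr0.
have rE x : (((r x)%:R - r0%:R) : C) = Eav M (fun al => PS al * (e (- \sum_j al j * (Lx x j)%:~R) - 1)).
  rewrite (cnt (Lx x) (LM x)) r0E -EavB; apply: eq_Eav => al; by rewrite mulrBr mulr1.
set bd : R := 2 / Y%:R + 8 * (k%:R * eta).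
have bd0 : 0 <= bd by rewrite addr_ge0 ?divr_ge0 ?mulr_ge0.
have bd1 : 2 / Y%:R <= bd by rewrite lerDl !mulr_ge0.
have bd2 : 8 * (k%:R * eta) <= bd by rewrite lerDr divr_ge0.
(* If the sum of index [i0] is large, the inverse theorem gives a denominator [q <= Y^E]; the value
   is a multiple of [q lam_i0] and its phase is near 1. Otherwise that sum itself saves [1 / Y]. *)
have ptw x al : x \in B -> nm (PS al * (e (- \sum_j al j * (Lx x j)%:~R) - 1)) <=
    N%:R ^+ s * bd * \sum_i nS N al i ^+ (2 * t).
  move=> xB; rewrite nmM nm_prod_S // -!mulrA ler_wpM2l ?exprn_ge0 //.
  have pm := prod_le_moment i0 (fun i => nS01 al i N0) (_ : 0 < 2 * t < s)%N.
  have {}pm : \prod_i nS N al i <= nS N al i0 * \sum_i nS N al i ^+ (2 * t).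
    by apply: pm; rewrite muln_gt0 t0.
  set sg := \sum_i _ in pm *.
  have sg0 : 0 <= sg by apply: sumr_ge0 => i _; rewrite exprn_ge0 //; have /andP[] := nS01 al i N0.
  have P0 : 0 <= \prod_i nS N al i by apply: prodr_ge0 => i _; have /andP[] := nS01 al i N0.
  have /andP[n0 n1] := nS01 al i0 N0.
  have [maj|min] := leP (Y%:R^-1) (nS N al i0).
    have [|q /andP[q0 qQ] hq] := hw N Y (zscale (lam i0) al) Y1 YN hJ.
      by move: maj; rewrite /nS ler_pdivlMr // mulrC.
    have [z hz] := boolp.choice (fun j => hq j isT).
    have Ed : nm (e (- \sum_j al j * (Lx x j)%:~R) - 1) <= 8 * (k%:R * eta).
      have [m hm] : exists m : 'I_k -> int, forall j, Lx x j = m j * (q%:Z * lam i0).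
        have H j : exists m : int, Lx x j = m * (q%:Z * lam i0).
          have [hd _] := hB x xB j; apply/dvdzP; apply: dvdz_trans hd.
          rewrite dvdzE /= abszM absz_nat mulnC dvdn_mul // dvdn_fact // q0 //.
        by have [m hm] := boolp.choice H; exists m.
      rewrite -[e (- _)](eDint _ (\sum_j m j * z j)) rmorph_sum /= [- _ + _]addrC -sumrB.
      apply: le_trans (e_lip1 _) _; rewrite ler_pM2l //.
      apply: le_trans (ler_norm_sum _ _ _) _; rewrite -[k in k%:R]card_ord mulr_natl -sumr_const.
      apply: ler_sum => j _; have [_ hs] := hB x xB j.
      rewrite -/(Lx x) in hs.
      have -> : (m j * z j)%:~R - al j * (Lx x j)%:~R = - (m j)%:~R * (q%:R * zscale (lam i0) al j - (z j)%:~R).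
        by rewrite hm !rmorphM /= /zscale; ring.
      rewrite normrM normrN; apply: le_trans (ler_wpM2l (normr_ge0 _) (hz j)) _.
      rewrite mulrA ler_pdivrMr ?exprn_gt0 //; apply: le_trans hs.
      rewrite mulrC ler_wpM2l // hm rmorphM normrM ler_peMr // -intr_norm -[1]/(1%:~R) ler_int.
      by rewrite -gtz0_ge1 normr_gt0 mulf_neq0 // eqz_nat -lt0n.
    apply: (@le_trans _ _ (sg * bd)); last by rewrite mulrC.
    apply: ler_pM; rewrite ?nm_ge0 //; last exact: le_trans Ed bd2.
    by apply: le_trans pm _; rewrite ler_piMl.
  apply: (@le_trans _ _ ((Y%:R^-1 * sg) * 2)).
    apply: ler_pM; rewrite ?nm_ge0 //.
      by apply: le_trans pm _; rewrite ler_wpM2r // ltW.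
    by apply: le_trans (nmD _ _) _; rewrite nmN nm_e nm1.
  have -> : Y%:R^-1 * sg * 2 = 2 / Y%:R * sg by ring.
  by rewrite ler_wpM2r.
have mom i : Eav M (fun al => nS N al i ^+ (2 * t)) <= (Jn k t N)%:R / N%:R ^+ (2 * t).
  rewrite (@eq_Eav R k _ _ _ (fun al => (N%:R ^+ (2 * t))^-1 * nm (esum (@npos N) (zscale (lam i) al)) ^+ (2 * t))).
    rewrite EavZ mulrC ler_wpM2r ?invr_ge0 ?exprn_ge0 //.
    apply: (@moment_le_Jn R k _ (fun x : 'I_N => x : nat)) => //; first exact: ord_inj.
    rewrite /M ltnS; apply: leq_mul; last by rewrite leq_mul2r leqnSn orbT.
    apply: (@leq_trans lamsum); last by rewrite leq_pmull.
    by rewrite /lamsum (bigD1 i) //= leq_addr.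
  by move=> al; rewrite /nS expr_div_n mulrC.
have tot : nm (Eav M (fun al => PS al * \sum_(x in B) (e (- \sum_j al j * (Lx x j)%:~R) - 1))) <=
   #|B|%:R * (s%:R * bd * ((Jn k t N)%:R * N%:R ^+ s / N%:R ^+ (2 * t))).
  apply: le_trans (nm_Eav _ _) _.
  apply: (@le_trans _ _ (Eav M (fun al => #|B|%:R * (N%:R ^+ s * bd) * \sum_i nS N al i ^+ (2 * t)))).
    apply: ler_Eav => al; rewrite [PS al * _]mulr_sumr; apply: le_trans (nm_sum _ _ _) _.
    rewrite -[leRHS]mulrA [leRHS]mulr_natl -sumr_const; apply: ler_sum => x xB; exact: ptw.
  rewrite EavZ Eav_sum -!mulrA ler_wpM2l //.
  apply: (@le_trans _ _ (N%:R ^+ s * (bd * \sum_(i < s) ((Jn k t N)%:R / N%:R ^+ (2 * t))))).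
    rewrite ler_wpM2l ?exprn_ge0 // ler_wpM2l // ler_sum //.
  rewrite sumr_const card_ord -[_ *+ s]mulr_natl le_eqVlt; apply/orP; left; apply/eqP.
  by ring.
have totE : Eav M (fun al => PS al * \sum_(x in B) (e (- \sum_j al j * (Lx x j)%:~R) - 1)) =
   ((\sum_(x in B) (r x)%:R) - #|B|%:R * r0%:R)%R :> C.
  rewrite (@eq_Eav R k _ _ _ (fun al => \sum_(x in B) PS al * (e (- \sum_j al j * (Lx x j)%:~R) - 1))).
    rewrite Eav_sum; under eq_bigr => x _ do rewrite -rE.
    by rewrite sumrB sumr_const -[r0%:R *+ _]mulr_natl.
  by move=> al; rewrite mulr_sumr.
have up : \sum_(x in B) (r x)%:R <= #|B|%:R * r0%:R +
   #|B|%:R * (s%:R * bd * ((Jn k t N)%:R * N%:R ^+ s / N%:R ^+ (2 * t))) :> R.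
  rewrite -lerBlDl; apply: le_trans tot; rewrite totE.
  have -> : (\sum_(x in B) (r x)%:R - #|B|%:R * r0%:R : C) =
     ((\sum_(x in B) (r x)%:R - #|B|%:R * r0%:R : R)%:C)%C.
    rewrite rmorphB rmorph_sum rmorphM /= !rmorph_nat; congr (_ - _); apply: eq_bigr => x _.
    by rewrite rmorph_nat.
  by rewrite nmC ler_norm.
(* Points of one fibre of [v] share their value, so [r] is at least the size of the fibre; Cauchy's
   inequality over the fibres concludes. *)
have low : #|B|%:R ^+ 2 <= #|D|%:R * \sum_(x in B) (r x)%:R :> R.
  pose n (c : V) := #|[set x in B | v x == c]|.
  have cB : #|B|%:R = \sum_(c : V | c \in D) (n c)%:R :> R.
    rewrite -natr_sum -sum1_card (partition_big v (mem D)) //=; congr (_%:R).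
    by apply: eq_bigr => c _; rewrite sum1dep_card; apply: eq_card => x; rewrite !inE.
  have sr : \sum_(c : V | c \in D) (n c)%:R ^+ 2 <= \sum_(x in B) (r x)%:R :> R.
    rewrite [leRHS](partition_big v (mem D)) //=; apply: ler_sum => c _.
    rewrite expr2 mulr_natl -sumr_const.
    rewrite [leRHS](eq_bigl (mem [set x in B | v x == c])) => [|x]; last by rewrite !inE.
    apply: ler_sum => x; rewrite inE => /andP[xB /eqP vx].
    rewrite ler_nat; apply: subset_leq_card; apply/fintype.subsetP => y; rewrite !inE => /andP[yB /eqP vy].
    apply/forallP => j; apply/eqP; apply: vinj => //; by rewrite vx vy.
  have := @sum_pow2_le R 'I_#|D| (fun c => (n (enum_val c))%:R) 1 (fun c => ler0n _ _).
  rewrite expn1 expr1 card_ord => h.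
  apply: (@le_trans _ _ (#|D|%:R * \sum_(c : V | c \in D) (n c)%:R ^+ 2)); last by rewrite ler_wpM2l.
  by rewrite cB big_enum_val [X in _ <= _ * X]big_enum_val; exact: h.
have [B0|B0] := posnP #|B|.
  rewrite B0 mul0r addr_ge0 // !mulr_ge0 ?invr_ge0 ?exprn_ge0 //.
have D0 : (0 < #|D|)%N.
  by move: B0 => /card_gt0P[x xB]; apply/card_gt0P; exists (v x); exact: vD.
rewrite ler_pdivrMr ?ltr0n // -(ler_pM2l (_ : 0 < #|B|%:R :> R)) ?ltr0n // -expr2.
apply: le_trans low _; rewrite [leRHS]mulrA [leRHS]mulrC ler_wpM2l // mulrDr; exact: up.
Qed.

End System.

(** * Congruences to moduli without small prime factors *)

Section Rough.
Variables (R : realType) (k : nat).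
Local Notation C := R[i].
Local Notation e := (@e R).
Local Notation S := (@S R k).
Local Notation K := (kap k).
Implicit Types (al : 'I_k -> R).

(** The count with right-hand side [h] is the moment twisted by unimodular factors, so it is largest
    for [h = 0]. *)
Lemma powdiff_count (h : 'I_k -> int) t N :
  (#|[set xy : {ffun 'I_t -> 'I_N} * {ffun 'I_t -> 'I_N} |
     [forall j, powdiff (@npos N) xy j == h j]]| <= Jn k t N)%N.
Proof.
rewrite -(ler_nat R); pose M := (t * N ^ k).+1.
apply: le_trans (@moment_S_le R k N t M (leqnn _)).
apply: (@le_trans _ _ #|[set xy : {ffun 'I_t -> 'I_N} * {ffun 'I_t -> 'I_N} |
     [forall j, (M%:Z %| powdiff (@npos N) xy j - h j)%Z]]|%:R).
  rewrite ler_nat; apply: subset_leq_card; apply/fintype.subsetP => xy; rewrite !inE.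
  by move=> /forallP hh; apply/forallP => j; rewrite (eqP (hh j)) subrr dvdz0.
have cE : (#|[set xy : {ffun 'I_t -> 'I_N} * {ffun 'I_t -> 'I_N} |
     [forall j, (M%:Z %| powdiff (@npos N) xy j - h j)%Z]]|%:R : C) =
   Eav M (fun al => (nm (S N al) ^+ (2 * t))%:C%C * e (- \sum_j al j * (h j)%:~R)).
  transitivity (Eav M (fun al : 'I_k -> R => \sum_(xy : {ffun 'I_t -> 'I_N} * {ffun 'I_t -> 'I_N}) 1 *
      e (\sum_j al j * (powdiff (@npos N) xy j - h j)%:~R))).
    by rewrite Eav_count // -sum1_card natr_sum; apply: eq_big => [xy|//]; rewrite inE.
  apply: eq_Eav => al; rewrite nm_pow2 /S esum_pow_expand e_sum_sqr mulr_suml.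
  apply: eq_bigr => xy _; rewrite mul1r -eD; congr e.
  have AE (x : {ffun 'I_t -> 'I_N}) : \sum_i phi al (npos (x i)) =
      \sum_j al j * (\sum_i npos (x i) ^+ j.+1)%:~R.
    rewrite /phi exchange_big /=; apply: eq_bigr => j _; rewrite -mulr_sumr rmorph_sum /=.
    by congr (_ * _); apply: eq_bigr => i _; rewrite rmorphXn.
  rewrite !AE -!sumrB; apply: eq_bigr => j _.
  by rewrite -!mulrBr /powdiff !rmorphB.
have -> : #|[set xy : {ffun 'I_t -> 'I_N} * {ffun 'I_t -> 'I_N} |
     [forall j, (M%:Z %| powdiff (@npos N) xy j - h j)%Z]]|%:R =
   nm (#|[set xy : {ffun 'I_t -> 'I_N} * {ffun 'I_t -> 'I_N} |
     [forall j, (M%:Z %| powdiff (@npos N) xy j - h j)%Z]]|%:R : C) by rewrite nm_natr.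
rewrite cE; apply: le_trans (nm_Eav _ _) _; apply: ler_Eav => al.
by rewrite nmM nm_e mulr1 nmC ger0_norm // exprn_ge0 ?nm_ge0.
Qed.

Lemma card_box (b : 'I_k -> nat) m : (forall j, (b j <= m)%N) ->
  #|family (fun j : 'I_k => [pred x : 'I_m | (x < b j)%N])| = (\prod_j b j)%N.
Proof.
move=> bm; rewrite card_family foldrE big_map big_enum /=; apply: eq_bigr => j _.
rewrite -sum1_card (eq_bigl (fun i : 'I_m => (i < b j)%N)) //.
by rewrite (big_ord_narrow (bm j)) sum1_card card_ord.
Qed.

Lemma card_le_fibers (T V : finType) (A : {set T}) (v : T -> V) (D : {pred V}) n :
  (forall x, x \in A -> v x \in D) ->
  (forall c, c \in D -> (#|[set x in A | v x == c]| <= n)%N) -> (#|A| <= #|D| * n)%N.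
Proof.
move=> vD hn; rewrite -sum1_card (partition_big v (mem D)) //= -sum_nat_const.
apply: leq_sum => c cD; apply: leq_trans (hn c cD).
by rewrite sum1dep_card; apply: eq_leq; apply: eq_card => x; rewrite !inE.
Qed.

(** A difference divisible by [q] is [q d] with [|d| <= t q^j]. This leaves at most
    [2 t q^j + 1 <= 3 t q^j] right-hand sides in coordinate [j], and [powdiff_count] bounds each
    system. *)
Lemma cong_count t q : (0 < t)%N -> (0 < q)%N ->
  (#|[set xy : {ffun 'I_t -> 'I_q} * {ffun 'I_t -> 'I_q} |
     [forall j : 'I_k, (q%:Z %| powdiff (@npos q) xy j)%Z]]| <=
   (\prod_(j < k) (3 * t * q ^ j)) * Jn k t q)%N.
Proof.
move=> t0 q0; pose m := (3 * t * q ^ k)%N; pose b (j : 'I_k) := (3 * t * q ^ j)%N.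
have bm j : (b j <= m)%N by rewrite leq_mul2l leq_pexp2l ?orbT // ltnW.
have b0 j : (0 < b j)%N by rewrite !muln_gt0 t0 expn_gt0 q0.
have m0 : (0 < m)%N by rewrite !muln_gt0 t0 expn_gt0 q0.
pose g (xy : {ffun 'I_t -> 'I_q} * {ffun 'I_t -> 'I_q}) (j : 'I_k) : nat :=
  absz ((powdiff (@npos q) xy j %/ q%:Z)%Z + (t * q ^ j)%N%:Z).
have gb xy j : (q%:Z %| powdiff (@npos q) xy j)%Z ->
   powdiff (@npos q) xy j = ((g xy j)%:Z - (t * q ^ j)%N%:Z) * q%:Z /\ (g xy j < b j)%N.
  move=> hd; have := divzK hd; set d := (_ %/ _)%Z => hde.
  have sb (x : {ffun 'I_t -> 'I_q}) : (\sum_i x i ^ j.+1 <= t * q ^ j * q)%N.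
    rewrite -mulnA -expnSr -[X in (_ <= X * _)%N]card_ord -sum_nat_const.
    by apply: leq_sum => i _; rewrite leq_exp2r // ltnW.
  have s1 := sb xy.1; have s2 := sb xy.2.
  have dl : - (t * q ^ j)%N%:Z <= d <= (t * q ^ j)%N%:Z.
    have qz : (0 : int) < q%:Z by rewrite ltz_nat.
    have bnd (a b' c : nat) : (a <= c)%N -> (b' <= c)%N -> - c%:Z <= a%:Z - b'%:Z <= c%:Z.
      by clear; lia.
    have /andP[h1 h2] := bnd _ _ _ s1 s2.
    by apply/andP; split; rewrite -(ler_pM2r qz) hde powdiff_npos ?mulNr -PoszM.
  rewrite /g -/d gez0_abs; last by move: dl; clear; lia.
  rewrite addrK hde; split => //; rewrite /b -ltz_nat gez0_abs; last by move: dl; clear; lia.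
  have : (0 < t * q ^ j)%N by rewrite muln_gt0 t0 expn_gt0 q0.
  by move: dl; rewrite -mulnA; move: (t * q ^ j)%N => z; clear; lia.
pose v xy : {ffun 'I_k -> 'I_m} := [ffun j => insubd (Ordinal m0) (g xy j)].
have vE xy j : (q%:Z %| powdiff (@npos q) xy j)%Z -> v xy j = g xy j :> nat.
  by move=> /gb[_ h]; rewrite ffunE insubdK // -topredE /=; apply: leq_trans h (bm j).
rewrite -(card_box bm); apply: (card_le_fibers (v := v)) => [xy|c cF].
  rewrite inE => /forallP h; apply/familyP => j; rewrite inE vE //; by have [] := gb xy j (h j).
apply: leq_trans (powdiff_count (fun j => ((c j : nat)%:Z - (t * q ^ j)%N%:Z) * q%:Z) t q).
apply: subset_leq_card; apply/fintype.subsetP => xy; rewrite !inE => /andP[/forallP h /eqP vc].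
by apply/forallP => j; have [-> _] := gb xy j (h j); rewrite -vE // vc.
Qed.

Lemma S_mult (c : 'I_k -> int) q m : (0 < q)%N ->
  S (q * m) (fun j => (c j)%:~R / q%:R) = m%:R * S q (fun j => (c j)%:~R / q%:R).
Proof.
move=> q0; rewrite /S /esum /npos (sum_blocks (fun x => e (phi (fun j => (c j)%:~R / q%:R) x%:Z))).
rewrite (eq_bigr (fun=> \sum_(y < q) e (phi (fun j => (c j)%:~R / q%:R) y%:Z))) => [|i _].
  by rewrite sumr_const card_ord mulr_natl.
apply: eq_bigr => y _; elim: (i : nat) => [|n IH]; first by rewrite muln0.
by rewrite mulnSr addnAC e_phi_periodic.
Qed.

Lemma prod_pow_kap q : ((\prod_(j < k) q ^ j) * q ^ k = q ^ K)%N.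
Proof.
rewrite -[X in (_ * q ^ X)%N]card_ord -prod_nat_const -big_split /=.
elim: k => [|m IH]; first by rewrite big_ord0.
rewrite big_ord_recr /= IH -expnSr -expnD; congr (_ ^ _)%N; apply/eqP.
by rewrite -(eqn_pmul2l (isT : 0 < 2)%N) mulnDr !kap2; apply/eqP; lia.
Qed.

Variables (s : nat) (lam : 'I_s -> int) (t E : nat) (Cj : R).
Hypotheses (hw : wp R k t 0 E) (t0 : (0 < t)%N) (ts : (2 * t < s)%N) (Kt : (K <= 2 * t)%N).
Hypotheses (lam0 : forall i, lam i != 0) (Cj0 : 0 < Cj).
Hypothesis hJ : forall N, (0 < N)%N -> (Jn k t N)%:R <= Cj * N%:R ^+ (2 * t - K).

Definition csol q := #|[set x : {ffun 'I_s -> 'I_q} |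
   [forall j : 'I_k, (q%:Z %| Lz lam (fun i => npos (x i)) j)%Z]]|.

Lemma Jn_Y Y N : Cj <= Y%:R -> (0 < N)%N ->
  (Jn k t N)%:R <= Y%:R * (N ^ (2 * t))%:R / (N ^ K)%:R :> R.
Proof.
move=> CY N0; have Nr : 0 < N%:R :> R by rewrite ltr0n.
apply: le_trans (hJ N0) _; rewrite !natrX -mulrA.
have -> : N%:R ^+ (2 * t) / N%:R ^+ K = N%:R ^+ (2 * t - K) :> R.
  by rewrite -{1}(subnK Kt) exprD mulfK // expf_neq0 // gt_eqF.
by rewrite ler_wpM2r ?exprn_ge0.
Qed.

(** If a frequency [a] has a normalised sum above [1 / Y], the inverse theorem makes [q] divide
    [d lam_i0 a_j] with [d <= Y^E]; as the primes of [q] exceed [W], this forces [a = 0]. The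
    nonzero frequencies are then paid by the moment of order [2t]. *)
Lemma rough_density : exists W : nat, forall q, (0 < q)%N ->
  (forall p, prime p -> (p %| q)%N -> (W < p)%N) ->
  q%:R ^+ s / q%:R ^+ k / 2 <= (csol q)%:R :> R.
Proof.
pose C3 : R := (3 * t)%:R ^+ k * Cj.
have C30 : 0 <= C3 by rewrite mulr_ge0 ?exprn_ge0 // ltW.
pose Y := (Num.bound (Cj + 2 * s%:R * C3)).+2.
have Yb : Cj + 2 * s%:R * C3 <= Y%:R.
  apply: le_trans (ltW (archi_boundP _)) _; first by rewrite addr_ge0 ?mulr_ge0 // ltW.
  by rewrite ler_nat /Y ltnW.
have x0 : 0 <= 2 * s%:R * C3 by apply: mulr_ge0 => //; exact: mulr_ge0.
have CY : Cj <= Y%:R by apply: le_trans Yb; rewrite lerDl.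
have Y1 : (1 < Y)%N by [].
have Yr : 0 < Y%:R :> R by [].
have s0 : (0 < s)%N by exact: leq_ltn_trans ts.
pose i0 : 'I_s := Ordinal s0.
exists (Y ^ E + lamsum lam)%N => q q0 hq.
have qr : 0 < q%:R :> R by rewrite ltr0n.
pose nS (a : {ffun 'I_k -> 'I_q}) i : R := nm (S q (zscale (lam i) (gpt R a))) / q%:R.
have nS01 a i : 0 <= nS a i <= 1.
  rewrite /nS divr_ge0 ?nm_ge0 //= ler_pdivrMr // mul1r.
  by apply: le_trans (nm_esum _ _) _; rewrite card_ord.
have cop d : (0 < d <= Y ^ E)%N -> forall i, coprime q (d * `|lam i|).
  move=> /andP[d0 dY] i; rewrite /coprime; apply: contraT => g1.
  have g0 : (0 < gcdn q (d * `|lam i|))%N by rewrite gcdn_gt0 q0.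
  have g2 : (1 < gcdn q (d * `|lam i|))%N by rewrite ltn_neqAle eq_sym g1.
  have pp := pdiv_prime g2; have pd := pdiv_dvd (gcdn q (d * `|lam i|)).
  move: pp pd; set p := pdiv _ => pp pd.
  have := hq p pp (dvdn_trans pd (dvdn_gcdl _ _)).
  have := dvdn_trans pd (dvdn_gcdr _ _); rewrite Euclid_dvdM // => /orP[] /dvdn_leq h.
    by rewrite ltnNge (leq_trans (h d0)) // (leq_trans dY) // leq_addr.
  rewrite ltnNge (leq_trans (h _)) ?absz_gt0 // (leq_trans _ (leq_addl _ _)) //.
  by rewrite /lamsum (bigD1 i) //= leq_addr.
have small a : a != [ffun=> Ordinal q0] -> nS a i0 <= Y%:R^-1.
  move=> an0; rewrite leNgt; apply: contra an0 => big; apply/eqP/ffunP => j.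
  pose c j : int := lam i0 * (a j : nat)%:Z.
  have cE : zscale (lam i0) (gpt R a) = fun j => (c j)%:~R / q%:R.
    by apply: boolp.funext => j'; rewrite /zscale /gpt /c rmorphM /= mulrA.
  (* Repeating the period [m] times preserves the normalised sum and makes the approximation error
     smaller than [1 / q], so that the fraction is exact. *)
  pose m := (Y ^ E * q).+1; pose N := (q * m)%N.
  have N0 : (0 < N)%N by rewrite muln_gt0 q0.
  have NE : (Y ^ E * q < N)%N by rewrite /N /m leq_pmull.
  have [|||d hd hz] := hw (N := N) (Y := Y) (al := fun j => (c j)%:~R / q%:R) Y1.
  - by apply: leq_trans (ltnW NE); rewrite leq_pmulr.
  - exact: Jn_Y.
  - rewrite /N S_mult // nmM nm_natr.
    move: big; rewrite /nS cE => /ltW; rewrite ler_pdivlMr // => h.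
    apply: le_trans (ler_wpM2l (ler0n _ m) h); rewrite natrM le_eqVlt; apply/orP; left.
    by apply/eqP; ring.
  have [z hzj] := hz j isT.
  have zq : d%:Z * c j - z * q%:Z = 0.
    apply: (@int_lt1_eq0 R); have -> : (d%:Z * c j - z * q%:Z)%:~R =
        (d%:R * ((c j)%:~R / q%:R) - z%:~R) * q%:R :> R.
      by rewrite rmorphB !rmorphM /=; field; rewrite gt_eqF.
    rewrite normrM (ger0_norm (ltW qr)); apply: le_lt_trans (ler_wpM2r (ltW qr) hzj) _.
    rewrite mulrAC ltr_pdivrMr ?exprn_gt0 ?ltr0n // mul1r -natrM -natrX ltr_nat.
    by apply: leq_trans NE _; rewrite -{1}[N]expn1 leq_pexp2l.
  have dv : (q %| d * `|lam i0| * a j)%N.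
    have -> : (d * `|lam i0| * a j = absz (d%:Z * c j)%R)%N by rewrite /c !abszM !absz_nat mulnA.
    by move/eqP: zq; rewrite subr_eq0 => /eqP ->; rewrite abszM absz_nat dvdn_mull.
  move: dv; rewrite Gauss_dvdr ?cop // => /dvdn_leq h.
  apply: val_inj; rewrite ffunE /=; apply/eqP; rewrite -leqn0 leqNgt; apply/negP => /h.
  by rewrite leqNgt ltn_ord.
have mom i : \sum_a nS a i ^+ (2 * t) <= C3.
  have := @esum_moment R k _ (@npos q) t q (lam i) q0; rewrite /Eav => h.
  have qk : 0 < (q ^ k)%:R :> R by rewrite ltr0n expn_gt0 q0.
  have {}h : \sum_a nS a i ^+ (2 * t) = (q ^ k)%:R / q%:R ^+ (2 * t) *
     #|[set xy : {ffun 'I_t -> 'I_q} * {ffun 'I_t -> 'I_q} |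
     [forall j : 'I_k, (q%:Z %| lam i * powdiff (@npos q) xy j)%Z]]|%:R.
    rewrite -h [RHS]mulrC mulrA divfK ?gt_eqF // mulr_suml.
    by apply: eq_bigr => a _; rewrite /nS expr_div_n.
  rewrite h.
  have cc : (#|[set xy : {ffun 'I_t -> 'I_q} * {ffun 'I_t -> 'I_q} |
     [forall j : 'I_k, (q%:Z %| (lam i * powdiff (@npos q) xy j)%R)%Z]]| <=
     (\prod_(j < k) (3 * t * q ^ j)) * Jn k t q)%N.
    apply: leq_trans (cong_count t0 q0); apply: subset_leq_card; apply/fintype.subsetP => xy.
    rewrite !inE => /forallP hh; apply/forallP => j; have := hh j; rewrite !dvdzE /= abszM Gauss_dvdr //.
    by have := cop 1%N _ i; rewrite mul1n; apply; rewrite expn_gt0.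
  apply: le_trans (ler_wpM2l _ (_ : _ <= ((3 * t) ^ k * \prod_(j < k) q ^ j)%:R * (Cj * q%:R ^+ (2 * t - K)))) _.
  - by rewrite divr_ge0 ?exprn_ge0.
  - apply: le_trans (_ : _ <= ((\prod_(j < k) (3 * t * q ^ j)) * Jn k t q)%:R) _; first by rewrite ler_nat.
    rewrite natrM big_split /= prod_nat_const card_ord ler_wpM2l //; exact: hJ.
  have e1 : ((3 * t) ^ k * \prod_(j < k) q ^ j)%:R * (q ^ k)%:R = (3 * t)%:R ^+ k * q%:R ^+ K :> R.
    by rewrite -natrM -mulnA prod_pow_kap natrM !natrX.
  have e2 : q%:R ^+ (2 * t) = q%:R ^+ (2 * t - K) * q%:R ^+ K :> R by rewrite -exprD subnK.
  have -> : (q ^ k)%:R / q%:R ^+ (2 * t) *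
     (((3 * t) ^ k * \prod_(j < k) q ^ j)%:R * (Cj * q%:R ^+ (2 * t - K))) =
     (((3 * t) ^ k * \prod_(j < k) q ^ j)%:R * (q ^ k)%:R) * (Cj * q%:R ^+ (2 * t - K)) / q%:R ^+ (2 * t) :> R.
    by ring.
  rewrite e1 e2 /C3 le_eqVlt; apply/orP; left; apply/eqP; field.
  by rewrite !expf_neq0 // gt_eqF.
pose PS (a : {ffun 'I_k -> 'I_q}) := \prod_i S q (zscale (lam i) (gpt R a)).
have nPS a : nm (PS a) = q%:R ^+ s * \prod_i nS a i.
  rewrite nm_prod; rewrite -[in X in q%:R ^+ X](card_ord s) -prodr_const -big_split /=.
  by apply: eq_bigr => i _; rewrite /nS mulrC divfK // gt_eqF.
have cE : ((csol q)%:R : C) * (q ^ k)%:R = \sum_a PS a.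
  have := @Eav_prod R k s lam _ (@npos q) (fun _ _ => 1) q q0.
  rewrite /Eav (eq_bigr PS) => [|a _]; last by apply: eq_bigr => i _; rewrite -S_one.
  move=> /(canRL (divfK _)) ->; last by rewrite pnatr_eq0 -lt0n expn_gt0 q0.
  congr (_ * _); rewrite /csol -sum1_card natr_sum; apply: eq_big => [x|x _]; first by rewrite inE.
  by rewrite big1.
have PS0 : PS [ffun=> Ordinal q0] = q%:R ^+ s.
  rewrite /PS -[in X in q%:R ^+ X](card_ord s) -prodr_const; apply: eq_bigr => i _.
  rewrite /S /esum (eq_bigr (fun=> 1)) ?sumr_const ?card_ord // => x _.
  rewrite /phi big1 ?e0 // => j _; by rewrite /zscale /gpt ffunE /= mul0r mulr0 mul0r.
have rest : nm (\sum_(a | a != [ffun=> Ordinal q0]) PS a) <= q%:R ^+ s / 2.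
  apply: le_trans (nm_sum _ _ _) _.
  apply: (@le_trans _ _ (\sum_(a : {ffun 'I_k -> 'I_q}) q%:R ^+ s * (Y%:R^-1 * \sum_i nS a i ^+ (2 * t)))).
    rewrite [leRHS](bigID (fun a => a != [ffun=> Ordinal q0])) /= -[leLHS]addr0; apply: lerD.
      apply: ler_sum => a an0; rewrite nPS ler_wpM2l ?exprn_ge0 //.
      apply: le_trans (prod_le_moment i0 (nS01 a) (_ : 0 < 2 * t < s)%N) _.
        by rewrite muln_gt0 t0.
      rewrite ler_wpM2r ?small // sumr_ge0 // => i _; rewrite exprn_ge0 //; by have /andP[] := nS01 a i.
    apply: sumr_ge0 => a _; rewrite !mulr_ge0 ?exprn_ge0 ?invr_ge0 //; apply: sumr_ge0 => i _.
    by rewrite exprn_ge0 //; have /andP[] := nS01 a i.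
  rewrite -mulr_sumr -mulr_sumr ler_wpM2l ?exprn_ge0 // exchange_big /=.
  rewrite ler_pdivrMl //; apply: (@le_trans _ _ (\sum_(i < s) C3)); first by apply: ler_sum => i _.
  rewrite sumr_const card_ord -[_ *+ s]mulr_natl; move: Yb Cj0; set x := s%:R * C3.
  have -> : 2 * s%:R * C3 = 2 * x by rewrite /x mulrA.
  by lra.
have qkr : 0 < q%:R ^+ k :> R by rewrite exprn_gt0.
rewrite mulrAC ler_pdivrMr //.
have main : (csol q)%:R * q%:R ^+ k = nm (\sum_a PS a).
  by rewrite -cE nmM !nm_natr natrX.
rewrite main (bigD1 [ffun=> Ordinal q0]) //= PS0.
have := nm_le_sub (q%:R ^+ s) (- \sum_(a | a != [ffun=> Ordinal q0]) PS a).
rewrite opprK nmN nmX nm_natr => h; apply: le_trans h; move: rest; lra.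
Qed.

End Rough.

(** * Newton iteration over a field with an absolute value *)

Section Newton.
Variables (F : fieldType) (V : realFieldType) (v : F -> V).
Hypotheses (v_ge0 : forall x, 0 <= v x) (vM : forall x y, v (x * y) = v x * v y)
  (vD : forall x y, v (x + y) <= v x + v y) (v1 : v 1 = 1) (v0 : v 0 = 0)
  (vN : forall x, v (- x) = v x) (v_gt0 : forall x, x != 0 -> 0 < v x).

Lemma v_sum (I : Type) (r : seq I) (P : pred I) (f : I -> F) :
  v (\sum_(i <- r | P i) f i) <= \sum_(i <- r | P i) v (f i).
Proof.
elim/big_rec2: _ => [|i y x _ h]; first by rewrite v0.
by apply: le_trans (vD _ _) _; rewrite lerD2l.
Qed.

Lemma v_prod (I : Type) (r : seq I) (P : pred I) (f : I -> F) :
  v (\prod_(i <- r | P i) f i) = \prod_(i <- r | P i) v (f i).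
Proof. by elim/big_rec2: _ => [|i y x _ <-]; rewrite ?v1 ?vM. Qed.

Lemma vX x n : v (x ^+ n) = v x ^+ n.
Proof. by elim: n => [|n IH]; rewrite ?expr0 // !exprS vM IH. Qed.

Lemma v_natr n : v n%:R <= n%:R.
Proof.
elim: n => [|n IH]; first by rewrite v0.
by rewrite -natr1 -[in leRHS]natr1; apply: le_trans (vD _ _) _; rewrite v1 lerD2r.
Qed.

Lemma vV x : x != 0 -> v x^-1 = (v x)^-1.
Proof.
move=> x0; apply: (@mulfI _ (v x)); first by rewrite gt_eqF ?v_gt0.
by rewrite -vM !divff ?v1 // gt_eqF ?v_gt0.
Qed.

Lemma det_bound n (M : 'M[F]_n) B : (forall i j, v (M i j) <= B) ->
  v (\det M) <= n`!%:R * B ^+ n.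
Proof.
move=> hM; rewrite /determinant; apply: le_trans (v_sum _ _ _) _.
apply: (@le_trans _ _ (\sum_(s0 : {perm 'I_n}) B ^+ n)); last first.
  by rewrite sumr_const card_Sn mulr_natl.
apply: ler_sum => s0 _; rewrite vM vX vN v1 expr1n mul1r v_prod.
rewrite -[n in leRHS]card_ord -prodr_const; apply: ler_prod => i _; by rewrite v_ge0 hM.
Qed.

Lemma inv_bound n (M : 'M[F]_n) B d : 1 <= B -> (forall i j, v (M i j) <= B) ->
  0 < d -> d <= v (\det M) ->
  exists2 W : 'M[F]_n, M *m W = 1%:M & forall i j, v (W i j) <= n`!%:R * B ^+ n / d.
Proof.
move=> B1 hM d0 hd.
have dn : \det M != 0 by apply: contraTneq hd => ->; rewrite v0 -ltNge.
exists (invmx M); first by rewrite mulmxV // unitmxE unitfE.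
move=> i j; rewrite /invmx unitmxE unitfE dn !mxE vM vV // mulrC.
have B0 : 0 <= B by exact: le_trans B1.
apply: ler_pM; rewrite ?invr_ge0 ?v_ge0 //; last by rewrite lef_pV2 ?posrE // v_gt0.
rewrite /cofactor vM vX vN v1 expr1n mul1r.
case: n M hM hd dn i j => [|n] M hM hd dn i j; first by case: i.
apply: le_trans (det_bound (B := B) _) _; first by move=> a b; rewrite !mxE hM.
apply: ler_pM; rewrite ?exprn_ge0 //; first by rewrite ler_nat factS leq_pmull.
by apply: ler_weXn2l.
Qed.

Section Jacobian.
Variables (k : nat) (mu : 'I_k -> F).

Definition Gs (z : 'I_k -> F) (j : 'I_k) : F := \sum_l mu l * z l ^+ j.+1.
Definition jac (z : 'I_k -> F) : 'M[F]_k := \matrix_(j, l) (mu l * (z l ^+ j *+ j.+1)).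

(** The Jacobian is a Vandermonde matrix between two diagonal ones, which ties non-singularity to
    the distinctness of the chosen coordinates. *)
Lemma det_jac z : \det (jac z) = (\prod_(j < k) (j.+1)%:R) *
  (\prod_(i < k) \prod_(j < k | (i < j)%N) (z j - z i)) * \prod_l mu l.
Proof.
have -> : jac z = diag_mx (\row_j (j.+1)%:R) *m Vandermonde k (\row_l z l) *m diag_mx (\row_l mu l).
  apply/matrixP => j l; rewrite mul_mx_diag mul_diag_mx !mxE mulr_natl mulrC //.
rewrite !det_mulmx !det_diag det_Vandermonde; congr (_ * _ * _).
- by apply: eq_bigr => j _; rewrite mxE.
- by apply: eq_bigr => i _; apply: eq_bigr => j _; rewrite !mxE.
by apply: eq_bigr => j _; rewrite mxE.
Qed.

Lemma det_jac_lower z eps : 0 < eps <= 1 -> (forall l, eps <= v (mu l)) ->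
  (forall j : 'I_k, eps <= v (j.+1)%:R) ->
  (forall l l', l != l' -> eps <= v (z l - z l')) ->
  eps ^+ (k + k * k + k) <= v (\det (jac z)).
Proof.
move=> /andP[e0 e1] hmu hj hz; rewrite det_jac !vM !exprD.
have pr (f : 'I_k -> F) : (forall i, eps <= v (f i)) -> eps ^+ k <= v (\prod_i f i).
  move=> hf; rewrite v_prod -[k in eps ^+ k]card_ord -prodr_const; apply: ler_prod => i _.
  by rewrite ltW //=.
rewrite !ler_pM ?mulr_ge0 ?exprn_ge0 ?(ltW e0) ?pr //.
rewrite v_prod exprM -[k in X in X <= _]card_ord -prodr_const; apply: ler_prod => i _.
rewrite exprn_ge0 ?(ltW e0) //= v_prod.
apply: (@le_trans _ _ (\prod_(j < k | (i < j)%N) eps)).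
  by rewrite prodr_const; apply: ler_wiXn2l; rewrite ?(ltW e0) // max_card.
by apply: ler_prod => j ij; rewrite ltW //= hz // -(inj_eq val_inj) gtn_eqF.
Qed.

Lemma v_mono_diff x y c (D r : V) m n : 1 <= D -> v x <= D -> v y <= D -> v c <= D ->
  v (x - c) <= r -> v (y - c) <= r ->
  v (x ^+ m * y ^+ n - c ^+ (m + n)) <= (m + n)%:R * D ^+ (m + n) * r.
Proof.
move=> D1 xD yD cD xr yr; have D0 : 0 <= D by exact: le_trans D1.
have r0 : 0 <= r by exact: le_trans (v_ge0 _) xr.
have step w N u : v w <= D -> v (w - c) <= r -> v (u - c ^+ N) <= N%:R * D ^+ N * r ->
   v (w * u - c ^+ N.+1) <= N.+1%:R * D ^+ N.+1 * r.
  move=> wD wr hu.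
  have -> : w * u - c ^+ N.+1 = w * (u - c ^+ N) + (w - c) * c ^+ N by rewrite exprS; ring.
  apply: le_trans (vD _ _) _; rewrite !vM -natr1 !mulrDl mul1r; apply: lerD.
    have -> : N%:R * D ^+ N.+1 * r = D * (N%:R * D ^+ N * r) by rewrite exprS; ring.
    by apply: ler_pM; rewrite ?v_ge0.
  rewrite [leRHS]mulrC vX; apply: ler_pM; rewrite ?exprn_ge0 ?v_ge0 //.
  apply: (@le_trans _ _ (D ^+ N)); first by rewrite lerXn2r ?nnegrE ?v_ge0.
  by apply: ler_weXn2l.
elim: m => [|m IH].
  rewrite expr0 mul1r add0n; elim: n => [|n IH]; first by rewrite !expr0 subrr v0 mul0r mul0r.
  by rewrite [y ^+ _]exprS; apply: step.
by rewrite exprS -mulrA addSn; apply: step.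
Qed.

Lemma v_taylor z h c (D r : V) (j : 'I_k) : 1 <= D -> v z <= D -> v (z + h) <= D -> v c <= D ->
  v (z - c) <= r -> v (z + h - c) <= r ->
  v ((z + h) ^+ j.+1 - z ^+ j.+1 - (c ^+ j *+ j.+1) * h) <= (k * k)%:R * D ^+ k * r * v h.
Proof.
move=> D1 zD zhD cD zr zhr; have D0 : 0 <= D by exact: le_trans D1.
have r0 : 0 <= r by exact: le_trans (v_ge0 _) zr.
have -> : (z + h) ^+ j.+1 - z ^+ j.+1 - (c ^+ j *+ j.+1) * h =
   (\sum_(i < j.+1) ((z + h) ^+ (j - i) * z ^+ i - c ^+ j)) * h.
  rewrite subrXX [z + h - z]addrC addKr sumrB sumr_const card_ord mulrBl; congr (_ - _).
  by rewrite mulrC.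
rewrite vM ler_wpM2r ?v_ge0 //; apply: le_trans (v_sum _ _ _) _.
apply: (@le_trans _ _ (\sum_(i < j.+1) k%:R * D ^+ k * r)).
  apply: ler_sum => i _; have ij : (i <= j)%N by rewrite -ltnS.
  have := v_mono_diff (j - i) i D1 zhD zD cD zhr zr; rewrite subnK // => h1.
  apply: le_trans h1 _; rewrite ler_wpM2r // ler_pM ?exprn_ge0 ?ler_nat ?(ltnW (ltn_ord j)) //.
  by apply: ler_weXn2l => //; exact: ltnW.
rewrite sumr_const card_ord -[_ *+ j.+1]mulr_natl natrM !mulrA ler_wpM2r // ler_wpM2r ?exprn_ge0 //.
by rewrite ler_wpM2r // ler_nat.
Qed.

(** Newton's method with the inverse Jacobian [W] frozen at [z0]: for small [rho] each step at least
    halves the error. The precision grows with [m] while the total displacement stays within a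
    geometric series. *)
Lemma newton (D b : V) : 1 <= D -> 0 <= b -> exists2 rho : V, 0 < rho &
  forall (z0 tau : 'I_k -> F) (W : 'M[F]_k) theta, jac z0 *m W = 1%:M ->
  (forall l j, v (W l j) <= b) -> (forall l, v (z0 l) <= D) -> (forall l, v (mu l) <= D) ->
  0 <= theta <= rho -> (forall j, v (Gs z0 j - tau j) <= theta) ->
  forall m, exists z : 'I_k -> F, (forall l, v (z l - z0 l) <= 2 * k%:R * b * theta) /\
    (forall j, v (Gs z j - tau j) <= theta / 2 ^+ m).
Proof.
move=> D1 b0; pose D' := D + 1; pose cc : V := (k * k)%:R * D' ^+ k.
have D0 : 0 <= D by exact: le_trans D1.
have D'1 : 1 <= D' by rewrite /D' lerDr.
have D'0 : 0 <= D' by exact: le_trans D'1.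
have cc0 : 0 <= cc by rewrite mulr_ge0 ?exprn_ge0.
pose c1 : V := k%:R * D * cc * (2 * k%:R * b) * (k%:R * b).
have c10 : 0 <= c1 by rewrite /c1 !mulr_ge0 // exprn_ge0.
have den : 0 < 1 + 2 * k%:R * b + 2 * c1.
  have : 0 <= 2 * k%:R * b by rewrite !mulr_ge0.
  by move: c10; lra.
(* Two bounds are wanted from [theta <= rho]: [2 k b theta <= 1] keeps the iterates within [D + 1],
   and [2 c1 theta <= 1] halves the error. *)
exists (1 + 2 * k%:R * b + 2 * c1)^-1; first by rewrite invr_gt0.
move=> z0 tau W theta JW hW hz0 hmu /andP[th0 thr] h0.
have thd : theta * (1 + 2 * k%:R * b + 2 * c1) <= 1 by rewrite -ler_pdivlMr // div1r.
have kb0 : 0 <= k%:R * b by rewrite mulr_ge0.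
have small1 : 2 * k%:R * b * theta <= 1.
  have t1 : 0 <= theta * c1 by rewrite mulr_ge0.
  move: thd t1 th0; rewrite !mulrDr mulr1 [theta * (2 * c1)]mulrCA.
  by rewrite [2 * k%:R * b * theta]mulrC; lra.
have small2 : 2 * c1 * theta <= 1.
  have t1 : 0 <= theta * (2 * k%:R * b) by rewrite !mulr_ge0.
  by move: thd t1 th0; rewrite !mulrDr mulr1 [2 * c1 * theta]mulrC; lra.
set r := 2 * k%:R * b * theta in small1.
have r0 : 0 <= r by rewrite !mulr_ge0.
have key m : exists z : 'I_k -> F, (forall l, v (z l - z0 l) <= r * (1 - 2^-1 ^+ m)) /\
    (forall j, v (Gs z j - tau j) <= theta * 2^-1 ^+ m).
  elim: m => [|m [z [hz hE]]].
    by exists z0; split => [l|j]; rewrite ?subrr ?v0 ?mulr0 // expr0 mulr1.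
  set q := 2^-1 ^+ m in hz hE.
  have q0 : 0 <= q by rewrite exprn_ge0 // invr_ge0.
  have q1 : q <= 1 by rewrite exprn_ile1 ?invr_ge0 // invf_le1 ?ler1n.
  pose h l := - \sum_j W l j * (Gs z j - tau j).
  have hh l : v (h l) <= k%:R * b * theta * q.
    rewrite /h vN; apply: le_trans (v_sum _ _ _) _.
    rewrite -!mulrA -[k in leRHS]card_ord mulr_natl -sumr_const; apply: ler_sum => j _.
    by rewrite vM; apply: ler_pM; rewrite ?v_ge0 ?hW.
  have hzh l : v (z l + h l - z0 l) <= r * (1 - 2^-1 ^+ m.+1).
    have -> : z l + h l - z0 l = (z l - z0 l) + h l by rewrite addrAC.
    apply: le_trans (vD _ _) _; apply: le_trans (lerD (hz l) (hh l)) _.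
    by rewrite exprS -/q /r le_eqVlt; apply/orP; left; apply/eqP; field.
  have rle x : 0 <= x -> r * (1 - x) <= r by move=> x0; rewrite ler_piMr // lerBlDr lerDl.
  have hzr l : v (z l - z0 l) <= r by apply: le_trans (hz l) (rle _ q0).
  have hzhr l : v (z l + h l - z0 l) <= r.
    by apply: le_trans (hzh l) (rle _ _); rewrite exprn_ge0 ?invr_ge0.
  have bdd w l : v (w - z0 l) <= r -> v w <= D'.
    move=> hwr; rewrite -[w](subrK (z0 l)); apply: le_trans (vD _ _) _.
    by rewrite /D' addrC; apply: lerD => //; exact: le_trans hwr small1.
  exists (fun l => z l + h l); split => // j.
  have -> : Gs (fun l => z l + h l) j - tau j = \sum_l mu l *
      ((z l + h l) ^+ j.+1 - z l ^+ j.+1 - (z0 l ^+ j *+ j.+1) * h l).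
    have Ah : \sum_l mu l * (z0 l ^+ j *+ j.+1) * h l = - (Gs z j - tau j).
      rewrite /h; under eq_bigr => l _ do rewrite mulrN mulr_sumr.
      rewrite sumrN; congr (- _); rewrite exchange_big /=.
      transitivity (\sum_j' (1%:M : 'M[F]_k) j j' * (Gs z j' - tau j')).
        apply: eq_bigr => j' _; rewrite -JW !mxE mulr_suml; apply: eq_bigr => l _.
        by rewrite !mxE mulrA.
      rewrite (bigD1 j) //= mxE eqxx mul1r big1 ?addr0 // => j' jj.
      by rewrite mxE eq_sym (negbTE jj) mul0r.
    under eq_bigr => l _ do rewrite mulrBr mulrBr mulrA.
    rewrite sumrB sumrB Ah opprK /Gs; ring.
  apply: le_trans (v_sum _ _ _) _.
  apply: (@le_trans _ _ (\sum_(l < k) D * (cc * r * (k%:R * b * theta * q)))).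
    apply: ler_sum => l _; rewrite vM; apply: ler_pM; rewrite ?v_ge0 //.
    apply: le_trans (v_taylor j D'1 (bdd _ l (hzr l)) (bdd _ l (hzhr l)) _ (hzr l) (hzhr l)) _.
      by apply: le_trans (hz0 l) _; rewrite lerDl.
    by apply: ler_wpM2l; [rewrite mulr_ge0|exact: hh].
  rewrite sumr_const card_ord -[_ *+ k]mulr_natl exprS -/q.
  have -> : k%:R * (D * (cc * r * (k%:R * b * theta * q))) = (2 * c1 * theta) * (theta * (2^-1 * q)).
    by rewrite /c1 /r; field.
  by rewrite ler_piMl // !mulr_ge0 ?invr_ge0.
move=> m; have [z [hz hE]] := key m; exists z; split => [l|j].
  apply: le_trans (hz l) _; rewrite ler_piMr // lerBlDr lerDl exprn_ge0 ?invr_ge0 //.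
by rewrite -exprVn.
Qed.

End Jacobian.
End Newton.

Section Split.
Variables (k s : nat) (ic : 'I_k -> 'I_s).
Hypothesis icI : injective ic.

Lemma sum_split (V : nmodType) (f : 'I_s -> V) :
  \sum_i f i = \sum_l f (ic l) + \sum_(i | i \notin codom ic) f i.
Proof.
rewrite (bigID (mem (codom ic))) /=; congr (_ + _).
rewrite (eq_bigl (mem [set ic l | l in 'I_k])) => [|i]; last first.
  by apply/codomP/imsetP => [[l ->]|[l _ ->]]; exists l.
by rewrite big_imset //=; move=> l l' _ _; exact: icI.
Qed.

(** The coordinates listed by [ic] are solved for; the others are prescribed. *)
Definition comb (T : Type) (z : 'I_k -> T) (x : 'I_s -> T) (i : 'I_s) : T :=
  if [pick l | ic l == i] is Some l then z l else x i.

Lemma comb_crit (T : Type) (z : 'I_k -> T) x l : comb z x (ic l) = z l.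
Proof.
by rewrite /comb; case: pickP => [l' /eqP/icI -> //|/(_ l)]; rewrite eqxx.
Qed.

Lemma comb_free (T : Type) (z : 'I_k -> T) x i : i \notin codom ic -> comb z x i = x i.
Proof.
move=> ni; rewrite /comb; case: pickP => // l /eqP li.
by case/negP: ni; rewrite -li codom_f.
Qed.

Lemma card_free : #|[pred i | i \notin codom ic]| = (s - k)%N.
Proof.
have := cardC (mem (codom ic)); rewrite card_codom // !card_ord => h.
have -> : (s - k)%N = #|[predC mem (codom ic)]|.
  by apply/eqP; rewrite -(eqn_add2l k) h subnKC // -h leq_addr.
by apply: eq_card => i; rewrite !inE.
Qed.

End Split.

Section NewtonSystem.
Variables (F : fieldType) (V : realFieldType) (v : F -> V).
Hypotheses (v_ge0 : forall x, 0 <= v x) (vM : forall x y, v (x * y) = v x * v y)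
  (vD : forall x y, v (x + y) <= v x + v y) (v1 : v 1 = 1) (v0 : v 0 = 0)
  (vN : forall x, v (- x) = v x) (v_gt0 : forall x, x != 0 -> 0 < v x).
Variables (k s : nat) (ic : 'I_k -> 'I_s) (mu : 'I_s -> F).
Hypothesis icI : injective ic.

(** [rho] and [B] are fixed before the free coordinates [x] and the accuracy [m]. The lower bounds
    by [eps] control the inverse Jacobian through [det_jac]. *)
Lemma newton_system (D eps : V) : 1 <= D -> 0 < eps <= 1 -> (forall i, v (mu i) <= D) ->
  (forall l, eps <= v (mu (ic l))) -> (forall j : 'I_k, eps <= v (j.+1)%:R) ->
  exists rho B : V, [/\ 0 < rho, 0 <= B & forall (x y : 'I_s -> F) theta, 0 <= theta <= rho ->
  (forall i, v (y i) <= D) -> (forall i, v (x i) <= D) -> (forall i, v (x i - y i) <= theta) ->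
  (forall l l', l != l' -> eps <= v (y (ic l) - y (ic l'))) ->
  (forall j : 'I_k, v (\sum_i mu i * y i ^+ j.+1) <= theta) ->
  forall m, exists z : 'I_k -> F, (forall l, v (z l - y (ic l)) <= B * theta) /\
    forall j : 'I_k, v (\sum_l mu (ic l) * z l ^+ j.+1 +
       \sum_(i | i \notin codom ic) mu i * x i ^+ j.+1) <= (2 ^+ m)^-1].
Proof.
move=> D1 he hmu hmue hje; have D0 : 0 <= D by exact: le_trans D1.
have e0 : 0 < eps by have /andP[] := he.
pose Bj := D * (k%:R * D ^+ k) + 1; pose d := eps ^+ (k + k * k + k).
have d0 : 0 < d by rewrite exprn_gt0.
pose b := k`!%:R * Bj ^+ k / d.
have Bj0 : 0 <= D * (k%:R * D ^+ k) by rewrite !mulr_ge0 ?exprn_ge0.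
have Bj1 : 1 <= Bj by rewrite lerDr.
have Bj2 : 0 <= Bj by exact: le_trans Bj1.
have b0 : 0 <= b by rewrite divr_ge0 ?(ltW d0) // mulr_ge0 // exprn_ge0.
have [rho rho0 hnewt] := newton v_ge0 vM vD v1 v0 vN (fun l => mu (ic l)) D1 b0.
pose c3 : V := 1 + s%:R * (D * (k%:R * D ^+ k)).
have c31 : 1 <= c3 by rewrite lerDl mulr_ge0.
have c30 : 0 < c3 by exact: lt_le_trans c31.
exists (Num.min rho 1 / c3), (2 * k%:R * b * c3); split.
- by rewrite divr_gt0 // lt_min rho0 ltr01.
- by apply: mulr_ge0; [apply: mulr_ge0 => //; exact: mulr_ge0|exact: ltW].
move=> x y theta /andP[th0 th1] hy hx hxy hdiff hL m.
have thc : c3 * theta <= Num.min rho 1 by rewrite mulrC -ler_pdivlMr.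
have thr : 0 <= c3 * theta <= rho.
  by rewrite mulr_ge0 ?(ltW c30) //=; apply: le_trans thc _; rewrite ge_min lexx.
have th11 : c3 * theta <= 1 by apply: le_trans thc _; rewrite ge_min lexx orbT.
pose z0 l := y (ic l); pose muc l := mu (ic l).
have [W JW hW] : exists2 W : 'M[F]_k, jac muc z0 *m W = 1%:M & forall i j, v (W i j) <= b.
  apply: (inv_bound v_ge0 vM vD v1 v0 vN v_gt0) => //.
    move=> j l; rewrite mxE vM -mulr_natr vM (vX vM v1).
    apply: (@le_trans _ _ (D * (D ^+ k * k%:R))); last by rewrite /Bj [D ^+ k * _]mulrC lerDl.
    apply: ler_pM; rewrite ?mulr_ge0 ?exprn_ge0 ?hmu //; apply: ler_pM; rewrite ?exprn_ge0 //.
      apply: (@le_trans _ _ (D ^+ j)); first by rewrite lerXn2r ?nnegrE //; exact: hy.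
      by apply: ler_weXn2l => //; exact: ltnW.
    by apply: le_trans (v_natr vD v1 v0 _) _; rewrite ler_nat.
  by apply: det_jac_lower.
pose tau (j : 'I_k) := - \sum_(i | i \notin codom ic) mu i * x i ^+ j.+1.
have err j : v (Gs muc z0 j - tau j) <= c3 * theta.
  have -> : Gs muc z0 j - tau j = \sum_i mu i * y i ^+ j.+1 +
     \sum_(i | i \notin codom ic) mu i * (x i ^+ j.+1 - y i ^+ j.+1).
    rewrite opprK (sum_split icI (fun i => mu i * y i ^+ j.+1)) -addrA -big_split /=.
    congr (_ + _); apply: eq_bigr => i _; by rewrite -mulrDr addrC subrK.
  apply: le_trans (vD _ _) _; rewrite /c3 mulrDl mul1r; apply: lerD => //.
  apply: le_trans (v_sum vD v0 _ _ _) _.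
  apply: (@le_trans _ _ (\sum_(i < s) D * (k%:R * D ^+ k) * theta)); last first.
    by rewrite sumr_const card_ord -[leLHS]mulr_natl !mulrA.
  rewrite [leRHS](bigID (fun i => i \notin codom ic)) /= -[leLHS]addr0; apply: lerD; last first.
    by apply: sumr_ge0 => i _; rewrite mulr_ge0.
  apply: ler_sum => i _; rewrite vM -mulrA; apply: ler_pM; rewrite ?hmu //.
  have := v_mono_diff v_ge0 vM vD v1 v0 j.+1 0 D1 (hx i) (hy i) (hy i) (hxy i) _.
  rewrite expr0 mulr1 addn0 subrr v0 => /(_ th0) h; apply: le_trans h _.
  rewrite ler_wpM2r // ler_pM ?exprn_ge0 ?ler_nat //.
  by apply: ler_weXn2l.
have [z [hz hG]] := hnewt z0 tau W _ JW hW (fun l => hy (ic l)) (fun l => hmu (ic l)) thr err m.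
exists z; split => [l|j]; first by apply: le_trans (hz l) _; rewrite -!mulrA.
have := hG j; rewrite opprK => h; apply: le_trans h _.
by rewrite ler_piMl // invr_ge0 exprn_ge0.
Qed.

End NewtonSystem.

Lemma jac_dL (T : fieldType) k s (lam : 'I_s -> int) (i : 'I_k -> 'I_s) (x : 'I_s -> T) :
  \matrix_(j < k, l < k) dL lam j.+1 (i l) x = jac (fun l => (lam (i l))%:~R) (fun l => x (i l)).
Proof. by apply/matrixP => j l; rewrite !mxE dLE. Qed.

Lemma nonsingular_distinct (T : fieldType) k s (lam : 'I_s -> int) (i : 'I_k -> 'I_s) (x : 'I_s -> T) :
  \det (\matrix_(j < k, l < k) dL lam j.+1 (i l) x) != 0 ->
  forall l l', l != l' -> x (i l) != x (i l').
Proof.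
rewrite jac_dL det_jac; move=> nz.
suff h (l l' : 'I_k) : (l < l')%N -> x (i l') != x (i l).
  move=> l l' ll; have [/h|/h//|/val_inj e] := ltngtP l l'; first by rewrite eq_sym.
  by rewrite e eqxx in ll.
move=> ll; apply: contra nz => /eqP e.
rewrite mulf_eq0 mulf_eq0; apply/orP; left; apply/orP; right.
by rewrite (bigD1 l) //= (bigD1 l') //= e subrr !mul0r.
Qed.

(** * From p-adic solutions to congruences *)

Section PadicBasics.
Variable p : nat.
Hypothesis p_pr : prime p.
Local Notation v := (padic_abs p).
Let p0 : (0 < p)%N. Proof. exact: prime_gt0. Qed.
Let pr : 0 < p%:R :> rat. Proof. by rewrite ltr0n. Qed.
Let pr1 : 1 < p%:R :> rat. Proof. by rewrite ltr1n prime_gt1. Qed.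

Lemma padic_tri x y : v (x + y) <= v x + v y.
Proof.
by apply: le_trans (padic_abs_ultra p x y) _; rewrite ge_max lerDl lerDr !padic_abs_ge0.
Qed.

Lemma padic_intE (z : int) : z != 0 -> v z%:~R = (p%:R ^+ logn p `|z|)^-1.
Proof.
move=> z0; rewrite /padic_abs intr_eq0 (negbTE z0) numq_int denq_int absz1 logn1 sub0r.
by rewrite -invr_expz.
Qed.

Lemma padic_int_le1 (z : int) : v z%:~R <= 1.
Proof.
have [->|z0] := eqVneq z 0; first by rewrite padic_abs0.
by rewrite padic_intE // invf_le1 ?exprn_gt0 // exprn_ege1 // ltW.
Qed.

Lemma padic_p n : v (p%:R ^+ n) = (p%:R ^+ n)^-1.
Proof.
have h : (p ^ n)%N%:Z != 0 by rewrite eqz_nat -lt0n expn_gt0 p0.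
by have := padic_intE h; rewrite absz_nat pfactorK // => <-; rewrite -natrX.
Qed.

Lemma padic_dvd (z : int) n : (v z%:~R <= (p%:R ^+ n)^-1) = ((p ^ n)%N%:Z %| z)%Z.
Proof.
have [->|z0] := eqVneq z 0.
  by rewrite padic_abs0 dvdz0 invr_ge0 exprn_ge0.
rewrite padic_intE // lef_pV2 ?posrE ?exprn_gt0 // ler_eXn2l // dvdzE /= pfactor_dvdn //.
by rewrite absz_gt0.
Qed.

(** The denominator is prime to [p], hence invertible modulo [p^n] by Bézout. *)
Lemma padic_approx x n : v x <= 1 -> exists z : int, v (x - z%:~R) <= (p%:R ^+ n)^-1.
Proof.
move=> vx; have [x0|x0] := eqVneq x 0.
  by exists 0; rewrite x0 subr0 padic_abs0 invr_ge0 exprn_ge0.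
have nd : ~~ (p %| `|denq x|)%N.
  apply/negP => pd; have pn : ~~ (p %| `|numq x|)%N.
    apply/negP => pn; have := coprime_num_den x; rewrite /coprime => /eqP g1.
    have : (p %| gcdn `|numq x| `|denq x|)%N by rewrite dvdn_gcd pn.
    by rewrite g1 dvdn1 => /eqP p1; move: p_pr; rewrite p1.
  move: vx; rewrite /padic_abs (negbTE x0).
  have -> : logn p `|numq x| = 0%N by apply/eqP; rewrite -leqn0 -ltnS ltnNge logn_gt0 mem_primes p_pr (negbTE pn) !andbF.
  rewrite subr0 leNgt exprn_egt1 // -lt0n logn_gt0 mem_primes p_pr pd absz_gt0 denq_eq0 //.
have cop : coprime (p ^ n) `|denq x| by rewrite coprimeXl // prime_coprime.
have [u [w hw]] := Bezoutz (denq x) (p ^ n)%N%:Z.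
have g1 : gcdz (denq x) (p ^ n)%N%:Z = 1.
  by rewrite /gcdz absz_nat gcdnC (eqP cop).
exists (numq x * u).
have db : v (denq x)%:~R = 1.
  rewrite padic_intE ?denq_neq0 // lognE (negbTE nd) !andbF expr0 invr1 //.
have E : (denq x)%:~R * (x - (numq x * u)%:~R) = (numq x * (w * (p ^ n)%N%:Z))%:~R.
  have -> : w * (p ^ n)%N%:Z = 1 - u * denq x by rewrite -g1 -hw; ring.
  rewrite mulrBr [_ * x]mulrC -numqE !rmorphM rmorphB rmorphM /=; ring.
have := congr1 v E; rewrite padic_absM db mul1r => ->.
rewrite padic_dvd; by rewrite mulrA dvdz_mull.
Qed.

End PadicBasics.

Section QpRepr.
Variable p : nat.
Local Notation v := (padic_abs p).
Local Notation pi := (\pi_({ideal_quot (@padic_null p)}))%qT.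

Definition cev (n : nat) (u : cauchy_seq p) : rat := cauchy_val u n.

Fact cev_additive n : zmod_morphism (cev n).
Proof. by []. Qed.
Fact cev_multiplicative n : monoid_morphism (cev n).
Proof. by split. Qed.
HB.instance Definition _ n := GRing.isZmodMorphism.Build _ _ (cev n) (cev_additive n).
HB.instance Definition _ n := GRing.isMonoidMorphism.Build _ _ (cev n) (cev_multiplicative n).

Definition eventually_nat (P : nat -> Prop) := exists M : nat, forall n, (M <= n)%N -> P n.

Lemma eventually_all (I : finType) (P : I -> nat -> Prop) :
  (forall i, eventually_nat (P i)) -> eventually_nat (fun n => forall i, P i n).
Proof.
move=> /boolp.choice[M hM]; exists (\max_i M i)%N => n hn i; apply: hM.
by apply: leq_trans hn; exact: leq_bigmax.
Qed.

Lemma cev_L (s : nat) (lam : 'I_s -> int) j (u : 'I_s -> cauchy_seq p) n :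
  cev n (L lam j u) = L lam j (fun i => cev n (u i)).
Proof.
by rewrite /L rmorph_sum; apply: eq_bigr => i _; rewrite rmorphM rmorphXn rmorph_int.
Qed.

(** Passes to Cauchy representatives: vanishing becomes eventual smallness, and distinctness becomes
    eventual separation by the ultrametric inequality. The rest of the [p]-adic argument takes place
    in the rationals. *)
Lemma Qp_solution_seq (k s : nat) (lam : 'I_s -> int) (x : 'I_s -> Qp p) (i : 'I_k -> 'I_s) :
  solution lam k x -> (forall l l', l != l' -> x (i l) != x (i l')) ->
  exists u : 'I_s -> nat -> rat, exists B eps : rat, [/\ 0 < eps, (forall i n, v (u i n) <= B),
    eventually_nat (fun n => forall ll : 'I_k * 'I_k, ll.1 != ll.2 ->
       eps <= v (u (i ll.1) n - u (i ll.2) n)) &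
    forall th : rat, 0 < th -> eventually_nat (fun n => forall j : 'I_k,
       v (L lam j.+1 (fun i => u i n)) <= th)].
Proof.
move=> sol dis; pose u a : cauchy_seq p := repr (x a).
have xE a : x a = pi (u a) by rewrite reprK.
have null0 (w : cauchy_seq p) : (w \in @padic_null p) = (pi w == 0).
  by rewrite -(rmorph0 pi) -Quotient.idealrBE subr0.
have hL (j : 'I_k) : L lam j.+1 u \in @padic_null p.
  rewrite null0; have := forallP sol j; congr (_ == _).
  rewrite /L rmorph_sum; apply: eq_bigr => a _.
  by rewrite xE rmorphM rmorphXn rmorph_int.
have [B hB] : exists B : 'I_s -> rat, forall a n, v (u a n) <= B a.
  have H a : exists B : rat, forall n, v (u a n) <= B.
    by have [B _ hB] := padic_cauchy_bounded (valP (u a)); exists B.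
  by have [B hB] := boolp.choice H; exists B.
have sep (ll : 'I_k * 'I_k) : exists eps : rat, 0 < eps /\ eventually_nat (fun n =>
    ll.1 != ll.2 -> eps <= v (u (i ll.1) n - u (i ll.2) n)).
  case: ll => l l' /=; have [e|ll] := eqVneq l l'.
    by exists 1; split => //; exists 0%N.
  pose w := u (i l) - u (i l').
  have wn : w \notin @padic_null p.
    by rewrite null0 rmorphB /= -!xE subr_eq0 dis.
  have [eps e0 He] : exists2 eps : rat, 0 < eps &
      forall M, exists2 n, (M <= n)%N & eps <= v (w n).
    apply: contrapT => H; case/negP: wn; apply/asboolP => eps e0.
    apply: contrapT => H1; apply: H; exists eps => // M.
    apply: contrapT => H2; apply: H1; exists M => n Mn.
    by rewrite ltNge; apply/negP => ?; apply: H2; exists n.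
  exists eps; split => //; have /asboolP cw := valP w.
  have [M HM] := cw _ e0; have [n0 Mn0 un0] := He M.
  exists M => m Mm _; rewrite leNgt; apply/negP => um.
  have := padic_abs_ultra p (w n0 - w m) (w m).
  rewrite subrK => /(le_trans un0); rewrite le_max leNgt HM //=.
  by rewrite leNgt um.
have [eps heps] := boolp.choice sep.
pose ep : rat := \big[Num.min/1]_ll eps ll.
have ep0 : 0 < ep.
  by apply: (big_ind (fun z : rat => 0 < z)) => // [a b a0 b0|ll _]; [rewrite lt_min a0|have [] := heps ll].
have epl ll : ep <= eps ll by rewrite /ep (bigD1 ll) //= ge_min lexx.
pose BB : rat := \sum_a `|B a|.
exists (fun a n => u a n), BB, ep; split => //.
- move=> a n; apply: le_trans (hB a n) _; rewrite /BB (bigD1 a) //=.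
  by apply: le_trans (ler_norm _) _; rewrite lerDl sumr_ge0.
- apply: eventually_all => ll; have [_ [M hM]] := heps ll.
  by exists M => n Mn ne; apply: le_trans (epl ll) (hM n Mn ne).
move=> th th0; apply: eventually_all => j; have /asboolP /(_ _ th0) [M hM] := hL j.
by exists M => n /hM/ltW; rewrite -[cauchy_val _ _]/(cev n _) cev_L.
Qed.

End QpRepr.

Lemma Lz_cong (s k : nat) (lam : 'I_s -> int) (x y : 'I_s -> int) (q : int) (j : 'I_k) :
  (forall i, (q %| x i - y i)%Z) -> (q %| Lz lam x j - Lz lam y j)%Z.
Proof.
move=> h; rewrite /Lz -sumrB; apply: rpred_sum => i _; rewrite -mulrBr dvdz_mull //.
by rewrite subrXX dvdz_mulr.
Qed.

Lemma csol_coprime (s k : nat) (lam : 'I_s -> int) q1 q2 : (0 < q1)%N -> (0 < q2)%N ->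
  coprime q1 q2 -> (csol k lam q1 * csol k lam q2 <= csol k lam (q1 * q2))%N.
Proof.
move=> q10 q20 cop; have q0 : (0 < q1 * q2)%N by rewrite muln_gt0 q10.
pose f (xy : {ffun 'I_s -> 'I_q1} * {ffun 'I_s -> 'I_q2}) : {ffun 'I_s -> 'I_(q1 * q2)} :=
  [ffun i => Ordinal (ltn_pmod (chinese q1 q2 (xy.1 i) (xy.2 i)) q0)].
have f1 xy i : f xy i = xy.1 i %[mod q1].
  by rewrite ffunE /= modn_dvdm ?dvdn_mulr // chinese_modl.
have f2 xy i : f xy i = xy.2 i %[mod q2].
  by rewrite ffunE /= modn_dvdm ?dvdn_mull // chinese_modr.
have fI : injective f.
  move=> [x1 x2] [y1 y2] ff; congr (_, _); apply/ffunP => i; apply: val_inj => /=.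
    have := f1 (x1, x2) i; rewrite ff f1 /= => /eqP; rewrite !modn_small ?ltn_ord // => /eqP ->.
    by [].
  have := f2 (x1, x2) i; rewrite ff f2 /= => /eqP; rewrite !modn_small ?ltn_ord // => /eqP ->.
  by [].
rewrite /csol -cardsX -(card_imset _ fI); apply: subset_leq_card; apply/fintype.subsetP => z /imsetP[xy].
rewrite !inE => /andP[/forallP h1 /forallP h2] ->; apply/forallP => j.
have toZ (a b q : nat) : a = b %[mod q] -> (q%:Z %| a%:Z - b%:Z)%Z.
  by move=> h; rewrite -eqz_mod_dvd !modz_nat h.
have d1 : (q1%:Z %| Lz lam (fun i => npos (f xy i)) j)%Z.
  rewrite -[Lz _ _ _](subrK (Lz lam (fun i => npos (xy.1 i)) j)); apply: rpredD => //.
  by apply: Lz_cong => i; apply: toZ.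
have d2 : (q2%:Z %| Lz lam (fun i => npos (f xy i)) j)%Z.
  rewrite -[Lz _ _ _](subrK (Lz lam (fun i => npos (xy.2 i)) j)); apply: rpredD => //.
  by apply: Lz_cong => i; apply: toZ.
by move: d1 d2; rewrite !dvdzE /= => d1 d2; rewrite Gauss_dvd // d1.
Qed.

(** Near the given solution the [s - k] free coordinates run over classes modulo [p^w], with
    [p^(n - w)] choices each; Newton's method and rounding to integers supply the others modulo
    [p^n]. *)
Lemma padic_density (p k s : nat) (lam : 'I_s -> int) : prime p -> (forall i, lam i != 0) ->
  has_nonsingular_solution (Qp p) lam k ->
  exists w : nat, forall n, (p ^ (n * (s - k)) <= p ^ w * csol k lam (p ^ n))%N.
Proof.
move=> p_pr lam0 [x [sol [ic nz]]]; pose v := padic_abs p.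
have p0 : (0 < p)%N by exact: prime_gt0.
have p1 : (1 < p)%N by exact: prime_gt1.
have pr : 0 < p%:R :> rat by rewrite ltr0n.
have pr1 : 1 < p%:R :> rat by rewrite ltr1n.
have dis := nonsingular_distinct nz.
have icI : injective ic.
  by move=> l l' ll; apply/eqP; apply: contraT => /dis; rewrite ll eqxx.
have [u [B [eps [eps0 hB hsep hL]]]] := Qp_solution_seq sol dis.
pose a := Num.bound `|B|.
have Ba : B <= p%:R ^+ a.
  apply: le_trans (ler_norm _) _; apply: le_trans (ltW (archi_boundP (normr_ge0 _))) _.
  by rewrite -natrX ler_nat ltnW // ltn_expl.
pose mu i : rat := (lam i)%:~R.
have mu0 i : mu i != 0 by rewrite intr_eq0.
pose ep1 : rat := \big[Num.min/1]_(l < k) v (mu (ic l)).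
pose ep2 : rat := \big[Num.min/1]_(j < k) v (j.+1)%:R.
pose ep : rat := Num.min (Num.min ep1 ep2) (Num.min 1 (eps / p%:R ^+ a)).
have v_gt0 (y : rat) : y != 0 -> 0 < v y by exact: padic_abs_gt0.
have ep0 : 0 < ep <= 1.
  rewrite /ep !lt_min ltr01 divr_gt0 ?exprn_gt0 // ge_min [X in _ || X]ge_min lexx orbT !andbT.
  apply/andP; split.
    by apply: (big_ind (fun z : rat => 0 < z)) => // [c d c0 d0|l _]; rewrite ?lt_min ?c0 ?d0 ?v_gt0.
  by apply: (big_ind (fun z : rat => 0 < z)) => // [c d c0 d0|l _]; rewrite ?lt_min ?c0 ?d0 ?v_gt0 // pnatr_eq0.
have hmu i : v (mu i) <= 1 by exact: padic_int_le1.
have h1 l : ep <= v (mu (ic l)).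
  by rewrite /ep !ge_min /ep1 (bigD1 l) //= ge_min lexx.
have h2 (j : 'I_k) : ep <= v (j.+1)%:R.
  by rewrite /ep !ge_min /ep2 (bigD1 j) //= !ge_min lexx ?orbT.
have [rho [Bn [rho0 Bn0 hN]]] := newton_system (padic_abs_ge0 p) (padic_absM p) (padic_tri p)
  (padic_abs1 p) (padic_abs0 p) (padic_absN p) v_gt0 icI (lexx 1) ep0 hmu h1 h2.
pose rc := (rho^-1 + Bn : rat).
have rc0 : 0 <= rc by rewrite addr_ge0 // invr_ge0 ltW.
pose w := Num.bound rc; pose th : rat := (p%:R ^+ w)^-1.
have th0 : 0 < th by rewrite invr_gt0 exprn_gt0.
have rcw : rc <= p%:R ^+ w.
  by apply: le_trans (ltW (archi_boundP rc0)) _; rewrite -natrX ler_nat ltnW // ltn_expl.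
have thr : th <= rho.
  rewrite -[rho]invrK lef_pV2 ?posrE ?invr_gt0 ?exprn_gt0 //; apply: le_trans rcw.
  by rewrite lerDl.
have thB : Bn * th <= 1.
  rewrite ler_pdivrMr ?exprn_gt0 // mul1r; apply: le_trans rcw; rewrite lerDr invr_ge0 ltW //.
have [M1 hM1] := hsep; have [M2 hM2] := hL th th0.
(* Homogeneity allows scaling by [p^a], which makes the coordinates [p]-integral. *)
pose n0 := maxn M1 M2; pose y i : rat := p%:R ^+ a * u i n0.
have hy i : v (y i) <= 1.
  rewrite /v /y padic_absM padic_p // mulrC ler_pdivrMr ?exprn_gt0 // mul1r.
  exact: le_trans (hB i n0) Ba.
have yd l l' : l != l' -> ep <= v (y (ic l) - y (ic l')).
  move=> ll; rewrite /v /y -mulrBr padic_absM padic_p // mulrC.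
  apply: (@le_trans _ _ (eps / p%:R ^+ a)); first by rewrite /ep !ge_min lexx !orbT.
  rewrite ler_wpM2r ?invr_ge0 ?exprn_ge0 //.
  exact: (hM1 n0 (leq_maxl _ _) (l, l') ll).
have yL (j : 'I_k) : v (\sum_i mu i * y i ^+ j.+1) <= th.
  have -> : \sum_i mu i * y i ^+ j.+1 = (p%:R ^+ a) ^+ j.+1 * L lam j.+1 (fun i => u i n0).
    by rewrite /L mulr_sumr; apply: eq_bigr => i _; rewrite /y exprMn mulrCA.
  rewrite /v padic_absM -exprM padic_p //; apply: le_trans (hM2 n0 (leq_maxr _ _) j).
  by rewrite ler_piMl ?padic_abs_ge0 // invf_le1 ?exprn_gt0 // exprn_ege1 // ltW.
have [Y hY] : exists Y : 'I_s -> int, forall i, v (y i - (Y i)%:~R) <= th.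
  by have [Y hY] := boolp.choice (fun i => padic_approx p_pr w (hy i)); exists Y.
exists (w * (s - k))%N => n.
(* For small [n] the zero vector is enough, given the constant [p^(w (s - k))]. *)
have [nw|wn] := leqP n w.
  apply: (@leq_trans (p ^ (w * (s - k)))); first by rewrite leq_exp2l // leq_mul2r nw orbT.
  rewrite leq_pmulr //; apply/card_gt0P.
  have q0 : (0 < p ^ n)%N by rewrite expn_gt0 p0.
  exists [ffun=> Ordinal q0]; rewrite inE; apply/forallP => j.
  rewrite /Lz big1 ?dvdz0 // => i _; by rewrite /npos ffunE /= expr0n mulr0.
pose q := (p ^ n)%N; pose m := (p ^ (n - w))%N.
have q0 : (0 < q)%N by rewrite expn_gt0 p0.
have qm : q = (p ^ w * m)%N by rewrite /q /m -expnD subnKC // ltnW.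
pose free := {i : 'I_s | i \notin codom ic}.
pose xr (r : {ffun free -> 'I_m}) (i : 'I_s) : int :=
  Y i + (p ^ w)%N%:Z * (if insub i is Some f then (r f : nat)%:Z else 0).
have xy r i : v ((xr r i)%:~R - y i) <= th.
  have -> : (xr r i)%:~R - y i = - (y i - (Y i)%:~R) + (xr r i - Y i)%:~R by rewrite rmorphB /=; ring.
  apply: le_trans (padic_abs_ultra p _ _) _; rewrite ge_max padic_absN hY /=.
  by rewrite padic_dvd // /xr addrC addKr dvdz_mulr.
have solv r : exists X : {ffun 'I_s -> 'I_q}, X \in [set x : {ffun 'I_s -> 'I_q} |
     [forall j : 'I_k, (q%:Z %| Lz lam (fun i => npos (x i)) j)%Z]] /\
     forall i, i \notin codom ic -> (q%:Z %| npos (X i) - xr r i)%Z.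
  have thp : 0 <= th <= rho by rewrite (ltW th0).
  (* [n p] rounds suffice because [2^(n p) >= p^n]. *)
  have [z [hz hG]] := hN (fun i => (xr r i)%:~R) y th thp hy (fun i => padic_int_le1 p_pr (xr r i)) (xy r) yd yL (n * p)%N.
  have hz1 l : v (z l) <= 1.
    rewrite -[z l](subrK (y (ic l))); apply: le_trans (padic_abs_ultra p _ _) _.
    by rewrite ge_max hy andbT; apply: le_trans (hz l) thB.
  have [Z hZ] := boolp.choice (fun l => padic_approx p_pr n (hz1 l)).
  pose X0 i := comb ic Z (xr r) i.
  have X0L (j : 'I_k) : (q%:Z %| Lz lam X0 j)%Z.
    rewrite -padic_dvd //.
    have -> : (Lz lam X0 j)%:~R = (\sum_l mu (ic l) * z l ^+ j.+1 +
       \sum_(i | i \notin codom ic) mu i * (xr r i)%:~R ^+ j.+1) -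
       \sum_l mu (ic l) * (z l ^+ j.+1 - (Z l)%:~R ^+ j.+1) :> rat.
      rewrite /Lz rmorph_sum (sum_split icI) /= addrAC -sumrB; congr (_ + _).
        by apply: eq_bigr => l _; rewrite /X0 comb_crit // rmorphM rmorphXn -mulrBr opprB addrC subrK.
      by apply: eq_bigr => i ni; rewrite /X0 comb_free // rmorphM rmorphXn.
    apply: le_trans (padic_abs_ultra p _ _) _; rewrite ge_max padic_absN; apply/andP; split.
      apply: le_trans (hG j) _; rewrite lef_pV2 ?posrE ?exprn_gt0 // -!natrX ler_nat mulnC expnM.
      case: (n) => // n'; rewrite leq_exp2r //; exact: ltnW (ltn_expl _ _).
    apply: (big_ind (fun t : rat => v t <= (p%:R ^+ n)^-1)).
    - by rewrite /v padic_abs0 invr_ge0 exprn_ge0.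
    - by move=> c d hc hd; apply: le_trans (padic_abs_ultra p _ _) _; rewrite ge_max hc.
    move=> l _; rewrite subrXX /v !padic_absM.
    apply: (@le_trans _ _ (1 * ((p%:R ^+ n)^-1 * 1))); last by rewrite mul1r mulr1.
    apply: ler_pM; rewrite ?mulr_ge0 ?padic_abs_ge0 ?hmu //; apply: ler_pM; rewrite ?padic_abs_ge0 ?hZ //.
    apply: (big_ind (fun t : rat => v t <= 1)).
    - by rewrite /v padic_abs0.
    - by move=> c d hc hd; apply: le_trans (padic_abs_ultra p _ _) _; rewrite ge_max hc.
    move=> i _; rewrite /v padic_absM; apply: mulr_ile1; rewrite ?padic_abs_ge0 //.
      by rewrite (vX (padic_absM p) (padic_abs1 p)) exprn_ile1 ?padic_abs_ge0 ?hz1.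
    by rewrite (vX (padic_absM p) (padic_abs1 p)) exprn_ile1 ?padic_abs_ge0 ?padic_int_le1.
  have qz : q%:Z != 0 by rewrite eqz_nat -lt0n.
  have rlt t : (absz (t %% q%:Z)%Z < q)%N.
    by rewrite -ltz_nat gez0_abs ?modz_ge0 // ltz_pmod // ltz_nat.
  pose X : {ffun 'I_s -> 'I_q} := [ffun i => Ordinal (rlt (X0 i))].
  have XX i : (q%:Z %| npos (X i) - X0 i)%Z.
    by rewrite /npos ffunE /= gez0_abs ?modz_ge0 // -eqz_mod_dvd modz_mod.
  exists X; split.
    rewrite inE; apply/forallP => j; rewrite -[Lz _ _ _](subrK (Lz lam X0 j)).
    by apply: rpredD => //; exact: Lz_cong.
  by move=> i ni; have := XX i; rewrite /X0 comb_free.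
have [f hf] := boolp.choice solv.
have fI : injective f.
  move=> r r' rr; apply/ffunP => g; apply: val_inj => /=.
  have [_ /(_ (val g) (valP g)) d1] := hf r; have [_ /(_ (val g) (valP g)) d2] := hf r'.
  have : (q%:Z %| xr r (val g) - xr r' (val g))%Z.
    have -> : xr r (val g) - xr r' (val g) = (npos (f r' (val g)) - xr r' (val g)) - (npos (f r (val g)) - xr r (val g)).
      by rewrite rr; ring.
    exact: rpredB.
  rewrite /xr valK opprD addrACA subrr add0r -mulrBr qm PoszM dvdz_mul2l; last first.
    by rewrite eqz_nat -lt0n expn_gt0 p0.
  rewrite -eqz_mod_dvd !modz_small ?ltz_nat ?ltn_ord // => /eqP[]; exact.
have : (#|{ffun free -> 'I_m}| <= csol k lam q)%N.
  rewrite -(card_imset _ fI); apply: subset_leq_card; apply/fintype.subsetP => X /imsetP[r _ ->].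
  by have [] := hf r.
rewrite card_ffun card_ord card_sig card_free // => h.
apply: (@leq_trans (p ^ (w * (s - k)) * m ^ (s - k))); last by rewrite leq_mul2l h orbT.
by rewrite /m -expnM -expnD -mulnDl subnKC // ltnW.
Qed.

(** In the binomial expansion each positive power of [x] is an equation of the system of no higher
    degree, and the constant term vanishes because the [lam i] sum to 0. *)
Lemma solution_affine (T : comNzRingType) k s (lam : 'I_s -> int) (x : 'I_s -> T) (a b : T) :
  \sum_i lam i = 0 -> solution lam k x -> solution lam k (fun i => a + b * x i).
Proof.
move=> lam0 /forallP hx; apply/forallP => j; apply/eqP; rewrite /L.
have E i : (lam i)%:~R * (a + b * x i) ^+ j.+1 = \sum_(r < j.+2)
    (a ^+ (j.+1 - r) * b ^+ r *+ 'C(j.+1, r)) * ((lam i)%:~R * x i ^+ r).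
  rewrite exprDn mulr_sumr; apply: eq_bigr => r _; rewrite exprMn mulrnAr mulrnAl; congr (_ *+ _).
  by move: (lam i)%:~R (a ^+ _) (b ^+ r) (x i ^+ r) => l A B X; ring.
rewrite (eq_bigr _ (fun i _ => E i)) exchange_big big1 //= => r _; rewrite -mulr_sumr.
case: r => -[|r] /= hr.
  rewrite (eq_bigr (fun i => (lam i)%:~R)) => [|i _]; last by rewrite expr0 mulr1.
  have -> : \sum_i (lam i)%:~R = (\sum_i lam i)%:~R :> T by rewrite rmorph_sum.
  by rewrite lam0 mulr0z mulr0.
have rk : (r < k)%N by apply: leq_trans (ltn_ord j).
by have /eqP := hx (Ordinal rk); rewrite /L /= => ->; rewrite mulr0.
Qed.

Lemma residue_near (R : realType) (c : R) (b : int) (q : nat) : (0 < q)%N ->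
  exists n : int, (q%:Z %| n - b)%Z /\ c <= n%:~R <= c + q%:R.
Proof.
move=> q0; have qr : 0 < q%:R :> R by rewrite ltr0n.
pose f := Num.floor ((b%:~R - c) / q%:R); exists (b - q%:Z * f); split.
  by rewrite addrAC subrr add0r rpredN dvdz_mulr.
have := floor_le_tmp ((b%:~R - c) / q%:R); have := floorD1_gt ((b%:~R - c) / q%:R).
rewrite -/f intrD ltr_pdivrMr // ler_pdivlMr // rmorphB rmorphM /= => h1 h2.
have -> : (q%:Z)%:~R = q%:R :> R by [].
by move: h1 h2; rewrite mulrDl mul1r; move: (f%:~R) => g; set gq := g * q%:R;
   rewrite [q%:R * g]mulrC -/gq; lra.
Qed.

Lemma nat_floor (R : realType) (x : R) : 0 <= x -> exists n : nat, n%:R <= x < n%:R + 1.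
Proof.
move=> x0; exists `|Num.floor x|%N; have f0 : 0 <= Num.floor x by rewrite floor_ge0.
have -> : `|Num.floor x|%N%:R = (Num.floor x)%:~R :> R by rewrite -[in RHS](gez0_abs f0).
by have := floor_le_tmp x; have := floorD1_gt x; rewrite intrD; lra.
Qed.

(** The primes up to [W] are split off one at a time by the Chinese remainder theorem, each with its
    own constant, while [rough] covers all larger ones together; so the constant stays positive. *)
Lemma density_lower (R : realType) k s (lam : 'I_s -> int) (W : nat) (c0 : R) : (k <= s)%N ->
  0 < c0 ->
  (forall q, (0 < q)%N -> (forall p, prime p -> (p %| q)%N -> (W < p)%N) ->
     c0 * q%:R ^+ (s - k) <= (csol k lam q)%:R) ->
  (forall p, prime p -> exists w : nat, forall n,
     (p ^ (n * (s - k)) <= p ^ w * csol k lam (p ^ n))%N) ->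
  exists2 c : R, 0 < c & forall q, (0 < q)%N -> c * q%:R ^+ (s - k) <= (csol k lam q)%:R.
Proof.
move=> ks c00 rough hp.
suff A m : (m <= W)%N -> exists2 c : R, 0 < c & forall q, (0 < q)%N ->
    (forall p, prime p -> (p %| q)%N -> (W - m < p)%N) -> c * q%:R ^+ (s - k) <= (csol k lam q)%:R.
  have [c cc hc] := A W (leqnn _); exists c => // q q0; apply: hc => // p pp _.
  by rewrite subnn prime_gt0.
elim: m => [|m IH] mW; first by exists c0 => // q q0 h; apply: rough => // p pp pd; have := h p pp pd; rewrite subn0.
have [c cc hc] := IH (ltnW mW); set p := (W - m)%N.
have pE : (W - m.+1).+1 = p by rewrite /p -subSn // subSS.
have [pp|np] := boolP (prime p); last first.
  exists c => // q q0 h; apply: hc => // p' pp' pd; rewrite ltn_neqAle -/p.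
  have h1 := h p' pp' pd; rewrite pE in h1; rewrite h1 andbT; apply: contraNneq np => ->.
  by [].
have [w hw] := hp p pp; have p0 := prime_gt0 pp.
exists (c / (p ^ w)%:R); first by rewrite divr_gt0 // ltr0n expn_gt0 p0.
move=> q q0 h; pose n := logn p q.
have [q' cop' qE'] := pfactor_coprime pp q0.
have qE : q = (p ^ n * q')%N by rewrite mulnC.
have q'0 : (0 < q')%N by move: q0; rewrite qE muln_gt0 => /andP[].
have cop : coprime (p ^ n) q' by rewrite coprimeXl.
have h1 := hw n.
have h2 : c * q'%:R ^+ (s - k) <= (csol k lam q')%:R.
  apply: hc => // p' pp' pd; rewrite ltn_neqAle -/p.
  have h1' : (W - m.+1 < p')%N by apply: h => //; rewrite qE dvdn_mull.
  rewrite pE in h1'; rewrite h1' andbT; apply/eqP => pe.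
  by move: cop'; rewrite prime_coprime // pe pd.
have h3 := csol_coprime k lam (_ : 0 < p ^ n)%N q'0 cop.
rewrite qE; apply: (@le_trans _ _ (csol k lam (p ^ n) * csol k lam q')%:R); last first.
  by rewrite ler_nat h3 // expn_gt0 p0.
rewrite !natrM exprMn.
apply: (@le_trans _ _ ((csol k lam (p ^ n))%:R * (c * q'%:R ^+ (s - k)))); last by rewrite ler_wpM2l.
have -> : c / (p ^ w)%:R * ((p ^ n)%:R ^+ (s - k) * q'%:R ^+ (s - k)) =
  (c * q'%:R ^+ (s - k)) * ((p ^ n)%:R ^+ (s - k) / (p ^ w)%:R) :> R by ring.
rewrite [leRHS]mulrC; apply: ler_wpM2l; first by rewrite mulr_ge0 ?exprn_ge0 // ltW.
rewrite ler_pdivrMr ?ltr0n ?expn_gt0 ?p0 // -natrX -natrM ler_nat mulnC -expnM; exact: h1.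
Qed.

(** * Lower bound for the number of integral solutions *)

Section RealCount.
Variables (R : realType) (k s : nat) (lam : 'I_s -> int).
Hypotheses (lam0 : forall i, lam i != 0) (lamS : \sum_i lam i = 0).

Lemma real_solution_box : has_nonsingular_solution R lam k ->
  exists (y : 'I_s -> R) (ic : 'I_k -> 'I_s), [/\ injective ic, solution lam k y,
    (forall i, 4^-1 <= y i <= 3 / 4) & forall l l', l != l' -> y (ic l) != y (ic l')].
Proof.
move=> [x [sol [ic nz]]]; have dis := nonsingular_distinct nz.
pose m := 1 + \sum_i `|x i|.
have m0 : 0 < m by rewrite ltr_pwDl // sumr_ge0.
have b0 : 0 < (4 * m)^-1 by rewrite invr_gt0 mulr_gt0.
exists (fun i => 2^-1 + (4 * m)^-1 * x i), ic; split.
- by move=> l l' ll; apply/eqP; apply: contraT => /dis; rewrite ll eqxx.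
- exact: solution_affine.
- move=> i; have : `|(4 * m)^-1 * x i| <= 4^-1.
    rewrite normrM gtr0_norm // ler_pdivrMl ?mulr_gt0 // mulrAC divff // mul1r.
    by rewrite /m (bigD1 i) //= addrCA lerDl addr_ge0 // sumr_ge0.
  by rewrite ler_norml; lra.
move=> l l' ll; rewrite (inj_eq (addrI _)) (inj_eq (mulfI _)) ?dis //.
by rewrite gt_eqF.
Qed.

(** The points lie near [N] times the real solution, in the residue classes of a congruence
    solution. Free coordinates range over a length [dl N]; the [k] critical ones, recentred by
    Newton's method, over the length [ka om N] that keeps the values within [om N^(j+1)]. *)
Lemma real_count : has_nonsingular_solution R lam k ->
  exists dl ka : R, [/\ 0 < dl, 0 < ka & forall (om : R) (q N : nat), 0 < om <= 1 -> (0 < q)%N ->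
   2 * q%:R <= dl * N%:R -> 2 * q%:R <= ka * om * N%:R ->
   exists B : {set {ffun 'I_s -> 'I_N}},
     (csol k lam q)%:R * (dl * N%:R / (2 * q%:R)) ^+ (s - k) * (ka * om * N%:R / (2 * q%:R)) ^+ k
       <= #|B|%:R /\
     forall x, x \in B -> forall j : 'I_k, (q%:Z %| Lz lam (fun i => npos (x i)) j)%Z /\
        `|(Lz lam (fun i => npos (x i)) j)%:~R| <= om * N%:R ^+ j.+1].
Proof.
move=> /real_solution_box[y [ic [icI sol hy dis]]].
pose mu i : R := (lam i)%:~R.
pose D : R := 1 + \sum_i `|mu i|.
have D1 : 1 <= D by rewrite lerDl sumr_ge0.
have D0 : 0 < D by exact: lt_le_trans D1.
have hmu i : `|mu i| <= D by rewrite /D (bigD1 i) //= addrCA lerDl addr_ge0 // sumr_ge0.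
pose ep : R := \big[Num.min/1]_(ll : 'I_k * 'I_k | ll.1 != ll.2) `|y (ic ll.1) - y (ic ll.2)|.
have ep0 : 0 < ep <= 1.
  apply/andP; split.
    apply: (big_ind (fun z : R => 0 < z)) => // [c d c0 d0|ll ne]; first by rewrite lt_min c0.
    by rewrite normr_gt0 subr_eq0 dis.
  apply: (big_ind (fun z : R => z <= 1)) => // [c d c0 d0|ll ne]; first by rewrite ge_min c0.
  have /andP[a1 a2] := hy (ic ll.1); have /andP[b1 b2] := hy (ic ll.2).
  by rewrite ler_norml; move: a1 a2 b1 b2; lra.
have hep l l' : l != l' -> ep <= `|y (ic l) - y (ic l')|.
  by move=> ll; rewrite /ep (bigD1 (l, l')) //= ge_min lexx.
have one_le (z : int) : z != 0 -> 1 <= `|z%:~R| :> R.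
  by move=> z0; rewrite -intr_norm -[1]/(1%:~R) ler_int -gtz0_ge1 normr_gt0.
have ep1 : ep <= 1 by have /andP[] := ep0.
have h1 l : ep <= `|mu (ic l)| by apply: le_trans ep1 _; exact: one_le.
have h2 (j : 'I_k) : ep <= `|(j.+1)%:R| :> R by apply: le_trans ep1 _; rewrite normr_nat ler1n.
have ngt0 (x : R) : x != 0 -> 0 < `|x| by move=> x0; rewrite normr_gt0.
have [rho [B [rho0 B0 hN]]] := newton_system (@normr_ge0 R R) (@normrM R) (@ler_normD R R)
  (@normr1 R) (@normr0 R R) (@normrN R R) ngt0 icI D1 ep0 hmu h1 h2.
(* Keeps the free displacement [dl] and the critical one [B dl] at most 1/8, inside the box. *)
pose dl : R := Num.min rho (8 + 8 * B)^-1.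
have dB : 0 < 8 + 8 * B by move: B0; lra.
have dl0 : 0 < dl by rewrite lt_min rho0 invr_gt0.
have dlr : dl <= rho by rewrite ge_min lexx.
have dlb : dl * (8 + 8 * B) <= 1.
  by rewrite -ler_pdivlMr // div1r ge_min lexx orbT.
have dl8 : dl <= 8^-1.
  have : 0 <= dl * B by rewrite mulr_ge0 // ltW.
  by move: dlb; rewrite mulrDr [dl * (8 * B)]mulrCA; lra.
have Bdl : B * dl <= 8^-1.
  by move: dlb dl0; rewrite mulrDr [dl * (8 * B)]mulrCA [B * dl]mulrC; lra.
(* Rounding the critical coordinates within [ka om] changes the values by at most [om / 2], the
   other half being left to Newton's error; the 16 keeps the points inside the box. *)
pose ka : R := (16 + 2 * (k * k)%:R * D)^-1.
have kd : 0 < 16 + 2 * (k * k)%:R * D by rewrite ltr_pwDl // !mulr_ge0 // ltW.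
have ka0 : 0 < ka by rewrite invr_gt0.
have kaE : ka * (16 + 2 * (k * k)%:R * D) = 1 by rewrite mulVf // gt_eqF.
exists dl, ka; split => // om q N /andP[om0 om1] q0 qdl qka.
have qr : 0 < q%:R :> R by rewrite ltr0n.
have N0 : (0 < N)%N.
  rewrite lt0n; apply/eqP => N0; move: qdl; rewrite N0 mulr0; move: qr; lra.
have Nr : 0 < N%:R :> R by rewrite ltr0n.
pose ko := ka * om.
have ko0 : 0 < ko by rewrite mulr_gt0.
have ko16 : ko <= 16^-1.
  have : ko <= ka by rewrite ler_piMr // ltW.
  have : 0 <= ka * (2 * (k * k)%:R * D) by rewrite !mulr_ge0 // ltW.
  by move: kaE; rewrite mulrDr; lra.
have koD : 2 * (k * k)%:R * D * ko <= om.
  have -> : 2 * (k * k)%:R * D * ko = (ka * (2 * (k * k)%:R * D)) * om by rewrite /ko; ring.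
  rewrite ler_piMl ?(ltW om0) //; move: kaE ka0; rewrite mulrDr; lra.
have [|m1 /andP[m1l m1u]] := @nat_floor R (dl * N%:R / q%:R).
  by rewrite divr_ge0 // mulr_ge0 // ltW.
have [|m2 /andP[m2l m2u]] := @nat_floor R (ko * N%:R / q%:R).
  by rewrite divr_ge0 // mulr_ge0 // ltW.
have m1q : m1%:R * q%:R <= dl * N%:R by rewrite -ler_pdivlMr.
have m2q : m2%:R * q%:R <= ko * N%:R by rewrite -ler_pdivlMr.
have m1b : dl * N%:R / (2 * q%:R) <= m1%:R.
  rewrite ler_pdivrMr ?mulr_gt0 //; move: m1u; rewrite ltr_pdivrMr // mulrDl mul1r mulrCA.
  by move: qdl; lra.
have m2b : ko * N%:R / (2 * q%:R) <= m2%:R.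
  rewrite ler_pdivrMr ?mulr_gt0 //; move: m2u; rewrite ltr_pdivrMr // mulrDl mul1r mulrCA.
  by move: qka; rewrite -/ko; lra.
have [M hM] : exists M : nat, (2 ^+ M)^-1 <= om / 2 :> R.
  pose M := Num.bound (2 / om); exists M.
  have o2 : 0 < 2 / om by rewrite divr_gt0.
  rewrite -[om / 2]invrK lef_pV2 ?posrE ?exprn_gt0 ?invr_gt0 ?divr_gt0 // invf_div.
  apply: le_trans (ltW (archi_boundP (ltW o2))) _; rewrite -natrX ler_nat ltnW // ltn_expl //.
pose free := {i : 'I_s | i \notin codom ic}.
pose T := ({ffun 'I_s -> 'I_q} * {ffun free -> 'I_m1} * {ffun 'I_k -> 'I_m2})%type.
have [b1 hb1] : exists b1 : {ffun 'I_s -> 'I_q} * 'I_s -> int, forall a,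
   (q%:Z %| b1 a - npos (a.1 a.2))%Z /\ (y a.2 - dl) * N%:R <= (b1 a)%:~R <= (y a.2 - dl) * N%:R + q%:R.
  have H (a : {ffun 'I_s -> 'I_q} * 'I_s) := @residue_near R ((y a.2 - dl) * N%:R) (npos (a.1 a.2)) q q0.
  by have [b1 hb1] := boolp.choice H; exists b1.
pose xf (b : {ffun 'I_s -> 'I_q}) (r : {ffun free -> 'I_m1}) (i : 'I_s) : int :=
  b1 (b, i) + q%:Z * (if insub i is Some f then (r f : nat)%:Z else 0).
have xfb b r i : (y i - dl) * N%:R <= (xf b r i)%:~R <= (y i + dl) * N%:R.
  have [_ /= /andP[l1 l2]] := hb1 (b, i).
  have t0 : 0 <= ((if insub i is Some f then (r f : nat)%:Z else 0)%:~R : R) <= m1%:R.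
    case: insubP => [f _ _|_]; last by rewrite lexx ler0n.
    by rewrite ler0n /= ler_nat ltnW.
  rewrite /xf rmorphD rmorphM /=; have -> : (q%:Z)%:~R = q%:R :> R by [].
  move: t0; set tt := (X in 0 <= X <= _) => /andP[t0 t1].
  have u1 : q%:R * tt <= dl * N%:R by apply: le_trans m1q; rewrite mulrC ler_wpM2r // ltW.
  have u0 : 0 <= q%:R * tt by rewrite mulr_ge0 // ltW.
  by move: l1 l2 u0 u1 qdl; rewrite !mulrDl mulNr; move: (y i * N%:R) (dl * N%:R) => aa bb; lra.
have [z hz] : exists z : {ffun 'I_s -> 'I_q} * {ffun free -> 'I_m1} -> 'I_k -> R, forall br,
    (forall l, `|z br l - y (ic l)| <= 8^-1) /\ forall j : 'I_k,
    `|\sum_l mu (ic l) * z br l ^+ j.+1 +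
       \sum_(i | i \notin codom ic) mu i * ((xf br.1 br.2 i)%:~R / N%:R) ^+ j.+1| <= om / 2.
  have H br : exists z : 'I_k -> R, (forall l, `|z l - y (ic l)| <= 8^-1) /\ forall j : 'I_k,
    `|\sum_l mu (ic l) * z l ^+ j.+1 +
       \sum_(i | i \notin codom ic) mu i * ((xf br.1 br.2 i)%:~R / N%:R) ^+ j.+1| <= om / 2.
    have xN i : y i - dl <= (xf br.1 br.2 i)%:~R / N%:R <= y i + dl.
      by have /andP[l1 l2] := xfb br.1 br.2 i; rewrite ler_pdivlMr // l1 ler_pdivrMr.
    have [|||||z [hz1 hz2]] := hN (fun i => (xf br.1 br.2 i)%:~R / N%:R) y dl _ _ _ _ hep _ M.
    - by rewrite (ltW dl0).
    - move=> i; have /andP[a1 a2] := hy i; rewrite ler_norml; move: a1 a2 D1; lra.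
    - move=> i; have /andP[a1 a2] := hy i; have /andP[c1 c2] := xN i.
      by rewrite ler_norml; move: a1 a2 c1 c2 D1 dl8 dl0; lra.
    - by move=> i; have /andP[c1 c2] := xN i; rewrite ler_norml; move: c1 c2; lra.
    - move=> j; have /forallP/(_ j)/eqP := sol; rewrite /L => ->; by rewrite normr0 ltW.
    exists z; split => [l|j]; first exact: le_trans (hz1 l) Bdl.
    exact: le_trans (hz2 j) hM.
  by have [z hz] := boolp.choice H; exists z.
have [b2 hb2] : exists b2 : {ffun 'I_s -> 'I_q} * {ffun free -> 'I_m1} * 'I_k -> int, forall a,
   (q%:Z %| b2 a - npos (a.1.1 (ic a.2)))%Z /\ (z a.1 a.2 - ko) * N%:R <= (b2 a)%:~R <= (z a.1 a.2 - ko) * N%:R + q%:R.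
  have H (a : {ffun 'I_s -> 'I_q} * {ffun free -> 'I_m1} * 'I_k) :=
    @residue_near R ((z a.1 a.2 - ko) * N%:R) (npos (a.1.1 (ic a.2))) q q0.
  by have [b2 hb2] := boolp.choice H; exists b2.
pose X (t : T) (i : 'I_s) : int := comb ic
   (fun l => b2 (t.1, l) + q%:Z * (t.2 l : nat)%:Z) (xf t.1.1 t.1.2) i.
have Xcrit t l : X t (ic l) = b2 (t.1, l) + q%:Z * (t.2 l : nat)%:Z by exact: comb_crit.
have Xfree t i : i \notin codom ic -> X t i = xf t.1.1 t.1.2 i by exact: comb_free.
have Xcb t l : `|(X t (ic l))%:~R / N%:R - z t.1 l| <= ko.
  have [_ /= /andP[l1 l2]] := hb2 (t.1, l).
  have -> : (X t (ic l))%:~R / N%:R - z t.1 l = ((X t (ic l))%:~R - z t.1 l * N%:R) / N%:R.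
    by field; rewrite gt_eqF.
  rewrite normrM normfV (ger0_norm (ltW Nr)) ler_pdivrMr // Xcrit rmorphD rmorphM /=.
  have -> : (q%:Z)%:~R = q%:R :> R by [].
  have -> : ((t.2 l : nat)%:Z)%:~R = (t.2 l)%:R :> R by [].
  have t1 : (t.2 l)%:R <= m2%:R :> R by rewrite ler_nat ltnW.
  have u1 : q%:R * (t.2 l)%:R <= ko * N%:R by apply: le_trans m2q; rewrite mulrC ler_wpM2r // ltW.
  have u0 : 0 <= q%:R * (t.2 l)%:R :> R by rewrite mulr_ge0.
  move: l1 l2 u0 u1 qka; rewrite !mulrDl mulNr -/ko; move: (z t.1 l * N%:R) (ko * N%:R) (q%:R * _) => aa bb cc.
  by move=> *; rewrite ler_norml; lra.
have X01 t i : 0 <= (X t i)%:~R / (N%:R : R) < 1.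
  have [/codomP[l ->]|ni] := boolP (i \in codom ic).
    have := Xcb t l; have [/(_ l) hl _] := hz t.1; have /andP[a1 a2] := hy (ic l).
    by move: hl; rewrite !ler_norml; move: a1 a2 ko16; lra.
  have /andP[c1 c2] := xfb t.1.1 t.1.2 i; have /andP[a1 a2] := hy i; rewrite Xfree //.
  rewrite -ler_pdivlMr // in c1; rewrite -ler_pdivrMr // in c2.
  by move: a1 a2 c1 c2 dl8 dl0; lra.
have XN t i : 0 <= X t i < N%:Z.
  have /andP[a1 a2] := X01 t i.
  rewrite pmulr_lge0 ?invr_gt0 // ler0z in a1; rewrite a1 /=.
  by rewrite ltr_pdivrMr // mul1r -[N%:R]/((N%:Z)%:~R) ltr_int in a2.
pose fX (t : T) : {ffun 'I_s -> 'I_N} := [ffun i => insubd (Ordinal N0) `|X t i|%N].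
have fXE t i : npos (fX t i) = X t i.
  have /andP[a1 a2] := XN t i; rewrite /npos ffunE insubdK ?gez0_abs //.
  by rewrite -topredE /= -ltz_nat gez0_abs.
pose dom : {set T} := [set t : T | [forall j : 'I_k, (q%:Z %| Lz lam (fun i => npos (t.1.1 i)) j)%Z]].
have Xmod t i : (q%:Z %| X t i - npos (t.1.1 i))%Z.
  have [/codomP[l ->]|ni] := boolP (i \in codom ic).
    by have [h _] := hb2 (t.1, l); rewrite Xcrit addrAC rpredD // dvdz_mulr.
  by have [h _] := hb1 (t.1.1, i); rewrite Xfree // /xf addrAC rpredD // dvdz_mulr.
(* The point modulo [q] gives back the congruence solution, hence the base points [b1] and the free
   offsets; these fix the base points [b2] and so the critical offsets. *)
have fI : injective fX.
  move=> t t' tt; have XX i : X t i = X t' i by rewrite -!fXE tt.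
  have e1 : t.1.1 = t'.1.1.
    apply/ffunP => i; apply: val_inj => /=.
    have d1 := Xmod t i; have d2 := Xmod t' i; rewrite XX in d1.
    have : (q%:Z %| npos (t.1.1 i) - npos (t'.1.1 i))%Z.
      have -> : npos (t.1.1 i) - npos (t'.1.1 i) =
        (X t' i - npos (t'.1.1 i)) - (X t' i - npos (t.1.1 i)) by ring.
      exact: rpredB.
    rewrite -eqz_mod_dvd /npos.
    by rewrite !modz_small ?ltz_nat ?ltn_ord // => /eqP[].
  have qz : q%:Z != 0 by rewrite eqz_nat -lt0n.
  have e2 : t.1.2 = t'.1.2.
    apply/ffunP => g; apply: val_inj => /=; have := XX (val g).
    rewrite !Xfree ?(valP g) // /xf e1 valK => /addrI/(mulfI qz)[]; exact.
  have e3 : t.2 = t'.2.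
    apply/ffunP => l; apply: val_inj => /=; have := XX (ic l).
    have et : t.1 = t'.1 by rewrite [t.1]surjective_pairing [t'.1]surjective_pairing e1 e2.
    by rewrite !Xcrit et => /addrI/(mulfI qz)[].
  by rewrite [t]surjective_pairing [t'] surjective_pairing e3 [t.1]surjective_pairing [t'.1]surjective_pairing e1 e2.
exists [set fX t | t in dom]; split.
  rewrite card_imset //.
  have -> : #|dom| = (csol k lam q * m1 ^ (s - k) * m2 ^ k)%N.
    have -> : dom = finset.setX (finset.setX [set x : {ffun 'I_s -> 'I_q} |
         [forall j : 'I_k, (q%:Z %| Lz lam (fun i => npos (x i)) j)%Z]] [set: {ffun free -> 'I_m1}]%SET)
         [set: {ffun 'I_k -> 'I_m2}]%SET.
      by apply/finset.setP => -[[b r] r']; rewrite !inE /= !andbT.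
    by rewrite !cardsX !cardsT !card_ffun !card_ord card_sig card_free.
  rewrite -/ko !natrM !natrX; apply: ler_pM; rewrite ?mulr_ge0 ?exprn_ge0 ?divr_ge0 ?mulr_ge0 ?(ltW dl0) ?(ltW ka0) ?(ltW om0) //.
    by rewrite ler_wpM2l // lerXn2r ?nnegrE // divr_ge0 ?mulr_ge0 ?(ltW dl0).
  by rewrite lerXn2r ?nnegrE // divr_ge0 ?mulr_ge0 ?(ltW ka0) ?(ltW om0).
move=> x /imsetP[t]; rewrite inE => /forallP td -> j.
have LE : Lz lam (fun i => npos (fX t i)) j = Lz lam (X t) j.
  by apply: eq_bigr => i _; rewrite fXE.
rewrite LE; split.
  rewrite -[Lz lam (X t) j](subrK (Lz lam (fun i => npos (t.1.1 i)) j)); apply: rpredD => //.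
  by apply: Lz_cong => i; exact: Xmod.
have -> : (Lz lam (X t) j)%:~R = N%:R ^+ j.+1 * ((\sum_l mu (ic l) * z t.1 l ^+ j.+1 +
       \sum_(i | i \notin codom ic) mu i * ((xf t.1.1 t.1.2 i)%:~R / N%:R) ^+ j.+1) +
       \sum_l mu (ic l) * (((X t (ic l))%:~R / N%:R) ^+ j.+1 - z t.1 l ^+ j.+1)) :> R.
  have Nj : N%:R ^+ j.+1 != 0 :> R by rewrite expf_neq0 // gt_eqF.
  have E (w : int) : N%:R ^+ j.+1 * (w%:~R / N%:R) ^+ j.+1 = w%:~R ^+ j.+1 :> R.
    by rewrite expr_div_n mulrC divfK.
  rewrite addrAC -big_split /= /Lz rmorph_sum (sum_split icI) /= mulrDr; congr (_ + _); rewrite mulr_sumr.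
    by apply: eq_bigr => l _; rewrite -mulrDr [z _ _ ^+ _ + _]addrC subrK mulrCA E rmorphM rmorphXn.
  by apply: eq_bigr => i ni; rewrite mulrCA E rmorphM rmorphXn /= Xfree.
rewrite normrM ger0_norm ?exprn_ge0 // mulrC ler_wpM2r ?exprn_ge0 //.
apply: le_trans (ler_normD _ _) _; have [hz1 /(_ j) hz2] := hz t.1.
have -> : om = om / 2 + om / 2 by field.
apply: lerD => //; apply: le_trans (ler_norm_sum _ _ _) _.
apply: (@le_trans _ _ (\sum_(l < k) D * (k%:R * ko))).
  apply: ler_sum => l _; rewrite normrM; apply: ler_pM => //.
  have hz01 : 0 <= z t.1 l <= 1.
    by have := hz1 l; have /andP[a1 a2] := hy (ic l); rewrite ler_norml; move: a1 a2; lra.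
  have hx01 : 0 <= (X t (ic l))%:~R / (N%:R : R) <= 1 by have /andP[-> /ltW ->] := X01 t (ic l).
  apply: le_trans (pow_diff_le j hx01 hz01) _; rewrite expr1n mulr1; apply: ler_pM => //.
  by rewrite ler_nat.
rewrite sumr_const card_ord -[_ *+ k]mulr_natl.
have -> : k%:R * (D * (k%:R * ko)) = 2 * (k * k)%:R * D * ko / 2 by rewrite natrM; field.
by rewrite ler_pM2r ?invr_gt0.
Qed.

End RealCount.

Lemma prod_scale_pow (R : realType) k (c : R) (N : nat) :
  \prod_(j < k) (c * N%:R ^+ j.+1) = c ^+ k * N%:R ^+ kap k.
Proof.
rewrite big_split /= prodr_const card_ord; congr (_ * _).
have := prod_pow_kap k N; rewrite -[X in (_ * N ^ X)%N]card_ord -prod_nat_const -big_split /= => h.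
rewrite -natrX -h natr_prod; apply: eq_bigr => j _; by rewrite -natrX expnSr.
Qed.

Theorem solutions_lower_bound (R : realType) k s (lam : 'I_s -> int) t : (0 < k)%N ->
  (forall i, lam i != 0) -> \sum_i lam i = 0 -> (kap k < t)%N -> (2 * t < s)%N ->
  has_nonsingular_solution R lam k ->
  (forall p, prime p -> has_nonsingular_solution (Qp p) lam k) ->
  exists2 c : R, 0 < c & exists N0 : nat, forall N, (N0 <= N)%N ->
    c * N%:R ^+ (s - kap k) <=
    #|[set x : {ffun 'I_s -> 'I_N} | solution lam k (fun i => npos (x i))]|%:R.
Proof.
move=> k0 lam0 lamS Kt ts hR hp; set K := kap k in Kt *.
have [Cj Cj0 hJ] := @sharp_mean R k k0 t Kt.
have [E hw] := @weyl R k t.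
have t0 : (0 < t)%N by exact: leq_ltn_trans Kt.
have K2t : (K <= 2 * t)%N by move: Kt; clear; lia.
have kK : (k <= K)%N.
  rewrite -(leq_pmul2l (isT : 0 < 2)%N) kap2 mulnC leq_mul2l ltnS k0 orbT //.
have ks : (k <= s)%N by move: kK K2t ts; clear; lia.
have Ks : (K <= s)%N by move: K2t ts; clear; lia.
have s0 : (0 < s)%N by exact: leq_trans ks.
have [W hW] := rough_density hw t0 ts K2t lam0 Cj0 hJ.
have h2 : 0 < 2^-1 :> R by rewrite invr_gt0.
have [||cs cs0 hcs] := density_lower (lam := lam) (W := W) ks h2.
- move=> q q0 hq; apply: le_trans (hW q q0 hq); rewrite mulrC ler_wpM2r ?invr_ge0 //.
  by rewrite -{2}(subnK ks) exprD mulfK // expf_neq0 // pnatr_eq0 -lt0n.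
- by move=> p pp; exact: padic_density pp lam0 (hp p pp).
have [dl [ka [dl0 ka0 hcount]]] := real_count lam0 lamS hR.
(* [c'] does not involve [q], [om] or [Y], which cancel in [#|B| / #|D|]; so [Y] and [eta] can be
   chosen in terms of it. The 6 is the 2 of [real_count] times the 3 that bounds [#|D|]. *)
have [c' c'E c'0] : exists2 c' : R, c' = cs * (dl / 2) ^+ (s - k) * (ka / 6) ^+ k & 0 < c'.
  by exists (cs * (dl / 2) ^+ (s - k) * (ka / 6) ^+ k); rewrite ?mulr_gt0 ?exprn_gt0 ?divr_gt0.
have [sC sCE sC0] : exists2 sC : R, sC = s%:R * Cj & 0 < sC.
  by exists (s%:R * Cj); rewrite // mulr_gt0 // ltr0n.
pose Y := (Num.bound (Cj + 8 * sC / c')).+2.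
have Yb : Cj + 8 * sC / c' <= Y%:R.
  apply: le_trans (ltW (archi_boundP _)) _; last by rewrite ler_nat /Y ltnW.
  by rewrite addr_ge0 ?divr_ge0 ?mulr_ge0 ?(ltW c'0) ?(ltW sC0) ?(ltW Cj0).
have q8 : 0 <= 8 * sC / c' by rewrite divr_ge0 ?mulr_ge0 ?(ltW c'0) ?(ltW sC0).
have CY : Cj <= Y%:R by apply: le_trans Yb; rewrite lerDl.
have Yr : 0 < Y%:R :> R by [].
have sY : 2 / Y%:R * sC <= c' / 4.
  have h : 8 * sC / c' <= Y%:R by apply: le_trans Yb; rewrite lerDr ltW.
  rewrite mulrAC ler_pdivrMr // mulrAC ler_pdivlMr //; move: h; rewrite ler_pdivrMr //.
  by rewrite [Y%:R * c']mulrC; lra.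
have kr : 0 < k%:R :> R by rewrite ltr0n.
pose eta : R := Num.min 1 (c' / (32 * (k%:R * sC))).
have eta0 : 0 < eta by rewrite lt_min ltr01 divr_gt0 // !mulr_gt0.
have eta1 : eta <= 1 by rewrite ge_min lexx.
have seta : 8 * (k%:R * eta) * sC <= c' / 4.
  have h : eta <= c' / (32 * (k%:R * sC)) by rewrite ge_min lexx orbT.
  have h3 : 0 < 32 * (k%:R * sC) by rewrite !mulr_gt0.
  rewrite ler_pdivlMr // in h.
  have -> : 8 * (k%:R * eta) * sC = eta * (32 * (k%:R * sC)) / 4 by field.
  by rewrite ler_pM2r ?invr_gt0.
pose Q := (Y ^ E)%N; pose om := eta / Q%:R.
have Q0 : (0 < Q)%N by rewrite expn_gt0.
have Qr : 0 < Q%:R :> R by rewrite ltr0n.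
have om0 : 0 < om by rewrite divr_gt0.
have om1 : om <= 1.
  by rewrite ler_pdivrMr // mul1r (le_trans eta1) // ler1n.
pose i0 : 'I_s := Ordinal s0; pose q := (`|lam i0| * Q`!)%N.
have q0 : (0 < q)%N by rewrite muln_gt0 absz_gt0 lam0 fact_gt0.
have qr : 0 < q%:R :> R by rewrite ltr0n.
have ko0 : 0 < ka * om by rewrite mulr_gt0.
pose xx : R := 2 * q%:R / dl + 2 * q%:R / (ka * om) + q%:R / om + Q%:R.
have e1 : 0 <= 2 * q%:R / dl by rewrite divr_ge0 ?mulr_ge0 // ltW.
have e2 : 0 <= 2 * q%:R / (ka * om) by rewrite divr_ge0 ?mulr_ge0 // ltW.
have e3 : 0 <= q%:R / om by rewrite divr_ge0 // ltW.
have xx0 : 0 <= xx by rewrite /xx !addr_ge0.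
exists (c' / 2); first by rewrite divr_gt0.
exists (Num.bound xx) => N hN.
have xN : xx <= N%:R by apply: le_trans (ltW (archi_boundP xx0)) _; rewrite ler_nat.
have n1 : 2 * q%:R <= dl * N%:R.
  by rewrite -ler_pdivrMl // mulrC; apply: le_trans xN; move: e2 e3 (ltW Qr); rewrite /xx; lra.
have n2 : 2 * q%:R <= ka * om * N%:R.
  by rewrite -ler_pdivrMl // mulrC; apply: le_trans xN; move: e1 e3 (ltW Qr); rewrite /xx; lra.
have n3 : q%:R <= om * N%:R.
  by rewrite -ler_pdivrMl // mulrC; apply: le_trans xN; move: e1 e2 (ltW Qr); rewrite /xx; lra.
have n4 : (Q <= N)%N.
  by rewrite -(ler_nat R); apply: le_trans xN; move: e1 e2 e3; rewrite /xx; lra.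
have N0 : (0 < N)%N by exact: leq_trans n4.
have Nr : 0 < N%:R :> R by rewrite ltr0n.
have N1 : 1 <= N%:R :> R by rewrite ler1n.
have om01 : 0 < om <= 1 by rewrite om0.
have [B [cB hB]] := hcount om q N om01 q0 n1 n2.
have ob (j : 'I_k) : 1 <= om * N%:R ^+ j.+1 / q%:R.
  rewrite ler_pdivlMr // mul1r; apply: le_trans n3 _; rewrite ler_pM2l // -{1}[N%:R]expr1 ler_weXn2l //.
have [H hH] : exists H : 'I_k -> nat, forall j, (H j)%:R <= om * N%:R ^+ j.+1 / q%:R < (H j)%:R + 1.
  have Hx (j : 'I_k) := @nat_floor R (om * N%:R ^+ j.+1 / q%:R) (le_trans ler01 (ob j)).
  by have [H hH] := boolp.choice Hx; exists H.
(* Divided by [q], the values lie in [[-H j, H j]]; adding [H j] makes them natural numbers below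
   [b j]. *)
pose b j := (2 * H j + 1)%N; pose m := (\sum_j b j)%N.
have bm j : (b j <= m)%N by rewrite /m (bigD1 j) //= leq_addr.
have m0 : (0 < m)%N by apply: leq_trans (bm (Ordinal k0)); rewrite /b addn1.
pose Lx (x : {ffun 'I_s -> 'I_N}) := Lz lam (fun i => npos (x i)) : 'I_k -> int.
pose g x j : nat := absz ((Lx x j %/ q%:Z)%Z + (H j)%:Z).
have gP x j : x \in B -> Lx x j = ((g x j)%:Z - (H j)%:Z) * q%:Z /\ (g x j < b j)%N.
  move=> xB; have [hd hs] := hB x xB j; have := divzK hd; rewrite -/(Lx x j) => hde.
  rewrite -/(Lx x j) in hd hs.
  set d := (Lx x j %/ q%:Z)%Z in hde.
  have dH : - (H j)%:Z <= d <= (H j)%:Z.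
    have /andP[_ u] := hH j; have dr : `|d%:~R| < (H j)%:R + 1 :> R.
      apply: le_lt_trans u; rewrite ler_pdivlMr //; apply: le_trans hs.
      have E3 := congr1 (fun z : int => z%:~R : R) hde; rewrite /= intrM in E3.
      by rewrite -E3 normrM normr_nat.
    rewrite -intr_norm -[1]/(1%:~R) -[(H j)%:R]/(((H j)%:Z)%:~R) -intrD ltr_int in dr.
    by move: dr; clear; lia.
  rewrite /g -/d gez0_abs; last by move: dH; clear; lia.
  rewrite addrK hde; split => //; rewrite /b -ltz_nat gez0_abs; last by move: dH; clear; lia.
  by move: dH; clear; lia.
pose v x : {ffun 'I_k -> 'I_m} := [ffun j => insubd (Ordinal m0) (g x j)].
have vE x j : x \in B -> v x j = g x j :> nat.
  by move=> /(gP x j)[_ h]; rewrite ffunE insubdK // -topredE /=; apply: leq_trans h (bm j).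
pose D := [set c | c \in family (fun j : 'I_k => [pred x : 'I_m | (x < b j)%N])].
have cD : #|D| = (\prod_j b j)%N by rewrite cardsE card_box.
have hB1 x : x \in B -> forall j, (q%:Z %| Lx x j)%Z /\
    (Y ^ E)%:R * `|(Lx x j)%:~R| <= eta * N%:R ^+ j.+1.
  move=> xB j; have [hd hs] := hB x xB j; split => //.
  apply: le_trans (ler_wpM2l (ler0n _ _) hs) _; rewrite -/Q /om mulrA [Q%:R * _]mulrC divfK ?gt_eqF //.
have hB2 x : x \in B -> v x \in D.
  by move=> xB; rewrite inE; apply/familyP => j; rewrite inE vE //; have [] := gP x j xB.
have hB3 x y : x \in B -> y \in B -> v x = v y -> forall j, Lx x j = Lx y j.
  move=> xB yB vxy j; have [-> _] := gP x j xB; have [-> _] := gP y j yB.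
  by rewrite -!vE // vxy.
have cmp := @compare_solutions R k s lam N Y t E eta i0 B _ v D hw t0 ts isT n4 lam0 (ltW eta0)
  (Jn_Y K2t hJ CY N0) hB1 hB2 hB3.
set r0 := #|[set x : {ffun 'I_s -> 'I_N} | solution lam k (fun i => npos (x i))]|%:R in cmp *.
have NsK : 0 < N%:R ^+ (s - K) :> R by rewrite exprn_gt0.
have JN : (Jn k t N)%:R * N%:R ^+ s / N%:R ^+ (2 * t) <= Cj * N%:R ^+ (s - K).
  rewrite ler_pdivrMr ?exprn_gt0 //; apply: le_trans (ler_wpM2r _ (hJ N N0)) _; first by rewrite exprn_ge0.
  rewrite -!mulrA -!exprD -/K; have -> : (2 * t - K + s = s - K + 2 * t)%N by move: K2t Ks; clear; lia.
  by [].
have rt : s%:R * (2 / Y%:R + 8 * (k%:R * eta)) * ((Jn k t N)%:R * N%:R ^+ s / N%:R ^+ (2 * t)) <=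
   c' / 2 * N%:R ^+ (s - K).
  apply: le_trans (ler_wpM2l _ JN) _.
    by rewrite mulr_ge0 // addr_ge0 ?divr_ge0 // mulr_ge0 // mulr_ge0 // ltW.
  rewrite [leLHS]mulrA ler_pM2r // mulrAC -sCE mulrDr.
  move: sY seta; rewrite [2 / Y%:R * sC]mulrC [_ * sC]mulrC; lra.
have lowB : c' * N%:R ^+ (s - K) <= #|B|%:R / #|D|%:R.
  have cD0 : 0 < #|D|%:R :> R.
    by rewrite ltr0n cD prodn_gt0 // => j; rewrite /b addn1.
  rewrite ler_pdivlMr //.
  have cDb : #|D|%:R <= (3 * om / q%:R) ^+ k * N%:R ^+ K.
    rewrite cD natr_prod -prod_scale_pow; apply: ler_prod => j _; rewrite ler0n /=.
    have /andP[l1 _] := hH j; have l2 := ob j.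
    rewrite /b natrD natrM; have -> : 3 * om / q%:R * N%:R ^+ j.+1 = 3 * (om * N%:R ^+ j.+1 / q%:R).
      by field; rewrite gt_eqF.
    by move: l1 l2; lra.
  apply: le_trans (ler_wpM2l (ltW (mulr_gt0 c'0 NsK)) cDb) _.
  apply: le_trans cB; rewrite -mulrA.
  apply: (@le_trans _ _ (cs * q%:R ^+ (s - k) * ((dl * N%:R / (2 * q%:R)) ^+ (s - k) * (ka * om * N%:R / (2 * q%:R)) ^+ k))).
    rewrite le_eqVlt; apply/orP; left; apply/eqP.
    have NE : N%:R ^+ (s - K) * N%:R ^+ K = N%:R ^+ (s - k) * N%:R ^+ k :> R.
      by rewrite -!exprD !subnK.
    have -> : (dl * N%:R / (2 * q%:R)) ^+ (s - k) = (dl / 2) ^+ (s - k) * N%:R ^+ (s - k) / q%:R ^+ (s - k).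
      by rewrite -exprMn -expr_div_n; congr (_ ^+ _); field; rewrite gt_eqF.
    have -> : (ka * om * N%:R / (2 * q%:R)) ^+ k = (ka / 6) ^+ k * (3 * om / q%:R) ^+ k * N%:R ^+ k.
      by rewrite -!exprMn; congr (_ ^+ _); field; rewrite gt_eqF.
    transitivity (c' * (3 * om / q%:R) ^+ k * (N%:R ^+ (s - K) * N%:R ^+ K)); first by ring.
    rewrite NE c'E; field; by rewrite expf_neq0 // gt_eqF.
  rewrite -[leRHS]mulrA ler_wpM2r ?hcs // mulr_ge0 ?exprn_ge0 ?divr_ge0 ?mulr_ge0 ?(ltW dl0) ?(ltW ka0) ?(ltW om0) ?(ltW eta0) //.
by move: cmp rt lowB; move: (#|B|%:R / #|D|%:R) => aa; move: (s%:R * _ * _) => bb; lra.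
Qed.

(** * Uniform sets *)

Lemma prod_but_le (R : realType) s (a : 'I_s -> R) n i0 : (forall i, 0 <= a i <= 1) ->
  (0 < n < s)%N -> \prod_(i | i != i0) a i <= \sum_i a i ^+ n.
Proof.
move=> ha /andP[n0 ns].
have a0 i : 0 <= a i by have /andP[] := ha i.
have a1 i : a i <= 1 by have /andP[] := ha i.
have [i1 _ hmax] := @arg_maxP _ _ _ i0 xpredT a isT.
have {}hmax i : a i <= a i1 by exact: hmax.
apply: (@le_trans _ _ (\prod_(i | i != i0) a i1)).
  by apply: ler_prod => i _; rewrite a0 /= hmax.
rewrite prodr_const cardC1 card_ord.
apply: (@le_trans _ _ (a i1 ^+ n)).
  by apply: ler_wiXn2l => //; move: ns; case: s {a ha a0 a1 i0 i1 hmax} => // m; rewrite ltnS.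
by rewrite (bigD1 i1) //= lerDl sumr_ge0 // => i _; rewrite exprn_ge0.
Qed.

(** Telescoping: the factors are exchanged one at a time. *)
Lemma prod_diff_le (R : realType) s (u w : 'I_s -> R[i]) (m : 'I_s -> R) :
  (forall i, nm (u i) <= m i) -> (forall i, nm (w i) <= m i) ->
  nm (\prod_i u i - \prod_i w i) <= \sum_i nm (u i - w i) * \prod_(j | j != i) m j.
Proof.
move=> hu hw; have m0 i : 0 <= m i by exact: le_trans (nm_ge0 _) (hu i).
have : uniq (index_enum 'I_s) by exact: index_enum_uniq.
elim: (index_enum _) => [|x r IH] /=; first by rewrite !big_nil subrr nm0.
move=> /andP[xr ur]; rewrite !big_cons.
have -> : u x * \prod_(j <- r) u j - w x * \prod_(j <- r) w j =
   u x * (\prod_(j <- r) u j - \prod_(j <- r) w j) + (u x - w x) * \prod_(j <- r) w j by ring.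
apply: le_trans (nmD _ _) _; rewrite !nmM addrC; apply: lerD.
  rewrite ler_wpM2l ?nm_ge0 // ?big_cons eqxx /= nm_prod.
  rewrite [leRHS](_ : _ = \prod_(j <- r) m j); last first.
    rewrite big_seq_cond [RHS]big_seq; apply: eq_bigl => j; rewrite andbC.
    by case: (eqVneq j x) => [->|//]; rewrite (negbTE xr).
  by apply: ler_prod => j _; rewrite nm_ge0 hw.
apply: le_trans (ler_wpM2r (nm_ge0 _) (hu x)) _.
apply: le_trans (ler_wpM2l (m0 x) (IH ur)) _.
rewrite mulr_sumr [leLHS]big_seq [leRHS]big_seq; apply: ler_sum => i ir.
rewrite ?big_cons; have -> : x != i by apply: contraNneq xr => ->.
by rewrite mulrCA.
Qed.

Section FsetSums.
Variables (R : realType) (k N : nat).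
Local Notation C := R[i].
Local Notation e := (@e R).
Local Notation I := (zitv 1 N%:Z).
Implicit Types (al : 'I_k -> R) (A : {fset int}).

Definition fsum A al : C := esum (fun x : A => val x) al.

Lemma fset_nat A (x : A) : (A `<=` I)%fset -> (0 < `|val x| <= N)%N /\ val x = `|val x|%N%:Z.
Proof.
move=> /fsubsetP/(_ _ (valP x)); rewrite in_zitv; by case: (val x) => n //=; rewrite absz_nat.
Qed.

Lemma count_fset s (lam : 'I_s -> int) A M : (A `<=` I)%fset -> (0 < N)%N ->
  (lamsum lam * N ^ k < M)%N ->
  ((num_solutions lam k A)%:R : C) = Eav M (fun al => \prod_i fsum A (zscale (lam i) al)).
Proof.
move=> AI N0 hM; have M0 : (0 < M)%N by exact: leq_ltn_trans hM.
have := @Eav_prod R k s lam A (fun x => val x) (fun _ _ => 1) M M0.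
rewrite (@eq_Eav R k _ _ _ (fun al => \prod_i fsum A (zscale (lam i) al))) => [->|al]; last first.
  by apply: eq_bigr => i _; apply: eq_bigr => x _; rewrite mul1r.
rewrite /num_solutions -sum1_card natr_sum; apply: eq_big => [x|x _]; last by rewrite big1.
rewrite inE solutionE; apply: eq_forallb => j.
rewrite -[Lz lam _ j in RHS]subr0 (@Lz_dvd k s lam (fun i => val (x i)) 0 N) ?absz0 ?addn0 // => i.
by have [/andP[]] := fset_nat (x i) AI.
Qed.

(** [N + 1] because [Jn] counts from 0 while [A] may contain [N]. *)
Lemma moment_fset A t M lam : (A `<=` I)%fset -> lam != 0 -> (`|lam| * (t * N.+1 ^ k) < M)%N ->
  Eav M (fun al => nm (fsum A (zscale lam al)) ^+ (2 * t)) <= (Jn k t N.+1)%:R.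
Proof.
move=> AI lam0 hM.
apply: (@moment_le_Jn R k A (fun x => `|val x|%N)) => //.
- move=> x y xy; apply: val_inj; have [_ ->] := fset_nat x AI; have [_ ->] := fset_nat y AI.
  by rewrite xy.
- by move=> x; have [/andP[]] := fset_nat x AI.
- by move=> x; have [] := fset_nat x AI.
Qed.

Lemma card_zitv : #|` I| = N.
Proof.
have : perm_eq (enum_fset I) [seq i%:Z | i <- iota 1 N].
  apply: uniq_perm; rewrite ?fset_uniq ?map_inj_uniq ?iota_uniq //; first by move=> a b [].
  move=> x; rewrite in_zitv; apply/idP/mapP => [h|]; last by case=> i; rewrite mem_iota => h ->; move: h; lia.
  by exists `|x|%N; rewrite ?mem_iota; move: h; lia.
by move=> /perm_size; rewrite size_map size_iota.
Qed.

Lemma nm_fsum A al : nm (fsum A al) <= #|` A|%:R.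
Proof. by apply: le_trans (nm_esum _ _) _; rewrite cardfE. Qed.

Lemma fsum_balanced A al : (A `<=` I)%fset ->
  Tsum N (fun x => (balanced R N A x)%:C%C * e (phi al x)) =
  (density R N A)%:C%C * fsum I al - fsum A al.
Proof.
move=> AI; have -> : fsum A al = \sum_(x <- I) ((x \in A)%:R : C) * e (phi al x).
  rewrite /fsum /esum -(big_seq_fsetE _ A xpredT (fun x => e (phi al x))) /=.
  have -> : \sum_(x <- A) e (phi al x) = \sum_(x <- A) ((x \in A)%:R : C) * e (phi al x).
    by rewrite big_seq [RHS]big_seq; apply: eq_bigr => x ->; rewrite mul1r.
  symmetry; apply: sum_supp; rewrite ?fset_uniq //; first by move=> x xA; exact: (fsubsetP AI).
  by move=> x /negbTE ->; rewrite mul0r.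
rewrite /fsum /esum -(big_seq_fsetE _ I xpredT (fun x => e (phi al x))) /= mulr_sumr -sumrB /Tsum.
rewrite big_seq [RHS]big_seq; apply: eq_bigr => x xI; rewrite /balanced xI rmorphB mulrBl /=.
by rewrite rmorph_nat.
Qed.

Lemma parseval (J : finType) (pos : J -> int) (f : J -> R) M : (0 < k)%N -> (0 < M)%N ->
  (forall x y, (M%:Z %| pos x - pos y)%Z -> x = y) ->
  Eav M (fun al => nm (\sum_x (f x)%:C%C * e (phi al (pos x))) ^+ 2) = \sum_x f x ^+ 2.
Proof.
move=> k0 M0 inj; apply: (@complexI R); rewrite -EavC.
have cr (r : R) : (r%:C%C : C)^*%C = r%:C%C by apply/eqP; rewrite eq_complex /= oppr0 !eqxx.
transitivity (Eav M (fun al => \sum_(xy : J * J) (f xy.1 * f xy.2)%:C%C *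
   e (\sum_j al j * (pos xy.1 ^+ j.+1 - pos xy.2 ^+ j.+1)%:~R))).
  apply: eq_Eav => al; rewrite nm_sqr conjc_sum mulr_suml.
  under eq_bigr => x _ do rewrite mulr_sumr.
  rewrite pair_bigA; apply: eq_bigr => -[x y] _; rewrite [fst _]/= [snd _]/=.
  have -> : ((f y)%:C%C * e (phi al (pos y)))^*%C = (f y)%:C%C * e (- phi al (pos y)) :> C by rewrite conjcM cr eN.
  have -> : (f x * f y)%:C%C = (f x)%:C%C * (f y)%:C%C :> C by rewrite rmorphM.
  have -> : \sum_j al j * (pos x ^+ j.+1 - pos y ^+ j.+1)%:~R = phi al (pos x) - phi al (pos y).
    by rewrite /phi -sumrB; apply: eq_bigr => j _; rewrite rmorphB !rmorphXn mulrBr.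
  by rewrite eD; ring.
rewrite Eav_count // rmorph_sum.
rewrite (eq_bigl (fun xy : J * J => xy.2 == xy.1)) => [|[x y] /=]; last first.
  apply/forallP/eqP => [h|-> j]; last by rewrite subrr dvdz0.
  by apply/esym/inj; have := h (Ordinal k0); rewrite !expr1.
rewrite -(pair_big_dep xpredT (fun x y => y == x) (fun x y => (f x * f y)%:C%C)) /=.
by apply: eq_bigr => x _; rewrite big_pred1_eq expr2.
Qed.

End FsetSums.

(** Each exchange of [A] for [delta] times the interval involves one small difference, [2t] factors
    handled by the sharp mean value, and [s - 1 - 2t] factors of size at most [delta N]. *)
Lemma uniform_count (R : realType) k s (lam : 'I_s -> int) t (Cj c0 : R) N1 :
  (forall i, lam i != 0) -> (0 < t)%N -> (2 * t < s)%N -> (kap k <= 2 * t)%N ->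
  0 < Cj -> 0 < c0 ->
  (forall N, (0 < N)%N -> (Jn k t N)%:R <= Cj * N%:R ^+ (2 * t - kap k)) ->
  (forall N, (N1 <= N)%N -> c0 * N%:R ^+ (s - kap k) <= (num_solutions lam k (zitv 1 N%:Z))%:R) ->
  exists2 ka : R, 0 < ka <= 4^-1 & forall N (A : {fset int}), (N1 <= N)%N -> (0 < N)%N ->
    (A `<=` zitv 1 N%:Z)%fset -> A != fset0 ->
    (forall al : 'I_k -> R, nm (Tsum N (fun x => (balanced R N A x)%:C%C * e (phi al x))) <=
       2 * ka * density R N A ^+ (2 * t + 2) * N%:R) ->
    c0 / 2 * density R N A ^+ s * N%:R ^+ (s - kap k) <= (num_solutions lam k A)%:R.
Proof.
move=> lam0 t0 ts Kt Cj0 c00 hJ hlow; set K := kap k in Kt *.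
have s0 : (0 < s)%N by exact: leq_ltn_trans ts.
have Ks : (K <= s)%N by move: Kt ts; clear; lia.
(* Collects the constants of the error, so that [ka c1 <= c0] makes it at most half of the main
   term. *)
pose c1 : R := 8 * (s * s)%:R * Cj * 2 ^+ (2 * t - K).
have c10 : 0 < c1 by rewrite !mulr_gt0 ?exprn_gt0 // ltr0n muln_gt0 s0.
exists (Num.min 4^-1 (c0 / c1)); first by rewrite lt_min invr_gt0 ltr0n divr_gt0 // ge_min lexx.
set ka := Num.min _ _; have ka0 : 0 < ka by rewrite lt_min invr_gt0 ltr0n divr_gt0.
have kac : ka * c1 <= c0 by rewrite -ler_pdivlMr // ge_min lexx orbT.
move=> N A hN1 N0 AI A0 hE; set de := density R N A in hE *.
have Nr : 0 < N%:R :> R by rewrite ltr0n.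
have cA : #|` A|%:R = de * N%:R by rewrite /de /density divfK // gt_eqF.
have cA0 : (0 < #|` A|)%N by rewrite cardfs_gt0.
have de0 : 0 < de by rewrite divr_gt0 // ltr0n.
have de1 : de <= 1.
  rewrite ler_pdivrMr // mul1r ler_nat; have := fsubset_leq_card AI.
  by rewrite card_zitv.
have [dN dNE] : exists x : R, x = de * N%:R by exists (de * N%:R).
have dN0 : 0 < dN by rewrite dNE mulr_gt0.
pose M := (lamsum lam * (t * N.+1 ^ k + N ^ k)).+1.
have M0 : (0 < M)%N by [].
have ll i : (`|lam i| <= lamsum lam)%N by rewrite /lamsum (bigD1 i) //= leq_addr.
have hM1 : (lamsum lam * N ^ k < M)%N by rewrite ltnS leq_mul2l leq_addl orbT.
have hM2 i : (`|lam i| * (t * N.+1 ^ k) < M)%N.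
  by rewrite ltnS; apply: leq_mul => //; rewrite leq_addr.
pose I := zitv 1 N%:Z.
pose u (al : 'I_k -> R) (i : 'I_s) := fsum A (zscale (lam i) al) : R[i].
pose w (al : 'I_k -> R) (i : 'I_s) := de%:C%C * fsum I (zscale (lam i) al) : R[i].
pose m (al : 'I_k -> R) (i : 'I_s) := Num.max (nm (u al i)) (nm (w al i)).
have hu al i : nm (u al i) <= m al i by rewrite le_max lexx.
have hw al i : nm (w al i) <= m al i by rewrite le_max lexx orbT.
have nde : nm de%:C%C = de by rewrite nmC ger0_norm // ltW.
have m1 al i : 0 <= m al i / dN <= 1.
  apply/andP; split.
    by rewrite divr_ge0 ?(ltW dN0) //; apply: le_trans (nm_ge0 _) (hu al i).
  rewrite ler_pdivrMr // mul1r ge_max; apply/andP; split.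
    by apply: le_trans (nm_fsum _ _) _; rewrite cA dNE.
  by rewrite nmM nde dNE ler_pM2l //; apply: le_trans (nm_fsum _ _) _; rewrite card_zitv.
have uw al i : nm (u al i - w al i) <= 2 * ka * de ^+ (2 * t + 2) * N%:R.
  by apply: le_trans (hE (zscale (lam i) al)); rewrite fsum_balanced // nmB.
have [D DE] : exists x : R, x = 2 * ka * de ^+ (2 * t + 2) * N%:R by eexists.
rewrite -DE in uw.
have D0 : 0 <= D by rewrite DE !mulr_ge0 ?exprn_ge0 ?(ltW ka0) ?(ltW de0).
pose J : R := (Jn k t N.+1)%:R.
have ptw al : nm (\prod_i u al i - \prod_i w al i) <=
    s%:R * D * dN ^+ s.-1 / dN ^+ (2 * t) * \sum_j (nm (u al j) ^+ (2 * t) + nm (w al j) ^+ (2 * t)).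
  apply: le_trans (prod_diff_le (hu al) (hw al)) _.
  apply: (@le_trans _ _ (\sum_(i < s) D * (dN ^+ s.-1 * \sum_j (m al j / dN) ^+ (2 * t)))).
    apply: ler_sum => i _; apply: ler_pM; rewrite ?nm_ge0 //.
      by apply: prodr_ge0 => j _; apply: le_trans (nm_ge0 _) (hu al j).
    have -> : \prod_(j | j != i) m al j = dN ^+ s.-1 * \prod_(j | j != i) (m al j / dN).
      have -> : dN ^+ s.-1 = \prod_(j < s | j != i) dN by rewrite prodr_const cardC1 card_ord.
      rewrite -big_split /=; apply: eq_bigr => j _; by rewrite mulrC divfK // gt_eqF.
    rewrite ler_wpM2l ?exprn_ge0 ?(ltW dN0) //; apply: prod_but_le; first exact: m1.
    by rewrite muln_gt0 t0.
  rewrite sumr_const card_ord -[leLHS]mulr_natl -!mulrA ler_wpM2l // ler_wpM2l // ler_wpM2l ?exprn_ge0 ?(ltW dN0) //.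
  rewrite mulr_sumr; apply: ler_sum => j _; rewrite expr_div_n mulrC.
  rewrite ler_wpM2l ?invr_ge0 ?exprn_ge0 ?(ltW dN0) // /m.
  by case: (leP (nm (u al j)) (nm (w al j))) => _; rewrite ?lerDl ?lerDr exprn_ge0 ?nm_ge0.
have mom : Eav M (fun al => \sum_j (nm (u al j) ^+ (2 * t) + nm (w al j) ^+ (2 * t))) <= s%:R * (2 * J).
  rewrite Eav_sum -[s in s%:R]card_ord mulr_natl -sumr_const; apply: ler_sum => j _.
  have -> : Eav M (fun al => nm (u al j) ^+ (2 * t) + nm (w al j) ^+ (2 * t)) =
    Eav M (fun al => nm (u al j) ^+ (2 * t)) + Eav M (fun al => nm (w al j) ^+ (2 * t)).
    by rewrite /Eav big_split mulrDl.
  rewrite mulr2n mulrDl mul1r; apply: lerD; first exact: moment_fset.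
  rewrite (@eq_Eav R k _ _ _ (fun al => de ^+ (2 * t) * nm (fsum I (zscale (lam j) al)) ^+ (2 * t))).
    rewrite EavZ; apply: (@le_trans _ _ (1 * J)); last by rewrite mul1r.
    apply: ler_pM; rewrite ?exprn_ge0 ?(ltW de0) //.
    - rewrite /Eav divr_ge0 // sumr_ge0 // => a _; by rewrite exprn_ge0 ?nm_ge0.
    - by rewrite exprn_ile1 ?(ltW de0).
    by apply: moment_fset => //; exact: fsubset_refl.
  by move=> al; rewrite /w nmM nde exprMn.
have diff : nm ((num_solutions lam k A)%:R - de%:C%C ^+ s * (num_solutions lam k I)%:R) <=
   s%:R * D * dN ^+ s.-1 / dN ^+ (2 * t) * (s%:R * (2 * J)).
  have -> : ((num_solutions lam k A)%:R - de%:C%C ^+ s * (num_solutions lam k I)%:R : R[i]) =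
     Eav M (fun al => \prod_i u al i - \prod_i w al i).
    rewrite EavB (count_fset R AI N0 hM1) (count_fset R (fsubset_refl I) N0 hM1); congr (_ - _).
    rewrite -EavZ; apply: eq_Eav => al; rewrite /w big_split /=; congr (_ * _).
    by rewrite prodr_const card_ord.
  apply: le_trans (nm_Eav _ _) _; apply: le_trans (ler_Eav M ptw) _.
  rewrite EavZ; apply: ler_wpM2l => //.
  by rewrite divr_ge0 ?exprn_ge0 ?(ltW dN0) // mulr_ge0 ?exprn_ge0 ?(ltW dN0) // mulr_ge0.
have JN : J <= Cj * 2 ^+ (2 * t - K) * N%:R ^+ (2 * t - K).
  apply: le_trans (hJ N.+1 isT) _; rewrite -mulrA -exprMn ler_pM2l // lerXn2r ?nnegrE ?mulr_ge0 //.
  by rewrite -natrM ler_nat mul2n -addnn -addn1 leq_add2l.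
have errb : s%:R * D * dN ^+ s.-1 / dN ^+ (2 * t) * (s%:R * (2 * J)) <=
    c0 / 2 * de ^+ s * N%:R ^+ (s - K).
  have s1 : dN ^+ s.-1 / dN ^+ (2 * t) = dN ^+ (s.-1 - 2 * t).
    have tl : (2 * t <= s.-1)%N by rewrite -ltnS prednK.
    by rewrite -{1}(subnK tl) exprD mulfK // expf_neq0 // gt_eqF.
  have -> : s%:R * D * dN ^+ s.-1 / dN ^+ (2 * t) * (s%:R * (2 * J)) =
     2 * (s * s)%:R * D * dN ^+ (s.-1 - 2 * t) * J by rewrite -s1 natrM; ring.
  have pos0 : 0 <= 2 * (s * s)%:R * D * dN ^+ (s.-1 - 2 * t).
    by rewrite mulr_ge0 ?exprn_ge0 ?(ltW dN0) // mulr_ge0.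
  apply: le_trans (ler_wpM2l pos0 JN) _.
  have sE : (s = (2 * t + 2) + (s.-1 - 2 * t) - 1)%N by move: ts s0; clear; lia.
  have eN : N%:R * N%:R ^+ (s.-1 - 2 * t) * N%:R ^+ (2 * t - K) = N%:R ^+ (s - K) :> R.
    rewrite -exprS -exprD; congr (_ ^+ _); move: ts s0 Kt; clear; lia.
  (* The powers of [delta] combine to [delta^(s+1)], at most [delta^s]. *)
  have ed : de ^+ (2 * t + 2) * de ^+ (s.-1 - 2 * t) = de ^+ s * de.
    rewrite -exprD -exprSr; congr (_ ^+ _); move: ts s0; clear; lia.
  have -> : 2 * (s * s)%:R * D * dN ^+ (s.-1 - 2 * t) * (Cj * 2 ^+ (2 * t - K) * N%:R ^+ (2 * t - K)) =
    (ka * c1) / 2 * (de ^+ (2 * t + 2) * de ^+ (s.-1 - 2 * t)) *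
    (N%:R * N%:R ^+ (s.-1 - 2 * t) * N%:R ^+ (2 * t - K)).
    have -> : dN ^+ (s.-1 - 2 * t) = de ^+ (s.-1 - 2 * t) * N%:R ^+ (s.-1 - 2 * t) by rewrite dNE exprMn.
    rewrite DE /c1 natrM; move: (2 ^+ (2 * t - K)) (de ^+ (2 * t + 2)) (de ^+ (s.-1 - 2 * t)).
    by move: (N%:R ^+ (s.-1 - 2 * t) : R) (N%:R ^+ (2 * t - K) : R) => *; field.
  rewrite eN ed ler_wpM2r ?exprn_ge0 // mulrA; apply: (@le_trans _ _ (c0 / 2 * de ^+ s * 1)); last by rewrite mulr1.
  apply: ler_pM; rewrite ?mulr_ge0 ?exprn_ge0 ?invr_ge0 ?(ltW de0) ?(ltW ka0) ?(ltW c10) ?(ltW Cj0) //.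
  by rewrite ler_wpM2r ?exprn_ge0 ?(ltW de0) // ler_pM2r ?invr_gt0.
have dE : (num_solutions lam k A)%:R - de%:C%C ^+ s * (num_solutions lam k I)%:R =
   ((num_solutions lam k A)%:R - de ^+ s * (num_solutions lam k I)%:R)%:C%C :> R[i].
  have cM (x y : R) : (x * y)%:C%C = x%:C%C * y%:C%C :> R[i] by rewrite rmorphM.
  have cX : (de ^+ s)%:C%C = de%:C%C ^+ s :> R[i] by rewrite rmorphXn.
  have cn n : (n%:R : R)%:C%C = n%:R :> R[i] by rewrite rmorph_nat.
  have cB (x y : R) : (x - y)%:C%C = x%:C%C - y%:C%C :> R[i] by rewrite rmorphB.
  by rewrite cB (cM (de ^+ s)) cX !cn.
have := le_trans diff errb; rewrite dE nmC => h1.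
have h2 := ler_wpM2l (exprn_ge0 s (ltW de0)) (hlow N hN1); rewrite -/I in h2.
have := ler_norm (- ((num_solutions lam k A)%:R - de ^+ s * (num_solutions lam k I)%:R : R)).
rewrite normrN => h3; have := le_trans h3 h1; move: h2; rewrite -/K.
have -> : c0 / 2 * de ^+ s * N%:R ^+ (s - K) = de ^+ s * (c0 * N%:R ^+ (s - K)) / 2 by field.
lra.
Qed.

(** Being even, [s0 k] can be the order of a moment. From [ln k >= 1/2] and [ln (ln k) >= -1] the
    integer part is at least [-2k]; the term [10 k^2] dominates, and [t] exceeds [kap k]. *)
Lemma s0_double (R : realType) k : (2 <= k)%N ->
  exists2 t : nat, s0 R k = (2 * t)%N%:Z & (3 * k ^ 2 + 3 <= t)%N.
Proof.
move=> k2; rewrite /s0; set y := k%:R * _; set f := Num.floor y.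
have kr : 2 <= k%:R :> R by rewrite (ler_nat R 2).
have ln2_ge : 2^-1 <= ln (2 : R).
  have := @le_ln1Dx R (- 2^-1) (_ : -1 < - 2^-1); rewrite (_ : 1 + - 2^-1 = 2^-1 :> R); last by field.
  by rewrite lnV ?posrE // => h; have := h ltac:(lra); lra.
have ln2_le : ln (2 : R) <= 1 by have := @le_ln1Dx R 1 ltac:(lra).
have lnk : 2^-1 <= ln (k%:R : R) by apply: le_trans ln2_ge _; rewrite ler_ln ?posrE //; lra.
have lnlnk : -1 <= ln (ln (k%:R : R)).
  apply: (@le_trans _ _ (ln (2^-1 : R))); first by rewrite lnV ?posrE //; lra.
  by rewrite ler_ln ?posrE //; lra.
have f_ge : - (2 * k)%N%:Z <= f.
  rewrite floor_ge_int rmorphN /= -pmulrn natrM /y.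
  have : 0 <= k%:R * (ln k%:R + 2 * ln (ln k%:R) + 2) :> R by apply: mulr_ge0 => //; lra.
  by rewrite mulrDr; lra.
have kf : - (2 * k ^ 2)%N%:Z <= k%:Z * f.
  have := ler_wpM2l (_ : 0 <= k%:Z) f_ge; rewrite mulrN -PoszM => h.
  by apply: le_trans (h isT); rewrite lerN2 lez_nat expnS expn1; lia.
exists `|(k%:Z * f + (5 * k ^ 2 + 3)%N%:Z)%R|%N; last by move: kf; move: (k ^ 2)%N (k%:Z * f) => *; lia.
have -> : (2 * k)%N%:Z * f = 2 * (k%:Z * f) by rewrite PoszM mulrA.
by move: kf; move: (k ^ 2)%N (k%:Z * f) => *; lia.
Qed.

Lemma num_solutions_zitv s (lam : 'I_s -> int) k N : \sum_i lam i = 0 ->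
  (#|[set x : {ffun 'I_s -> 'I_N} | solution lam k (fun i => npos (x i))]| <=
   num_solutions lam k (zitv 1 N%:Z))%N.
Proof.
move=> lamS.
have mem (i : 'I_N) : 1 + npos i \in zitv 1 N%:Z.
  by rewrite in_zitv /npos; have := ltn_ord i; lia.
pose g (x : {ffun 'I_s -> 'I_N}) : {ffun 'I_s -> zitv 1 N%:Z} := [ffun i => FSetSub (mem (x i))].
rewrite -(@card_imset _ _ g) => [|x y /ffunP xy]; last first.
  apply/ffunP => i; apply: val_inj; have := congr1 val (xy i); rewrite !ffunE /= /npos => /addrI.
  by case.
apply/subset_leq_card/fintype.subsetP => _ /imsetP[x + ->]; rewrite !inE => hx.
rewrite (_ : (fun i => _) = fun i => 1 + 1 * npos (x i)); first exact: solution_affine.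
by apply/funext => i; rewrite ffunE /= mul1r.
Qed.

(** As no [lam i] vanishes, every class has at least two elements; so at most [s / 2] values occur,
    and they determine the solution together with the map from indices to values. *)
Lemma card_trivial_solutions s (lam : 'I_s -> int) (A : {fset int}) :
  (forall i, lam i != 0) -> (0 < s)%N ->
  (#|[set x : {ffun 'I_s -> A} | `[< trivial_solution lam (fun i => val (x i)) >]]| <=
   s./2 ^ s * #|` A| ^ s./2)%N.
Proof.
move=> lam0 s_gt0; set h := s./2.
pose G (p : {ffun 'I_s -> 'I_h} * {ffun 'I_h -> A}) : {ffun 'I_s -> A} := [ffun i => p.2 (p.1 i)].
set T := [set x | _]; have sub : T \subset [set G p | p in [set: {ffun 'I_s -> 'I_h} * {ffun 'I_h -> A}]].
  apply/fintype.subsetP => x; rewrite inE => /asboolP[P pP hP]; pose i0 := Ordinal s_gt0.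
  have cP : (#|P| <= h)%N.
    have := card_partition pP; rewrite cardsT card_ord => sE.
    rewrite /h geq_half_double [X in (_ <= X)%N]sE -muln2 -sum_nat_const; apply: leq_sum => B BP.
    have /set0Pn[i iB] : B != finset.set0.
      by have /and3P[_ _ nP] := pP; apply: contraNneq nP => <-.
    rewrite ltnNge; apply/negP => B1; have BE : B = [set i]%SET.
      by apply/esym/eqP; rewrite eqEcard cards1 B1 finset.sub1set iB.
    by have [/eqP] := hP _ BP; rewrite BE big_set1 (negbTE (lam0 i)).
  pose im := [set x i | i in [set: 'I_s]]%SET.
  have cim : (#|im| <= h)%N.
    apply: leq_trans cP.
    apply: (@leq_trans #|[set x (odflt i0 [pick i in B]) | B : {set 'I_s} in P]%SET|); last exact: leq_imset_card.
    apply/subset_leq_card/fintype.subsetP => a /imsetP[i _ ->].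
    have iP : i \in finset.cover P by rewrite (finset.cover_partition pP) inE.
    apply/imsetP; exists (finset.pblock P i); first exact: finset.pblock_mem.
    have iB : i \in finset.pblock P i by rewrite finset.mem_pblock.
    case: pickP => [j jB|/(_ i)]; last by rewrite iB.
    by apply: val_inj; have [_ /=] := hP _ (finset.pblock_mem iP); apply.
  have ix i : (index (x i) (enum im) < h)%N.
    by apply: leq_trans cim; rewrite cardE index_mem mem_enum imset_f.
  apply/imsetP; exists ([ffun i => Ordinal (ix i)], [ffun j : 'I_h => nth (x i0) (enum im) j]); rewrite ?inE //.
  by apply/ffunP => i; rewrite !ffunE /= nth_index // mem_enum imset_f.
apply: leq_trans (subset_leq_card sub) _; apply: leq_trans (leq_imset_card _ _) _.
by rewrite cardsT card_prod !card_ffun !card_ord -cardfE.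
Qed.

Lemma exists_nontrivial s (lam : 'I_s -> int) k (A : {fset int}) :
  (forall i, lam i != 0) -> (0 < s)%N ->
  (s./2 ^ s * #|` A| ^ s./2 < num_solutions lam k A)%N ->
  exists x : 'I_s -> int, [/\ forall i, x i \in A, solution lam k x & ~ trivial_solution lam x].
Proof.
move=> lam0 s_gt0 hlt; apply: contrapT => hno; move: hlt; rewrite ltnNge => /negP; apply.
apply: leq_trans (card_trivial_solutions A lam0 s_gt0); apply/subset_leq_card/fintype.subsetP => x.
rewrite !inE => hx; apply: contrapT => hx'; apply: hno.
exists (fun i => val (x i)); split => // i; exact: fsvalP.
Qed.

(* Parseval bounds the mean square of the exponential sum of the balanced
   function from below, so that a sparse set cannot be very uniform. *)
Lemma density_large (R : realType) k N (A : {fset int}) t (ka : R) :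
  (0 < k)%N -> (16 <= N)%N -> (A `<=` zitv 1 N%:Z)%fset -> A != fset0 -> (0 < t)%N ->
  0 < ka <= 4^-1 ->
  (forall al : 'I_k -> R, nm (Tsum N (fun x => (balanced R N A x)%:C%C * e (phi al x))) <=
     2 * ka * density R N A ^+ (2 * t + 2) * N%:R) ->
  1 <= density R N A ^+ 4 * N%:R.
Proof.
move=> k0 N16 AI A0 t0 /andP[ka0 ka4] hE; set de := density R N A in hE *.
have N0 : (0 < N)%N by exact: leq_trans N16.
have Nr : 16 <= N%:R :> R by rewrite (ler_nat R 16).
have Nr0 : 0 < N%:R :> R by rewrite ltr0n.
have cA : #|` A|%:R = de * N%:R by rewrite /de /density divfK // gt_eqF.
have de0 : 0 < de by rewrite divr_gt0 // ltr0n cardfs_gt0.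
have de1 : de <= 1.
  by rewrite ler_pdivrMr // mul1r ler_nat; have := fsubset_leq_card AI; rewrite card_zitv.
(* Density above 1/2 is settled by [16 <= N], since [(1/2)^4] times 16 is 1. *)
case: (lerP de 2^-1) => hde; last first.
  have : (2^-1) ^+ 4 <= de ^+ 4 by rewrite lerXn2r ?nnegrE ?invr_ge0 ?(ltW de0) // ltW.
  rewrite exprVn => h; apply: le_trans (ler_pM _ _ h Nr) => //.
  by rewrite -ler_pdivrMl ?invr_gt0 ?exprn_gt0 // invrK; lra.
have pars := @parseval R k (zitv 1 N%:Z) (fun x => val x) (fun x => balanced R N A (val x)) N.+1 k0 isT.
have /pars {}pars : forall x y : zitv 1 N%:Z, (N.+1%:Z %| val x - val y)%Z -> x = y.
  move=> x y /dvdzP[c hc]; apply: val_inj; move: (valP x) (valP y) hc; rewrite !in_zitv.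
  move: (val x) (val y) => {}x {}y hx hy hc; have [c0|c0|c0] := ltgtP c 0; last by move: hc; rewrite c0; lia.
    have : c * N.+1%:Z <= -1 * N.+1%:Z by rewrite ler_pM2r //; lia.
    by lia.
  have : 1 * N.+1%:Z <= c * N.+1%:Z by rewrite ler_pM2r //; lia.
  by lia.
have up : \sum_(x : zitv 1 N%:Z) balanced R N A (val x) ^+ 2 <= (2 * ka * de ^+ (2 * t + 2) * N%:R) ^+ 2.
  rewrite -pars; apply: (@le_trans _ _ (Eav (k := k) N.+1 (fun _ => (2 * ka * de ^+ (2 * t + 2) * N%:R) ^+ 2))).
    apply: ler_Eav => al; rewrite lerXn2r ?nnegrE ?nm_ge0 //.
      by rewrite !mulr_ge0 ?exprn_ge0 ?(ltW ka0) ?(ltW de0).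
    apply: le_trans (hE al); rewrite /Tsum.
    by rewrite (big_seq_fsetE _ (zitv 1 N%:Z) xpredT (fun x => (balanced R N A x)%:C%C * e (phi al x))).
  rewrite /Eav sumr_const card_ffun !card_ord -[_ *+ (N.+1 ^ k)]mulr_natr mulfK // pnatr_eq0 expn_eq0.
(* On [A] the balanced function is now at most [-1/2], so each element contributes at least 1/4. *)
have low : de * N%:R / 4 <= \sum_(x : zitv 1 N%:Z) balanced R N A (val x) ^+ 2.
  rewrite -(big_seq_fsetE _ (zitv 1 N%:Z) xpredT (fun x => balanced R N A x ^+ 2)) /=.
  apply: (@le_trans _ _ (\sum_(x <- zitv 1 N%:Z) (x \in A)%:R / 4)).
    rewrite (@sum_supp _ _ A) ?fset_uniq //; first last.
    - by move=> y /negbTE ->; rewrite mul0r.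
    - by move=> y yA; exact: (fsubsetP AI).
    rewrite big_seq (eq_bigr (fun=> 4^-1)) => [|x ->]; last by rewrite mul1r.
    by rewrite -big_seq big_const_seq count_predT iter_addr_0 -cA -[leRHS]mulr_natl.
  rewrite big_seq [leRHS]big_seq; apply: ler_sum => x xI; rewrite /balanced xI -/de.
  case: (x \in A); last by rewrite mul0r sqr_ge0.
  by rewrite /= mulr1n; nra.
have := le_trans low up => h.
have h1 : (2 * ka * de ^+ (2 * t + 2) * N%:R) ^+ 2 <= 4^-1 * (de ^+ 5 * N%:R ^+ 2).
  have -> : (2 * ka * de ^+ (2 * t + 2) * N%:R) ^+ 2 = (2 * ka) ^+ 2 * (de ^+ ((2 * t + 2) * 2) * N%:R ^+ 2).
    by rewrite exprM; move: (de ^+ _) => z; ring.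
  apply: ler_pM; rewrite ?mulr_ge0 ?exprn_ge0 ?mulr_ge0 ?(ltW de0) ?(ltW ka0) //.
    by move: ka0 ka4; clear; nra.
  by rewrite ler_wpM2r ?exprn_ge0 //; apply: ler_wiXn2l; rewrite ?(ltW de0) //; move: t0; clear; lia.
have := le_trans h h1.
have -> : 4^-1 * (de ^+ 5 * N%:R ^+ 2) = (de ^+ 4 * N%:R) * (de * N%:R / 4) by field.
have p : 0 < de * N%:R / 4 by rewrite divr_gt0 // mulr_gt0.
by rewrite -{1}[de * N%:R / 4]mul1r ler_pM2r.
Qed.

(** The main term exceeds [(delta N)^(s/2)] by the factor [Z = delta^u N^(u - K)], up to a constant.
    Its fourth power is [(delta^4 N)^u N^(3u - 4K)], at least [N], which outgrows any constant. *)
Lemma many_solutions_nontrivial (R : realType) s K (c : R) : (4 * K < 3 * (s - s./2))%N -> 0 < c ->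
  exists N0 : nat, forall N a (de : R), (N0 <= N)%N -> 0 <= de -> a%:R = de * N%:R ->
    1 <= de ^+ 4 * N%:R -> (s./2 ^ s * a ^ s./2)%N%:R < c * de ^+ s * N%:R ^+ (s - K) :> R.
Proof.
move=> hK c0; set h := s./2; set u := (s - h)%N in hK.
have hs : (h <= s)%N by rewrite /h; lia.
pose B : R := ((h ^ s)%:R / c) ^+ 4; have B0 : 0 <= B by rewrite exprn_ge0 // divr_ge0 // ltW.
have [n /andP[_ hn]] := nat_floor B0.
exists n.+1 => N a de nN de0 aE hd.
have NB : B < N%:R by apply: lt_le_trans hn _; rewrite natr1 ler_nat.
have N0 : (0 < N)%N by exact: leq_trans nN.
have Nr0 : 0 < N%:R :> R by rewrite ltr0n.
have de_gt0 : 0 < de.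
  rewrite lt_neqAle de0 andbT; apply/eqP => d0; move: hd; rewrite -d0 expr0n mul0r.
  by rewrite ler10.
pose Z := de ^+ u * N%:R ^+ (u - K).
have Z0 : 0 <= Z by rewrite mulr_ge0 ?exprn_ge0.
have Z4 : N%:R <= Z ^+ 4.
  have -> : Z ^+ 4 = (de ^+ 4 * N%:R) ^+ u * N%:R ^+ (3 * u - 4 * K).
    have -> : Z ^+ 4 = de ^+ (u * 4) * N%:R ^+ ((u - K) * 4) by rewrite /Z exprMn -!exprM.
    have -> : (de ^+ 4 * N%:R) ^+ u = de ^+ (u * 4) * N%:R ^+ u by rewrite exprMn -exprM mulnC.
    rewrite -mulrA -exprD; congr (_ * _ ^+ _).
    by move: hK; clear; lia.
  rewrite -[leLHS]mul1r; apply: ler_pM => //; first exact: exprn_ege1.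
  by rewrite -[leLHS]expr1; apply: ler_weXn2l; rewrite ?ler1n // subn_gt0.
have hZ : (h ^ s)%:R / c < Z.
  by rewrite -(@ltr_pXn2r _ 4) ?nnegrE ?divr_ge0 ?(ltW c0) //; exact: lt_le_trans NB Z4.
have -> : c * de ^+ s * N%:R ^+ (s - K) = (c * Z) * (de * N%:R) ^+ h.
  have -> : de ^+ s = de ^+ u * de ^+ h by rewrite -exprD subnK.
  have -> : N%:R ^+ (s - K) = N%:R ^+ (u - K) * N%:R ^+ h :> R.
    by rewrite -exprD; congr (_ ^+ _); rewrite /u; move: hK hs; rewrite /u; clear; lia.
  by rewrite exprMn /Z; ring.
rewrite natrM [(a ^ h)%:R]natrX aE ltr_pM2r ?exprn_gt0 ?mulr_gt0 //.
by rewrite mulrC -ltr_pdivrMr.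
Qed.

Lemma solutions_in_uniform_sets (R : realType) k s (lam : 'I_s -> int) :
  (forall i, lam i != 0) -> \sum_i lam i = 0 -> (2 <= k)%N -> s0 R k < s%:Z ->
  has_nonsingular_solution R lam k ->
  (forall p, prime p -> has_nonsingular_solution (Qp p) lam k) ->
  exists2 K : R, 0 < K & exists N0 : nat, exists c : R, 0 < c /\
  forall (N : nat) (A : {fset int}) (a : R), (N0 <= N)%N -> (A `<=` zitv 1 N%:Z)%fset ->
    A != fset0 -> uniform_of_degree N A a k ->
    a <= K * density R N A ^ ((2 ^ k.+1)%N%:Z * (s0 R k + 2)) ->
    (exists x : 'I_s -> int,
       [/\ forall i, x i \in A, solution lam k x & ~ trivial_solution lam x]) /\
    c * density R N A ^+ s * N%:R ^ (s%:Z - ((k * k.+1)./2)%:Z) <= (num_solutions lam k A)%:R.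
Proof.
move=> lam0 lamS k2; have [t -> ht] := s0_double R k2; rewrite ltz_nat => ts hR hp.
have k0 : (0 < k)%N by exact: leq_trans k2.
have K2 := kap2 k; have kk : (k ^ 2 = k * k)%N by rewrite expnS expn1.
have Kt : (kap k < t)%N by move: ht K2; rewrite kk; clear; nia.
have t0 : (0 < t)%N by exact: leq_ltn_trans Kt.
have s_gt0 : (0 < s)%N by exact: leq_ltn_trans ts.
have [c0 c0_gt0 [N1 hlow]] := @solutions_lower_bound R k s lam t k0 lam0 lamS Kt ts hR hp.
have [Cj Cj0 hJ] := @sharp_mean R k k0 t Kt.
have hlow' N : (N1 <= N)%N -> c0 * N%:R ^+ (s - kap k) <= (num_solutions lam k (zitv 1 N%:Z))%:R.
  by move=> /hlow h; apply: le_trans h _; rewrite ler_nat num_solutions_zitv.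
have [|ka /andP[ka0 ka4] hka] := @uniform_count R k s lam t Cj c0 N1 lam0 t0 ts _ Cj0 c0_gt0 hJ hlow'.
  by move: Kt; clear; lia.
have [|N2 hN2] := @many_solutions_nontrivial R s (kap k) (c0 / 2) _ (divr_gt0 c0_gt0 (ltr0Sn R 1)).
  by move: ht ts K2; rewrite kk; clear; nia.
(* The [2^(k+1)]-th root of the hypothesis on [a] is then the bound asked by [uniform_count]. *)
exists (ka ^+ (2 ^ k.+1)); first by rewrite exprn_gt0.
exists (maxn N1 (maxn N2 16)), (c0 / 2); split; first by rewrite divr_gt0.
move=> N A a; rewrite !geq_max => /and3P[hN1 hN2' N16] AI A0 hu ha.
have N0 : (0 < N)%N by exact: leq_trans N16.
have Nr0 : 0 < N%:R :> R by rewrite ltr0n.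
have hE (al : 'I_k -> R) : nm (Tsum N (fun x => (balanced R N A x)%:C%C * e (phi al x))) <=
    2 * ka * density R N A ^+ (2 * t + 2) * N%:R.
  set D := density R N A in ha *; have D0 : 0 <= D by rewrite divr_ge0.
  have p0 : (0 < 2 ^ k.+1)%N by rewrite expn_gt0.
  rewrite -(@ler_pXn2r _ (2 ^ k.+1)) ?nnegrE ?nm_ge0 //; last first.
    by rewrite mulr_ge0 ?(ltW Nr0) // mulr_ge0 ?exprn_ge0 // mulr_ge0 ?(ltW ka0).
  apply: le_trans (uniform_phase al N0 hu) _.
  apply: (@le_trans _ _ (ka ^+ (2 ^ k.+1) * D ^+ (2 ^ k.+1 * (2 * t + 2)) * (2 * N)%:R ^+ (2 ^ k.+1))).
    by rewrite ler_wpM2r ?exprn_ge0 // exprnP PoszM PoszD.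
  rewrite [(2 ^ k.+1 * _)%N]mulnC exprM -!exprMn natrM le_eqVlt; apply/orP; left; apply/eqP.
  by congr (_ ^+ _); ring.
have hnum := hka N A hN1 N0 AI A0 hE.
have hd := density_large k0 N16 AI A0 t0 (introT andP (conj ka0 ka4)) hE.
have hs : (kap k <= s)%N by move: Kt ts; clear; lia.
split; last by rewrite -/(kap k) subzn.
apply: (exists_nontrivial lam0 s_gt0); rewrite -(ltr_nat R).
apply: lt_le_trans hnum; apply: hN2 => //; first by rewrite divr_ge0.
by rewrite /density divfK // gt_eqF.
Qed.

(** Lets [K] and [N0] be chosen before [k] when finitely many degrees are concerned. *)
Lemma uniform_choice (R : realType) (P : nat -> R -> nat -> Prop) n :
  (forall k K K' N N', 0 < K' -> K' <= K -> (N <= N')%N -> P k K N -> P k K' N') ->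
  (forall k, exists2 K, 0 < K & exists N, P k K N) ->
  exists2 K, 0 < K & exists N, forall k, (k < n)%N -> P k K N.
Proof.
move=> mono hP; elim: n => [|n [K K0 [N hN]]]; first by exists 1; rewrite ?ltr01 //; exists 0%N.
have [K1 K10 [N1 hN1]] := hP n.
have m0 : 0 < Num.min K K1 by rewrite lt_min K0.
exists (Num.min K K1) => //; exists (maxn N N1) => k; rewrite ltnS leq_eqVlt => /orP[/eqP->|kn].
  by apply: mono hN1; rewrite ?ge_min ?lexx ?orbT ?leq_maxr.
by apply: mono (hN k kn); rewrite ?ge_min ?lexx ?leq_maxl.
Qed.

(** [K] and [N0] precede [k] as they may depend on the [lam i] alone; [c] follows it. The empty set
    is excluded because it meets the uniformity hypotheses with [a = 0]. *)
Theorem theorem2 (R : realType) (s : nat) (lam : 'I_s -> int)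
    (lam_neq0 : forall i, lam i != 0) (lam_sum0 : \sum_(i < s) lam i = 0) :
  exists K : R, 0 < K /\
  exists N0 : nat,
  forall k : nat, (2 <= k)%N ->
  s0 R k < s%:Z ->
  has_nonsingular_solution R lam k ->
  (forall p : nat, prime p -> has_nonsingular_solution (Qp p) lam k) ->
  exists c : R, 0 < c /\
  forall (N : nat) (A : {fset int}) (a : R),
    (N0 <= N)%N ->
    (A `<=` zitv 1 N%:Z)%fset ->
    A != fset0 ->
    uniform_of_degree N A a k ->
    a <= K * density R N A ^ ((2 ^ k.+1)%N%:Z * (s0 R k + 2)) ->
    (exists x : 'I_s -> int,
       [/\ forall i, x i \in A, solution lam k x & ~ trivial_solution lam x]) /\
    c * density R N A ^+ s * N%:R ^ (s%:Z - ((k * k.+1)./2)%:Z)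
      <= (num_solutions lam k A)%:R.
Proof.
pose H k := [/\ (2 <= k)%N, s0 R k < s%:Z, has_nonsingular_solution R lam k &
  forall p : nat, prime p -> has_nonsingular_solution (Qp p) lam k].
pose P k (K : R) N0 := H k -> exists c : R, 0 < c /\
  forall (N : nat) (A : {fset int}) (a : R), (N0 <= N)%N -> (A `<=` zitv 1 N%:Z)%fset ->
    A != fset0 -> uniform_of_degree N A a k ->
    a <= K * density R N A ^ ((2 ^ k.+1)%N%:Z * (s0 R k + 2)) ->
    (exists x : 'I_s -> int,
       [/\ forall i, x i \in A, solution lam k x & ~ trivial_solution lam x]) /\
    c * density R N A ^+ s * N%:R ^ (s%:Z - ((k * k.+1)./2)%:Z) <= (num_solutions lam k A)%:R.
have [||K K0 [N0 hK]] := @uniform_choice R P s.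
- move=> k K K' N N' _ KK NN hP hk; have [c [c0 hc]] := hP hk; exists c; split=> // N2 A a hN AI A0 hu ha.
  apply: (hc N2 A a) => //; first exact: leq_trans hN.
  by apply: le_trans ha _; rewrite ler_wpM2r // exprz_ge0 // divr_ge0.
- move=> k; have [[k2 sk hR hp]|nH] := pselect (H k); last by exists 1; rewrite ?ltr01 //; exists 0%N => /nH.
  have [K K0 [N0 [c hc]]] := solutions_in_uniform_sets lam_neq0 lam_sum0 k2 sk hR hp.
  by exists K => //; exists N0 => _; exists c.
exists K; split=> //; exists N0 => k k2 sk hR hp; apply: hK; last by split.
(* [s0 k >= 6 k^2 + 6] gives [k < s], so the range [k < s] covers every degree. *)
have [t st ht] := s0_double R k2; move: sk; rewrite st ltz_nat => sk.
by move: ht sk; rewrite expnS expn1; clear; nia.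
Qed.
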